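(* Let $M^n$ be an $n$-dimensional submanifold of the Euclidean space $\mathbb{R}^N$. Assume that at any point of $M$ the local normal holonomy group and the restricted normal holonomy group coincide (or, equivalently, that the dimensions of the local normal holonomy groups are constant on $M$). Let $p\in M$ and let $r$ be the number of irreducible (non-abelian) subspaces of the representation of the restricted normal holonomy group $\Phi(p)$ on the normal space $\nu_p(M)$. Then $r\leq \frac n2$. Moreover, this bound is sharp for all $n\in\mathbb{N}$ (also in the class of irreducible submanifolds).
   Context: The restricted normal holonomy group $\Phi(p)$ is the group of $\nabla^\perp$-parallel transports on $\nu_p(M)$ along null-homotopic piecewise smooth loops based at $p$, where $\nabla^\perp$ is the normal connection. The local normal holonomy group at $p$ is the intersection, over the open neighbourhoods $U$ of $p$ in $M$, of the restricted normal holonomy groups at $p$ of $U$. The normal space decomposes orthogonally into a subspace on which $\Phi(p)$ acts trivially and subspaces on which $\Phi(p)$ acts irreducibly; an irreducible subspace is called non-abelian if the group by which $\Phi(p)$ acts on it is non-abelian. Since $r$ is an integer, the bound is $r\leq[\frac n2]$, where $[x]$ denotes the integer part of $x$; sharpness means that for every $n$ the value $[\frac n2]$ is attained. A Euclidean submanifold is irreducible if it is not an extrinsic product of submanifolds.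
   Formalization: The parenthetical equivalence (local = restricted holonomy at every point iff the local holonomy dimensions are constant) is stated for connected M, as it fails for disconnected M, e.g. a flat plane together with a surface with SO(3) normal holonomy; the bound itself does not assume M connected. *)

(* Defs.v *)
From HB Require Import structures.
From mathcomp Require Export all_boot all_order all_algebra.
From mathcomp Require Export all_classical all_reals all_analysis.
Export numFieldNormedType.Exports.

Set Implicit Arguments.
Unset Strict Implicit.
Unset Printing Implicit Defensive.

Import Order.TTheory GRing.Theory Num.Theory.

Local Open Scope classical_set_scope.
Local Open Scope ring_scope.

(* Vectors of R^N are row vectors and u *m v^T is the Euclidean inner product.
   The library norm on 'rV[R]_N is the sup norm; it is only used for the
   topology and for derivatives, which do not depend on the choice of norm. *)

Section Smooth.
Context {R : realType} {V W : normedModType R}.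

(* [U] is meant to be open.  In finite dimension, differentiability together
   with C^k directional derivatives in every direction is C^(k+1). *)
Fixpoint Ck (k : nat) (U : set V) (f : V -> W) : Prop :=
  match k with
  | 0 => forall x, U x -> {for x, continuous f}
  | k'.+1 => (forall x, U x -> differentiable f x) /\
             (forall v, Ck k' U (fun x => 'D_v f x))
  end.

Definition smooth_on (U : set V) (f : V -> W) : Prop := forall k, Ck k U f.

End Smooth.

(* [c] is only looked at on [0, 1].  On each closed piece it must be the
   restriction of a smooth curve, so one-sided derivatives of all orders exist
   at the break points, and [c] is continuous on [0, 1]. *)
Definition piecewise_smooth {R : realType} {W : normedModType R}
    (c : R -> W) : Prop :=
  exists2 s : seq R, itv_partition 0 1 s &
    forall i, (i < size s)%N ->
      exists2 g : R -> W, smooth_on setT g &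
        {in `[nth 0 (0 :: s) i, nth 0 (0 :: s) i.+1], c =1 g}.

Section Submanifold.
Context {R : realType} {M : topologicalType} {N : nat}.
Implicit Types (f : M -> 'rV[R]_N) (p : M) (u v : 'rV[R]_N).

(* [phi] is a homeomorphism of the open set [V] of R^n onto an open set of [M]
   and [f \o phi] is a smooth immersion on [V]. *)
Definition local_parametrization (n : nat) f (V : set 'rV[R]_n)
    (phi : 'rV[R]_n -> M) : Prop :=
  [/\ open V /\ {in V &, injective phi},
      (forall x, V x -> {for x, continuous phi}),
      (forall W, open W -> W `<=` V -> open (phi @` W)),
      smooth_on V (f \o phi) &
      forall x w, V x -> 'D_w (f \o phi) x = 0 -> w = 0].

(* An immersed submanifold of dimension [n].  The smooth structure of [M] is the
   unique one that makes [f] an immersion: a continuous change of local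
   parametrizations is automatically smooth. *)
Definition submanifold (n : nat) f : Prop :=
  [/\ hausdorff_space M, @second_countable M &
      forall p, exists (V : set 'rV[R]_n) (phi : 'rV[R]_n -> M),
        local_parametrization f V phi /\ (phi @` V) p].

(* [f] is moreover a homeomorphism onto its image. *)
Definition embedded f : Prop :=
  injective f /\
  forall U : set M, open U -> exists2 O : set 'rV[R]_N, open O & U = f @^-1` O.

Definition tangent_space (n : nat) f p : set 'rV[R]_N :=
  [set v | exists (V : set 'rV[R]_n) (phi : 'rV[R]_n -> M) (x w : 'rV[R]_n),
    [/\ local_parametrization f V phi, V x, phi x = p &
        v = 'D_w (f \o phi) x]].

Definition normal_space (n : nat) f p : set 'rV[R]_N :=
  [set u | forall v, tangent_space n f p v -> u *m v^T = 0].

(* The normal connection is the normal component of the derivative in R^N, so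
   xi is parallel along c exactly when xi' is tangent. *)
Definition parallel_normal_field (n : nat) f (c : R -> M)
    (xi : R -> 'rV[R]_N) : Prop :=
  [/\ piecewise_smooth xi,
      {in `[0, 1], forall t, normal_space n f (c t) (xi t)} &
      {in `]0, 1[, forall t, derivable xi t 1 ->
         tangent_space n f (c t) (derive1 xi t)}].

Definition normal_transport (n : nat) f (c : R -> M) u v : Prop :=
  exists xi, [/\ parallel_normal_field n f c xi, xi 0 = u & xi 1 = v].

(* [f] being an immersion, a continuous curve [c] in [M] is piecewise smooth if
   and only if [f \o c] is. *)
Definition piecewise_smooth_loop f (U : set M) p (c : R -> M) : Prop :=
  [/\ {within `[0, 1], continuous c}, piecewise_smooth (f \o c),
      {in `[0, 1], forall t, U (c t)}, c 0 = p & c 1 = p].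

Definition null_homotopic (U : set M) p (c : R -> M) : Prop :=
  exists H : R * R -> M,
    {within `[0, 1] `*` `[0, 1], continuous H} /\
    {in `[0, 1] &, forall s t, U (H (s, t))} /\
    {in `[0, 1], forall t,
       [/\ H (0, t) = c t, H (1, t) = p, H (t, 0) = p & H (t, 1) = p]}.

(* The restricted normal holonomy group at [p] of the open submanifold [U].
   An isometry of the normal space at [p] is encoded by the matrix, acting on
   row vectors on the right, of its extension to R^N by the identity on the
   tangent space. *)
Definition restricted_holonomy_of (n : nat) f (U : set M) p : set 'M[R]_N :=
  [set g | exists c : R -> M,
    [/\ piecewise_smooth_loop f U p c, null_homotopic U p c,
        (forall v, tangent_space n f p v -> v *m g = v) &
        forall u, normal_space n f p u -> normal_transport n f c u (u *m g)]].

Definition restricted_holonomy (n : nat) f p : set 'M[R]_N :=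
  restricted_holonomy_of n f setT p.

Definition local_holonomy (n : nat) f p : set 'M[R]_N :=
  \bigcap_(U in open_nbhs p) restricted_holonomy_of n f U p.

End Submanifold.

Section Groups.
Context {R : realType} {N : nat}.
Implicit Types (G : set 'M[R]_N) (V W : {vspace 'rV[R]_N}).

Definition orthogonal_spaces V W : Prop :=
  {in V & W, forall u v, u *m v^T = 0}.

Definition invariant G V : Prop :=
  forall g, G g -> {in V, forall u, u *m g \in V}.

Definition acts_trivially G V : Prop :=
  forall g, G g -> {in V, forall u, u *m g = u}.

Definition acts_irreducibly G V : Prop :=
  [/\ V != 0%VS, invariant G V &
      forall W, (W <= V)%VS -> invariant G W -> W = 0%VS \/ W = V].

Definition acts_nonabelian G V : Prop :=
  exists g h u, [/\ G g, G h, u \in V & u *m g *m h <> u *m h *m g].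

(* The dimension of a Lie group [G] of matrices: its Lie algebra is the set of
   velocities at the identity of the smooth curves contained in [G]. *)
Definition lie_group_dim G (d : nat) : Prop :=
  exists2 L : {vspace 'M[R]_N}, \dim L = d &
    forall X, X \in L <->
      exists gamma : R -> 'M[R]_N,
        [/\ smooth_on setT gamma, gamma 0 = 1%:M, (forall t, G (gamma t)) &
            derive1 gamma 0 = X].

End Groups.

Section Statement.
Context {R : realType} {M : topologicalType} {N : nat}.
Implicit Types (f : M -> 'rV[R]_N) (p : M).

(* [r] is the number of non-abelian summands in an orthogonal decomposition of
   the normal space into a subspace with trivial action and irreducible
   subspaces. *)
Definition num_nonabelian_irreducible (n : nat) f p (r : nat) : Prop :=
  let Phi := restricted_holonomy n f p in
  exists (k : nat) (V0 : {vspace 'rV[R]_N}) (V : 'I_k -> {vspace 'rV[R]_N}),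
    [/\ (forall u, normal_space n f p u <-> u \in (V0 + \sum_i V i)%VS),
        (forall i, orthogonal_spaces V0 (V i)) /\
        (forall i j, i != j -> orthogonal_spaces (V i) (V j)),
        acts_trivially Phi V0,
        (forall i, acts_irreducibly Phi (V i)) &
        r = #|[pred i | `[< acts_nonabelian Phi (V i) >]]|].

Definition local_eq_restricted (n : nat) f : Prop :=
  forall p, local_holonomy n f p = restricted_holonomy n f p.

Definition local_holonomy_dim_constant (n : nat) f : Prop :=
  exists d, forall p, lie_group_dim (local_holonomy n f p) d.

(* f is congruent to f1 x f2 : M1 x M2 -> R^N1 x R^N2; the rows of A and of B
   together form an orthonormal basis of R^N. *)
Definition extrinsic_product (n : nat) f : Prop :=
  exists (n1 n2 N1 N2 : nat) (M1 M2 : topologicalType)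
         (f1 : M1 -> 'rV[R]_N1) (f2 : M2 -> 'rV[R]_N2)
         (h : M1 * M2 -> M) (h' : M -> M1 * M2)
         (A : 'M[R]_(N1, N)) (B : 'M[R]_(N2, N)) (b : 'rV[R]_N),
    [/\ [/\ (0 < n1)%N, (0 < n2)%N, (n1 + n2 = n)%N & (N1 + N2 = N)%N],
        submanifold n1 f1 /\ submanifold n2 f2,
        [/\ cancel h h', cancel h' h, continuous h & continuous h'],
        [/\ A *m A^T = 1%:M, B *m B^T = 1%:M & A *m B^T = 0] &
        forall x y, f (h (x, y)) = b + f1 x *m A + f2 y *m B].

Definition irreducible_submanifold (n : nat) f : Prop :=
  ~ extrinsic_product n f.

End Statement.

(* Main.v *)
(* If g' = g w with w in the Lie algebra of a group of orthogonal matrices, then g stays in a coset of the group.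
   In a radial gauge this shows that the holonomy group of a chart domain is determined by its Lie algebra; when
   the dimensions of the local groups are constant, subdividing a null homotopy into cells lying in small charts
   then shows that restricted holonomies are local.  For the bound, a block of the normal bundle on which the
   curvature vanishes on an open set is fixed by the local holonomy; so there is a point at which the curvature is
   nonzero on each of the r non-abelian blocks.  By the Ricci equation the shape operators of different blocks
   commute there, while each block contains two which do not commute, and r mutually commuting pairs of
   non-commuting self-adjoint operators need a space of dimension 2r.  For the sharpness, take a product of
   surfaces in R^6 with holonomy SO(4) on a suitable block (and a line if n is odd), and invert it in a sphere:
   inversion preserves the normal connection, and the closure of the image gains exactly one point, which is
   impossible for an extrinsic product. *)

From HB Require Import structures.
Require Import Defs.
From mathcomp Require Import ring lra zify.

Set Implicit Arguments.
Unset Strict Implicit.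
Unset Printing Implicit Defensive.

Import Order.TTheory GRing.Theory Num.Theory.

Local Open Scope classical_set_scope.
Local Open Scope ring_scope.

(** * Calculus of C^k maps *)

(** A holonomy group is handled as an abstract group of orthogonal matrices whose Lie algebra
    consists of the velocities of smooth curves that stay inside it. The coset argument therefore
    uses a product of such curves as coordinates near the identity. Parametrizations are taken on
    all of R^n, so that radial paths exist and every loop in a chart is null-homotopic there. The
    count of 2r rests on a subspace of minimal rank among those that are stable under all pairs but
    one and are moved by an operator of the remaining pair. In the example, a suitable normal frame
    has a connection form that does not depend on the point, so the holonomy algebra is the same for
    all open sets and is found by brackets. A product of two helices has a flat normal bundle;
    mixing the two by a matrix that ignores the product structure yields so(4). The entries of that
    matrix come from the 3-4-5 triangle and are thus rational. A constant coordinate 1 keeps the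
    image away from the centre of inversion and adds one parallel normal direction. *)

Section Coordinates.
Context {R : realType}.

Lemma cvg_mxP {T : Type} {F : set_system T} {FF : Filter F} (m n : nat)
    (f : T -> 'M[R]_(m, n)) (l : 'M[R]_(m, n)) :
  f @ F --> l <-> forall i j, (fun x => f x i j) @ F --> l i j.
Proof.
split=> [fl i j|fl].
  have := @coord_continuous R m n i j l; rewrite /continuous_at => /(cvg_comp _ _ fl).
  exact.
apply/cvgrPdist_le => e e0; near=> x.
rewrite [leLHS]/Num.Def.normr/= mx_normrE (bigmax_le _ (ltW e0))// => i _.
rewrite !mxE; move: i; near: x; apply: filter_forall => /= i.
exact: ((cvgrPdist_le _ _).1 (fl i.1 i.2)).
Unshelve. all: by end_near. Qed.

Lemma continuous_mxP {T : topologicalType} (m n : nat) (f : T -> 'M[R]_(m, n)) x :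
  {for x, continuous f} <-> forall i j, {for x, continuous (fun y => f y i j)}.
Proof. exact: cvg_mxP. Qed.

Lemma is_derive_mxP {V : normedModType R} (m n : nat) (f : V -> 'M[R]_(m, n))
    (x v : V) (l : 'M[R]_(m, n)) :
  is_derive x v f l <-> forall i j, is_derive x v (fun y => f y i j) (l i j).
Proof.
split=> [fl i j|fl].
  have df := @ex_derive _ _ _ _ _ _ _ fl; rewrite -(@derive_val _ _ _ _ _ _ _ fl) derive_mx// mxE.
  by apply/derivableP; move/derivable_mxP: df.
have df : derivable f x v by apply/derivable_mxP => i j; exact: (@ex_derive _ _ _ _ _ _ _ (fl i j)).
have -> : l = 'D_v f x.
  by rewrite derive_mx//; apply/matrixP => i j; rewrite mxE (@derive_val _ _ _ _ _ _ _ (fl i j)).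
exact/derivableP.
Qed.

Lemma derive_coord {V : normedModType R} (m n : nat) (f : V -> 'M[R]_(m, n)) (x v : V) i j :
  derivable f x v -> 'D_v (fun y => f y i j) x = ('D_v f x) i j.
Proof. by move=> /derive_mx ->; rewrite mxE. Qed.

Lemma mx_norm_ge (m n : nat) (M : 'M[R]_(m, n)) i j : `|M i j| <= `|M|.
Proof.
rewrite [leRHS]/Num.Def.normr/= mx_normrE.
exact: (le_bigmax _ (fun k : 'I_m * 'I_n => `|M k.1 k.2|) (i, j)).
Qed.

Lemma mx_norm_le (m n : nat) (M : 'M[R]_(m, n)) e :
  0 <= e -> (forall i j, `|M i j| <= e) -> `|M| <= e.
Proof.
by move=> e0 Me; rewrite [leLHS]/Num.Def.normr/= mx_normrE (bigmax_le _ e0)//.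
Qed.

(** The sup norm is not submultiplicative: the inner dimension enters as a factor, and reappears in
    all the estimates for matrix equations. *)
Lemma mx_norm_mulmx (m n p : nat) (A : 'M[R]_(m, n)) (B : 'M[R]_(n, p)) :
  `|A *m B| <= n%:R * (`|A| * `|B|).
Proof.
apply: mx_norm_le => [|i j]; first by rewrite !mulr_ge0.
rewrite mxE (le_trans (ler_norm_sum _ _ _))//.
rewrite (@le_trans _ _ (\sum_(k < n) `|A| * `|B|))//.
  by apply: ler_sum => k _; rewrite normrM ler_pM// mx_norm_ge.
by rewrite sumr_const card_ord mulr_natl.
Qed.

Lemma differentiable_mxP {V : normedModType R} (m n : nat) (f : V -> 'M[R]_(m, n)) x :
  differentiable f x <-> forall i j, differentiable (fun y => f y i j) x.
Proof.
split=> [df i j|df].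
  exact: (differentiable_comp df (differentiable_coord _ i j)).
have -> : f = \sum_(i < m) \sum_(j < n) (fun y => f y i j *: delta_mx i j).
  apply/funext => y; rewrite [LHS]matrix_sum_delta fct_sumE.
  by apply: eq_bigr => i _; rewrite fct_sumE.
apply: differentiable_sum => i; apply: differentiable_sum => j.
exact: differentiableZl.
Qed.

End Coordinates.

Section Differentiability.
Context {R : realType} {V W : normedModType R}.

Lemma differentiable_epsP (f : V -> W) x :
  differentiable f x <-> exists L : {linear V -> W}, continuous L /\
    forall e, 0 < e -> \forall h \near 0, `|f (h + x) - f x - L h| <= e * `|h|.
Proof.
split=> [df|[L [cL Lx]]].
  exists ('d f x); split; first exact: diff_continuous.
  have /eqaddoE := diff_locally df.
  move=> /eqaddoP fo e e0; have := fo _ e0; apply: filterS => h /=.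
  by rewrite opprD addrA.
have fo : f \o shift x = cst (f x) + L +o_ 0 id.
  apply/eqaddoP => e e0; have := Lx _ e0; apply: filterS => h /=.
  by rewrite opprD addrA.
by apply/diff_locallyP; rewrite (diff_unique cL fo).
Qed.

Lemma near_eq_differentiable (f g : V -> W) x :
  (\near x, f x = g x) -> differentiable f x -> differentiable g x.
Proof.
move=> fg /differentiable_epsP[L [cL Lx]]; apply/differentiable_epsP.
exists L; split=> // e e0; have fgx := nbhs_singleton fg.
move: fg; rewrite (near_shift 0 x) => fg; move: (Lx e e0); apply: filterS2 fg => h /=.
by rewrite subr0 => -> ; rewrite fgx.
Qed.

Lemma is_derive_line (f : V -> W) (y v : V) (t : R) d :
  is_derive (y + t *: v) v f d -> is_derive t 1 (fun s : R => f (y + s *: v)) d.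
Proof.
case=> df dE.
have E : (fun h : R => h^-1 *: ((f \o shift (y + t *: v)) (h *: v) - f (y + t *: v))) =
    (fun h : R => h^-1 *: (((fun s : R => f (y + s *: v)) \o shift t) (h *: 1) - f (y + t *: v))).
  apply/funext => h /=; congr (_ *: (f _ - _)).
  by rewrite scalerDl [_%:A]mulr1 addrCA.
split; first by move: df; rewrite /derivable E.
by rewrite -dE /derive E.
Qed.

End Differentiability.

Section CkCalculus.
Context {R : realType} {V : normedModType R}.
Implicit Types (U : set V) (k : nat).

Lemma CkS {W : normedModType R} k U (f : V -> W) : Ck k.+1 U f -> Ck k U f.
Proof.
elim: k f => [|k IH] f [df Df] /=.
  by move=> x Ux; exact: differentiable_continuous (df x Ux).
by split=> // v; exact: IH.
Qed.

Lemma Ck_le {W : normedModType R} k l U (f : V -> W) : (l <= k)%N -> Ck k U f -> Ck l U f.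
Proof.
elim: k => [|k IH]; first by rewrite leqn0 => /eqP ->.
by rewrite leq_eqVlt => /predU1P[->//|lk] /CkS; exact: IH.
Qed.

Lemma Ck_eq {W : normedModType R} k U (f g : V -> W) : open U ->
  (forall x, U x -> f x = g x) -> Ck k U f -> Ck k U g.
Proof.
move=> oU; elim: k f g => [|k IH] f g fg /=.
  move=> cf x Ux; rewrite /prop_for /continuous_at -fg//.
  apply: cvg_trans (cf x Ux); apply: near_eq_cvg.
  by near=> y; apply/fg; near: y; exact: open_nbhs_nbhs.
have nfg x : U x -> \forall y \near x, f y = g y.
  by move=> Ux; near=> y; apply: fg; near: y; exact: open_nbhs_nbhs.
case=> df Df; split=> [x Ux|v].
  exact: near_eq_differentiable (nfg x Ux) (df x Ux).
apply: (IH ('D_v f)) (Df v) => x Ux.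
exact: near_eq_derive (nfg x Ux).
Unshelve. all: by end_near. Qed.

Lemma Ck_cst {W : normedModType R} k U (c : W) : Ck k U (fun=> c).
Proof.
elim: k c => [|k IH] c /=; first by move=> x _; exact: cst_continuous.
split=> [x _|v]; first exact: differentiable_cst.
rewrite (_ : 'D_v _ = fun=> 0)//.
by apply/funext => x; exact: derive_cst.
Qed.

Lemma Ck_linear {W : normedModType R} k U (L : {linear V -> W}) : continuous L -> Ck k U L.
Proof.
move=> cL; have dL x : differentiable L x by apply: linear_differentiable; exact: cL.
case: k => [|k] /=; first by move=> x _; exact: cL.
split=> // v; rewrite (_ : (fun x => _) = fun=> L v); first exact: Ck_cst.
by apply/funext => x; rewrite deriveE// diff_lin//; exact: cL.
Qed.

Lemma CkD {W : normedModType R} k U (f g : V -> W) : open U ->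
  Ck k U f -> Ck k U g -> Ck k U (fun x => f x + g x).
Proof.
move=> oU; elim: k f g => [|k IH] f g /=.
  by move=> cf cg x Ux; apply: continuousD; [exact: cf|exact: cg].
move=> [df Df] [dg Dg]; split=> [x Ux|v].
  by apply: differentiableD; [exact: df|exact: dg].
apply: (@Ck_eq _ _ _ (fun x => 'D_v f x + 'D_v g x)) => //; last exact: IH.
by move=> x Ux; rewrite (@deriveD _ _ _ f g)//; apply: diff_derivable; auto.
Qed.

Lemma CkZ {W : normedModType R} k U (f : V -> W) c : open U ->
  Ck k U f -> Ck k U (fun x => c *: f x).
Proof.
move=> oU; elim: k f => [|k IH] f /=.
  by move=> cf x Ux; apply: continuousZr; exact: cf.
move=> [df Df]; split=> [x Ux|v].
  by apply: differentiableZ; exact: df.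
apply: (@Ck_eq _ _ _ (fun x => c *: 'D_v f x)) => //; last exact: IH.
by move=> x Ux; rewrite (@deriveZ _ _ _ f)//; apply: diff_derivable; auto.
Qed.

Lemma CkN {W : normedModType R} k U (f : V -> W) : open U ->
  Ck k U f -> Ck k U (fun x => - f x).
Proof.
by move=> oU /(CkZ (-1) oU); apply: Ck_eq => // x _; rewrite scaleN1r.
Qed.

Lemma CkB {W : normedModType R} k U (f g : V -> W) : open U ->
  Ck k U f -> Ck k U g -> Ck k U (fun x => f x - g x).
Proof. by move=> oU Cf Cg; apply: CkD => //; exact: CkN. Qed.

Lemma CkM k U (f g : V -> R) : open U ->
  Ck k U f -> Ck k U g -> Ck k U (fun x => f x * g x).
Proof.
move=> oU; elim: k f g => [|k IH] f g.
  by move=> /= cf cg x Ux; apply: continuousM; [exact: cf|exact: cg].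
move=> Cf Cg; have [df Df] := Cf; have [dg Dg] := Cg; split=> [x Ux|v].
  by apply: differentiableM; auto.
apply: (@Ck_eq _ _ _ (fun x => f x * 'D_v g x + g x * 'D_v f x)) => //.
  by move=> x Ux; rewrite (@deriveM _ _ f g)//; apply: diff_derivable; auto.
exact: (CkD oU (IH _ _ (CkS Cf) (Dg v)) (IH _ _ (CkS Cg) (Df v))).
Qed.

Lemma Ck_sum {W : normedModType R} k U (I : Type) (r : seq I) (P : pred I) (f : I -> V -> W) :
  open U -> (forall i, P i -> Ck k U (f i)) -> Ck k U (fun x => \sum_(i <- r | P i) f i x).
Proof.
move=> oU Cf; elim: r => [|i r IH].
  by apply: (@Ck_eq _ _ _ (fun=> 0)) (Ck_cst _ _ _) => // x _; rewrite big_nil.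
apply: (@Ck_eq _ _ _ (fun x => (if P i then f i x else 0) + \sum_(j <- r | P j) f j x)) => //.
  by move=> x _; rewrite big_cons; case: ifP => // _; rewrite add0r.
apply: (CkD oU) IH; case: (P i) (Cf i) => [|_]; [exact|exact: Ck_cst].
Qed.

Lemma Ck_prod k U (I : Type) (r : seq I) (f : I -> V -> R) :
  open U -> (forall i, Ck k U (f i)) -> Ck k U (fun x => \prod_(i <- r) f i x).
Proof.
move=> oU Cf; elim: r => [|i r IH].
  apply: (@Ck_eq _ _ _ (fun=> (1 : R) : R)); [exact: oU| |exact: Ck_cst].
  by move=> x _; rewrite big_nil.
apply: (@Ck_eq _ _ _ (fun x => f i x * \prod_(j <- r) f j x)) => //.
  by move=> x _; rewrite big_cons.
exact: CkM.
Qed.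

Lemma CkV k U (f : V -> R) : open U -> (forall x, U x -> f x != 0) ->
  Ck k U f -> Ck k U (fun x => (f x)^-1).
Proof.
move=> oU f0; elim: k => [|k IH].
  by move=> /= cf x Ux; apply: continuousV; [exact: f0|exact: cf].
move=> Cf; have [df Df] := Cf; split=> [x Ux|v].
  by apply: differentiableV; auto.
apply: (@Ck_eq _ _ _ (fun x => - ((f x)^-1 * (f x)^-1) * 'D_v f x)) => //.
  move=> x Ux; rewrite deriveV//; first by rewrite -exprVn expr2.
    exact: f0.
  by apply: diff_derivable; auto.
have CI := IH (CkS Cf).
exact: (CkM oU (CkN oU (CkM oU CI CI)) (Df v)).
Qed.

Lemma Ck_coord (m n : nat) k U (f : V -> 'M[R]_(m, n)) i j :
  open U -> Ck k U f -> Ck k U (fun x => f x i j).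
Proof.
move=> oU; elim: k f => [|k IH] f /=.
  by move=> cf x Ux; exact: (continuous_mxP _ _).1 (cf x Ux) i j.
move=> [df Df]; split=> [x Ux|v].
  exact: (differentiable_mxP _ _).1 (df x Ux) i j.
apply: (@Ck_eq _ _ _ (fun x => 'D_v f x i j)) => //; last exact: IH.
by move=> x Ux; rewrite derive_coord//; apply: diff_derivable; auto.
Qed.

Lemma Ck_mx (m n : nat) k U (f : V -> 'M[R]_(m, n)) :
  open U -> (forall i j, Ck k U (fun x => f x i j)) -> Ck k U f.
Proof.
move=> oU; elim: k f => [|k IH] f /=.
  by move=> cf x Ux; apply/continuous_mxP => i j; exact: cf.
move=> Cf; have df x : U x -> differentiable f x.
  by move=> Ux; apply/differentiable_mxP => i j; have [+ _] := Cf i j; exact.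
split=> // v; apply: IH => i j; have [_ /(_ v)] := Cf i j.
by apply: Ck_eq => // x Ux; rewrite derive_coord//; apply: diff_derivable; auto.
Qed.

Lemma Ck_mulmx (m n p : nat) k U (f : V -> 'M[R]_(m, n)) (g : V -> 'M[R]_(n, p)) :
  open U -> Ck k U f -> Ck k U g -> Ck k U (fun x => f x *m g x).
Proof.
move=> oU Cf Cg; apply: Ck_mx => // i j.
apply: (@Ck_eq _ _ _ (fun x => \sum_l f x i l * g x l j)) => //.
  by move=> x _; rewrite mxE.
by apply: Ck_sum => // l _; apply: CkM => //; exact: Ck_coord.
Qed.

Lemma Ck_trmx (m n : nat) k U (f : V -> 'M[R]_(m, n)) :
  open U -> Ck k U f -> Ck k U (fun x => (f x)^T).
Proof.
move=> oU Cf; apply: Ck_mx => // i j; apply: Ck_eq (Ck_coord j i oU Cf) => // x _.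
by rewrite mxE.
Qed.

Lemma Ck_det (n : nat) k U (f : V -> 'M[R]_n) :
  open U -> Ck k U f -> Ck k U (fun x => \det (f x)).
Proof.
move=> oU Cf; apply: Ck_sum => // s _; apply: CkM => //; first exact: Ck_cst.
by apply: Ck_prod => // i; exact: Ck_coord.
Qed.

Lemma Ck_invmx (n : nat) k U (f : V -> 'M[R]_n) : open U ->
  (forall x, U x -> f x \in unitmx) -> Ck k U f -> Ck k U (fun x => invmx (f x)).
Proof.
move=> oU fU Cf; apply: Ck_mx => // i j.
apply: (@Ck_eq _ _ _ (fun x => (\det (f x))^-1 * cofactor (f x) j i)) => //.
  by move=> x Ux; rewrite /invmx fU// !mxE.
apply: CkM => //; first apply: CkV => //; last 2 first.
- exact: Ck_det.
- apply: CkM => //; first exact: Ck_cst.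
  apply: Ck_det => //; apply: Ck_mx => // a b.
  apply: Ck_eq (Ck_coord (lift j a) (lift i b) oU Cf) => // x _.
  by rewrite !mxE.
- by move=> x Ux; rewrite -unitfE -unitmxE fU.
Qed.

End CkCalculus.

Section Composition.
Context {R : realType} {E : normedModType R}.

Lemma linear_rV {W : lmodType R} (n : nat) (L : {linear 'rV[R]_n -> W}) (w : 'rV[R]_n) :
  L w = \sum_i w 0 i *: L (delta_mx 0 i).
Proof.
rewrite [in LHS](row_sum_delta w) linear_sum.
by apply: eq_bigr => i _; rewrite linearZ.
Qed.

Lemma derive_comp_rV {W : normedModType R} (n : nat) (F : 'rV[R]_n -> W) (th : E -> 'rV[R]_n) y v :
  differentiable F (th y) -> differentiable th y ->
  'D_v (F \o th) y = \sum_i ('D_v th y) 0 i *: 'D_(delta_mx 0 i) F (th y).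
Proof.
move=> dF dth; have -> : 'D_v (F \o th) y = 'd F (th y) ('D_v th y).
  have dc := differentiable_comp dth dF.
  by rewrite (deriveE _ dc) (deriveE _ dth) (diff_comp dth dF).
by rewrite linear_rV; apply: eq_bigr => i _; rewrite (deriveE _ dF).
Qed.

(** The chain rule in partial derivatives writes the derivative of [F \o th] as a sum of products of
    scalar functions of class C^k, to which the induction applies. This is why [th] takes values in
    row vectors and [F] in [R]. *)
Lemma Ck_comp (n : nat) k (U : set E) (O : set 'rV[R]_n) (F : 'rV[R]_n -> R) (th : E -> 'rV[R]_n) :
  open U -> open O -> (forall y, U y -> O (th y)) ->
  Ck k O F -> Ck k U th -> Ck k U (F \o th).
Proof.
move=> oU oO UO; elim: k F => [|k IH] F.
  by move=> /= cF cth y Uy; apply: continuous_comp; [exact: cth|apply: cF; exact: UO].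
move=> [dF DF] Cth; have [dth Dth] := Cth; split=> [y Uy|v].
  by apply: differentiable_comp; [exact: dth|apply: dF; exact: UO].
apply: (@Ck_eq _ _ _ _ _ (fun y => \sum_i ('D_v th y) 0 i * 'D_(delta_mx 0 i) F (th y))) => //.
  by move=> y Uy; rewrite derive_comp_rV//; [apply: dF; exact: UO|exact: dth].
apply: Ck_sum => // i _; apply: (CkM oU); first exact: (Ck_coord 0 i oU (Dth v)).
exact: (IH _ (DF (delta_mx 0 i)) (CkS Cth)).
Qed.

Lemma Ck_comp_mx (m p n : nat) k (U : set E) (O : set 'rV[R]_n) (F : 'rV[R]_n -> 'M[R]_(m, p))
    (th : E -> 'rV[R]_n) :
  open U -> open O -> (forall y, U y -> O (th y)) ->
  Ck k O F -> Ck k U th -> Ck k U (F \o th).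
Proof.
move=> oU oO UO CF Cth; apply: Ck_mx => // i j.
exact: (Ck_comp oU oO UO (Ck_coord i j oO CF) Cth).
Qed.

Lemma Ck_comp_real k (h : R -> R) (g : E -> R) :
  Ck k setT h -> Ck k setT g -> Ck k setT (h \o g).
Proof.
elim: k h => [|k IH] h.
  by move=> /= ch cg x _; apply: continuous_comp; [exact: cg|exact: ch].
move=> [dh Dh] Cg; have [dg Dg] := Cg; split=> [x _|v].
  exact: (differentiable_comp (dg x I) (dh (g x) I)).
rewrite (_ : (fun x => _) = fun x => 'D_v g x * 'D_1 h (g x)); last first.
  apply/funext => x; have dgx := dg x I; have dhx := dh (g x) I.
  have -> : 'D_v (h \o g) x = 'd h (g x) ('D_v g x).
    have dc := differentiable_comp dgx dhx.
    by rewrite (deriveE _ dc) (deriveE _ dgx) (diff_comp dgx dhx).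
  by rewrite (diff1E dhx) derive1E.
exact: (CkM openT (Dg v) (IH _ (Dh 1) (CkS Cg))).
Qed.

End Composition.

(** * Mean value inequality, primitives and ordinary differential equations *)

Section MeanValue.
Context {R : realType}.

Lemma is_derive_continuous {W : normedModType R} (f : R -> W) (x : R) d :
  is_derive x 1 f d -> {for x, continuous f}.
Proof. by case=> /derivable1_diffP df _; exact: differentiable_continuous. Qed.

Lemma itv_is_derive_continuous (f : R -> R) (a b : R) (df : R -> R) :
  (forall x, x \in `[a, b] -> is_derive x 1 f (df x)) -> {within `[a, b], continuous f}.
Proof.
move=> fd; apply: derivable_within_continuous => x xab.
exact: (@ex_derive _ _ _ _ _ _ _ (fd x xab)).
Qed.

Lemma mvt (f df : R -> R) (a b : R) : a <= b ->
  (forall x, x \in `[a, b] -> is_derive x 1 f (df x)) ->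
  exists2 c, c \in `[a, b] & f b - f a = df c * (b - a).
Proof.
move=> ab fd; have cf := itv_is_derive_continuous fd.
have fd' x : x \in `]a, b[ -> is_derive x 1 f (df x).
  by move=> xab; apply: fd; exact: subset_itv_oo_cc xab.
exact: MVT_segment ab fd' cf.
Qed.

(** Both [E + f] and [E - f] have a nonnegative derivative. The majorant [E] is arbitrary because
    Picard iteration needs an exponential one. *)
Lemma diff_le (f df E dE : R -> R) (a b : R) : a <= b ->
  (forall x, x \in `[a, b] -> is_derive x 1 f (df x)) ->
  (forall x, x \in `[a, b] -> is_derive x 1 E (dE x)) ->
  (forall x, x \in `[a, b] -> `|df x| <= dE x) ->
  `|f b - f a| <= E b - E a.
Proof.
move=> ab fd Ed le; rewrite ler_norml; apply/andP; split.
  have fEd x : x \in `[a, b] -> is_derive x 1 (E \+ f) (dE x + df x).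
    by move=> xab; apply: is_deriveD; [exact: Ed|exact: fd].
  have [c cab] := mvt ab fEd; rewrite /= => e.
  have : 0 <= (dE c + df c) * (b - a).
    rewrite mulr_ge0 ?subr_ge0//; have := le c cab; rewrite ler_norml => /andP[+ _]; lra.
  by rewrite -e; lra.
have fEd x : x \in `[a, b] -> is_derive x 1 (E \- f) (dE x - df x).
  by move=> xab; apply: is_deriveB; [exact: Ed|exact: fd].
have [c cab] := mvt ab fEd; rewrite /= => e.
have : 0 <= (dE c - df c) * (b - a).
  rewrite mulr_ge0 ?subr_ge0//; have := le c cab; rewrite ler_norml => /andP[_ +]; lra.
by rewrite -e; lra.
Qed.

Lemma mx_diff_le (m n : nat) (f df : R -> 'M[R]_(m, n)) (E dE : R -> R) (a b : R) : a <= b ->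
  (forall x, x \in `[a, b] -> is_derive x 1 f (df x)) ->
  (forall x, x \in `[a, b] -> is_derive x 1 E (dE x)) ->
  (forall x, x \in `[a, b] -> `|df x| <= dE x) ->
  `|f b - f a| <= E b - E a.
Proof.
move=> ab fd Ed le; apply: mx_norm_le => [|i j].
  have [c cab ->] := mvt ab Ed; rewrite mulr_ge0 ?subr_ge0//.
  exact: le_trans (normr_ge0 _) (le c cab).
rewrite !mxE; apply: (@diff_le (fun x => f x i j) (fun x => df x i j) E dE a b ab _ Ed).
  by move=> x xab; exact: (is_derive_mxP _ _ _ _).1 (fd x xab) i j.
by move=> x xab; exact: le_trans (mx_norm_ge _ _ _) (le x xab).
Qed.

Lemma is_derive_lin (C x : R) : is_derive x 1 (fun t => C * t) C.
Proof.
have := @is_deriveZ R R R id C x 1 1 (is_derive_id x 1).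
by rewrite /GRing.scale/= mulr1.
Qed.

Lemma mx_diff_bound (m n : nat) (f df : R -> 'M[R]_(m, n)) (C a b : R) : a <= b ->
  (forall x, x \in `[a, b] -> is_derive x 1 f (df x)) ->
  (forall x, x \in `[a, b] -> `|df x| <= C) ->
  `|f b - f a| <= C * (b - a).
Proof.
move=> ab fd le; rewrite mulrBr.
by apply: (mx_diff_le ab fd) le => x _; exact: is_derive_lin.
Qed.

Lemma mx_derive0_const (m n : nat) (f : R -> 'M[R]_(m, n)) (a b : R) :
  (forall x : R, is_derive x 1 f 0) -> f a = f b.
Proof.
have main c d : (forall x : R, is_derive x 1 f 0) -> c <= d -> f c = f d.
  move=> f0 cd; apply/esym/eqP; rewrite -subr_eq0 -normr_le0.
  have := @mx_diff_bound _ _ f (fun=> 0) 0 _ _ cd (fun x _ => f0 x).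
  by rewrite mul0r; apply => x _; rewrite normr0.
move=> f0; have [ab|/ltW ba] := leP a b; first exact: main.
by apply/esym/main.
Qed.

Lemma is_derive_comp1 {W : normedModType R} (f : R -> W) (g : R -> R) (x : R) dg df :
  is_derive x 1 g dg -> is_derive (g x) 1 f df -> is_derive x 1 (f \o g) (dg *: df).
Proof.
move=> [/derivable1_diffP dgx gE] [/derivable1_diffP dfx fE].
have dc := differentiable_comp dgx dfx.
split; first exact/derivable1_diffP.
rewrite (deriveE _ dc) (diff_comp dgx dfx)/= -gE -fE (diff1E dfx) derive1E.
by rewrite (deriveE _ dgx).
Qed.

Lemma is_derive_opp (x : R) : is_derive x 1 (fun t : R => - t) (-1).
Proof. exact: is_deriveNid. Qed.

Lemma is_derive_affine (c d x : R) : is_derive x 1 (fun t : R => c + d * t) d.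
Proof.
have := @is_deriveD R R R (cst c) (fun t => d * t) x 1 0 d (is_derive_cst _ _ _) (is_derive_lin d x).
by rewrite add0r.
Qed.

End MeanValue.

Section Primitive.
Context {R : realType}.
Local Notation mu := (@lebesgue_measure R).

Lemma primitive_from (f : R -> R) (a : R) : continuous f ->
  forall x, a < x -> is_derive x 1 (fun y : R => \int[mu]_(t in [set` `[a, y]]) f t) (f x).
Proof.
move=> cf x ax.
have xu : x < x + 1 by rewrite ltrDl.
have fi : mu.-integrable `[a, x + 1] (EFin \o f).
  apply: continuous_compact_integrable; first exact: segment_compact.
  exact: continuous_subspaceT.
have [d e] := continuous_FTC1_closed xu fi ax (cf x).
split; [exact: d|rewrite -e derive1E; reflexivity].
Qed.

(** An integral from [- k] is a primitive only to the right of [- k]. Normalised to vanish at 0, the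
    primitives for different [k] agree where they overlap, so the base point may move with [x] as
    [- (|x| + 1)]; near [x] the fixed base point [- (|x| + 2)] gives the same function. *)
Lemma primitive_ex (f : R -> R) : continuous f ->
  exists F : R -> R, F 0 = 0 /\ forall x : R, is_derive x 1 F (f x).
Proof.
move=> cf.
pose G (k : R) (y : R) : R := \int[mu]_(t in [set` `[- k, y]]) f t.
have dG (k x : R) : - k < x -> is_derive x 1 (G k) (f x) by exact: primitive_from.
pose H k y := G k y - G k 0.
have dH (k x : R) : - k < x -> is_derive x 1 (H k) (f x).
  move=> kx; have := @is_deriveB R R R (G k) (cst (G k 0)) x 1 (f x) 0 (dG _ _ kx) (is_derive_cst _ _ _).
  by rewrite subr0.
have HH (k l y : R) : 0 < k -> k <= l -> - k < y -> H k y = H l y.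
  move=> k0 kl ky.
  have dD x : - k < x -> is_derive x 1 (H k \- H l) 0.
    move=> kx; rewrite -(subrr (f x)); apply: is_deriveB; apply: dH => //.
    by apply: le_lt_trans kx; rewrite lerN2.
  have D0 : (H k \- H l) 0 = 0 by rewrite /= /H !subrr.
  suff : (H k \- H l) y = 0 by move=> /eqP; rewrite subr_eq0 => /eqP.
  rewrite -D0; have [y0|/ltW y0] := leP 0 y.
    have dD' x : x \in `[0, y] -> is_derive x 1 (H k \- H l) 0.
      by rewrite in_itv/= => /andP[x0 _]; apply: dD; lra.
    by have [c _] := mvt y0 dD'; rewrite mul0r => /eqP; rewrite subr_eq0 => /eqP.
  have dD' x : x \in `[y, 0] -> is_derive x 1 (H k \- H l) 0.
    by rewrite in_itv/= => /andP[x0 _]; apply: dD; lra.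
  by have [c _] := mvt y0 dD'; rewrite mul0r => /eqP; rewrite subr_eq0 => /eqP ->.
exists (fun x => H (`|x| + 1) x); split; first by rewrite /H subrr.
move=> x; apply: (@near_eq_is_derive _ _ _ (H (`|x| + 2))); last first.
  apply: dH; have := ler_norm (- x); rewrite normrN; lra.
near=> y; apply/esym/HH.
- by rewrite ltr_wpDl.
- have xy : `|x - y| < 1 by near: y; apply: cvgr_dist_lt => //.
  have := ler_normD (y - x) x; rewrite subrK distrC in xy *; lra.
- have := ler_norm (- y); rewrite normrN; lra.
Unshelve. all: by end_near. Qed.

End Primitive.

(** * Global solutions of Lipschitz equations by Picard iteration *)

Section Picard.
Context {R : realType} (m n : nat).
Local Notation E := 'M[R]_(m, n).

Lemma mx_primitive_ex (f : R -> E) : continuous f ->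
  exists F : R -> E, F 0 = 0 /\ forall x : R, is_derive x 1 F (f x).
Proof.
move=> cf.
have H i j : exists F : R -> R, F 0 = 0 /\ forall x : R, is_derive x 1 F (f x i j).
  by apply: (@primitive_ex R (fun x => f x i j)) => x; exact: (continuous_mxP _ _).1 (cf x) i j.
pose F i j := sval (cid (H i j)).
have HF i j : F i j 0 = 0 /\ forall x : R, is_derive x 1 (F i j) (f x i j) := svalP (cid (H i j)).
exists (fun t => \matrix_(i, j) F i j t); split.
  by apply/matrixP => i j; rewrite !mxE; case: (HF i j).
move=> x; apply/is_derive_mxP => i j.
rewrite (_ : (fun y => _) = F i j); first by case: (HF i j).
by apply/funext => y; rewrite mxE.
Qed.


Lemma mx_derive_reflect (f df : R -> E) :
  (forall x : R, is_derive x 1 f (df x)) ->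
  forall x : R, is_derive x 1 (fun t => f (- t)) (- df (- x)).
Proof.
move=> fd x; have := is_derive_comp1 (is_derive_opp x) (fd (- x)).
by rewrite scaleN1r.
Qed.

Lemma mx_diff_bound0 (f df : R -> E) (C t : R) :
  (forall x : R, is_derive x 1 f (df x)) ->
  (forall x, `|x| <= `|t| -> `|df x| <= C) -> `|f t - f 0| <= C * `|t|.
Proof.
move=> fd fC; have [t0|/ltW t0] := leP 0 t.
  have := @mx_diff_bound _ _ _ f df C 0 t t0 (fun x _ => fd x).
  rewrite subr0 ger0_norm//; apply=> x /itvP x0; apply: fC.
  by rewrite !ger0_norm ?x0.
have nt0 : 0 <= - t by rewrite oppr_ge0.
have := @mx_diff_bound _ _ _ _ _ C 0 (- t) nt0 (fun x _ => mx_derive_reflect fd x).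
rewrite /= opprK oppr0 addr0 ler0_norm//; apply=> x /itvP x0.
by rewrite normrN; apply: fC; rewrite normrN ger0_norm ?x0// ler0_norm// x0.
Qed.

Lemma is_derive_wexp (c K x : R) : K != 0 ->
  is_derive x 1 (fun t : R => c / (2 * K) * expR (2 * K * t)) (c * expR (2 * K * x)).
Proof.
move=> K0.
have h := @is_derive_comp1 R R expR (fun t => 2 * K * t) x _ _ (is_derive_lin (2 * K) x) (is_derive_expR _).
have := @is_deriveZ R R R _ (c / (2 * K)) x 1 _ h.
rewrite /GRing.scale/= mulrA divfK// mulf_neq0// pnatr_eq0.
Qed.

(** The weight [expR (2 * K * |t|)] has primitive 1 / (2 K) times itself. An iteration step, which
    costs a factor [K], thus halves the weighted error, so the iterates converge geometrically on
    every interval [-T, T], however long. *)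
Lemma growth_bound (f df : R -> E) (c K T : R) : 0 < K -> 0 <= c -> f 0 = 0 ->
  (forall x : R, is_derive x 1 f (df x)) ->
  (forall x, `|x| <= T -> `|df x| <= c * expR (2 * K * `|x|)) ->
  forall t, `|t| <= T -> `|f t| <= c / (2 * K) * expR (2 * K * `|t|).
Proof.
move=> K0 c0 f0 fd fc t tT; have K0' : K != 0 by rewrite gt_eqF.
have cK : 0 <= c / (2 * K) by rewrite divr_ge0// mulr_ge0// ltW.
have main (g dg : R -> E) : g 0 = 0 -> (forall x : R, is_derive x 1 g (dg x)) ->
    (forall x, `|x| <= T -> `|dg x| <= c * expR (2 * K * `|x|)) ->
    forall s, 0 <= s -> s <= T -> `|g s| <= c / (2 * K) * expR (2 * K * s).
  move=> g0 gd gc s s0 sT.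
  have := @mx_diff_le _ _ _ g dg _ _ 0 s s0 (fun x _ => gd x) (fun x _ => is_derive_wexp c x K0').
  rewrite g0 subr0 mulr0 expR0 mulr1 => /(_ _)/le_trans; apply; last first.
    by rewrite lerBlDr lerDl.
  move=> x /itvP x0; have := gc x; rewrite ger0_norm ?x0//; apply.
  by rewrite (le_trans _ sT)// x0.
have [t0|/ltW t0] := leP 0 t.
  by move: tT; rewrite !ger0_norm// => tT; exact: (main f df).
move: tT; rewrite !ler0_norm// => tT; rewrite -[t in f t]opprK.
apply: (main _ _ _ (mx_derive_reflect fd)) => //; first by rewrite oppr0.
  by move=> x xT; rewrite normrN; have := fc (- x); rewrite [`|- x|]normrN => /(_ xT).
by rewrite oppr_ge0.
Qed.

Lemma half_pow_small (C e : R) : 0 < e -> exists k : nat, C / 2 ^+ k < e.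
Proof.
move=> e0; have [C0|C0] := leP C 0.
  by exists 0%N; rewrite expr0 divr1 (le_lt_trans C0).
have [k kC] : exists k : nat, C / e < k%:R.
  by exists (Num.bound (C / e)); apply: archi_boundP; rewrite divr_ge0// ltW.
exists k; rewrite ltr_pdivrMr ?exprn_gt0// mulrC -ltr_pdivrMr//.
by rewrite (lt_trans kC)// -natrX ltr_nat ltn_expl.
Qed.

Variables (F : R -> E -> E) (Y0 : E).
Hypothesis Fcont : forall Y : R -> E, continuous Y ->
  continuous (fun s => F s (Y s)).
Hypothesis Flip : forall T, exists2 K, 0 < K & forall t X Y, `|t| <= T ->
  `|F t X - F t Y| <= K * `|X - Y|.

Let prim (f : R -> E) : R -> E :=
  xget (fun=> 0) [set G | G 0 = 0 /\ forall x : R, is_derive x 1 G (f x)].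

Let primP f : continuous f ->
  prim f 0 = 0 /\ forall x : R, is_derive x 1 (prim f) (f x).
Proof. by move=> /mx_primitive_ex[G HG]; exact: (@xgetPex _ (fun=> 0) [set G | G 0 = 0 /\ forall x : R, is_derive x 1 G (f x)] (ex_intro _ G HG)). Qed.

Let Yk k : R -> E := iter k (fun Y t => Y0 + prim (fun s => F s (Y s)) t) (fun=> Y0).

Let Ystep Y : continuous Y ->
  forall x : R, is_derive x 1 (fun t => Y0 + prim (fun s => F s (Y s)) t) (F x (Y x)).
Proof.
move=> cY x; have [_ /(_ x) d] := primP (Fcont cY).
have := @is_deriveD R R _ (cst Y0) _ x 1 0 _ (is_derive_cst _ _ _) d.
by rewrite add0r.
Qed.

Let Yk_cont k : continuous (Yk k).
Proof.
elim: k => [|k IH] t; first exact: cst_continuous.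
exact: is_derive_continuous (Ystep IH t).
Qed.

Let Yk_derive k (t : R) : is_derive t 1 (Yk k.+1) (F t (Yk k t)).
Proof. exact: Ystep (@Yk_cont k) t. Qed.

Let Yk0 k : Yk k 0 = Y0.
Proof. by case: k => //= k; have [-> _] := primP (Fcont (@Yk_cont k)); rewrite addr0. Qed.

Let YkB k (t : R) : is_derive t 1 (Yk k.+2 \- Yk k.+1) (F t (Yk k.+1 t) - F t (Yk k t)).
Proof. by apply: is_deriveB; exact: Yk_derive. Qed.

Let Yk_bound T : 0 <= T -> exists M K : R, [/\ 0 <= M, 0 < K,
  (forall t X Y, `|t| <= T -> `|F t X - F t Y| <= K * `|X - Y|) &
  forall k t, `|t| <= T -> `|Yk k.+1 t - Yk k t| <= M / 2 ^+ k * expR (2 * K * `|t|)].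
Proof.
move=> T0; have [K K0 FK] := Flip T.
have [||c cT cM] := @EVT_max R (fun t => `|Yk 1 t - Yk 0 t|) (- T) T.
- by rewrite ge0_cp.
- apply: continuous_subspaceT => t; apply: cvg_norm; apply: cvgB; exact: Yk_cont.
exists `|Yk 1 c - Yk 0 c|, K; split=> //; elim=> [|k IH] t tT.
  rewrite expr0 divr1 (@le_trans _ _ `|Yk 1 c - Yk 0 c|)//.
    by apply: cM; rewrite in_itv/= -ler_norml.
  by rewrite ler_peMr// -expR0 ler_expR !mulr_ge0// ltW.
set M := `|Yk 1 c - Yk 0 c| in IH *.
have := @growth_bound (Yk k.+2 \- Yk k.+1) _ (K * (M / 2 ^+ k)) K T K0 _ _ (YkB k) _ t tT.
rewrite (_ : K * (M / 2 ^+ k) / (2 * K) = M / 2 ^+ k.+1); last first.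
  by rewrite exprS; field; rewrite expf_neq0// ?pnatr_eq0 // gt_eqF.
apply.
- by rewrite mulr_ge0 ?divr_ge0 ?exprn_ge0 ?(ltW K0)// normr_ge0.
- by rewrite -[LHS]/(Yk k.+2 0 - Yk k.+1 0) !Yk0 subrr.
- by move=> x xT; apply: (le_trans (FK _ _ _ xT)); rewrite -[leRHS]mulrA ler_pM2l//; exact: IH.
Qed.

Let Y t := limn (fun k => Yk k t).

Let Y_bound T : 0 <= T -> exists M K : R, [/\ 0 <= M, 0 < K,
  (forall t X Y, `|t| <= T -> `|F t X - F t Y| <= K * `|X - Y|) &
  forall k t, `|t| <= T -> `|Y t - Yk k t| <= M / 2 ^+ k].
Proof.
move=> T0; have [M [K [M0 K0 FK HM]]] := Yk_bound T0.
pose C := M * expR (2 * K * T).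
have C0 : 0 <= C by rewrite mulr_ge0// expR_ge0.
have HC k t : `|t| <= T -> `|Yk k.+1 t - Yk k t| <= C / 2 ^+ k.
  move=> tT; rewrite (le_trans (HM k t tT))// /C [leRHS]mulrAC ler_wpM2l//.
    by rewrite divr_ge0.
  by rewrite ler_expR ler_wpM2l// mulr_ge0// ltW.
have HD t : `|t| <= T -> forall k d, `|Yk (k + d) t - Yk k t| <= 2 * C / 2 ^+ k * (1 - 2^-1 ^+ d).
  move=> tT k; elim=> [|d IH]; first by rewrite addn0 !subrr normr0 mulr0.
  rewrite addnS -(subrKA (Yk (k + d) t)) (le_trans (ler_normD _ _))//.
  rewrite (le_trans (lerD (HC _ _ tT) IH))// le_eqVlt; apply/orP; left; apply/eqP.
  by rewrite exprD exprS !exprVn; field; rewrite !expf_neq0// pnatr_eq0.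
have HD' t : `|t| <= T -> forall k d, `|Yk (k + d) t - Yk k t| <= 2 * C / 2 ^+ k.
  move=> tT k d; rewrite (le_trans (HD t tT k d))// ler_piMr//.
    by rewrite divr_ge0// mulr_ge0.
have Ycvg t : `|t| <= T -> cvgn (fun k => Yk k t).
  move=> tT; have cij i j : cvgn (fun k => Yk k t i j).
    have : cvgn (series (telescope (fun k => Yk k t i j))).
      apply: normed_cvg; apply: (@series_le_cvg _ _ (geometric C 2^-1)).
      - by move=> n0; rewrite normr_ge0.
      - by move=> n0; rewrite /= mulr_ge0// exprn_ge0// invr_ge0.
      - move=> n0; rewrite /= exprVn; apply: le_trans (HC n0 t tT).
        rewrite /= (_ : telescope _ n0 = (Yk n0.+1 t - Yk n0 t) i j); first exact: mx_norm_ge.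
        by rewrite [RHS]mxE [X in _ + X]mxE.
      - apply: is_cvg_geometric_series; rewrite ger0_norm ?invr_ge0//.
        by rewrite invf_lt1// ltr1n.
    rewrite telescopeK => /cvg_ex[l /= cl]; apply/cvg_ex; exists (l + Yk 0 t i j).
    apply: cvg_trans (cvgD cl (cvg_cst (Yk 0 t i j))); apply: near_eq_cvg.
    by near=> k; rewrite /= subrK.
  apply/cvg_ex; exists (\matrix_(i, j) limn (fun k => Yk k t i j)).
  by apply/cvg_mxP => i j; rewrite mxE; exact: cij.
exists (2 * C), K; split=> //; first by rewrite mulr_ge0.
move=> k t tT; apply/ler_addgt0Pl => e e0.
have := Ycvg t tT; rewrite -/(Y t) => /cvgrPdist_le/(_ e e0)[N _ HN].
rewrite -(subrKA (Yk (k + N) t)) (le_trans (ler_normD _ _))// lerD//.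
  by apply: HN; rewrite /= leq_addl.
exact: HD'.
Unshelve. all: by end_near. Qed.

Let Y_cont : continuous Y.
Proof.
move=> t; apply/cvgrPdist_lt => e e0.
have [M [K [M0 K0 FK HM]]] := @Y_bound (`|t| + 1) (addr_ge0 (normr_ge0 _) ler01).
have [k Hk] := half_pow_small M (divr_gt0 e0 (ltr0n R 3)).
have e3 : 0 < e / 3 by rewrite divr_gt0.
near=> s.
have ts : `|t - s| < 1 by near: s; apply: cvgr_dist_lt => //.
have sT : `|s| <= `|t| + 1.
  by have := ler_normD (s - t) t; rewrite subrK distrC; lra.
have tT : `|t| <= `|t| + 1 by rewrite lerDl.
have h : `|Yk k t - Yk k s| < e / 3.
  by near: s; move/cvgrPdist_lt : (@Yk_cont k t) => /(_ _ e3).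
have h1 := HM k s sT; have h2 := HM k t tT.
have := ler_normD (Y t - Yk k t + (Yk k t - Yk k s)) (Yk k s - Y s).
rewrite subrKA subrKA; have := ler_normD (Y t - Yk k t) (Yk k t - Yk k s).
rewrite subrKA; move: h1; rewrite distrC; lra.
Unshelve. all: by end_near. Qed.

(** Both sides of the integral equation for the limit [Y] are within a geometrically small error of
    the same iterate, uniformly on each symmetric interval; hence they coincide. *)
Theorem picard : exists Y : R -> E, Y 0 = Y0 /\ forall t : R, is_derive t 1 Y (F t (Y t)).
Proof.
have [G0 dG] := primP (Fcont Y_cont).
have E1 t : Y t = Y0 + prim (fun s => F s (Y s)) t.
  apply/eqP; rewrite -subr_eq0 -normr_le0; apply/ler_addgt0Pl => e e0; rewrite addr0.
  have [M [K [M0 K0 FK HM]]] := @Y_bound `|t| (normr_ge0 _).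
  have [k Hk] := half_pow_small (M + K * M * `|t|) e0.
  have dD (x : R) : is_derive x 1 (Yk k.+1 \- (fun t => Y0 + prim (fun s => F s (Y s)) t))
      (F x (Yk k x) - F x (Y x)).
    by apply: is_deriveB; [exact: Yk_derive|exact: (Ystep Y_cont)].
  have := @mx_diff_bound0 _ _ (K * (M / 2 ^+ k)) t dD.
  have -> : (Yk k.+1 \- (fun t0 : R => Y0 + prim (fun s : R => F s (Y s)) t0)) 0 = 0.
    by rewrite -[LHS]/(Yk k.+1 0 - (Y0 + prim (fun s : R => F s (Y s)) 0)) Yk0 G0 addr0 subrr.
  rewrite subr0 => bd.
  have {bd} : `|(Yk k.+1 \- (fun t => Y0 + prim (fun s => F s (Y s)) t)) t| <= K * (M / 2 ^+ k) * `|t|.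
    apply: bd => x xt; rewrite (le_trans (FK _ _ _ xt))// ler_pM2l// distrC.
    exact: HM.
  rewrite -[(_ \- _) t]/(Yk k.+1 t - (Y0 + prim (fun s => F s (Y s)) t)) => bd.
  apply: le_trans (ltW Hk); rewrite -(subrKA (Yk k.+1 t)).
  rewrite (le_trans (ler_normD _ _))// mulrDl lerD//.
    rewrite (le_trans (HM _ _ _))// ler_wpM2l// lef_pV2 ?posrE ?exprn_gt0//.
    by rewrite exprS ler_peMl ?exprn_ge0// ler1n.
  by rewrite (le_trans bd)// mulrA mulrAC.
exists Y; split; first by rewrite E1 G0 addr0.
have EY : (fun t => Y0 + prim (fun s => F s (Y s)) t) = Y by apply/funext => t; rewrite -E1.
by move=> t; rewrite -{1}EY; exact: Ystep.
Qed.

End Picard.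

Section MatrixDerivative.
Context {R : realType}.

Lemma cvg_sumr {T : Type} {F : set_system T} {FF : Filter F} (I : Type) (r : seq I)
    (f : I -> T -> R) (l : I -> R) :
  (forall i, f i @ F --> l i) -> (fun x => \sum_(i <- r) f i x) @ F --> \sum_(i <- r) l i.
Proof.
move=> fl; elim: r => [|i r IH].
  under [X in X @ _]eq_fun do rewrite big_nil.
  by rewrite big_nil; exact: cvg_cst.
under [X in X @ _]eq_fun do rewrite big_cons.
by rewrite big_cons; apply: cvgD => //; exact: fl.
Qed.

Lemma cvg_mulmx {T : Type} {F : set_system T} {FF : Filter F} (m n p : nat)
    (f : T -> 'M[R]_(m, n)) (g : T -> 'M[R]_(n, p)) (a : 'M[R]_(m, n)) (b : 'M[R]_(n, p)) :
  f @ F --> a -> g @ F --> b -> (fun x => f x *m g x) @ F --> a *m b.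
Proof.
move=> /cvg_mxP fa /cvg_mxP gb; apply/cvg_mxP => i j; rewrite mxE.
under [X in X @ _]eq_fun do rewrite mxE.
by apply: cvg_sumr => k; apply: cvgM; [exact: fa|exact: gb].
Qed.

Lemma is_derive_mulmx (m n p : nat) (f : R -> 'M[R]_(m, n)) (g : R -> 'M[R]_(n, p)) (x : R) df dg :
  is_derive x 1 f df -> is_derive x 1 g dg ->
  is_derive x 1 (fun t => f t *m g t) (df *m g x + f x *m dg).
Proof.
move=> /is_derive_mxP fd /is_derive_mxP gd; apply/is_derive_mxP => i j.
have -> : (fun t => (f t *m g t) i j) = \sum_k ((fun t => f t i k) * (fun t => g t k j)).
  by apply/funext => t; rewrite mxE fct_sumE.
have := @is_derive_sum R R R n (fun k => (fun t => f t i k) * (fun t => g t k j)) x 1 _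
  (fun k => is_deriveM (fd i k) (gd k j)).
move=> h; apply: (is_derive_eq h); rewrite !mxE -big_split/=; apply: eq_bigr => k _.
by rewrite addrC /GRing.scale/=; congr (_ + _); rewrite mulrC.
Qed.

Lemma is_derive_trmx (m n : nat) (f : R -> 'M[R]_(m, n)) (x : R) df :
  is_derive x 1 f df -> is_derive x 1 (fun t => (f t)^T) df^T.
Proof.
move=> /is_derive_mxP fd; apply/is_derive_mxP => i j; rewrite mxE.
by rewrite (_ : (fun t => _) = fun t => f t j i)//; apply/funext => t; rewrite mxE.
Qed.

Lemma is_derive_mulmxl (m n p : nat) (A : 'M[R]_(m, n)) (g : R -> 'M[R]_(n, p)) (x : R) dg :
  is_derive x 1 g dg -> is_derive x 1 (fun t => A *m g t) (A *m dg).
Proof.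
move=> gd; have := is_derive_mulmx (is_derive_cst A x 1) gd.
by rewrite mul0mx add0r.
Qed.

Lemma is_derive_mulmxr (m n p : nat) (f : R -> 'M[R]_(m, n)) (B : 'M[R]_(n, p)) (x : R) df :
  is_derive x 1 f df -> is_derive x 1 (fun t => f t *m B) (df *m B).
Proof.
move=> fd; have := is_derive_mulmx fd (is_derive_cst B x 1).
by rewrite mulmx0 addr0.
Qed.

Lemma linear_ode (n m : nat) (A : R -> 'M[R]_n) (Y0 : 'M[R]_(m, n)) : continuous A ->
  exists Y : R -> 'M[R]_(m, n), Y 0 = Y0 /\ forall t : R, is_derive t 1 Y (Y t *m A t).
Proof.
move=> cA; apply: (@picard R m n (fun t Y => Y *m A t)).
  by move=> Y cY t; apply: cvg_mulmx; [exact: cY|exact: cA].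
move=> T; have [T0|T0] := leP 0 T; last first.
  by exists 1 => // t X Y tT; have := normr_ge0 t; lra.
have [||c cT cM] := @EVT_max R (fun t => `|A t|) (- T) T.
- by rewrite ge0_cp.
- by apply: continuous_subspaceT => t; apply: cvg_norm; exact: cA.
exists (1 + n%:R * `|A c|); first by rewrite ltr_pwDl// mulr_ge0.
move=> t X Y tT; rewrite -mulmxBl (le_trans (mx_norm_mulmx _ _))//.
rewrite [`|X - Y| * _]mulrC mulrA ler_wpM2r// (@le_trans _ _ (n%:R * `|A c|))// ?lerDr//.
by rewrite ler_wpM2l// cM// in_itv/= -ler_norml.
Qed.

End MatrixDerivative.

Section Epsilon.
Context {R : realType}.

Lemma is_derive_eps {V W : normedModType R} (f : V -> W) (x v : V) (d : W) :
  (forall e, 0 < e -> \forall h \near (0 : R), `|f (x + h *: v) - f x - h *: d| <= e * `|h|) ->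
  is_derive x v f d.
Proof.
move=> H.
have cv : (fun h : R => h^-1 *: ((f \o shift x) (h *: v) - f x)) @ 0^' --> d.
  apply/cvgrPdist_le => e e0; near=> h.
  have h0 : h != 0 by near: h; exact: nbhs_dnbhs_neq.
  have He : `|f (x + h *: v) - f x - h *: d| <= e * `|h|.
    by near: h; apply: cvg_within; exact: H.
  rewrite -[d](scale1r) -(mulVf h0) -scalerA -scalerBr normrZ normfV distrC /=.
  by rewrite ler_pdivrMl ?normr_gt0// mulrC [h *: v + x]addrC.
split; first by apply/cvg_ex; exists d.
exact: cvg_lim cv.
Unshelve. all: by end_near. Qed.

Lemma compact_bounded_itv {W : normedModType R} (f : R -> W) (T : R) : 0 <= T -> continuous f ->
  exists2 C, 0 <= C & forall t, `|t| <= T -> `|f t| <= C.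
Proof.
move=> T0 cf; have [||c cT cM] := @EVT_max R (fun t => `|f t|) (- T) T.
- by rewrite ge0_cp.
- by apply: continuous_subspaceT => t; apply: cvg_norm; exact: cf.
exists `|f c| => // t tT; apply: cM; by rewrite in_itv/= -ler_norml.
Qed.

Lemma tube_continuity {V W : normedModType R} (f : V * R -> W) (x : V) (T : R) : continuous f ->
  forall e, 0 < e -> \forall y \near x, forall t, `|t| <= T -> `|f (y, t) - f (x, t)| < e.
Proof.
move=> cf e e0.
have := (compact_near_coveringP _).1 (@segment_compact R (- T) T) V (nbhs x)
  (fun y t => `|f (y, t) - f (x, t)| < e).
move=> H; have {H} : \forall y \near x, `[- T, T] `<=` (fun t => `|f (y, t) - f (x, t)| < e).
  apply: H => t _; have e2 : 0 < e / 2 by rewrite divr_gt0.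
  have := (cvgrPdist_lt _ _).1 (cf (x, t)) _ e2.
  case=> -[B C] /= [Bx Ct] BC.
  exists (C, B) => //= -[t' y] /= [Ct' By].
  have h1 := BC (y, t') (conj By Ct').
  have h2 := BC (x, t') (conj (nbhs_singleton Bx) Ct').
  rewrite /= in h1 h2; rewrite distrC.
  rewrite -(subrKA (f (x, t))) (le_lt_trans (ler_normD _ _))// [ltRHS]splitr.
  by rewrite ltrD// distrC.
by apply: filterS => y + t tT; apply; rewrite /= in_itv/= -ler_norml.
Qed.

(** The mean value theorem on the segment from [x] to [x + h] compares the increment with the
    partial derivatives at an intermediate point, and these are close to their values at [x] by
    continuity. *)
Lemma differentiable_partials (n : nat) (f : 'rV[R]_n -> R) (g : 'I_n -> 'rV[R]_n -> R) x :
  (forall i, continuous (g i)) ->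
  (forall y v : 'rV[R]_n, is_derive y v f (\sum_i v 0 i * g i y)) ->
  differentiable f x.
Proof.
move=> cg df; apply/differentiable_epsP.
pose Lx (v : 'rV[R]_n) := v *m (\col_i g i x : 'M[R]_(n, 1)).
have Lxlin : linear (fun v => Lx v 0 0).
  by move=> a u v; rewrite /Lx mulmxDl -scalemxAl mxE [X in X + _]mxE.
pose Lmix := GRing.isLinear.Build R 'rV[R]_n R^o *:%R (fun v => Lx v 0 0) Lxlin.
pose L : {linear 'rV[R]_n -> R^o} := HB.pack (fun v => Lx v 0 0) Lmix.
have LE v : L v = \sum_i v 0 i * g i x.
  by rewrite /= /Lx mxE; apply: eq_bigr => i _; rewrite mxE.
exists L; split.
  move=> v; have -> : (L : _ -> _) = fun v => \sum_i v 0 i * g i x by apply/funext => u; exact: LE.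
  by apply: (@cvg_sumr R _ (nbhs v) (nbhs_filter v)) => i; apply: cvgM; [exact: coord_continuous|exact: cvg_cst].
move=> e e0.
have e1 : 0 < e / n.+1%:R by rewrite divr_gt0.
have near1 : \forall y \near x, forall i, `|g i x - g i y| < e / n.+1%:R.
  by apply: (@filter_forall _ _ _ (nbhs x) (nbhs_filter x)) => i; exact: ((@cvgrPdist_lt _ _ _ (nbhs x) (nbhs_filter x) _ _).1 (cg i x) _ e1).
have [r /= r0 Hr] := (nbhs_ballP _ _).1 near1.
near=> h.
have hr : `|h| < r.
  by near: h; apply/nbhs_ballP; exists r => //= y; rewrite -ball_normE /= sub0r normrN.
have line (t : R) : t \in `[0, 1] -> is_derive t 1 (fun s => f (x + s *: h)) (\sum_i h 0 i * g i (x + t *: h)).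
  by move=> _; apply: is_derive_line; exact: df.
have [c c01] := mvt ler01 line.
rewrite scale1r scale0r addr0 subr0 mulr1 [x + h]addrC => ->.
rewrite -[Lx h 0 0]/(L h) LE -sumrB (le_trans (ler_norm_sum _ _ _))//.
rewrite (@le_trans _ _ (\sum_(i < n) `|h| * (e / n.+1%:R)))//.
  apply: ler_sum => i _; rewrite -mulrBr normrM ler_pM// ?mx_norm_ge// distrC ltW//.
  apply: Hr; rewrite -ball_normE /= opprD addrA subrr add0r normrN normrZ.
  move: c01; rewrite in_itv/= => /andP[c0 c1]; rewrite ger0_norm//.
  by rewrite (le_lt_trans _ hr)// ler_piMl.
rewrite sumr_const card_ord -mulrnAr -[_ *+ n]mulr_natr mulrC ler_wpM2r// -mulrA ler_piMr ?ltW//.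
by rewrite mulrC ltr_pdivrMr// mul1r ltr_nat.
Unshelve. all: by end_near. Qed.

End Epsilon.

Section LinearODE.
Context {R : realType} {q : nat}.
Implicit Types (A Y : R -> 'M[R]_q).

Definition ode_sol A Y := Y 0 = 1%:M /\ forall t : R, is_derive t 1 Y (Y t *m A t).

Lemma ode_sol_ex A : continuous A -> exists Y, ode_sol A Y.
Proof. by move=> cA; have [Y [Y0 dY]] := linear_ode (1%:M : 'M[R]_q) cA; exists Y. Qed.

(** [Z] is the transposed solution of the adjoint equation: the derivative of [Y Z] is
    [Y A Z - Y A Z = 0], and a one-sided inverse of a square matrix is two-sided. *)
Lemma ode_inv A Y : continuous A -> ode_sol A Y -> exists Z,
  [/\ Z 0 = 1%:M, forall t : R, is_derive t 1 Z (- A t *m Z t),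
      forall t, Y t *m Z t = 1%:M & forall t, Z t *m Y t = 1%:M].
Proof.
move=> cA [Y0 dY].
have cA' : continuous (fun t => - (A t)^T).
  move=> t; apply: cvgN; apply: (continuous_mxP (fun t => (A t)^T) t).2 => i j.
  rewrite (_ : (fun y => _) = fun y => A y j i); last by apply/funext => y; rewrite mxE.
  exact: (continuous_mxP _ _).1 (cA t) j i.
have [Z [Z0 dZ]] := linear_ode (1%:M : 'M[R]_q) cA'.
have dZ' (t : R) : is_derive t 1 (fun t => (Z t)^T) (- A t *m (Z t)^T).
  by have := is_derive_trmx (dZ t); rewrite trmx_mul linearN/= trmxK.
have YZ t : Y t *m (Z t)^T = 1%:M.
  have dYZ (s : R) : is_derive s 1 (fun s => Y s *m (Z s)^T) 0.
    have := is_derive_mulmx (dY s) (dZ' s).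
    by rewrite mulmxA mulmxN mulNmx subrr.
  by rewrite (mx_derive0_const t 0 dYZ) Y0 Z0 trmx1 mulmx1.
exists (fun t => (Z t)^T); split=> //; first by rewrite Z0 trmx1.
by move=> t; exact: mulmx1C (YZ t).
Qed.

Lemma ode_unique (p : nat) A Y (y : R -> 'M[R]_(p, q)) : continuous A -> ode_sol A Y ->
  (forall t : R, is_derive t 1 y (y t *m A t)) -> forall t, y t = y 0 *m Y t.
Proof.
move=> cA sY dy t; have [Z [Z0 dZ YZ ZY]] := ode_inv cA sY.
have dyZ (s : R) : is_derive s 1 (fun s => y s *m Z s) 0.
  have := is_derive_mulmx (dy s) (dZ s).
  by rewrite mulNmx mulmxN mulmxA subrr.
have := mx_derive0_const t 0 dyZ; rewrite Z0 mulmx1 => <-.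
by rewrite -mulmxA ZY mulmx1.
Qed.

Lemma ode_sol_continuous A Y : ode_sol A Y -> continuous Y.
Proof. by move=> [_ dY] t; exact: is_derive_continuous (dY t). Qed.

End LinearODE.

(** * Dependence of linear equations on a parameter *)

Section SmoothDependence.
Context {R : realType} {n : nat}.
Local Notation V := 'rV[R]_n.

Lemma slice_continuous {W : normedModType R} (f : V * R -> W) x :
  continuous f -> continuous (fun t => f (x, t)).
Proof.
move=> cf t; apply: (@continuous_comp _ _ _ (fun t => (x, t)) f t); last exact: cf.
by apply: (@cvg_pair _ _ _ _ (nbhs x) (nbhs t)); [exact: cvg_cst|exact: cvg_id].
Qed.

(* Duhamel: [(Y_y Y_x^-1)' = Y_y (A_y - A_x) Y_x^-1]. *)
Lemma ode_duhamel (q : nat) (A B Y Z X : R -> 'M[R]_q) (t : R) :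
  ode_sol B X -> ode_sol A Y -> (forall t : R, is_derive t 1 Z (- A t *m Z t)) ->
  is_derive t 1 (fun s => X s *m Z s) (X t *m (B t - A t) *m Z t).
Proof.
move=> [_ dX] _ dZ; have := is_derive_mulmx (dX t) (dZ t).
by rewrite mulmxBr mulmxBl mulNmx mulmxN mulmxA.
Qed.

Lemma mx_norm_mulmx3 (a b c d : nat) (A : 'M[R]_(a, b)) (B : 'M[R]_(b, c)) (C : 'M[R]_(c, d)) :
  `|A *m B *m C| <= b%:R * c%:R * (`|A| * `|B| * `|C|).
Proof.
rewrite (le_trans (mx_norm_mulmx _ _))// [leLHS]mulrCA mulrA.
rewrite [leRHS](_ : _ = c%:R * (b%:R * (`|A| * `|B|)) * `|C|); last by ring.
rewrite ler_wpM2r// [leLHS]mulrC ler_wpM2l//; exact: mx_norm_mulmx.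
Qed.

Variables (q : nat) (A : V * R -> 'M[R]_q) (Y : V -> R -> 'M[R]_q).
Hypothesis cA : continuous A.
Hypothesis Ysol : forall x, ode_sol (fun t => A (x, t)) (Y x).

(** Bootstrap in place of Gronwall's inequality: [D], the deviation of [Y_y Y_x^-1] from the
    identity, has a maximum [S] on [-1, 1] which the Duhamel formula bounds by [P * d * (1 + S)],
    where [d] measures the distance of the coefficients. Once [P * d] is at most 1/2 this gives [S]
    at most 1, and then at most [2 * P * d]. *)
Lemma ode_uniform_continuity x e : 0 < e ->
  \forall y \near x, forall t, `|t| <= 1 -> `|Y y t - Y x t| <= e.
Proof.
move=> e0; have cAx y := slice_continuous (x := y) cA.
have [Z [Z0 dZ YZ ZY]] := ode_inv (cAx x) (Ysol x).
have cY y := ode_sol_continuous (Ysol y).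
have cZ : continuous Z by move=> t; exact: is_derive_continuous (dZ t).
have [CY CY0 HY] := compact_bounded_itv ler01 (cY x).
have [CZ CZ0 HZ] := compact_bounded_itv ler01 cZ.
pose Q : R := q%:R; have Q0 : 0 <= Q by exact: ler0n.
pose P := Q * Q * (1 + Q) * CY * CZ.
have P0 : 0 <= P by rewrite !mulr_ge0// addr_ge0.
(* The first bound absorbs [S] in the bootstrap; the second makes the resulting estimate of
   [Y y t - Y x t] at most [e]. *)
pose d := Num.min (1 / (2 * (P + 1))) (e / (2 * (P + 1) * (1 + Q * CY))).
have QC0 : 0 <= Q * CY by rewrite mulr_ge0.
have d0 : 0 < d by rewrite lt_min !divr_gt0// ?mulr_gt0//; lra.
have d1 : P * d <= 1 / 2.
  have : d <= 1 / (2 * (P + 1)) by rewrite ge_min lexx.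
  rewrite ler_pdivlMr; last by lra.
  by move: d0 P0; nra.
have d2 : 2 * (P * d) * (Q * CY) <= e.
  have : d <= e / (2 * (P + 1) * (1 + Q * CY)) by rewrite ge_min lexx orbT.
  rewrite ler_pdivlMr; last by rewrite !mulr_gt0//; lra.
  have : P * (Q * CY) <= (P + 1) * (1 + Q * CY) by nra.
  by move: d0; nra.
have := tube_continuity x 1 cA d0; apply: filterS => y Hy t t1.
pose D s := Y y s *m Z s - 1%:M.
have YD s : Y y s = Y x s + D s *m Y x s.
  by rewrite /D mulmxBl -mulmxA ZY mulmx1 mul1mx addrC subrK.
have dD (s : R) : is_derive s 1 D (Y y s *m (A (y, s) - A (x, s)) *m Z s).
  have := @is_deriveB R R _ _ (cst 1%:M) s 1 _ 0 (ode_duhamel s (Ysol y) (Ysol x) dZ) (is_derive_cst _ _ _).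
  by rewrite subr0.
have D0 : D 0 = 0 by rewrite /D (Ysol y).1 Z0 mulmx1 subrr.
have cD : continuous D by move=> s; exact: is_derive_continuous (dD s).
have [||c cT cM] := @EVT_max R (fun t => `|D t|) (- 1) 1.
- by rewrite ge0_cp.
- by apply: continuous_subspaceT => s; apply: cvg_norm; exact: cD.
set S := `|D c| in cM.
have S0 : 0 <= S by exact: normr_ge0.
have HS s : `|s| <= 1 -> `|D s| <= S by move=> s1; apply: cM; rewrite in_itv/= -ler_norml.
have HYy s : `|s| <= 1 -> `|Y y s| <= CY + Q * (S * CY).
  move=> s1; rewrite YD (le_trans (ler_normD _ _))// lerD ?HY//.
  rewrite (le_trans (mx_norm_mulmx _ _))// ler_wpM2l//; apply: ler_pM => //; [exact: HS|exact: HY].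
have HD s : `|s| <= 1 -> `|D s| <= Q * Q * ((CY + Q * (S * CY)) * d * CZ).
  move=> s1; have := mx_diff_bound0 (t := s) dD; rewrite D0 subr0 => bd.
  apply: (le_trans (bd (Q * Q * ((CY + Q * (S * CY)) * d * CZ)) _)).
    move=> r rs; have r1 : `|r| <= 1 by exact: le_trans s1.
    rewrite (le_trans (mx_norm_mulmx3 _ _ _))// ler_wpM2l ?mulr_ge0//.
    apply: ler_pM; rewrite ?mulr_ge0//; last exact: HZ.
    by apply: ler_pM => //; [exact: HYy|exact/ltW/Hy].
  by rewrite ler_piMr// !mulr_ge0// ?addr_ge0 ?mulr_ge0// ltW.
have S2 : S <= 2 * (P * d).
  have SP : S <= P * d * (1 + S).
    have c1 : `|c| <= 1 by move: cT; rewrite in_itv/= -ler_norml.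
    apply: le_trans (HD c c1) _; rewrite /P.
    have -> : Q * Q * ((CY + Q * (S * CY)) * d * CZ) = (Q * Q * CY * CZ * d) * (1 + Q * S) by ring.
    have -> : Q * Q * (1 + Q) * CY * CZ * d * (1 + S) = (Q * Q * CY * CZ * d) * ((1 + Q) * (1 + S)) by ring.
    rewrite ler_wpM2l ?mulr_ge0 ?(ltW d0)//; nra.
  have S1 : S <= 1 by move: SP d1 S0; nra.
  by move: SP S1 P0 (ltW d0) => h1 h2 h3 h4; have := mulr_ge0 h3 h4; nra.
rewrite YD addrC addKr (le_trans (mx_norm_mulmx _ _))// (le_trans _ d2)//.
rewrite [leRHS]mulrCA ler_wpM2l// ler_pM//; first by rewrite (le_trans (HS t t1)).
exact: HY.
Qed.

Lemma ode_solution_continuous : continuous (fun x => Y x 1).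
Proof.
move=> x; apply/(@cvgrPdist_le _ _ _ (nbhs x) (nbhs_filter x)) => e e0; have := ode_uniform_continuity x e0.
by apply: filterS => y /(_ 1); rewrite normr1 lexx distrC; exact.
Qed.

Variables (v : V) (dA : V * R -> 'M[R]_q).
Hypothesis cdA : continuous dA.
Hypothesis AdA : forall x t, is_derive x v (fun y => A (y, t)) (dA (x, t)).

(** Variation of constants. The curve [Y_(x + h v) Z - h N] starts at the identity and its
    derivative is o(h) uniformly in time: one part comes from the first-order expansion of [A], the
    other from the continuity of the solution in the parameter. *)
Lemma ode_solution_derive x Z N :
  (forall t : R, is_derive t 1 Z (- A (x, t) *m Z t)) -> Z 0 = 1%:M ->
  (forall t, Z t *m Y x t = 1%:M) ->
  N 0 = 0 -> (forall t : R, is_derive t 1 N (Y x t *m dA (x, t) *m Z t)) ->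
  is_derive x v (fun y => Y y 1) (N 1 *m Y x 1).
Proof.
move=> dZ Z0 ZY N0 dN; apply: is_derive_eps => e e0.
have cZ : continuous Z by move=> t; exact: is_derive_continuous (dZ t).
have cY y := ode_sol_continuous (Ysol y).
have [CY CY0 HY] := compact_bounded_itv ler01 (cY x).
have [CZ CZ0 HZ] := compact_bounded_itv ler01 cZ.
have [CD CD0 HD] := compact_bounded_itv ler01 (slice_continuous (x := x) cdA).
pose Q : R := q%:R; have Q0 : 0 <= Q by exact: ler0n.
pose P := Q * (Q * Q) * CZ * CY * (CY + 1 + CD).
have P0 : 0 <= P by rewrite !mulr_ge0// !addr_ge0.
pose e1 := Num.min 1 (e / (P + 1)).
have e10 : 0 < e1 by rewrite lt_min ltr01 divr_gt0//; lra.
have e11 : e1 <= 1 by rewrite ge_min lexx.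
have e1e : P * e1 <= e.
  have : e1 <= e / (P + 1) by rewrite ge_min lexx orbT.
  by rewrite ler_pdivlMr; [move: e10; nra|lra].
have /nbhs_ballP[r1 /= r10 H1] := tube_continuity x 1 cdA e10.
have /nbhs_ballP[r2 /= r20 H2] := ode_uniform_continuity x e10.
near=> h.
have hv : `|h *: v| < Num.min r1 r2.
  near: h; have : (fun h : R => h *: v) @ 0 --> (0 : V).
    by rewrite -[X in _ --> X](scale0r v); apply: cvgZr_tmp; exact: cvg_id.
  move=> /cvgrPdist_lt /(_ (Num.min r1 r2)); rewrite lt_min r10 r20 => /(_ isT).
  by apply: filterS => k; rewrite sub0r normrN.
have hs s : `|s| <= `|h| -> `|s *: v| < Num.min r1 r2.
  by move=> sh; apply: le_lt_trans hv; rewrite !normrZ ler_wpM2r.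
have inb r s : `|s *: v| < r -> ball x r (x + s *: v).
  by rewrite -ball_normE /= opprD addrA subrr add0r normrN.
have HA t : `|t| <= 1 -> `|A (x + h *: v, t) - A (x, t) - h *: dA (x, t)| <= e1 * `|h|.
  move=> t1.
  have dl (s : R) : is_derive s 1 (fun s => A (x + s *: v, t) - s *: dA (x, t))
      (dA (x + s *: v, t) - dA (x, t)).
    apply: is_deriveB; first exact: is_derive_line (AdA _ t).
    apply/is_derive_mxP => i j.
    have := is_derive_lin (dA (x, t) i j) s.
    by rewrite (_ : (fun y => (y *: dA (x, t)) i j) = fun s => dA (x, t) i j * s)//;
       apply/funext => y; rewrite mxE mulrC.
  rewrite addrAC; have := mx_diff_bound0 (C := e1) (t := h) dl.
  rewrite !scale0r subr0 addr0; apply=> s sh.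
  apply/ltW/(H1 (x + s *: v)) => //; apply: inb.
  by apply: lt_le_trans (hs _ sh) _; rewrite ge_min lexx.
have HYh t : `|t| <= 1 -> `|Y (x + h *: v) t - Y x t| <= e1.
  move=> t1; apply: (H2 (x + h *: v)) => //; apply: inb.
  by apply: lt_le_trans hv _; rewrite ge_min lexx orbT.
have HYh' t : `|t| <= 1 -> `|Y (x + h *: v) t| <= CY + 1.
  move=> t1; rewrite -(subrK (Y x t) (Y (x + h *: v) t)) addrC.
  by rewrite (le_trans (ler_normD _ _))// lerD ?HY// (le_trans (HYh _ t1)).
have dG (t : R) : is_derive t 1 (fun s => Y (x + h *: v) s *m Z s - h *: N s)
    (Y (x + h *: v) t *m (A (x + h *: v, t) - A (x, t) - h *: dA (x, t)) *m Z t +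
     (Y (x + h *: v) t - Y x t) *m (h *: dA (x, t)) *m Z t).
  have d1 := ode_duhamel t (Ysol (x + h *: v)) (Ysol x) dZ.
  have := is_deriveB d1 (@is_deriveZ _ _ _ N h t 1 _ (dN t)).
  move=> d; apply: (is_derive_eq d).
  by rewrite !(mulmxBr, mulmxBl) -!scalemxAr -!scalemxAl addrA subrK.
have := mx_diff_bound0 (C := Q * Q * CZ * (CY + 1 + CD) * (e1 * `|h|)) (t := 1) dG.
rewrite (Ysol _).1 Z0 N0 scaler0 subr0 mulmx1 normr1 mulr1 => /(_ _) bd.
have {}bd : `|Y (x + h *: v) 1 *m Z 1 - h *: N 1 - 1%:M| <= Q * Q * CZ * (CY + 1 + CD) * (e1 * `|h|).
  apply: bd => t t1; rewrite (le_trans (ler_normD _ _))//.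
  have -> : Q * Q * CZ * (CY + 1 + CD) * (e1 * `|h|) =
    Q * Q * ((CY + 1) * (e1 * `|h|) * CZ) + Q * Q * (e1 * (`|h| * CD) * CZ) by ring.
  apply: lerD; rewrite (le_trans (mx_norm_mulmx3 _ _ _))// ler_wpM2l ?mulr_ge0//.
    apply: ler_pM; rewrite ?mulr_ge0 ?HZ//; apply: ler_pM => //; [exact: HYh'|exact: HA].
  apply: ler_pM; rewrite ?mulr_ge0 ?HZ//; apply: ler_pM => //; first exact: HYh.
  by rewrite normrZ ler_wpM2l// HD.
have -> : Y (x + h *: v) 1 - Y x 1 - h *: (N 1 *m Y x 1) =
    (Y (x + h *: v) 1 *m Z 1 - h *: N 1 - 1%:M) *m Y x 1.
  by rewrite !mulmxBl mul1mx -mulmxA ZY mulmx1 -scalemxAl addrAC.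
rewrite (le_trans (mx_norm_mulmx _ _))//.
apply: (@le_trans _ _ (Q * ((Q * Q * CZ * (CY + 1 + CD) * (e1 * `|h|)) * CY))).
  rewrite ler_wpM2l// ler_pM// HY// normr1//.
have -> : Q * (Q * Q * CZ * (CY + 1 + CD) * (e1 * `|h|) * CY) = P * e1 * `|h| by rewrite /P; ring.
by rewrite ler_wpM2r.
Unshelve. all: by end_near. Qed.

End SmoothDependence.

Section SmoothDependenceCk.
Context {R : realType} {n : nat}.
Local Notation V := 'rV[R]_n.

Lemma Ck_block_mx {U : normedModType R} k (a b c d : nat) (A : U -> 'M[R]_(a, c)) (B : U -> 'M[R]_(a, d))
    (C : U -> 'M[R]_(b, c)) (D : U -> 'M[R]_(b, d)) :
  Ck k setT A -> Ck k setT B -> Ck k setT C -> Ck k setT D ->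
  Ck k setT (fun x => block_mx (A x) (B x) (C x) (D x)).
Proof.
move=> CA CB CC CD; apply: (Ck_mx openT) => i j.
case: (split_ordP i) => i' ->; case: (split_ordP j) => j' ->.
- by rewrite (_ : (fun x => _) = fun x => A x i' j'); [exact: (Ck_coord _ _ openT)|apply/funext => x; rewrite block_mxEul].
- by rewrite (_ : (fun x => _) = fun x => B x i' j'); [exact: (Ck_coord _ _ openT)|apply/funext => x; rewrite block_mxEur].
- by rewrite (_ : (fun x => _) = fun x => C x i' j'); [exact: (Ck_coord _ _ openT)|apply/funext => x; rewrite block_mxEdl].
- by rewrite (_ : (fun x => _) = fun x => D x i' j'); [exact: (Ck_coord _ _ openT)|apply/funext => x; rewrite block_mxEdr].
Qed.

Lemma Ck_ursubmx {U : normedModType R} k (a b c d : nat) (A : U -> 'M[R]_(a + b, c + d)) :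
  Ck k setT A -> Ck k setT (fun x => ursubmx (A x)).
Proof.
move=> CA; apply: (Ck_mx openT) => i j.
rewrite (_ : (fun x => _) = fun x => A x (lshift b i) (rshift c j)); first exact: (Ck_coord _ _ openT).
by apply/funext => x; rewrite !mxE.
Qed.

Lemma is_derive_slice {W : normedModType R} (f : V * R -> W) x t v :
  differentiable f (x, t) -> is_derive x v (fun y => f (y, t)) ('D_(v, 0) f (x, t)).
Proof.
move=> df; have := diff_derivable (v := (v, 0)) df => /derivableP.
case=> d e; have E : (fun h : R => h^-1 *: ((f \o shift (x, t)) (h *: (v, 0)) - f (x, t))) =
    (fun h : R => h^-1 *: (((fun y => f (y, t)) \o shift x) (h *: v) - f (x, t))).
  apply/funext => h /=; congr (_ *: (f _ - _)).
  by rewrite -[LHS]/(h *: v + x, h *: 0 + t) scaler0 add0r.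
split; first by move: d; rewrite /derivable E.
by rewrite /derive E.
Qed.

(** The derivative of [Y x 1] in the direction [v] is the upper right block of the time-one solution
    of the linear equation with coefficient [B v], the block triangular matrix built from [A] and
    its derivative. So it is an object of the same kind, of size [q + q] and with coefficients of
    class C^k; the induction on [k] therefore keeps [q] general. *)
Theorem ode_smooth_dependence k (q : nat) (A : V * R -> 'M[R]_q) (Y : V -> R -> 'M[R]_q) :
  Ck k setT A -> (forall x, ode_sol (fun t => A (x, t)) (Y x)) -> Ck k setT (fun x => Y x 1).
Proof.
elim: k q A Y => [|k IH] q A Y CA Ysol.
  by move=> x _; apply: (@ode_solution_continuous _ _ _ A) => // y; exact: CA.
have [dA DA] := CA.
have cA : continuous A by move=> p; exact: differentiable_continuous (dA p I).
have CkD_ v : Ck k setT ('D_(v, 0) A) by exact: DA.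
have cD v : continuous ('D_(v, 0) A) by have := Ck_le (leq0n k) (CkD_ v) => h p; exact: h.
pose B v (p : V * R) := block_mx (A p) ('D_(v, 0) A p) 0 (A p) : 'M[R]_(q + q).
have CB v : Ck k setT (B v).
  by apply: Ck_block_mx => //; [exact: CkS|exact: Ck_cst|exact: CkS].
have cB v x : continuous (fun t => B v (x, t)).
  by apply: slice_continuous => p; exact: (Ck_le (leq0n k) (CB v)).
have [X HX] : exists X : V -> V -> R -> 'M[R]_(q + q), forall v x, ode_sol (fun t => B v (x, t)) (X v x).
  exists (fun v x => sval (cid (ode_sol_ex (cB v x)))) => v x.
  exact: svalP (cid (ode_sol_ex (cB v x))).
have CX v : Ck k setT (fun x => X v x 1) by apply: (IH _ (B v)) => //; exact: HX.
have ND x v : exists N Z, [/\ N 0 = 0, forall t : R, is_derive t 1 N (Y x t *m 'D_(v, 0) A (x, t) *m Z t),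
   forall t, N t *m Y x t = ursubmx (X v x t), is_derive x v (fun y => Y y 1) (N 1 *m Y x 1) &
   [/\ Z 0 = 1%:M, forall t : R, is_derive t 1 Z (- A (x, t) *m Z t) & forall t, Z t *m Y x t = 1%:M]].
  have [Z [Z0 dZ YZ ZY]] := ode_inv (slice_continuous (x := x) cA) (Ysol x).
  have cI : continuous (fun t => Y x t *m 'D_(v, 0) A (x, t) *m Z t).
    move=> t; apply: cvg_mulmx; first apply: cvg_mulmx.
    - exact: (ode_sol_continuous (Ysol x)).
    - exact: (slice_continuous (x := x) (cD v)).
    - exact: is_derive_continuous (dZ t).
  have [N [N0 dN]] := mx_primitive_ex cI.
  exists N, Z; split=> //.
  - move=> t; pose y s := row_mx (Y x s) (N s *m Y x s).
    have dy (s : R) : is_derive s 1 y (y s *m B v (x, s)).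
      have d2 := is_derive_mulmx (dN s) ((Ysol x).2 s).
      rewrite /y /B mul_row_block mulmx0 addr0.
      rewrite -(mulmxA _ (Z s)) ZY mulmx1 mulmxA in d2.
      apply/is_derive_mxP => i j; case: (split_ordP j) => j' ->.
        rewrite row_mxEl (_ : (fun t => _) = fun s => Y x s i j').
          exact: (is_derive_mxP _ _ _ _).1 ((Ysol x).2 s) i j'.
        by apply/funext => r; rewrite row_mxEl.
      rewrite row_mxEr (_ : (fun t => _) = fun s => (N s *m Y x s) i j').
        exact: (is_derive_mxP _ _ _ _).1 d2 i j'.
      by apply/funext => r; rewrite row_mxEr.
    have := ode_unique (cB v x) (HX v x) dy t.
    rewrite /y N0 mul0mx (Ysol x).1 -[X v x t](@submxK _ q q q q) mul_row_block.
    by rewrite !mul0mx !mul1mx !addr0 => /eq_row_mx[_ ->]; rewrite block_mxKur.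
  - by apply: (ode_solution_derive cA Ysol (cD v) _ dZ) => // y t; exact: (is_derive_slice v (dA (y, t) I)).
have Ydiff x v : is_derive x v (fun y => Y y 1) (ursubmx (X v x 1)).
  by have [N [Z [_ _ <-]]] := ND x v.
(* Linearity in [v] is seen on the integrands of the [N]; it lets continuous partial derivatives
   yield differentiability. *)
have lin x v : ursubmx (X v x 1) = \sum_i v 0 i *: ursubmx (X (delta_mx 0 i) x 1).
  have [N HN'] := choice (ND x).
  have HN w : exists Z, [/\ N w 0 = 0, forall t : R, is_derive t 1 (N w) (Y x t *m 'D_(w, 0) A (x, t) *m Z t),
   forall t, N w t *m Y x t = ursubmx (X w x t), is_derive x w (fun y => Y y 1) (N w 1 *m Y x 1) &
   [/\ Z 0 = 1%:M, forall t : R, is_derive t 1 Z (- A (x, t) *m Z t) & forall t, Z t *m Y x t = 1%:M]]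
   := HN' w.
  have [Z [N0 dN EN _ [Z0 dZ ZY]]] := HN v; rewrite -(EN 1).
  have -> : \sum_i v 0 i *: ursubmx (X (delta_mx 0 i) x 1) = (\sum_i v 0 i *: N (delta_mx 0 i) 1) *m Y x 1.
    rewrite mulmx_suml; apply: eq_bigr => i _; rewrite -scalemxAl.
    by have [Z' [_ _ EN' _ _]] := HN (delta_mx 0 i); rewrite (EN' 1).
  congr (_ *m _).
  have dNi i (t : R) : is_derive t 1 (N (delta_mx 0 i)) (Y x t *m 'D_(delta_mx 0 i, 0) A (x, t) *m Z t).
    have [Z' [_ + _ _ [_ _ ZY']]] := HN (delta_mx 0 i).
    suff -> : Z = Z' by [].
    apply/funext => s; rewrite -[RHS]mulmx1 -[LHS]mulmx1.
    have YZ := mulmx1C (ZY s).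
    by rewrite -YZ !mulmxA ZY ZY'.
  have dD (t : R) : is_derive t 1 (fun s => N v s - \sum_i v 0 i *: N (delta_mx 0 i) s) 0.
    have dS : is_derive t 1 (\sum_i (v 0 i *: N (delta_mx 0 i)))
      (\sum_i v 0 i *: (Y x t *m 'D_(delta_mx 0 i, 0) A (x, t) *m Z t)).
      by apply: is_derive_sum => i; apply: is_deriveZ; exact: dNi.
    have := is_deriveB (dN t) dS.
    rewrite (_ : (fun s => _) = N v - \sum_i (v 0 i *: N (delta_mx 0 i))); last first.
      by apply/funext => s; rewrite -[RHS]/(N v s - _ s) fct_sumE.
    move=> d; apply: (is_derive_eq d).
    have dAp := dA (x, t) I.
    have -> : 'D_(v, 0) A (x, t) = \sum_i v 0 i *: 'D_(delta_mx 0 i, 0) A (x, t).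
      have -> : (v, 0) = \sum_i v 0 i *: (delta_mx 0 i : V, 0 : R) :> V * R.
        rewrite [in LHS](row_sum_delta v).
        elim: (index_enum _) => [|i r IHr]; first by rewrite !big_nil.
        rewrite !big_cons -IHr -[RHS]/(v 0 i *: delta_mx 0 i + _, v 0 i * 0 + 0).
        by rewrite mulr0 addr0.
      rewrite deriveE// linear_sum; apply: eq_bigr => i _.
      by rewrite linearZ deriveE.
    rewrite mulmx_sumr mulmx_suml -sumrB big1// => i _.
    by rewrite -scalemxAr -scalemxAl subrr.
  have := mx_derive0_const 1 0 dD; rewrite N0.
  have -> : \sum_i v 0 i *: N (delta_mx 0 i) 0 = 0.
    by rewrite big1// => i _; have [Z' [-> _ _ _ _]] := HN (delta_mx 0 i); rewrite scaler0.
  by rewrite subr0 => /eqP; rewrite subr_eq0 => /eqP.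
split=> [x _|v].
  apply/differentiable_mxP => a b.
  apply: (@differentiable_partials _ _ _ (fun i y => ursubmx (X (delta_mx 0 i) y 1) a b)).
    move=> i y; have := Ck_coord a b openT (Ck_ursubmx (CX (delta_mx 0 i))).
    by move=> /(Ck_le (leq0n k)); exact.
  move=> y v; have := (is_derive_mxP _ _ _ _).1 (Ydiff y v) a b.
  by rewrite lin summxE; under eq_bigr do rewrite mxE.
rewrite (_ : 'D_v _ = fun x => ursubmx (X v x 1)); first exact: Ck_ursubmx.
by apply/funext => x; exact: (@derive_val _ _ _ _ _ _ _ (Ydiff x v)).
Qed.

End SmoothDependenceCk.

(** * Lie algebras of groups of orthogonal matrices *)

Section VspaceOfPred.
Context {K : fieldType} {vT : vectType K}.

(** Among the subspaces contained in [P] take one of maximal dimension: a vector of [P] outside it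
    would enlarge it. *)
Lemma vspace_of_pred (P : vT -> Prop) : P 0 ->
  (forall a u v, P u -> P v -> P (a *: u + v)) ->
  exists L : {vspace vT}, forall x, x \in L <-> P x.
Proof.
move=> P0 Plin.
pose S (U : {vspace vT}) := forall x, x \in U -> P x.
suff [U SU Umax] : exists2 U, S U & forall W, S W -> (\dim W <= \dim U)%N.
  exists U => x; split; first exact: SU.
  move=> Px; have SW : S (U + <[x]>)%VS.
    move=> y /memv_addP[u uU [w /vlineP[k ->] ->]].
    by rewrite addrC; apply: Plin => //; exact: SU.
  have /eqP UW : U == (U + <[x]>)%VS by rewrite eqEdim addvSl Umax.
  by rewrite UW; apply: subvP (addvSr _ _) _ _; exact: memv_line.
apply: contrapT => nex.
have : forall k, exists2 U, S U & (k <= \dim U)%N.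
  elim=> [|k [U SU kU]].
    by exists 0%VS => // x; rewrite memv0 => /eqP ->.
  apply: contrapT => nW; apply: nex; exists U => // W SW.
  rewrite leqNgt; apply/negP => UW; apply: nW; exists W => //.
  exact: leq_ltn_trans UW.
move=> /(_ (\dim {:vT}).+1)[U _]; rewrite ltnNge; apply/negP; rewrite negbK.
exact: dimvS (subvf U).
Qed.

End VspaceOfPred.

Section LinearMaps.
Context {R : realType}.

Lemma linear_mx_sum (m n : nat) {W : lmodType R} (T : {linear 'M[R]_(m, n) -> W}) M :
  T M = \sum_i \sum_j M i j *: T (delta_mx i j).
Proof.
rewrite [in LHS](matrix_sum_delta M) linear_sum; apply: eq_bigr => i _.
by rewrite linear_sum; apply: eq_bigr => j _; rewrite linearZ.
Qed.

Lemma is_derive_linear (m n p q : nat) (T : {linear 'M[R]_(m, n) -> 'M[R]_(p, q)})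
    (f : R -> 'M[R]_(m, n)) (x : R) df :
  is_derive x 1 f df -> is_derive x 1 (fun t => T (f t)) (T df).
Proof.
move=> /is_derive_mxP fd; apply/is_derive_mxP => a b.
pose c i j := T (delta_mx i j) a b.
have TE M : T M a b = \sum_i \sum_j c i j * M i j.
  rewrite linear_mx_sum summxE; apply: eq_bigr => i _; rewrite summxE.
  by apply: eq_bigr => j _; rewrite mxE mulrC.
have -> : (fun t => T (f t) a b) = \sum_i \sum_j (c i j *: (fun t => f t i j : R)).
  apply/funext => t; rewrite TE fct_sumE; apply: eq_bigr => i _.
  by rewrite fct_sumE.
rewrite TE; apply: is_derive_sum => i; apply: is_derive_sum => j; apply: is_deriveZ; exact: fd.
Qed.

Lemma Ck_linear_comp {V : normedModType R} k (U : set V) (m n p q : nat)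
    (T : {linear 'M[R]_(m, n) -> 'M[R]_(p, q)}) (f : V -> 'M[R]_(m, n)) :
  open U -> Ck k U f -> Ck k U (fun x => T (f x)).
Proof.
move=> oU Cf; apply: (@Ck_eq _ _ _ k U (fun x => \sum_i \sum_j f x i j *: T (delta_mx i j))) => //.
  by move=> x _; rewrite -linear_mx_sum.
apply: Ck_sum => // i _; apply: Ck_sum => // j _; apply: (Ck_mx oU) => a b.
apply: (@Ck_eq _ _ _ k U (fun x => f x i j * T (delta_mx i j) a b)) => //.
  by move=> x _; rewrite mxE.
by apply: (CkM oU); [exact: Ck_coord|exact: Ck_cst].
Qed.

Lemma is_derive_unique {V W : normedModType R} (f : V -> W) (x v : V) a b :
  is_derive x v f a -> is_derive x v f b -> a = b.
Proof. by case=> _ <- [_ <-]. Qed.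

Lemma derive_in_vspace (m n : nat) (L : {vspace 'M[R]_(m, n)}) (f : R -> 'M[R]_(m, n)) (x e : R) df :
  0 < e -> (forall t, `|t - x| < e -> f t \in L) -> is_derive x 1 f df -> df \in L.
Proof.
move=> e0 fL fd.
have TP M : M \in L <-> projv L M = M.
  by split=> [|<-]; [exact: projv_id|exact: memv_proj].
apply/TP; have d1 := is_derive_linear (projv L) fd.
have d2 : is_derive x 1 f (projv L df).
  apply: near_eq_is_derive d1; near=> t; apply/TP/fL.
  by rewrite distrC; near: t; apply: cvgr_dist_lt.
exact: is_derive_unique d2 fd.
Unshelve. all: by end_near. Qed.

End LinearMaps.

Section CkId.
Context {R : realType}.

Lemma Ck_id {V : normedModType R} k (U : set V) : Ck k U (fun x : V => x).
Proof. exact: (@Ck_linear R V V k U idfun (fun x => cvg_id)). Qed.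

Lemma Ck_sub {V W : normedModType R} k (U O : set V) (f : V -> W) : O `<=` U -> Ck k U f -> Ck k O f.
Proof.
move=> OU; elim: k f => [|k IH] f /=; first by move=> cf x /OU; exact: cf.
by move=> [df Df]; split=> [x /OU|v]; [exact: df|exact: IH].
Qed.

End CkId.

Section ConstOffFinite.
Context {R : realType}.

Lemma const_off_finite (m n : nat) (f : R -> 'M[R]_(m, n)) (s : seq R) (a b : R) : a <= b ->
  {within `[a, b], continuous f} ->
  (forall t : R, t \in `]a, b[ -> t \notin s -> is_derive t 1 f 0) -> f a = f b.
Proof.
elim: s a b => [|c s IH] a b ab cf fd.
  apply/matrixP => i j.
  have cfij : {within `[a, b], continuous (fun t => f t i j)}.
    by move=> t; exact: (continuous_mxP _ _).1 (cf t) i j.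
  have [|d _ /eqP] := @MVT_segment R (fun t => f t i j) (fun=> 0) a b ab _ cfij.
    move=> t tab; have := (is_derive_mxP _ _ _ _).1 (fd t tab isT) i j.
    by rewrite mxE.
  by rewrite mul0r subr_eq0 => /eqP.
have [cab|cab] := boolP (c \in `]a, b[); last first.
  apply: (IH a b ab cf) => t tab ts; apply: fd => //.
  by rewrite inE negb_or ts andbT; apply: contraNneq cab => <-.
have /andP[ac cb] : a < c < b by move: cab; rewrite in_itv.
have acb : `[a, c] `<=` `[a, b] by apply: subset_itvl; rewrite bnd_simp ltW.
have cbb : `[c, b] `<=` `[a, b] by apply: subset_itvr; rewrite bnd_simp ltW.
have F1 (t : R) : t \in `]a, c[ -> t \notin s -> is_derive t 1 f 0.
  move=> /itvP tcb ts; apply: fd.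
    by rewrite in_itv/= tcb (lt_trans _ cb)// tcb.
  by rewrite inE negb_or ts lt_eqF// tcb.
have F2 (t : R) : t \in `]c, b[ -> t \notin s -> is_derive t 1 f 0.
  move=> /itvP tcb ts; apply: fd.
    by rewrite in_itv/= tcb (lt_trans ac)// tcb.
  by rewrite inE negb_or ts gt_eqF// tcb.
rewrite (IH a c (ltW ac) (continuous_subspaceW acb cf) F1).
exact: IH c b (ltW cb) (continuous_subspaceW cbb cf) F2.
Qed.

End ConstOffFinite.

Section MatrixGroups.
Context {R : realType} {N : nat}.
Implicit Types (G : set 'M[R]_N) (X Y : 'M[R]_N).

Definition orthogonal_group G :=
  [/\ G 1%:M, forall g h, G g -> G h -> G (g *m h), forall g, G g -> G g^T &
      forall g, G g -> g *m g^T = 1%:M].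

Definition velocity G X := exists gamma : R -> 'M[R]_N,
  [/\ smooth_on setT gamma, gamma 0 = 1%:M, (forall t, G (gamma t)) & is_derive (0 : R) 1 gamma X].

Lemma smooth_is_derive {W : normedModType R} (f : R -> W) (t : R) :
  smooth_on setT f -> is_derive t 1 f (derive1 f t).
Proof.
move=> sf; have [df _] := sf 1%N.
by rewrite derive1E; apply/derivableP/derivable1_diffP; exact: df.
Qed.

Lemma smooth_comp_lin {W : normedModType R} (f : R -> W) (a b : R) :
  smooth_on setT f -> smooth_on setT (fun t => f (a + b * t)).
Proof.
move=> sf k; elim: k f sf => [|k IH] f sf.
  move=> t _; apply: continuous_comp; last exact: (sf 0%N).
  exact: is_derive_continuous (is_derive_affine a b t).
have dg (t : R) : is_derive t 1 (fun t => f (a + b * t)) (b *: derive1 f (a + b * t)).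
  exact: (is_derive_comp1 (is_derive_affine a b t) (smooth_is_derive (a + b * t) sf)).
split=> [t _|v].
  by apply/derivable1_diffP; exact: (@ex_derive _ _ _ _ _ _ _ (dg t)).
have -> : 'D_v (fun t => f (a + b * t)) = fun t => (v * b) *: derive1 f (a + b * t).
  apply/funext => t; have df : differentiable (fun t => f (a + b * t)) t.
    by apply/derivable1_diffP; exact: (@ex_derive _ _ _ _ _ _ _ (dg t)).
  rewrite deriveE// (diff1E df) derive1E (@derive_val _ _ _ _ _ _ _ (dg t)).
  by rewrite scalerA.
apply: (CkZ _ openT); apply: IH => l.
have [_ /(_ 1)] := sf l.+1.
by rewrite (_ : 'D_1 f = derive1 f)//; apply/funext => t; rewrite derive1E.
Qed.

(** The product of the first curve run at speed [a] with the second curve stays in the group, and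
    its velocity at the identity is the required combination. *)
Lemma velocity_lin G a X Y : orthogonal_group G -> velocity G X -> velocity G Y -> velocity G (a *: X + Y).
Proof.
move=> [G1 GM _ _] [f [sf f0 Gf df]] [h [sh h0 Gh dh]].
exists (fun t => f (0 + a * t) *m h t); split.
- by move=> k; apply: (Ck_mulmx openT); [exact: smooth_comp_lin|exact: sh].
- by rewrite mulr0 addr0 f0 h0 mulmx1.
- by move=> t; apply: GM.
- have df' : is_derive (0 + a * 0 : R) 1 f X by rewrite mulr0 addr0.
  have := is_derive_mulmx (is_derive_comp1 (is_derive_affine 0 a 0) df') dh.
  by rewrite /= h0 mulr0 addr0 f0 mulmx1 mul1mx.
Qed.

Lemma velocity0 G : G 1%:M -> velocity G 0.
Proof.
move=> G1; exists (fun=> 1%:M); split=> //; first by move=> k; exact: Ck_cst.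
exact: is_derive_cst.
Qed.

Lemma lie_algebra_ex G : orthogonal_group G ->
  exists L : {vspace 'M[R]_N}, forall X, X \in L <-> velocity G X.
Proof.
move=> GG; apply: vspace_of_pred; first by case: GG => G1 _ _ _; exact: velocity0.
by move=> a u v; exact: velocity_lin.
Qed.

Lemma lie_group_dimE G (L : {vspace 'M[R]_N}) : (forall X, X \in L <-> velocity G X) ->
  lie_group_dim G (\dim L).
Proof.
move=> LP; exists L => // X; rewrite LP; split=> -[f [sf f0 Gf df]]; exists f; split=> //.
  by rewrite derive1E (@derive_val _ _ _ _ _ _ _ df).
by rewrite -df; exact: smooth_is_derive.
Qed.

Lemma velocity_skew G X : orthogonal_group G -> velocity G X -> X^T = - X.
Proof.
move=> [_ _ _ GO] [f [_ f0 Gf df]].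
have := is_derive_mulmx df (is_derive_trmx df); rewrite f0 trmx1 mulmx1 mul1mx.
have -> : (fun t => f t *m (f t)^T) = cst 1%:M by apply/funext => r; rewrite GO.
move=> /(is_derive_unique (is_derive_cst _ _ _))/esym/eqP.
by rewrite addrC addr_eq0 => /eqP.
Qed.

End MatrixGroups.

Section Clamp.
Context {R : realType}.

(** Retraction of the line onto [a, b]. Composing with it turns continuity within the interval into
    continuity on all of [R], where the existence theorems live. *)
Definition clamp (a b x : R) := Num.max a (Num.min b x).

Lemma clamp_in a b x : a <= b -> a <= clamp a b x <= b.
Proof.
by move=> ab; rewrite /clamp le_max lexx/= ge_max ab/= ge_min lexx.
Qed.

Lemma clamp_id a b x : a <= x <= b -> clamp a b x = x.
Proof. by move=> /andP[ax xb]; rewrite /clamp min_r// max_r. Qed.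

Lemma clamp_lip a b x y : a <= b -> `|clamp a b x - clamp a b y| <= `|x - y|.
Proof.
move=> ab; have minl u v : `|Num.min b u - Num.min b v| <= `|u - v|.
  have [bu|ub] := leP b u; have [bv|vb] := leP b v; rewrite ?subrr ?normr0//.
  - by rewrite !ger0_norm ?subr_ge0; lra.
  - by rewrite !ler0_norm ?subr_le0; lra.
apply: le_trans (minl x y); rewrite /clamp.
set u := Num.min b x; set v := Num.min b y.
have [au|ua] := leP a u; have [av|va] := leP a v; rewrite ?subrr ?normr0//.
- by rewrite !ger0_norm ?subr_ge0; lra.
- by rewrite !ler0_norm ?subr_le0; lra.
Qed.

Lemma lip_continuous {V W : normedModType R} (K : R) (f : V -> W) : 0 <= K ->
  (forall x y, `|f x - f y| <= K * `|x - y|) -> continuous f.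
Proof.
move=> K0 fl x; apply/(@cvgrPdist_lt _ _ _ (nbhs x) (nbhs_filter x)) => e e0.
have eK : 0 < e / (K + 1) by rewrite divr_gt0// ltr_wpDl.
near=> y; apply: (le_lt_trans (fl x y)).
have : `|x - y| < e / (K + 1) by near: y; apply: cvgr_dist_lt.
rewrite ltr_pdivlMr ?ltr_wpDl//; have := normr_ge0 (x - y); nra.
Unshelve. all: by end_near. Qed.

Lemma clamp_continuous a b : a <= b -> continuous (clamp a b).
Proof. by move=> ab; apply: (lip_continuous (K := 1)) => // x y; rewrite mul1r; exact: clamp_lip. Qed.

Lemma within_clamp {W : topologicalType} (f : R -> W) a b : a <= b ->
  {within `[a, b], continuous f} -> continuous (f \o clamp a b).
Proof.
move=> ab cf t; have cab : `[a, b]%classic (clamp a b t).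
  by rewrite /= in_itv/= clamp_in.
have := (@subspace_continuousP _ _ _ _).1 cf (clamp a b t) cab.
move=> H; apply: (@cvg_comp _ _ _ (clamp a b) f (nbhs t) (within `[a, b] (nbhs (clamp a b t))) _ _ H) => P.
move=> nP; have h : nbhs t (fun x => `[a, b]%classic (clamp a b x) -> P (clamp a b x)) := clamp_continuous ab nP.
suff : nbhs t (fun x => P (clamp a b x)) by [].
by apply: filterS h => x hx; apply: hx; rewrite /= in_itv/=; exact: clamp_in.
Qed.

End Clamp.

Section CubeLipschitz.
Context {R : realType} {d : nat}.
Local Notation V := 'rV[R]_d.

Definition rclamp (r : R) (x : V) : V := \row_i clamp (- r) r (x 0 i).

Lemma rclamp_norm r x : 0 <= r -> `|rclamp r x| <= r.
Proof.
move=> r0; apply: mx_norm_le => // i j; rewrite mxE ler_norml.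
by apply: clamp_in; rewrite ge0_cp.
Qed.

Lemma rclamp_id r x : `|x| <= r -> rclamp r x = x.
Proof.
move=> xr; apply/rowP => i; rewrite mxE clamp_id// -ler_norml.
exact: le_trans (mx_norm_ge _ _ _) xr.
Qed.

Lemma rclamp_lip r x y : 0 <= r -> `|rclamp r x - rclamp r y| <= `|x - y|.
Proof.
move=> r0; apply: mx_norm_le => // i j; rewrite !mxE.
apply: (le_trans (clamp_lip _ _ _)); first by rewrite ge0_cp.
by have := mx_norm_ge (x - y) 0 j; rewrite !mxE.
Qed.

Lemma cube_compact (r : R) : compact [set x : V | `|x| <= r].
Proof.
apply: bounded_closed_compact.
  by exists r; split; [exact: num_real|move=> y ry x /= /le_trans; apply; exact: ltW].
rewrite (_ : [set x : V | `|x| <= r] = Num.norm @^-1` [set t | t <= r])//.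
by apply: closed_comp; [move=> x _; exact: norm_continuous|exact: closed_le].
Qed.

Lemma cube_bounded (U : set V) (f : V -> R) (r : R) : 0 <= r ->
  (forall x, `|x| <= r -> U x) -> (forall x, U x -> {for x, continuous f}) ->
  exists2 K, 0 <= K & forall x, `|x| <= r -> `|f x| <= K.
Proof.
move=> r0 rU cf.
have [|||c _ cM] := @EVT_max_rV R d (fun x => `|f x|) [set x : V | `|x| <= r].
- by exists 0; rewrite /= normr0.
- exact: cube_compact.
- apply: continuous_in_subspaceT => x; rewrite inE /= => xr.
  by apply: (@cvg_norm _ _ _ (nbhs x)); exact: cf (rU _ xr).
by exists `|f c| => // x xr; apply: cM; rewrite inE.
Qed.

Lemma cube_lipschitz (U : set V) (f : V -> R) (r : R) : 0 <= r ->
  (forall x, `|x| <= r -> U x) -> Ck 1 U f ->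
  exists2 K, 0 <= K & forall x y, `|x| <= r -> `|y| <= r -> `|f x - f y| <= K * `|x - y|.
Proof.
move=> r0 rU [df Df].
have H i : exists K, 0 <= K /\ forall x, `|x| <= r -> `|'D_(delta_mx 0 i) f x| <= K.
  have [K K0 HK] := cube_bounded r0 rU (Df (delta_mx 0 i)).
  by exists K.
have [K HK] := choice H.
exists (\sum_i K i); first by apply: sumr_ge0 => i _; case: (HK i).
move=> x y xr yr.
have inr t : t \in `[0, 1] -> `|y + t *: (x - y)| <= r.
  rewrite in_itv/= => /andP[t0 t1].
  have -> : y + t *: (x - y) = (1 - t) *: y + t *: x.
    by rewrite scalerBr scalerBl scale1r addrA addrAC.
  rewrite (le_trans (ler_normD _ _))// !normrZ (ger0_norm t0) ger0_norm ?subr_ge0//.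
  have t1' : 0 <= 1 - t by rewrite subr_ge0.
  by have := ler_wpM2l t0 xr; have := ler_wpM2l t1' yr; lra.
have dl (t : R) : t \in `[0, 1] ->
    is_derive t 1 (fun s => f (y + s *: (x - y))) (\sum_i (x - y) 0 i * 'D_(delta_mx 0 i) f (y + t *: (x - y))).
  move=> t01; apply: is_derive_line; have dfp := df _ (rU _ (inr t t01)).
  have := derivableP (diff_derivable (v := x - y) dfp).
  suff -> : 'D_(x - y) f (y + t *: (x - y)) = \sum_i (x - y) 0 i * 'D_(delta_mx 0 i) f (y + t *: (x - y)) by [].
  by rewrite (deriveE _ dfp) linear_rV; apply: eq_bigr => i _; rewrite (deriveE _ dfp).
have [c c01] := mvt ler01 dl; rewrite scale1r scale0r addr0 subr0 mulr1 (addrC y) subrK => ->.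
rewrite (le_trans (ler_norm_sum _ _ _))// mulr_suml; apply: ler_sum => i _.
rewrite normrM mulrC; apply: ler_pM => //; last exact: mx_norm_ge.
by case: (HK i) => _; apply; exact: inr.
Qed.

End CubeLipschitz.

(** * Solutions of g' = g w stay in a coset of the group *)

Section ArcInGroup.
Context {R : realType} {N : nat}.
Variables (G : set 'M[R]_N).
Hypothesis GG : orthogonal_group G.
Variable L : {vspace 'M[R]_N}.
Hypothesis LP : forall X, X \in L <-> velocity G X.

Let G1 : G 1%:M. Proof. by case: GG. Qed.
Let GM g h : G g -> G h -> G (g *m h). Proof. by case: GG => _ GM _ _; exact: GM. Qed.
Let GT g : G g -> G g^T. Proof. by case: GG => _ _ GT _; exact: GT. Qed.
Let GO g : G g -> g *m g^T = 1%:M. Proof. by case: GG => _ _ _; apply. Qed.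
Let GO' g : G g -> g^T *m g = 1%:M. Proof. by move=> /GO/mulmx1C. Qed.

Let d := \dim L.
Let X (i : 'I_d) := (vbasis L)`_i.

(* Product of one-parameter curves whose velocities form a basis of the Lie algebra. *)
Lemma chart_of_second_kind : exists phi : 'rV[R]_d -> 'M[R]_N,
  [/\ forall k, Ck k setT phi, phi 0 = 1%:M, (forall x, G (phi x)) &
      forall i, is_derive (0 : 'rV[R]_d) (delta_mx 0 i) phi (X i)].
Proof.
have XL i : X i \in L by apply: vbasis_mem; rewrite mem_nth// size_tuple.
have H i : exists gamma : R -> 'M[R]_N,
  [/\ smooth_on setT gamma, gamma 0 = 1%:M, (forall t, G (gamma t)) & is_derive (0 : R) 1 gamma (X i)].
  exact: (LP _).1 (XL i).
have [gam Hgam] := choice H.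
pose F (s : seq 'I_d) (x : 'rV[R]_d) := foldr (fun i g => gam i (x 0 i) *m g) 1%:M s.
have coordC k i : Ck k setT (fun x : 'rV[R]_d => x 0 i).
  exact: (Ck_coord _ _ openT (Ck_id k setT)).
have gamC k i : Ck k setT (fun x : 'rV[R]_d => gam i (x 0 i)).
  apply: (Ck_mx openT) => a b.
  apply: (@Ck_comp_real _ _ k (fun t => gam i t a b)) => //.
  by apply: (Ck_coord _ _ openT); case: (Hgam i) => + _ _ _; apply.
have FC k s : Ck k setT (F s).
  elim: s => [|i s IH] /=; first exact: Ck_cst.
  exact: (Ck_mulmx openT (gamC k i) IH).
have FG s x : G (F s x).
  by elim: s => [|i s IH] //=; apply: GM => //; case: (Hgam i).
have F0 s : F s 0 = 1%:M.
  by elim: s => [|i s IH] //=; rewrite IH mxE mulmx1; case: (Hgam i).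
exists (F (enum 'I_d)); split=> // i.
have E (t : R) : F (enum 'I_d) (t *: delta_mx 0 i) = gam i t.
  have : uniq (enum 'I_d) by exact: enum_uniq.
  have : i \in enum 'I_d by rewrite mem_enum.
  have off s : i \notin s -> F s (t *: delta_mx 0 i) = 1%:M.
    elim: s => [|j s IH] //=; rewrite inE negb_or => /andP[ij /IH ->].
    by rewrite !mxE eqxx eq_sym (negbTE ij) mulr0 mulmx1; case: (Hgam j).
  elim: (enum 'I_d) => //= j s IH; rewrite inE => /predU1P[<-|is_] /andP[js us].
    by rewrite off// !mxE !eqxx mulr1 mulmx1.
  rewrite IH// !mxE eqxx (_ : (j == i) = false).
    by rewrite mulr0; case: (Hgam j) => _ -> _ _; rewrite mul1mx.
  by apply: contraNF js => /eqP ->.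
have dF : differentiable (F (enum 'I_d)) 0 by have [df _] := FC 1%N (enum 'I_d); exact: df.
have d1 := derivableP (diff_derivable (v := delta_mx 0 i) dF).
have d2 : is_derive (0 : R) 1 (gam i) ('D_(delta_mx 0 i) (F (enum 'I_d)) 0).
  rewrite (_ : gam i = fun t : R => F (enum 'I_d) (0 + t *: delta_mx 0 i)).
    by apply: is_derive_line; rewrite scale0r addr0.
  by apply/funext => t; rewrite add0r E.
have [_ _ _ d3] := Hgam i.
by rewrite (is_derive_unique d3 d2).
Qed.

(** The equation is solved in the coordinates [phi]: [u = phi (sg t)] satisfies [u' = u w] if
    [sg' = v C(sg)^-1], where [v] holds the coordinates of [w] in the basis of the Lie algebra. By
    construction [u] lies in the group. The length [delta] depends only on the bound [B], which
    permits a later subdivision into equal steps. *)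
Lemma short_arc_in_group (B : R) : 0 <= B -> exists2 delta : R, 0 < delta &
  forall (w : R -> 'M[R]_N), continuous w -> (forall t, w t \in L) ->
  (forall t i, `|coord (vbasis L) i (w t)| <= B) ->
  exists u : R -> 'M[R]_N, [/\ u 0 = 1%:M, forall t : R, G (u t) &
    forall t : R, 0 <= t -> t <= delta -> is_derive t 1 u (u t *m w t)].
Proof.
move=> B0; have [phi [phiC phi0 phiG phiX]] := chart_of_second_kind.
have dphi x : differentiable phi x by have [df _] := phiC 1%N; exact: df.
(* Left logarithmic derivatives of the coordinates [phi]; they lie in [L], being velocities of
   curves in the group translated back to the identity. *)
pose Y i x := (phi x)^T *m 'D_(delta_mx 0 i) phi x.
have YL i x : Y i x \in L.
  apply/LP; exists (fun s : R => (phi x)^T *m phi (x + s *: delta_mx 0 i)); split.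
  - move=> k; apply: (Ck_mulmx openT); first exact: Ck_cst.
    apply: (@Ck_comp_mx _ _ _ _ _ k setT setT phi (fun s : R => x + s *: delta_mx 0 i)); [exact: openT|exact: openT|by []|exact: phiC|].
    apply: (Ck_mx openT) => a b.
    rewrite (_ : (fun s => _) = fun s : R => x a b + delta_mx 0 i a b * s); last first.
      by apply/funext => s; rewrite !mxE mulrC.
    by apply: (@smooth_comp_lin _ _ (fun t => t : R)) => l; exact: Ck_id.
  - by rewrite scale0r addr0 GO'.
  - by move=> t; apply: (GM); [exact: GT|].
  - apply: is_derive_mulmxl; apply: is_derive_line; rewrite scale0r addr0.
    exact: derivableP (diff_derivable (dphi x)).
pose C x : 'M[R]_d := \matrix_(i, j) coord (vbasis L) j (Y i x).
have YC k i : Ck k setT (Y i).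
  apply: (Ck_mulmx openT); first exact: (Ck_trmx openT).
  by have [_] := phiC k.+1; apply.
have CC k : Ck k setT C.
  apply: (Ck_mx openT) => i j.
  rewrite (_ : (fun x => _) = fun x => \sum_a \sum_b Y i x a b * coord (vbasis L) j (delta_mx a b)).
    apply: Ck_sum => [|a _]; [exact: openT|apply: Ck_sum => [|b _]; first exact: openT].
    by apply: (CkM openT); [exact: (Ck_coord _ _ openT)|exact: Ck_cst].
  apply/funext => x; rewrite mxE [in LHS](matrix_sum_delta (Y i x)) linear_sum; apply: eq_bigr => a _.
  by rewrite linear_sum; apply: eq_bigr => b _; rewrite linearZ.
have C0 : C 0 = 1%:M.
  apply/matrixP => i j; rewrite !mxE /Y phi0 trmx1 mul1mx.
  have -> : 'D_(delta_mx 0 i) phi 0 = X i := @derive_val _ _ _ _ _ _ _ (phiX i).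
  have fr : free (vbasis L) := basis_free (vbasisP L).
  exact: (coord_free i j fr).
pose U := [set x | \det (C x) != 0].
have cdet : continuous (fun x => \det (C x)).
  by move=> x; exact: (Ck_det openT (CC 0%N)).
have oU : open U.
  by rewrite (_ : U = (fun x => \det (C x)) @^-1` [set t | t != 0])//; apply: open_comp; [move=> x _; exact: cdet|exact: open_neq].
have [r r0 rU] : exists2 r, 0 < r & forall x, `|x| <= r -> U x.
  have /nbhs_ballP[e /= e0 eU] : nbhs (0 : 'rV[R]_d) U.
    by apply: open_nbhs_nbhs; split => //; rewrite /U/= C0 det1 oner_neq0.
  exists (e / 2); first by rewrite divr_gt0.
  move=> x xe; apply: eU; rewrite -ball_normE/= sub0r normrN (le_lt_trans xe)//.
  by rewrite ltr_pdivrMr// mulr_natr mulr2n ltrDl.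
have DC : Ck 1 U (fun x => invmx (C x)).
  apply: (Ck_invmx oU) => [x Ux|]; first by rewrite unitmxE unitfE.
  exact: (Ck_sub (@subsetT _ U) (CC 1%N)).
have Dlip : exists2 K, 0 <= K & forall x y, `|x| <= r -> `|y| <= r -> `|invmx (C x) - invmx (C y)| <= K * `|x - y|.
  have H (ij : 'I_d * 'I_d) : exists K, 0 <= K /\ forall x y, `|x| <= r -> `|y| <= r ->
      `|invmx (C x) ij.1 ij.2 - invmx (C y) ij.1 ij.2| <= K * `|x - y|.
    have [K K0 HK] := cube_lipschitz (ltW r0) rU (Ck_coord ij.1 ij.2 oU DC).
    by exists K.
  have [K HK] := choice H; exists (\sum_ij K ij).
    by apply: sumr_ge0 => i _; case: (HK i).
  move=> x y xr yr; apply: mx_norm_le => [|i j].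
    by rewrite mulr_ge0// sumr_ge0// => i _; case: (HK i).
  rewrite !mxE; have [_ /(_ x y xr yr)/le_trans] := HK (i, j); apply.
  rewrite ler_wpM2r// (bigD1 (i, j))//= lerDl sumr_ge0// => k _.
  by case: (HK k).
have [K K0 HK] := Dlip.
(* Freezing [C^-1] outside the cube of radius [r] makes it globally Lipschitz, as Picard iteration
   requires; inside the cube nothing changes. *)
pose Dm x := invmx (C (rclamp r x)).
have HDm x y : `|Dm x - Dm y| <= K * `|x - y|.
  apply: le_trans (HK _ _ (rclamp_norm _ (ltW r0)) (rclamp_norm _ (ltW r0))) _.
  by rewrite ler_wpM2l// rclamp_lip// ltW.
have cDm : continuous Dm by apply: lip_continuous HDm.
pose KB := `|Dm 0| + K * r.
have HKB x : `|Dm x| <= KB.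
  have -> : Dm x = Dm (rclamp r x) by rewrite /Dm (rclamp_id (rclamp_norm _ (ltW r0))).
  rewrite -(subrK (Dm 0) (Dm _)) addrC (le_trans (ler_normD _ _))// lerD2l.
  by rewrite (le_trans (HDm _ _))// subr0 ler_wpM2l// rclamp_norm// ltW.
have KB0 : 0 <= KB by rewrite addr_ge0// mulr_ge0// ltW.
pose S := d%:R * (B * KB).
have S0 : 0 <= S by rewrite !mulr_ge0.
(* [S] bounds the speed of [sg], so up to this time the solution has not left the cube. *)
exists (r / (S + 1)); first by rewrite divr_gt0// ltr_wpDl.
move=> w cw wL wB.
pose v t : 'rV[R]_d := \row_j coord (vbasis L) j (w t).
have cv : continuous v.
  move=> t; apply: (continuous_mxP v t).2 => i j.
  rewrite (_ : (fun y => _) = fun y => \sum_a \sum_b w y a b * coord (vbasis L) j (delta_mx a b)).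
    apply: (@cvg_sumr R _ (nbhs t) (nbhs_filter t)) => a.
    apply: (@cvg_sumr R _ (nbhs t) (nbhs_filter t)) => b.
    by apply: cvgM; [exact: (continuous_mxP _ _).1 (cw t) a b|exact: cvg_cst].
  apply/funext => y; rewrite mxE [in LHS](matrix_sum_delta (w y)) linear_sum; apply: eq_bigr => a _.
  by rewrite linear_sum; apply: eq_bigr => b _; rewrite linearZ.
have vB t : `|v t| <= B by apply: mx_norm_le => // i j; rewrite mxE.
have [sg [sg0 dsg]] : exists sg : R -> 'rV[R]_d, sg 0 = 0 /\
    forall t : R, is_derive t 1 sg (v t *m Dm (sg t)).
  apply: (@picard R 1 d (fun t x => v t *m Dm x)).
    move=> x cx t; apply: cvg_mulmx; first exact: cv.
    by apply: (@continuous_comp _ _ _ x Dm t); [exact: cx|exact: cDm].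
  move=> T; exists (d%:R * (B * K) + 1); first by rewrite ltr_wpDl// !mulr_ge0.
  move=> t x y _; rewrite -mulmxBr (le_trans (mx_norm_mulmx _ _))//.
  rewrite mulrDl mul1r -mulrA (@le_trans _ _ (d%:R * (B * K * `|x - y|)))//; last by rewrite lerDl.
  by rewrite ler_wpM2l// -mulrA ler_pM.
have sgB t : `|sg t| <= S * `|t|.
  have := mx_diff_bound0 (C := S) (t := t) dsg; rewrite sg0 subr0; apply => x _.
  by rewrite (le_trans (mx_norm_mulmx _ _))// ler_wpM2l// ler_pM.
exists (fun t => phi (sg t)); split=> // [|t t0 tr]; first by rewrite sg0.
have sgr : `|sg t| <= r.
  rewrite (le_trans (sgB t))// ger0_norm//.
  by move: tr; rewrite ler_pdivlMr ?ltr_wpDl//; lra.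
have dsgt : differentiable sg t by apply/derivable1_diffP; exact: (@ex_derive _ _ _ _ _ _ _ (dsg t)).
have dc : derivable (phi \o sg) t 1.
  by apply/derivable1_diffP; apply: differentiable_comp => //; exact: dphi.
have := derivableP dc; rewrite (derive_comp_rV _ (dphi _) dsgt) (@derive_val _ _ _ _ _ _ _ (dsg t)).
move=> du; apply: (is_derive_eq du); rewrite /Dm (rclamp_id sgr).
have Cu : C (sg t) \in unitmx by rewrite unitmxE unitfE; exact: rU.
set x := v t *m _.
have xC : x *m C (sg t) = v t by rewrite /x -mulmxA mulVmx// mulmx1.
have -> : w t = \sum_j v t 0 j *: X j.
  by rewrite [LHS](coord_vbasis (wL t)); apply: eq_bigr => j _; rewrite mxE.
have -> : \sum_j v t 0 j *: X j = \sum_i x 0 i *: Y i (sg t).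
  rewrite -xC; under [RHS]eq_bigr => i _ do rewrite [Y i _](coord_vbasis (YL i (sg t))) scaler_sumr.
  rewrite exchange_big/=; apply: eq_bigr => j _; rewrite mxE scaler_suml.
  by apply: eq_bigr => i _; rewrite scalerA; congr ((_ * _) *: _); rewrite mxE.
rewrite mulmx_sumr; apply: eq_bigr => i _.
by rewrite -scalemxAr /Y mulmxA GO// mul1mx.
Qed.

(** On each short step, [g] times the transpose of the arc [U] in the group has derivative zero off
    [s], because the values of [w] are skew; so [g] is its initial value times an element of the
    group. The arcs have a uniform length, hence finitely many steps reach [b]. *)
Lemma arc_in_group (g w : R -> 'M[R]_N) (s : seq R) (a b : R) : a <= b ->
  {within `[a, b], continuous g} -> {within `[a, b], continuous w} ->
  (forall t, t \in `[a, b] -> w t \in L) ->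
  (forall t : R, t \in `]a, b[ -> t \notin s -> is_derive t 1 g (g t *m w t)) ->
  exists2 h, G h & g b = g a *m h.
Proof.
move=> ab cg cw wL dg.
pose wc := w \o clamp a b.
have cwc : continuous wc by exact: within_clamp.
have wcL t : wc t \in L by apply: wL; rewrite in_itv/=; exact: clamp_in.
have [B [B0 HB]] : exists B, 0 <= B /\ forall t i, `|coord (vbasis L) i (wc t)| <= B.
  have H (i : 'I_d) : exists K, 0 <= K /\ forall t, t \in `[a, b] -> `|coord (vbasis L) i (wc t)| <= K.
    have [||c cT cM] := @EVT_max R (fun t => `|coord (vbasis L) i (wc t)|) a b => //.
      apply: continuous_subspaceT => t; apply: cvg_norm.
      rewrite (_ : (fun y => _) = fun y => \sum_a \sum_b wc y a b * coord (vbasis L) i (delta_mx a b)).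
        rewrite [X in _ --> X](_ : _ = \sum_a \sum_b wc t a b * coord (vbasis L) i (delta_mx a b)).
          apply: (@cvg_sumr R _ (nbhs t) (nbhs_filter t)) => a'.
          apply: (@cvg_sumr R _ (nbhs t) (nbhs_filter t)) => b'.
          by apply: cvgM; [exact: (continuous_mxP _ _).1 (cwc t) a' b'|exact: cvg_cst].
        rewrite [in LHS](matrix_sum_delta (wc t)) linear_sum; apply: eq_bigr => a' _.
        by rewrite linear_sum; apply: eq_bigr => b' _; rewrite linearZ.
      apply/funext => y; rewrite [in LHS](matrix_sum_delta (wc y)) linear_sum; apply: eq_bigr => a' _.
      by rewrite linear_sum; apply: eq_bigr => b' _; rewrite linearZ.
    by exists `|coord (vbasis L) i (wc c)|.
  have [K HK] := choice H; exists (\sum_i K i); split.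
    by apply: sumr_ge0 => i _; case: (HK i).
  move=> t i; have cab : clamp a b t \in `[a, b] by rewrite in_itv/=; exact: clamp_in.
  have := (HK i).2 _ cab.
  have -> : wc (clamp a b t) = wc t by rewrite /wc/= [X in w X]clamp_id//; exact: clamp_in.
  move=> /le_trans; apply.
  by rewrite (bigD1 i)//= lerDl sumr_ge0// => k _; case: (HK k).
have [dl dl0 Hdl] := short_arc_in_group B0.
have step t0 t1 : a <= t0 -> t0 <= t1 -> t1 <= b -> t1 - t0 <= dl ->
    exists2 h, G h & g t1 = g t0 *m h.
  move=> at0 t01 t1b td.
  have cws : continuous (fun t : R => wc (t0 + 1 * t)).
    move=> t; apply: (@continuous_comp _ _ _ (fun t : R => t0 + 1 * t) wc t); last exact: cwc.
    exact: is_derive_continuous (is_derive_affine t0 1 t).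
  have [u [u0 Gu du]] := Hdl _ cws (fun t => wcL _) (fun t => HB _).
  exists (u (t1 - t0)); first exact: Gu.
  pose U t := u (- t0 + 1 * t).
  have dU (t : R) : t0 <= t -> t <= t1 -> is_derive t 1 U (U t *m wc t).
    move=> h1 h2; have := is_derive_comp1 (is_derive_affine (- t0) 1 t) (du (- t0 + 1 * t) _ _).
    rewrite scale1r mul1r [t0 + _](_ : _ = t); last by ring.
    by rewrite -[U t]/(u (- t0 + 1 * t)) mul1r; apply; lra.
  have sub : `[t0, t1] `<=` `[a, b].
    by move=> t /=; rewrite !in_itv/= => /andP[h1 h2]; rewrite (le_trans at0)//= (le_trans h2).
  have cgU : {within `[t0, t1], continuous (fun t => g t *m (U t)^T)}.
    have cg' := continuous_subspaceW sub cg.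
    have cU : {within `[t0, t1], continuous (fun t => (U t)^T)}.
      apply: derivable_within_continuous => t; rewrite in_itv/= => /andP[h1 h2].
      exact: (@ex_derive _ _ _ _ _ _ _ (is_derive_trmx (dU t h1 h2))).
    by move=> t; apply: cvg_mulmx; [exact: cg'|exact: cU].
  have dgU (t : R) : t \in `]t0, t1[ -> t \notin s -> is_derive t 1 (fun t => g t *m (U t)^T) 0.
    move=> tt ts.
    have /andP[h1 h2] : t0 < t < t1 by move: tt; rewrite in_itv.
    have tab : t \in `]a, b[ by rewrite in_itv/= (le_lt_trans at0)//= (lt_le_trans h2).
    have := is_derive_mulmx (dg t tab ts) (is_derive_trmx (dU t (ltW h1) (ltW h2))).
    have -> : wc t = w t.
      by rewrite /wc/= clamp_id// (ltW (le_lt_trans at0 h1))/= (ltW (lt_le_trans h2 t1b)).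
    have skew : (w t)^T = - w t.
      by apply: (velocity_skew GG); apply/LP/wL; exact: subset_itv_oo_cc.
    by rewrite trmx_mul skew mulNmx mulmxN mulmxA subrr.
  have := const_off_finite t01 cgU dgU; have -> : U t0 = 1%:M by rewrite /U mul1r addNr u0.
  rewrite trmx1 mulmx1 => ->.
  rewrite (_ : t1 - t0 = - t0 + 1 * t1); last by ring.
  by rewrite /U -mulmxA GO' ?mulmx1.
have [n0 Hn] : exists n0 : nat, (b - a) / n0.+1%:R <= dl.
  exists (Num.bound ((b - a) / dl)); rewrite ler_pdivrMr// mulrC -ler_pdivrMr//.
  have := archi_boundP (divr_ge0 (_ : 0 <= b - a) (ltW dl0)).
  rewrite subr_ge0 => /(_ ab)/ltW/le_trans; apply.
  by rewrite ler_nat.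
pose h0 := (b - a) / n0.+1%:R.
have h00 : 0 <= h0 by rewrite divr_ge0// subr_ge0.
have ind k : (k <= n0.+1)%N -> exists2 h, G h & g (a + k%:R * h0) = g a *m h.
  elim: k => [_|k IH kn]; first by exists 1%:M => //; rewrite mul0r addr0 mulmx1.
  have [h Gh gh] := IH (ltnW kn).
  have kb : a + k.+1%:R * h0 <= b.
    rewrite -lerBrDl /h0 mulrCA ler_piMr ?subr_ge0// ler_pdivrMr// mul1r ler_nat.
    exact: kn.
  have [|||h' Gh' gh'] := step (a + k%:R * h0) (a + k.+1%:R * h0) _ _ kb.
  - by rewrite lerDl mulr_ge0.
  - by rewrite lerD2l ler_wpM2r// ler_nat.
  - by rewrite -natr1 (_ : _ - _ = h0)//; ring.
  by exists (h *m h'); [exact: (GM)|rewrite gh' gh mulmxA].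
have [h Gh gh] := ind n0.+1 (leqnn _).
by exists h => //; rewrite -gh /h0 mulrCA divff ?mulr1 ?subrKC// addrC subrK.
Qed.

End ArcInGroup.

(** * Immersions and charts *)

Section EpsilonDifferential.
Context {R : realType} {V W : normedModType R}.

Lemma differentiable_eps (f : V -> W) x e : differentiable f x -> 0 < e ->
  \forall h \near 0, `|f (x + h) - f x - 'd f x h| <= e * `|h|.
Proof.
move=> df e0; have /eqaddoE/eqaddoP/(_ _ e0) := diff_locally df.
by apply: filterS => h /=; rewrite opprD addrA (addrC x h).
Qed.

End EpsilonDifferential.

Lemma is_derive_epsE {R : realType} {W : normedModType R} (f : R -> W) (x : R) d e :
  is_derive x 1 f d -> 0 < e -> \forall h \near (0 : R), `|f (x + h) - f x - h *: d| <= e * `|h|.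
Proof.
move=> fd e0; have df : differentiable f x.
  by apply/derivable1_diffP; exact: (@ex_derive _ _ _ _ _ _ _ fd).
have := differentiable_eps df e0; apply: filterS => h.
by rewrite (diff1E df) derive1E (@derive_val _ _ _ _ _ _ _ fd).
Qed.

Section RealMatrices.
Context {R : realType}.

Lemma mulmx_trmx_eq0 (n : nat) (u : 'rV[R]_n) : u *m u^T = 0 -> u = 0.
Proof.
move=> /matrixP/(_ 0 0); rewrite !mxE => /eqP.
rewrite psumr_eq0 => [/allP H|i _]; last by rewrite mxE -expr2 sqr_ge0.
apply/rowP => i; have := H i (mem_index_enum _); rewrite !mxE -expr2 sqrf_eq0.
by move=> /eqP.
Qed.

Lemma gram_unit (m n : nat) (J : 'M[R]_(m, n)) :
  (forall u : 'rV_m, u *m J = 0 -> u = 0) -> J *m J^T \in unitmx.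
Proof.
move=> Jinj; rewrite -row_free_unit -kermx_eq0; apply/eqP/row_matrixP => i.
rewrite row0; apply: Jinj; apply: mulmx_trmx_eq0.
by rewrite trmx_mul mulmxA -[X in X *m _]mulmxA -row_mul mulmx_ker row0 mul0mx.
Qed.

Definition orth_proj (n : nat) (P : 'M[R]_n) := P^T = P /\ P *m P = P.

Lemma orth_proj_unique (n : nat) (P Q : 'M[R]_n) : orth_proj P -> orth_proj Q ->
  (forall u : 'rV_n, u *m P = u <-> u *m Q = u) -> P = Q.
Proof.
move=> [PT PP] [QT QQ] H.
have sub (A B : 'M[R]_n) : A *m A = A -> (forall u : 'rV_n, u *m A = u -> u *m B = u) -> A *m B = A.
  move=> AA AB; apply/row_matrixP => i; rewrite row_mul; apply: AB.
  by rewrite -row_mul AA.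
have PQ : P *m Q = P by apply: sub => // u /H.
have QP : Q *m P = Q by apply: sub => // u /H.
by rewrite -PT -PQ trmx_mul PT QT QP.
Qed.

Lemma orth_projC (n : nat) (P : 'M[R]_n) : orth_proj P -> orth_proj (1%:M - P).
Proof.
move=> [PT PP]; split; first by rewrite linearB/= trmx1 PT.
by rewrite mulmxBl mul1mx mulmxBr mulmx1 PP subrr subr0.
Qed.

End RealMatrices.

Section ImmersedChart.
Context {R : realType} {n N : nat}.
Variable F : 'rV[R]_n -> 'rV[R]_N.
Hypothesis sF : smooth_on setT F.
Hypothesis immF : forall x w, 'D_w F x = 0 -> w = 0.

Definition jac (x : 'rV[R]_n) : 'M[R]_(n, N) := \matrix_(i, j) ('D_(delta_mx 0 i) F x) 0 j.
(** The Moore-Penrose right inverse of the Jacobian. Tangent vectors are the rows [w *m jac x], so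
    [jinv x *m jac x] is the orthogonal projection onto the tangent space. *)
Definition jinv (x : 'rV[R]_n) : 'M[R]_(N, n) := (jac x)^T *m invmx (jac x *m (jac x)^T).
Definition nproj (x : 'rV[R]_n) : 'M[R]_N := 1%:M - jinv x *m jac x.

Lemma immersion_diff x : differentiable F x.
Proof. by have [dF _] := sF 1%N; exact: dF. Qed.

Lemma deriveF x w : 'D_w F x = w *m jac x.
Proof.
rewrite deriveE; last exact: immersion_diff.
rewrite linear_rV; apply/rowP => j; rewrite summxE mxE; apply: eq_bigr => i _.
by rewrite !mxE deriveE//; exact: immersion_diff.
Qed.

Lemma jac_inj x (u : 'rV_n) : u *m jac x = 0 -> u = 0.
Proof. by rewrite -deriveF; exact: immF. Qed.

Lemma jac_smooth k : Ck k setT jac.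
Proof.
apply: (Ck_mx openT) => i j.
rewrite (_ : (fun x => _) = fun x => ('D_(delta_mx 0 i) F x) 0 j); last first.
  by apply/funext => x; rewrite mxE.
by apply: (Ck_coord _ _ openT); have [_] := sF k.+1; apply.
Qed.

Lemma jac_gram x : jac x *m (jac x)^T \in unitmx.
Proof. by apply: gram_unit => u; exact: jac_inj. Qed.

Lemma jinv_smooth k : Ck k setT jinv.
Proof.
have CJ := jac_smooth k; have CJT := Ck_trmx openT CJ.
apply: (Ck_mulmx openT CJT); apply: (Ck_invmx openT) => [x _|]; first exact: jac_gram.
exact: (Ck_mulmx openT CJ CJT).
Qed.

Lemma jacK x : jac x *m jinv x = 1%:M.
Proof. by rewrite /jinv mulmxA mulmxV ?jac_gram. Qed.

Lemma nproj_smooth k : Ck k setT nproj.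
Proof.
apply: (CkB openT); first exact: Ck_cst.
exact: (Ck_mulmx openT (jinv_smooth k) (jac_smooth k)).
Qed.

Lemma nproj_proj x : orth_proj (nproj x).
Proof.
apply: orth_projC; split.
  rewrite /jinv !trmx_mul trmxK trmx_inv trmx_mul trmxK mulmxA//.
by rewrite mulmxA -(mulmxA _ (jac x)) jacK mulmx1.
Qed.

Lemma jac_nproj x : jac x *m nproj x = 0.
Proof. by rewrite /nproj mulmxBr mulmx1 mulmxA jacK mul1mx subrr. Qed.

Lemma nproj_jacT x : nproj x *m (jac x)^T = 0.
Proof. by have [PT _] := nproj_proj x; rewrite -PT -trmx_mul jac_nproj trmx0. Qed.

Lemma nproj_ker x (v : 'rV[R]_N) : v *m nproj x = 0 <-> exists w, v = w *m jac x.
Proof.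
split=> [|[w ->]]; last by rewrite -mulmxA jac_nproj mulmx0.
rewrite /nproj mulmxBr mulmx1 => /eqP; rewrite subr_eq0 => /eqP vE.
by exists (v *m jinv x); rewrite -mulmxA.
Qed.

Lemma nproj_fix x (u : 'rV[R]_N) : u *m nproj x = u <-> u *m (jac x)^T = 0.
Proof.
split=> [<-|uJ]; first by rewrite -mulmxA nproj_jacT mulmx0.
by rewrite /nproj mulmxBr mulmx1 /jinv !mulmxA uJ !mul0mx subr0.
Qed.

Lemma lift_derive (x : R -> 'rV[R]_n) (y : R -> 'rV[R]_N) (t0 : R) d :
  {for t0, continuous x} -> (\forall t \near t0, F (x t) = y t) -> is_derive t0 1 y d ->
  is_derive t0 1 x (d *m jinv (x t0)) /\ d *m nproj (x t0) = 0.
Proof.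
move=> cx Fxy dy.
set x0 := x t0; set Q := jinv x0; set J := jac x0.
pose C := N%:R * `|Q|; have C0 : 0 <= C by rewrite mulr_ge0.
have cJ (k : 'rV_n) : `|k| <= C * `|k *m J|.
  rewrite -[k in leLHS]mulmx1 -(jacK x0) mulmxA (le_trans (mx_norm_mulmx _ _))//.
  by rewrite /C -mulrA ler_wpM2l// mulrC.
have dx : is_derive t0 1 x (d *m Q).
  apply: is_derive_eps => e e0.
  pose D := 2 * C * (`|d| + 1); have D0 : 0 <= D by rewrite !mulr_ge0// addr_ge0.
  (* In order: absorb the remainder of [F] into the norm of [k], bound the increment of [y]
     linearly, and bring the final error below [e]. *)
  pose e1 := Num.min (1 / (2 * (C + 1))) (Num.min 1 (e / ((C + 1) * (D + 1)))).
  have C1 : 0 < C + 1 by rewrite ltr_wpDl.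
  have D1 : 0 < D + 1 by rewrite ltr_wpDl.
  have e10 : 0 < e1 by rewrite !lt_min ltr01 !divr_gt0 ?mulr_gt0.
  have e1a : C * e1 <= 1 / 2.
    have : e1 <= 1 / (2 * (C + 1)) by rewrite ge_min lexx.
    rewrite ler_pdivlMr ?mulr_gt0//; move: e10; nra.
  have e1b : e1 <= 1 by rewrite !ge_min lexx orbT.
  have e1c : C * (e1 * (D + 1)) <= e.
    have : e1 <= e / ((C + 1) * (D + 1)) by rewrite !ge_min lexx !orbT.
    rewrite ler_pdivlMr ?mulr_gt0//; move: (mulr_gt0 e10 D1); nra.
  have dy1 : \forall h \near (0 : R), `|y (t0 + h) - y t0 - h *: d| <= e1 * `|h|.
    exact: is_derive_epsE dy e10.
  have dF1 : \forall k \near (0 : 'rV[R]_n), `|F (x0 + k) - F x0 - k *m J| <= e1 * `|k|.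
    have := differentiable_eps (immersion_diff x0) e10; apply: filterS => k.
    by rewrite -deriveE ?deriveF//; exact: immersion_diff.
  have ck : (fun h : R => x (t0 + h) - x0) @ 0 --> (0 : 'rV[R]_n).
    rewrite -[X in _ --> X](subrr x0); apply: cvgB; last exact: cvg_cst.
    have c1 : (fun h : R => t0 + h) @ 0 --> t0.
      by rewrite -[X in _ --> X](addr0 t0); apply: cvgD; [exact: cvg_cst|exact: cvg_id].
    exact: (@cvg_comp _ _ _ (fun h : R => t0 + h) x _ _ _ c1 cx).
  have dF2 : \forall h \near (0 : R), `|F (x0 + (x (t0 + h) - x0)) - F x0 - (x (t0 + h) - x0) *m J| <= e1 * `|x (t0 + h) - x0|.
    exact: (ck _ dF1).
  have Fxy' : \forall h \near (0 : R), F (x (t0 + h)) = y (t0 + h).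
    by move: Fxy; rewrite (near_shift 0 t0) => H; apply: filterS H => h /=; rewrite subr0 addrC.
  have y0 : y t0 = F x0 by rewrite -(nbhs_singleton Fxy).
  near=> h.
  have h1 : `|y (t0 + h) - y t0 - h *: d| <= e1 * `|h| by near: h.
  have h2 : `|F (x0 + (x (t0 + h) - x0)) - F x0 - (x (t0 + h) - x0) *m J| <= e1 * `|x (t0 + h) - x0| by near: h.
  have h3 : F (x (t0 + h)) = y (t0 + h) by near: h.
  have {}h2 : `|y (t0 + h) - y t0 - (x (t0 + h) - x0) *m J| <= e1 * `|x (t0 + h) - x0|.
    by move: h2; rewrite [x0 + _]addrC subrK h3 y0.
  have -> : x (t0 + h *: 1) = x (t0 + h) by rewrite [_%:A]mulr1.
  rewrite -/x0; set k := x (t0 + h) - x0 in h2 *.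
  set dyh := y (t0 + h) - y t0 in h1 h2.
  have n1 : `|k *m J| <= `|dyh| + e1 * `|k|.
    rewrite -(subrK dyh (k *m J)) addrC (le_trans (ler_normD _ _))// lerD2l.
    by rewrite distrC.
  have n2 : `|dyh| <= (`|d| + 1) * `|h|.
    rewrite -(subrK (h *: d) dyh) (le_trans (ler_normD _ _))// normrZ.
    have := ler_wpM2r (normr_ge0 h) e1b; move: h1; rewrite mul1r; lra.
  have n3 := cJ k; have k0 := normr_ge0 k; have hh := normr_ge0 h.
  have n4 : `|k| <= D * `|h|.
    have a1 : C * `|k *m J| <= C * ((`|d| + 1) * `|h| + e1 * `|k|) by rewrite ler_wpM2l//; lra.
    have a2 : C * e1 * `|k| <= 1 / 2 * `|k| by rewrite ler_wpM2r.
    rewrite /D; lra.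
  have n5 : `|k *m J - h *: d| <= e1 * `|k| + e1 * `|h|.
    rewrite -(subrKA dyh) (le_trans (ler_normD _ _))// lerD//.
    by rewrite distrC.
  have -> : k - h *: (d *m Q) = (k *m J - h *: d) *m Q.
    by rewrite mulmxBl -mulmxA jacK mulmx1 scalemxAl.
  rewrite (le_trans (mx_norm_mulmx _ _))//.
  have -> : N%:R * (`|k *m J - h *: d| * `|Q|) = C * `|k *m J - h *: d| by rewrite /C; ring.
  have n6 : C * `|k *m J - h *: d| <= C * (e1 * (D * `|h|) + e1 * `|h|).
    rewrite ler_wpM2l// (le_trans n5)// lerD2r ler_wpM2l//; exact: ltW.
  apply: le_trans n6 _; have := ler_wpM2r hh e1c; lra.
split=> //.
have dxt : differentiable x t0 by apply/derivable1_diffP; exact: (@ex_derive _ _ _ _ _ _ _ dx).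
have dc : derivable (F \o x) t0 1.
  by apply/derivable1_diffP; apply: differentiable_comp => //; exact: immersion_diff.
have := derivableP dc; rewrite (derive_comp_rV _ (immersion_diff _) dxt) (@derive_val _ _ _ _ _ _ _ dx).
have -> : \sum_i (d *m Q) 0 i *: 'D_(delta_mx 0 i) F (x t0) = d *m Q *m J.
  by rewrite -deriveF deriveE ?linear_rV; [apply: eq_bigr => i _; rewrite deriveE|]; rewrite //; exact: immersion_diff.
move=> /(near_eq_is_derive Fxy)/(is_derive_unique dy) dE.
by apply/nproj_ker; exists (d *m Q).
Unshelve. all: by end_near. Qed.

End ImmersedChart.

(** * Smooth identification of R^n with an open cube *)

Section Logistic.
Context {R : realType}.

Lemma Ck_expR k : Ck k setT (@expR R).
Proof.
elim: k => [|k IH]; first by move=> x _; exact: continuous_expR.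
split=> [x _|v]; first by apply/derivable1_diffP; exact: derivable_expR.
have dE (x : R) : differentiable (@expR R) x by apply/derivable1_diffP; exact: derivable_expR.
rewrite (_ : 'D_v _ = fun x => v * expR x).
  by apply: (CkM openT); [exact: Ck_cst|exact: IH].
by apply/funext => x; rewrite deriveE// (diff1E (dE x)) derive1E (@derive_val _ _ _ _ _ _ _ (is_derive_expR x)).
Qed.

Lemma derive_comp_real {V : normedModType R} (h : R -> R) (g : V -> R) x v dg dh :
  differentiable g x -> is_derive x v g dg -> is_derive (g x) 1 h dh ->
  is_derive x v (h \o g) (dg * dh).
Proof.
move=> dgx gv hd.
have dhx : differentiable h (g x) by apply/derivable1_diffP; exact: (@ex_derive _ _ _ _ _ _ _ hd).
have dc := differentiable_comp dgx dhx.
have := derivableP (diff_derivable (v := v) dc).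
rewrite (deriveE _ dc) (diff_comp dgx dhx)/= (diff1E dhx) derive1E.
by rewrite -(deriveE _ dgx) (@derive_val _ _ _ _ _ _ _ gv) (@derive_val _ _ _ _ _ _ _ hd).
Qed.

(** A diffeomorphism of the line onto (0, 1) with explicit inverse [logit]; applied to each
    coordinate, it shrinks a parametrization to a small cube while keeping R^n as its domain. *)
Definition logistic (t : R) : R := (1 + expR (- t))^-1.

Lemma logistic_den (t : R) : 0 < 1 + expR (- t).
Proof. by rewrite addr_gt0// expR_gt0. Qed.

Lemma logistic_gt0 t : 0 < logistic t.
Proof. by rewrite invr_gt0 logistic_den. Qed.

Lemma logistic_lt1 t : logistic t < 1.
Proof. by rewrite invf_lt1 ?logistic_den// ltrDl expR_gt0. Qed.

Lemma Ck_logistic k : Ck k setT logistic.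
Proof.
apply: (CkV openT) => [x _|]; first by rewrite gt_eqF// logistic_den.
apply: (CkD openT); first exact: Ck_cst.
apply: (@Ck_comp_real _ _ k (@expR R) (fun t => - t)); first exact: Ck_expR.
exact: (CkN openT (Ck_id k setT)).
Qed.

Lemma is_derive_logistic (t : R) : is_derive t 1 logistic (expR (- t) * logistic t ^+ 2).
Proof.
have d1 : is_derive t 1 (fun t : R => 1 + expR (- t)) (- expR (- t)).
  have := is_derive_comp1 (is_derive_opp t) (is_derive_expR (- t)); rewrite scaleN1r => d.
  have := is_deriveD (is_derive_cst (1 : R) t 1) d; rewrite add0r; exact.
have den : (1 + expR (- t)) != 0 by rewrite gt_eqF// logistic_den.
have d2 : derivable (fun t : R => (1 + expR (- t))^-1) t 1.
  exact: (@derivableV _ _ (fun t : R => 1 + expR (- t)) t 1 den (@ex_derive _ _ _ _ _ _ _ d1)).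
have E := @deriveV _ _ (fun t : R => 1 + expR (- t)) t 1 den (@ex_derive _ _ _ _ _ _ _ d1).
split; first exact: d2.
apply: etrans E _; rewrite (@derive_val _ _ _ _ _ _ _ d1) /GRing.scale/= mulrNN mulrC.
by rewrite /logistic exprVn.
Qed.

Definition logit (z : R) : R := - ln (z^-1 - 1).

Lemma logisticK z : 0 < z -> z < 1 -> logistic (logit z) = z.
Proof.
move=> z0 z1; have h : z^-1 - 1 \is Num.pos by rewrite posrE subr_gt0 invf_gt1.
by rewrite /logistic /logit opprK (lnK h) addrC subrK invrK.
Qed.

Lemma logitK t : logit (logistic t) = t.
Proof. by rewrite /logit /logistic invrK [1 + _]addrC addrK expRK opprK. Qed.

Lemma logit_continuous z : 0 < z -> z < 1 -> {for z, continuous logit}.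
Proof.
move=> z0 z1; apply: cvgN.
have h : 0 < z^-1 - 1 by rewrite subr_gt0 invf_gt1.
apply: (@continuous_comp _ _ _ (fun z : R => z^-1 - 1) (@ln R) z).
  by apply: cvgB; [apply: cvgV; [rewrite gt_eqF|exact: cvg_id]|exact: cvg_cst].
exact: continuous_ln.
Qed.

End Logistic.

Section CubeChart.
Context {R : realType} {n : nat}.
Local Notation V := 'rV[R]_n.
Variables (x0 : V) (r : R).
Hypothesis r0 : 0 < r.

Definition cube_coord (t a : R) := a + r * (2 * logistic t - 1).
Definition cube_chart (y : V) : V := \row_i cube_coord (y 0 i) (x0 0 i).

Lemma cube_coord_derive (a t : R) :
  is_derive t 1 (fun t => cube_coord t a) (r * (2 * (expR (- t) * logistic t ^+ 2))).
Proof.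
have d1 := @is_deriveZ _ _ _ _ 2 t 1 _ (is_derive_logistic t).
have d2 := is_deriveB d1 (is_derive_cst (1 : R) t 1).
have d3 := @is_deriveZ _ _ _ _ r t 1 _ d2.
have := is_deriveD (is_derive_cst a t 1) d3; rewrite subr0 add0r; exact.
Qed.

Lemma cube_chart_smooth k : Ck k setT cube_chart.
Proof.
apply: (Ck_mx openT) => i j.
rewrite (_ : (fun y => _) = fun y : V => x0 0 j + r * (2 * logistic (y 0 j) - 1)); last first.
  by apply/funext => y; rewrite mxE.
apply: (CkD openT); first exact: Ck_cst.
apply: (CkM openT); first exact: Ck_cst.
apply: (CkB openT); last exact: Ck_cst.
apply: (CkM openT); first exact: Ck_cst.
apply: (@Ck_comp_real _ _ k logistic (fun y : V => y 0 j)); first exact: Ck_logistic.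
exact: (Ck_coord 0 j openT (Ck_id k setT)).
Qed.

Lemma cube_chart_derive (y w : V) :
  is_derive y w cube_chart (\row_i (w 0 i * (r * (2 * (expR (- y 0 i) * logistic (y 0 i) ^+ 2))))).
Proof.
apply/is_derive_mxP => i j; rewrite mxE.
rewrite (_ : (fun y => _) = (fun t => cube_coord t (x0 0 j)) \o (fun y : V => y 0 j)); last first.
  by apply/funext => z; rewrite /= mxE.
apply: derive_comp_real (cube_coord_derive _ _); first exact: differentiable_coord.
exact: (is_derive_mxP _ _ _ _).1 (is_derive_id y w) 0 j.
Qed.

Lemma cube_chart_derive_inj (y w : V) : 'D_w cube_chart y = 0 -> w = 0.
Proof.
rewrite (@derive_val _ _ _ _ _ _ _ (cube_chart_derive y w)) => /rowP H.
apply/rowP => i; have := H i; rewrite !mxE => /eqP.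
rewrite mulf_eq0 => /predU1P[//|]; rewrite gt_eqF//.
by rewrite !mulr_gt0 ?exprn_gt0 ?expR_gt0 ?logistic_gt0.
Qed.

Lemma cube_chart_ball y : `|cube_chart y - x0| <= r.
Proof.
apply: mx_norm_le (ltW r0) _ => i j; rewrite !mxE (ord1 i) /cube_coord addrAC subrr add0r normrM (gtr0_norm r0).
rewrite -[leRHS]mulr1 ler_pM2l// ler_norml; have := logistic_gt0 (y 0 j); have := logistic_lt1 (y 0 j); lra.
Qed.

Definition cube_chart_inv (z : V) : V := \row_i logit (((z 0 i - x0 0 i) / r + 1) / 2).

Lemma cube_chartK : cancel cube_chart cube_chart_inv.
Proof.
move=> y; apply/rowP => i; rewrite !mxE -[RHS](logitK (y 0 i)); congr logit.
by rewrite /cube_coord; field; rewrite gt_eqF.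
Qed.

Lemma cube_chart_invK (z : V) : (forall i, `|z 0 i - x0 0 i| < r) -> cube_chart (cube_chart_inv z) = z.
Proof.
move=> zr; apply/rowP => i; rewrite !mxE /cube_coord logisticK.
- by field; rewrite gt_eqF.
- by have := zr i; rewrite ltr_norml => /andP[h _]; rewrite divr_gt0// -ltrBlDr sub0r ltr_pdivlMr// mulN1r.
- by have := zr i; rewrite ltr_norml => /andP[_ h]; rewrite ltr_pdivrMr// mul1r -ltrBrDr ltr_pdivrMr//; lra.
Qed.

Lemma cube_chart_open (W : set V) : open W -> open (cube_chart @` W).
Proof.
move=> oW; rewrite openE => _ [y Wy <-]; rewrite /interior.
set z := cube_chart y.
have zi i : `|z 0 i - x0 0 i| < r.
  rewrite mxE /cube_coord addrAC subrr add0r normrM (gtr0_norm r0) gtr_pMr// ltr_norml.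
  by have := logistic_gt0 (y 0 i); have := logistic_lt1 (y 0 i); lra.
have ci : {for z, continuous cube_chart_inv}.
  apply/(continuous_mxP cube_chart_inv z) => i j.
  rewrite (_ : (fun y => _) = fun z : V => logit (((z 0 j - x0 0 j) / r + 1) / 2)); last first.
    by apply/funext => u; rewrite mxE.
  apply: (@continuous_comp _ _ _ (fun z : V => (((z 0 j - x0 0 j) / r + 1) / 2)) logit z).
    apply: (@continuous_comp _ _ _ (fun z : V => z 0 j) (fun t => ((t - x0 0 j) / r + 1) / 2) z).
      exact: coord_continuous.
    rewrite (_ : (fun t => _) = fun t => ((1 - x0 0 j / r) / 2) + (2 * r)^-1 * t); last first.
      by apply/funext => t; field; rewrite gt_eqF.
    exact: is_derive_continuous (is_derive_affine _ _ _).
  apply: logit_continuous.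
  - by have := zi j; rewrite ltr_norml => /andP[h _]; rewrite divr_gt0// -ltrBlDr sub0r ltr_pdivlMr// mulN1r.
  - by have := zi j; rewrite ltr_norml => /andP[_ h]; rewrite ltr_pdivrMr// mul1r -ltrBrDr ltr_pdivrMr//; lra.
have n1 : \forall u \near z, W (cube_chart_inv u).
  apply: ci; rewrite cube_chartK; exact: open_nbhs_nbhs.
have n2 : \forall u \near z, forall i, `|(u : V) 0 i - x0 0 i| < r.
  apply: (@filter_forall _ _ _ (nbhs z) (nbhs_filter z)) => i.
  have cz : (fun u : V => `|u 0 i - x0 0 i|) @ z --> `|z 0 i - x0 0 i|.
    apply: (@continuous_comp _ _ _ (fun u : V => u 0 i) (fun t : R => `|t - x0 0 i|) z).
      exact: coord_continuous.
    by apply: cvg_norm; apply: cvgB; [exact: cvg_id|exact: cvg_cst].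
  by apply: (cz [set t | t < r]); apply: open_nbhs_nbhs; split; [exact: open_lt|exact: zi].
apply: (@filterS2 _ (nbhs z) _ _ _ _ _ n1 n2) => u Wu ur.
by exists (cube_chart_inv u) => //; exact: cube_chart_invK.
Qed.

End CubeChart.

(** * Charts defined on R^n, tangent spaces and normal projections *)

Section Charts.
Context {R : realType} {M : topologicalType} {n N : nat}.
Variable f : M -> 'rV[R]_N.

(** Having R^n as domain makes segments and rays available between all points of a chart, and makes
    its range contractible. *)
Definition chart (phi : 'rV[R]_n -> M) := local_parametrization f setT phi.

Lemma chart_smooth phi : chart phi -> smooth_on setT (f \o phi).
Proof. by case. Qed.

Lemma chart_imm phi : chart phi -> forall x w, 'D_w (f \o phi) x = 0 -> w = 0.
Proof. by case=> _ _ _ _ H x w; exact: H. Qed.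

Lemma chart_inj phi : chart phi -> injective phi.
Proof. by case=> -[_ pinj] _ _ _ _ x y; apply: pinj; rewrite inE. Qed.

Lemma chart_continuous phi : chart phi -> continuous phi.
Proof. by case=> _ cphi _ _ _ x; exact: cphi. Qed.

Lemma chart_open phi W : chart phi -> open W -> open (phi @` W).
Proof. by case=> _ _ H _ _ oW; exact: H. Qed.

(* Junk value 0 outside the range. *)
Definition chart_inv (phi : 'rV[R]_n -> M) (q : M) : 'rV[R]_n := xget 0 [set x | phi x = q].

Lemma chartK phi x : chart phi -> chart_inv phi (phi x) = x.
Proof.
move=> cp; rewrite /chart_inv; case: xgetP => [y _ /(chart_inj cp)//|/(_ x)].
by case.
Qed.

Lemma chart_invK phi q : range phi q -> phi (chart_inv phi q) = q.
Proof. by move=> [x _ xq]; exact: (@xgetPex _ 0 [set x | phi x = q] (ex_intro _ x xq)). Qed.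

Lemma chart_inv_continuous phi x : chart phi -> {for phi x, continuous (chart_inv phi)}.
Proof.
move=> cp; rewrite /prop_for /continuous_at chartK// => W; rewrite nbhsE => -[U [oU Ux] UW].
have : nbhs (phi x) (phi @` U).
  by apply: open_nbhs_nbhs; split; [exact: chart_open|exists x].
by apply: filterS => _ [y Uy <-]; apply: UW; rewrite chartK.
Qed.

Lemma chart_small p (U : set M) : submanifold n f -> open U -> U p ->
  exists phi, [/\ chart phi, phi 0 = p & range phi `<=` U].
Proof.
move=> [_ _ /(_ p)[V [ph [[[oV injph] cph oph sph imph] [x Vx phx]]]]] oU Up.
have nb : nbhs x [set y | V y /\ U (ph y)].
  apply: filterI; first exact: open_nbhs_nbhs.
  by apply: cph => //; apply: open_nbhs_nbhs; rewrite phx.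
have /nbhs_ballP[e /= e0 eV] := nb.
pose r := e / 2; have r0 : 0 < r by rewrite divr_gt0.
pose x1 : 'rV[R]_n := x.
pose th := cube_chart x1 r.
have thV y : V (th y) /\ U (ph (th y)).
  apply: eV; rewrite -ball_normE /= distrC (le_lt_trans (cube_chart_ball x1 r0 y))//.
  by rewrite /r ltr_pdivrMr// mulr_natr mulr2n ltrDl.
have th0 : th 0 = x.
  apply/rowP => i; rewrite !mxE /cube_coord /logistic oppr0 expR0.
  by rewrite -[1 + 1]/(2%:R) mulfV ?subrr ?mulr0 ?addr0.
have thK := cube_chartK x1 r0.
exists (ph \o th); split; last first.
- by move=> _ [y _ <-]; case: (thV y).
- by rewrite /= th0.
split.
- split; first exact: openT.
  move=> y z _ _ /= e1; apply: (can_inj thK); apply: injph => //; rewrite inE; by case: (thV y); case: (thV z).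
- move=> y _; apply: continuous_comp; last by apply: cph; case: (thV y).
  exact: (cube_chart_smooth x1 r 0%N).
- move=> W oW _; rewrite -[_ @` W](image_comp th ph); apply: oph; first exact: cube_chart_open.
  by move=> _ [y _ <-]; case: (thV y).
- move=> k; apply: (@Ck_comp_mx _ _ _ _ _ k setT V (f \o ph) th openT oV).
  + by move=> y _; case: (thV y).
  + exact: sph.
  + exact: cube_chart_smooth.
- move=> y w _ Dw; apply: (cube_chart_derive_inj (x0 := x1) r0 (y := y)).
  have Vy : V (th y) by case: (thV y).
  apply: (imph (th y)) => //.
  have [df _] := sph 1%N; have dfy := df _ Vy.
  have [dth _] := cube_chart_smooth x1 r 1%N; have dthy := dth y I.
  have := derive_comp_rV w dfy dthy; rewrite -[in LHS]/((f \o ph) \o th) => E.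
  have -> : 'D_('D_w (cube_chart x1 r) y) (f \o ph) (th y) = 'D_w ((f \o ph) \o th) y.
    by rewrite E (deriveE _ dfy) linear_rV; apply: eq_bigr => i _; rewrite (deriveE _ dfy).
  exact: Dw.
Qed.

(** A tangent vector may come from any parametrization [ph]. Its coordinate line, read in [phi], is
    a continuous lift through the immersion, and [lift_derive] says that the velocity is tangent in
    the chart [phi]. *)
Lemma tangent_chart phi x v : chart phi ->
  tangent_space n f (phi x) v <-> v *m nproj (f \o phi) x = 0.
Proof.
move=> cp; have sF := chart_smooth cp; have imF := chart_imm cp.
split; last first.
  move=> /(nproj_ker sF imF)[w ->]; exists setT, phi, x, w; split=> //.
  by rewrite (deriveF sF).
move=> [V [ph [x' [w [[[oV injph] cph oph sph imph] Vx phx ->]]]]].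
pose y (t : R) := (f \o ph) (x' + t *: w).
pose xc (t : R) := chart_inv phi (ph (x' + t *: w)).
have [df _] := sph 1%N; have dfx := df _ Vx.
have dy : is_derive (0 : R) 1 y ('D_w (f \o ph) x').
  apply: is_derive_line; rewrite scale0r addr0; apply: derivableP; exact: diff_derivable.
have cline : (fun t : R => x' + t *: w) @ (0 : R) --> x'.
  have e0 : x' = x' + (0 : R) *: w by rewrite scale0r addr0.
  rewrite {2}e0; by apply: cvgD; [exact: cvg_cst|apply: cvgZr_tmp; exact: cvg_id].
have cphl : (fun t : R => ph (x' + t *: w)) @ (0 : R) --> ph x'.
  exact: (cvg_comp _ _ cline (cph _ Vx)).
have xc0 : xc 0 = x by rewrite /xc scale0r addr0 phx chartK.
have cxc : {for (0 : R), continuous xc}.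
  rewrite /prop_for /continuous_at xc0.
  have := chart_inv_continuous (x := x) cp; rewrite /prop_for /continuous_at chartK// => c2.
  by apply: (cvg_comp _ _ _ c2); rewrite -phx.
have nr : \forall t \near (0 : R), (f \o phi) (xc t) = y t.
  have : nbhs (ph x') (range phi).
    rewrite phx; apply: open_nbhs_nbhs; split; last by exists x.
    by apply: chart_open => //; exact: openT.
  move=> rn; have H : \forall t \near (0 : R), range phi (ph (x' + t *: w)) := cphl _ rn.
  by apply: filterS H => t rt; rewrite /xc /y/= chart_invK.
by have [_] := lift_derive sF imF cxc nr dy; rewrite xc0.
Qed.

Lemma normal_chart phi x u : chart phi ->
  normal_space n f (phi x) u <-> u *m nproj (f \o phi) x = u.
Proof.
move=> cp; have sF := chart_smooth cp; have imF := chart_imm cp.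
rewrite (nproj_fix sF imF); split=> [H|uJ v].
  apply/rowP => i; rewrite [RHS]mxE.
  have := H (row i (jac (f \o phi) x)) _.
  rewrite (tangent_chart _ _ cp) -row_mul (jac_nproj sF imF) row0 => /(_ erefl) /matrixP/(_ 0 0).
  by rewrite [RHS]mxE => <-; rewrite !mxE; apply: eq_bigr => j _; rewrite !mxE.
move=> /(tangent_chart _ _ cp)/(nproj_ker sF imF)[w ->].
by rewrite trmx_mul mulmxA uJ mul0mx.
Qed.

(** An orthogonal projection is determined by its fixed vectors, so this choice is independent of
    the chart; 0 is the default value if there is none. *)
Definition normal_proj (p : M) : 'M[R]_N :=
  xget 0 [set P | orth_proj P /\ forall u : 'rV_N, u *m P = u <-> normal_space n f p u].

Lemma normal_proj_chart phi x : chart phi -> normal_proj (phi x) = nproj (f \o phi) x.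
Proof.
move=> cp; have sF := chart_smooth cp; have imF := chart_imm cp.
have H : [set P | orth_proj P /\ forall u : 'rV_N, u *m P = u <-> normal_space n f (phi x) u] (nproj (f \o phi) x).
  by split; [exact: nproj_proj|move=> u; rewrite normal_chart].
have [op1 H1] := xgetPex 0 (ex_intro _ _ H).
apply: orth_proj_unique => //; first exact: nproj_proj.
by move=> u; rewrite H1 normal_chart.
Qed.

Hypothesis smf : submanifold n f.

Lemma chart_at p : exists phi, chart phi /\ phi 0 = p.
Proof. by have [phi [cp p0 _]] := chart_small smf openT (I : setT p); exists phi. Qed.

Lemma normal_projP p : orth_proj (normal_proj p).
Proof.
have [phi [cp <-]] := chart_at p; rewrite normal_proj_chart//.
by apply: nproj_proj; [exact: chart_smooth|exact: chart_imm].
Qed.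

Lemma normal_spaceE p u : normal_space n f p u <-> u *m normal_proj p = u.
Proof. by have [phi [cp <-]] := chart_at p; rewrite normal_proj_chart// normal_chart. Qed.

Lemma tangent_spaceE p v : tangent_space n f p v <-> v *m normal_proj p = 0.
Proof. by have [phi [cp <-]] := chart_at p; rewrite normal_proj_chart// tangent_chart. Qed.

Lemma normal_proj_rank p : \rank (normal_proj p) = (N - n)%N.
Proof.
have [phi [cp <-]] := chart_at p; rewrite normal_proj_chart//.
have sF := chart_smooth cp; have imF := chart_imm cp.
set P := nproj _ _; set J := jac (f \o phi) 0.
have rJ : \rank J = n.
  apply/eqP; rewrite -[_ == _]/(row_free J) -kermx_eq0; apply/eqP/row_matrixP => i.
  by rewrite row0; apply: (jac_inj sF imF (x := 0)); rewrite -row_mul mulmx_ker row0.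
have : (kermx P == J)%MS.
  apply/andP; split.
    apply/row_subP => i; have : row i (kermx P) *m P = 0 by rewrite -row_mul mulmx_ker row0.
    by move=> /(nproj_ker sF imF)[w ->]; exact: submxMl.
  by apply/sub_kermxP; exact: jac_nproj.
move=> /eqmx_rank; rewrite mxrank_ker rJ => E.
by rewrite -E subKn// rank_leq_row.
Qed.

End Charts.

(** * Piecewise smooth curves *)

Section PiecewiseSmooth.
Context {R : realType} {W : normedModType R}.
Implicit Types (a b m : R) (c : R -> W).

(** [piecewise_smooth] on an arbitrary interval, as the closure of smooth pieces under
    concatenation: induction on pieces replaces indices into a partition. *)
Inductive pws : R -> R -> (R -> W) -> Prop :=
| pws_one a b c g : a < b -> smooth_on setT g -> {in `[a, b], c =1 g} -> pws a b c
| pws_cat a m b c : pws a m c -> pws m b c -> pws a b c.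

Lemma pws_lt a b c : pws a b c -> a < b.
Proof. by elim=> // {}a m {}b {}c _ am _ mb; exact: lt_trans mb. Qed.

Lemma pws_smooth a b c : a < b -> smooth_on setT c -> pws a b c.
Proof. by move=> ab sc; apply: (pws_one ab sc). Qed.

Lemma pws_eq a b c d : {in `[a, b], c =1 d} -> pws a b c -> pws a b d.
Proof.
move=> cd H; elim: H d cd => {a b c} [a b c g ab sg cg|a m b c H1 IH1 H2 IH2] d cd.
  by apply: (pws_one ab sg) => t tab; rewrite -cd// cg.
have am := pws_lt H1; have mb := pws_lt H2.
apply: (@pws_cat a m b).
  by apply: IH1 => t /itvP tam; apply: cd; rewrite in_itv/= tam (le_trans _ (ltW mb))// tam.
by apply: IH2 => t /itvP tam; apply: cd; rewrite in_itv/= tam (le_trans (ltW am))// tam.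
Qed.

Lemma pws_partition a b c (s : seq R) : a < b -> itv_partition a b s ->
  (forall i, (i < size s)%N -> exists2 g : R -> W, smooth_on setT g &
        {in `[nth 0 (a :: s) i, nth 0 (a :: s) i.+1], c =1 g}) -> pws a b c.
Proof.
elim: s a => [|x s IH] a ab [] /=.
  by move=> _ /eqP ab'; rewrite ab' ltxx in ab.
move=> /andP[ax sx] lx H.
have [g sg cg] := H 0%N isT.
have p1 : pws a x c by exact: (pws_one ax sg).
clear g sg cg.
case: s => [|y s] in IH sx lx H *.
  by move: lx => /= /eqP <-.
apply: (pws_cat p1); apply: IH.
- have /allP xs := order_path_min lt_trans sx.
  by rewrite -(eqP lx); apply: xs; exact: (mem_last y s).
- by split.
- by move=> i is_; have := H i.+1 is_.
Qed.

Lemma pws_partition_ex a b c : pws a b c -> exists2 s : seq R, itv_partition a b s &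
  (forall i, (i < size s)%N -> exists2 g : R -> W, smooth_on setT g &
        {in `[nth 0 (a :: s) i, nth 0 (a :: s) i.+1], c =1 g}).
Proof.
elim=> {a b c} [a b c g ab sg cg|a m b c H1 [s1 p1 Hs1] H2 [s2 p2 Hs2]].
  exists [:: b]; first by split => //=; rewrite ab.
  by case=> // _; exists g.
have [q1 l1] := p1; have [q2 l2] := p2.
exists (s1 ++ s2).
  split; first by rewrite cat_path q1 (eqP l1).
  by rewrite last_cat (eqP l1).
move=> i; rewrite size_cat => is12.
have [is1|s1i] := ltnP i (size s1).
  have [g sg cg] := Hs1 i is1; exists g => //.
  by rewrite -cat_cons !nth_cat/= ltnS (ltnW is1) ltnS is1.
have is2 : (i - size s1 < size s2)%N by rewrite ltn_subLR.
have [g sg cg] := Hs2 _ is2.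
exists g => //; rewrite -cat_cons !nth_cat/= !ltnS [(i < size s1)%N]ltnNge s1i/= subSS.
have -> : (if (i <= size s1)%N then nth 0 (a :: s1) i else nth 0 s2 (i - (size s1).+1)) =
    nth 0 (m :: s2) (i - size s1).
  case: ltngtP s1i => // [s1i _|e _].
    by rewrite -(subnSK s1i).
  by rewrite -e subnn /= -(eqP l1) -[RHS](nth_last 0 (a :: s1)).
exact: cg.
Qed.

Lemma piecewise_smoothE c : piecewise_smooth c <-> pws 0 1 c.
Proof.
split=> [[s p H]|/pws_partition_ex//].
exact: (pws_partition ltr01 p H).
Qed.

Lemma pws_affine a b c (al be : R) : 0 < al -> pws a b c ->
  pws ((a - be) / al) ((b - be) / al) (fun t => c (be + al * t)).
Proof.
move=> al0; elim=> {a b c} [a b c g ab sg cg|a m b c H1 IH1 H2 IH2]; last exact: pws_cat IH1 IH2.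
apply: (pws_one (g := fun t => g (be + al * t))).
- by rewrite ltr_pM2r ?invr_gt0// ltrD2r.
- exact: smooth_comp_lin.
move=> t; rewrite in_itv/= ler_pdivrMr// ler_pdivlMr// => /andP[h1 h2].
by apply: cg; rewrite in_itv/=; apply/andP; split; lra.
Qed.

Lemma pws_reverse a b c : pws a b c -> pws (- b) (- a) (fun t => c (- t)).
Proof.
elim=> {a b c} [a b c g ab sg cg|a m b c H1 IH1 H2 IH2]; last exact: pws_cat IH2 IH1.
apply: (pws_one (g := fun t => g (- t))).
- by rewrite ltrN2.
- rewrite (_ : (fun t => _) = fun t => g (0 + (-1) * t)); first exact: smooth_comp_lin.
  by apply/funext => t; rewrite add0r mulN1r.
by move=> t /itvP tab; apply: cg; rewrite in_itv/= lerNr lerNl !tab.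
Qed.

Lemma pws_restrict a b c a' b' : pws a b c -> a <= a' -> a' < b' -> b' <= b -> pws a' b' c.
Proof.
move=> H; elim: H a' b' => {a b c} [a b c g ab sg cg|a m b c H1 IH1 H2 IH2] a' b' aa ab' bb.
  apply: (pws_one ab' sg) => t /itvP tab; apply: cg.
  by rewrite in_itv/= (le_trans aa) ?tab// (le_trans _ bb)// tab.
have [bm|mb] := leP b' m; first exact: IH1.
have [ma|am] := leP m a'; first exact: IH2.
apply: (@pws_cat _ m); first exact: (IH1 a' m aa am (lexx m)).
exact: (IH2 m b' (lexx m) mb bb).
Qed.

Lemma smooth_continuous c : smooth_on setT c -> continuous c.
Proof. by move=> sc x; exact: (sc 0%N). Qed.

Lemma within_eq {T : topologicalType} (A : set R) (c d : R -> T) :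
  (forall t, A t -> c t = d t) -> {within A, continuous c} -> {within A, continuous d}.
Proof. by move=> cd; apply: subspace_eq_continuous => t; rewrite inE; exact: cd. Qed.

Lemma within_cat {T : topologicalType} a m b (c : R -> T) : a <= m -> m <= b ->
  {within `[a, m], continuous c} -> {within `[m, b], continuous c} -> {within `[a, b], continuous c}.
Proof.
move=> am mb c1 c2.
rewrite (_ : `[a, b]%classic = `[a, m]%classic `|` `[m, b]%classic).
  by apply: withinU_continuous => //; exact: interval_closed.
apply/seteqP; split=> t /=; rewrite !in_itv/=.
  by move=> /andP[at_ tb]; have [tm|/ltW mt] := leP t m; [left|right]; rewrite ?at_ ?tb ?tm ?mt.
by move=> [/andP[h1 h2]|/andP[h1 h2]]; apply/andP; split=> //; [exact: le_trans mb|exact: le_trans h1].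
Qed.

Lemma pws_continuous a b c : pws a b c -> {within `[a, b], continuous c}.
Proof.
elim=> {a b c} [a b c g ab sg cg|a m b c H1 c1 H2 c2].
  apply: (@within_eq _ _ g) => [t tab|]; first by rewrite cg.
  exact/continuous_subspaceT/smooth_continuous.
by apply: (@within_cat _ a m b) => //; apply: ltW; [exact: pws_lt H1|exact: pws_lt H2].
Qed.

Lemma near_itv (a b t : R) : t \in `]a, b[ -> \forall s \near t, s \in `]a, b[.
Proof.
move=> tab; have : nbhs t `]a, b[%classic.
  by apply: open_nbhs_nbhs; split; [exact: interval_open|].
by apply: filterS.
Qed.

Lemma piece_derive a b c g (t : R) : smooth_on setT g -> {in `[a, b], c =1 g} -> t \in `]a, b[ ->
  is_derive t 1 c (derive1 g t).
Proof.
move=> sg cg tab; have := smooth_is_derive t sg.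
apply: near_eq_is_derive; have := near_itv tab; apply: filterS => s sab.
by rewrite cg//; exact: subset_itv_oo_cc.
Qed.

Lemma pws_derivable a b c : pws a b c ->
  exists s : seq R, forall t, t \in `]a, b[ -> t \notin s -> derivable c t 1.
Proof.
elim=> {a b c} [a b c g ab sg cg|a m b c H1 [s1 d1] H2 [s2 d2]].
  by exists [::] => t tab _; exact: (@ex_derive _ _ _ _ _ _ _ (piece_derive sg cg tab)).
exists (m :: s1 ++ s2) => t; rewrite in_itv/= => /andP[at_ tb].
rewrite inE mem_cat !negb_or => /and3P[tm t1 t2].
case: (ltgtP t m) tm => // [tm _|mt _].
  by apply: d1 => //; rewrite in_itv/= at_.
by apply: d2 => //; rewrite in_itv/= mt.
Qed.

Lemma pws_left_piece a b c (t0 : R) : pws a b c -> a < t0 -> t0 <= b ->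
  exists e g, [/\ 0 < e, a <= t0 - e, smooth_on setT g & {in `[t0 - e, t0], c =1 g}].
Proof.
move=> H; elim: H t0 => {a b c} [a b c g ab sg cg|a m b c H1 IH1 H2 IH2] t0 at0 t0b.
  exists (t0 - a), g; split=> //; rewrite ?subr_gt0 ?subKr//.
  by move=> t /itvP tab; apply: cg; rewrite in_itv/= tab (le_trans _ t0b)// tab.
have [t0m|mt0] := leP t0 m; first exact: IH1.
have [e [g [e0 me sg cg]]] := IH2 t0 mt0 t0b.
by exists e, g; split=> //; apply: le_trans me; exact: ltW (pws_lt H1).
Qed.

Lemma avoid_finite a b (s : seq R) : a < b -> exists2 t, t \in `]a, b[ & t \notin s.
Proof.
elim: s b => [|x s IH] b ab.
  by exists ((a + b) / 2); [rewrite in_itv/= midf_lt// midf_lt//|].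
have [t tab ts] := IH b ab.
have [tx|tx] := eqVneq t x; last by exists t => //; rewrite inE negb_or tx.
have at_ : a < t by move: tab; rewrite in_itv/= => /andP[].
have [t' /itvP tab' ts'] := IH t at_.
exists t'; last by rewrite inE negb_or ts' -tx lt_eqF// tab'.
by rewrite in_itv/= tab' (lt_trans (_ : t' < t)) ?tab'//; move: tab; rewrite in_itv => /andP[].
Qed.

(** Both derivatives are two-sided, so each is already determined by increments to the left of [t0],
    where the curves agree. *)
Lemma left_derive_eq c g (t0 e : R) d d' : 0 < e -> {in `[t0 - e, t0], c =1 g} ->
  is_derive t0 1 c d -> is_derive t0 1 g d' -> d = d'.
Proof.
move=> e0 cg cd gd; apply/eqP; rewrite -subr_eq0 -normr_le0; apply/ler_addgt0Pl => eps eps0; rewrite addr0.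
have eps2 : 0 < eps / 2 by rewrite divr_gt0.
have /nbhs_ballP[r1 /= r10 H1] := is_derive_epsE cd eps2.
have /nbhs_ballP[r2 /= r20 H2] := is_derive_epsE gd eps2.
pose h := - (Num.min e (Num.min r1 r2) / 2).
have mn0 : 0 < Num.min e (Num.min r1 r2) by rewrite !lt_min e0 r10.
have mn1 : Num.min e (Num.min r1 r2) <= e by rewrite ge_min lexx.
have mn2 : Num.min e (Num.min r1 r2) <= r1 by rewrite !ge_min lexx orbT.
have mn3 : Num.min e (Num.min r1 r2) <= r2 by rewrite !ge_min lexx !orbT.
have hn : `|h| = Num.min e (Num.min r1 r2) / 2.
  by rewrite normrN gtr0_norm// divr_gt0.
have h0 : 0 < `|h| by rewrite hn divr_gt0.
have k1 : `|c (t0 + h) - c t0 - h *: d| <= eps / 2 * `|h|.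
  by apply: H1; rewrite -ball_normE /= sub0r normrN hn; lra.
have k2 : `|g (t0 + h) - g t0 - h *: d'| <= eps / 2 * `|h|.
  by apply: H2; rewrite -ball_normE /= sub0r normrN hn; lra.
have c1 : c (t0 + h) = g (t0 + h) by apply: cg; rewrite in_itv/=; apply/andP; split; rewrite /h; lra.
have c2 : c t0 = g t0 by apply: cg; rewrite in_itv/=; apply/andP; split; lra.
rewrite c1 c2 in k1.
suff : `|h| * `|d - d'| <= `|h| * eps by rewrite ler_pM2l.
rewrite -normrZ scalerBr.
have -> : h *: d - h *: d' = (g (t0 + h) - g t0 - h *: d') - (g (t0 + h) - g t0 - h *: d).
  by rewrite opprB [RHS]addrC addrA subrK.
rewrite (le_trans (ler_normB _ _))//; lra.
Qed.

End PiecewiseSmooth.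

(** * Parallel transport in the normal bundle *)

Section MoreAnalysis.
Context {R : realType}.

Lemma within_mulmx {T : topologicalType} (A : set T) (m n p : nat) (f : T -> 'M[R]_(m, n)) (g : T -> 'M[R]_(n, p)) :
  {within A, continuous f} -> {within A, continuous g} -> {within A, continuous (fun t => f t *m g t)}.
Proof. by move=> cf cg t; exact: (@cvg_mulmx R _ (nbhs (t : subspace A)) (nbhs_filter _) _ _ _ f g _ _ (cf t) (cg t)). Qed.

Lemma within_trmx {T : topologicalType} (A : set T) (m n : nat) (f : T -> 'M[R]_(m, n)) :
  {within A, continuous f} -> {within A, continuous (fun t => (f t)^T)}.
Proof.
move=> cf t; apply: (continuous_mxP (T := subspace A) (fun t => (f t)^T) t).2 => i j.
rewrite (_ : (fun _ => _) = fun y => f y j i); last by apply/funext => y; rewrite mxE.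
exact: ((continuous_mxP (T := subspace A) f t).1 (cf t)).
Qed.

Lemma within_comp {T U : topologicalType} (A : set R) (f : R -> T) (g : T -> U) :
  {within A, continuous f} -> (forall t, A t -> {for f t, continuous g}) -> {within A, continuous (g \o f)}.
Proof.
move=> /subspace_continuousP cf cg; apply/subspace_continuousP => t At.
exact: (cvg_comp _ _ (cf t At) (cg t At)).
Qed.

Lemma within_lin_comp {T : topologicalType} (a b : R) (c : R -> T) (al be : R) : a <= b ->
  {within `[a, b], continuous c} ->
  {within [set t | be + al * t \in `[a, b]], continuous (fun t => c (be + al * t))}.
Proof.
move=> ab cc; apply: (@within_eq _ _ _ (fun t => (c \o clamp a b) (be + al * t))).
  by move=> t /=; rewrite in_itv => /= h; rewrite clamp_id.
apply: continuous_subspaceT => t.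
have := @continuous_comp _ _ _ (fun t => be + al * t) (c \o clamp a b) t; apply; last exact: within_clamp.
exact: (is_derive_continuous (is_derive_affine be al t)).
Qed.

Lemma orth_proj_rank_eq (n : nat) (E P : 'M[R]_n) : orth_proj E -> orth_proj P ->
  E *m P = E -> (\rank P <= \rank E)%N -> E = P.
Proof.
move=> [ET EE] [PT PP] EP rPE.
have sEP : (E <= P)%MS by rewrite -EP submxMl.
have /submxP[D PD] : (P <= E)%MS.
  by have := (geq_leqif (mxrank_leqif_sup sEP)); rewrite rPE => <-.
have PE : P *m E = P by rewrite PD -mulmxA EE.
by rewrite -EP -[LHS]trmxK trmx_mul PT ET PE.
Qed.

Lemma mx_gram_eq0 (m n : nat) (A : 'M[R]_(m, n)) : A *m A^T = 0 -> A = 0.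
Proof.
move=> A0; apply/row_matrixP => i; rewrite row0; apply: mulmx_trmx_eq0.
by rewrite tr_row colE mulmxA -row_mul A0 row0 mul0mx.
Qed.

(** [A] is a partial isometry with [A A^T = P], so [A^T A] is an orthogonal projection with image in
    that of [Q]; equality of ranks makes it equal to [Q]. Parallel transports extended by zero are
    of this kind. *)
Lemma orth_frame (n : nat) (A P Q : 'M[R]_n) : orth_proj P -> orth_proj Q ->
  \rank P = \rank Q -> A *m A^T = P -> A *m Q = A -> P *m A = A /\ A^T *m A = Q.
Proof.
move=> oP oQ rPQ AAT AQ; have [PT PP] := oP.
have PA : P *m A = A.
  apply/eqP; rewrite -subr_eq0; apply/eqP.
  have : (P *m A - A) *m (P *m A - A)^T = 0.
    rewrite linearB /= trmx_mul PT mulmxBl !mulmxBr -!mulmxA (mulmxA A) AAT.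
    by rewrite !PP !subrr.
  exact: mx_gram_eq0.
split=> //; apply: orth_proj_rank_eq => //.
- split; first by rewrite trmx_mul trmxK.
  by rewrite mulmxA -(mulmxA _ A) AAT -mulmxA PA.
- by rewrite -mulmxA AQ.
rewrite -rPQ -PP -{1}AAT -{1}AAT mulmxA -(mulmxA A) (leq_trans (mxrankM_maxl _ _))//.
exact: mxrankM_maxr.
Qed.

End MoreAnalysis.

Lemma pws_op {R : realType} {W1 W2 W3 : normedModType R} (op : W1 -> W2 -> W3) :
  (forall g1 g2 : R -> _, smooth_on setT g1 -> smooth_on setT g2 -> smooth_on setT (fun t => op (g1 t) (g2 t))) ->
  forall a b c1 c2, pws a b c1 -> pws a b c2 -> pws a b (fun t => op (c1 t) (c2 t)).
Proof.
move=> sop a b c1 c2 H1; elim: H1 c2 => {a b c1} [a b c1 g ab sg cg|a m b c1 H1 IH1 H2 IH2] c2 p2.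
  elim: p2 cg {ab} => {a b c2} [a b c2 g2 ab sg2 cg2|a m b c2 H1 IH1 H2 IH2] cg.
    by apply: (pws_one (g := fun t => op (g t) (g2 t))) => [//||t tab]; [exact: sop|rewrite cg// cg2].
  have am := pws_lt H1; have mb := pws_lt H2.
  apply: (@pws_cat _ _ a m b).
    by apply: IH1 => t /itvP tam; apply: cg; rewrite in_itv/= tam (le_trans _ (ltW mb))// tam.
  by apply: IH2 => t /itvP tam; apply: cg; rewrite in_itv/= tam (le_trans (ltW am))// tam.
have am := pws_lt H1; have mb := pws_lt H2.
apply: (@pws_cat _ _ a m b); [apply: IH1|apply: IH2].
  exact: pws_restrict p2 (lexx a) am (ltW mb).
exact: pws_restrict p2 (ltW am) mb (lexx b).
Qed.

Section Transport.
Context {R : realType} {M : topologicalType} {n N : nat}.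
Variable f : M -> 'rV[R]_N.
Hypothesis smf : submanifold n f.
Implicit Types (O : set M) (p q : M) (c : R -> M) (a b : R).

Notation P := (@normal_proj R M n N f).

Lemma chart_range_open phi : chart f phi -> open (range (phi : 'rV[R]_n -> M)).
Proof. by move=> cp; exact: (chart_open cp openT). Qed.

Lemma normal_proj_continuous : continuous P.
Proof.
move=> q; have [phi [cp <-]] := chart_at smf q.
have h : {for phi 0, continuous ((nproj (f \o phi)) \o (chart_inv phi))}.
  apply: continuous_comp; first exact: (chart_inv_continuous (x := 0) cp).
  by rewrite (chartK _ cp); exact: (nproj_smooth (chart_smooth cp) (chart_imm cp) 0).
apply: cvg_trans; last by rewrite -[P (phi 0)](_ : (nproj (f \o phi) \o chart_inv phi) (phi 0) = _); [exact: h|rewrite /= (chartK _ cp) normal_proj_chart].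
apply: near_eq_cvg.
have : nbhs (phi 0) (range phi) by apply: open_nbhs_nbhs; split; [exact: chart_range_open|exists 0].
by apply: filterS => _ [x _ <-] /=; rewrite (chartK _ cp) normal_proj_chart.
Qed.

(* The rows of [Xi] are normal vectors transported along [c]. *)
Definition parallel O (m : nat) a b c (Xi : R -> 'M[R]_(m, N)) : Prop :=
  [/\ {within `[a, b], continuous c}, pws a b (f \o c), {in `[a, b], forall t, O (c t)},
      pws a b Xi /\ {in `[a, b], forall t, Xi t *m P (c t) = Xi t} &
      exists s : seq R, forall t : R, t \in `]a, b[ -> t \notin s ->
        exists2 d, is_derive t 1 Xi d & d *m P (c t) = 0].

Lemma parallel_sub O O' (m : nat) a b c Xi : O `<=` O' -> parallel O (m := m) a b c Xi -> parallel O' a b c Xi.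
Proof. by move=> OO [cc pc Oc pX dX]; split => // t tab; apply/OO/Oc. Qed.

Lemma parallel_lt O (m : nat) a b c (Xi : R -> 'M[R]_(m, N)) : parallel O a b c Xi -> a < b.
Proof. by move=> [_ pc _ _ _]; exact: pws_lt pc. Qed.

(** The derivative of [Xi] is tangent and [Xi] is normal, so both terms of the derivative of
    [Xi Xi^T] vanish. *)
Lemma parallel_gram O (m : nat) a b c (Xi : R -> 'M[R]_(m, N)) : parallel O a b c Xi ->
  forall t, t \in `[a, b] -> Xi t *m (Xi t)^T = Xi a *m (Xi a)^T.
Proof.
move=> H t /itvP tab; have [cc pc Oc [pX nX] [s dX]] := H.
apply/esym; apply: (@const_off_finite _ _ _ (fun t => Xi t *m (Xi t)^T) s a t); first by rewrite tab.
  apply: (@continuous_subspaceW _ _ _ `[a, b]).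
    by apply: subset_itvl; rewrite bnd_simp tab.
  have cX := pws_continuous pX.
  by apply: within_mulmx => //; exact: within_trmx.
move=> u /itvP uat us.
have uab : u \in `]a, b[ by rewrite in_itv/= uat (lt_le_trans _ (_ : t <= b)) ?uat ?tab.
have [d dXu d0] := dX u uab us.
apply: (is_derive_eq (is_derive_mulmx dXu (is_derive_trmx dXu))).
have [PT _] := normal_projP smf (c u).
have E : d *m (Xi u)^T = 0.
  by rewrite -(nX u (subset_itv_oo_cc uab)) trmx_mul PT mulmxA d0 mul0mx.
by rewrite E add0r -[X in X *m _]trmxK -trmx_mul E trmx0.
Qed.

Lemma parallel_frame O a b c (Xi : R -> 'M[R]_N) : parallel O a b c Xi -> Xi a = P (c a) ->
  forall t, t \in `[a, b] ->
  [/\ Xi t *m (Xi t)^T = P (c a), P (c a) *m Xi t = Xi t & (Xi t)^T *m Xi t = P (c t)].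
Proof.
move=> H Xa t tab; have [_ _ _ [_ nX] _] := H.
have [PT PP] := normal_projP smf (c a).
have XX : Xi t *m (Xi t)^T = P (c a) by rewrite (parallel_gram H tab) Xa PT PP.
have [||h1 h2] := orth_frame (normal_projP smf (c a)) (normal_projP smf (c t)) _ XX.
- by rewrite !(normal_proj_rank smf).
- exact: nX.
by split.
Qed.

Lemma parallel_restrict O (m : nat) a b a' b' c (Xi : R -> 'M[R]_(m, N)) : parallel O a b c Xi ->
  a <= a' -> a' < b' -> b' <= b -> parallel O a' b' c Xi.
Proof.
move=> [cc pc Oc [pX nX] [s dX]] aa ab bb.
have sab : `[a', b'] `<=` `[a, b] by move=> t; rewrite /= !in_itv/= => /andP[h1 h2]; rewrite (le_trans aa)// (le_trans h2).
have sab' t : t \in `[a', b'] -> t \in `[a, b] by exact: sab.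
split; [exact: continuous_subspaceW cc|exact: pws_restrict pc _ _ _|by move=> t /sab'/Oc|split; first exact: pws_restrict pX _ _ _|].
  by move=> t /sab'/nX.
exists s => t; rewrite in_itv/= => /andP[h1 h2]; apply: dX.
by rewrite in_itv/= (le_lt_trans aa)// (lt_le_trans h2).
Qed.

Lemma pws_lin (m k : nat) a b (Xi : R -> 'M[R]_(m, N)) (B : 'M[R]_(k, m)) : pws a b Xi -> pws a b (fun t => B *m Xi t).
Proof.
elim=> {a b Xi} [a b c g ab sg cg|a m' b c H1 IH1 H2 IH2]; last exact: pws_cat IH1 IH2.
apply: (pws_one (g := fun t => B *m g t)) => // [l|t tab]; last by rewrite cg.
by apply: (Ck_mulmx openT); [exact: Ck_cst|exact: sg].
Qed.

Lemma parallel_mulmx O (m k : nat) a b c (Xi : R -> 'M[R]_(m, N)) (B : 'M[R]_(k, m)) :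
  parallel O a b c Xi -> parallel O a b c (fun t => B *m Xi t).
Proof.
move=> [cc pc Oc [pX nX] [s dX]]; split=> //; [split; first exact: pws_lin|exists s => t tab ts].
  by move=> t tab; rewrite -mulmxA nX.
have [d dXt d0] := dX t tab ts; exists (B *m d); first exact: is_derive_mulmxl.
by rewrite -mulmxA d0 mulmx0.
Qed.

Lemma parallel_reverse O (m : nat) a b c (Xi : R -> 'M[R]_(m, N)) : parallel O a b c Xi ->
  parallel O (- b) (- a) (fun t => c (- t)) (fun t => Xi (- t)).
Proof.
move=> H; have ab := parallel_lt H; move: H => [cc pc Oc [pX nX] [s dX]].
have oab t : t \in `[- b, - a] -> - t \in `[a, b] by rewrite !in_itv/= lerNr lerNl andbC.
split; [|exact: (pws_reverse pc)|by move=> t /oab/Oc|split; [exact: pws_reverse|by move=> t /oab/nX]|].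
  have := @within_lin_comp _ _ a b c (-1) 0 (ltW ab) cc.
  rewrite (_ : (fun t => c (0 + -1 * t)) = fun t => c (- t)); last by apply/funext => t; rewrite add0r mulN1r.
  by apply: continuous_subspaceW => t /oab /=; rewrite add0r mulN1r.
exists (map -%R s) => t tab ts.
have tab' : - t \in `]a, b[ by move: tab; rewrite !in_itv/= ltrNr ltrNl andbC.
have [|d dXt d0] := dX (- t) tab'.
  by apply: contra ts => h; rewrite -[t]opprK map_f.
exists (- d); last by rewrite mulNmx d0 oppr0.
by apply: (is_derive_eq (is_derive_comp1 (is_derive_opp t) dXt)); rewrite scaleN1r.
Qed.

Lemma parallel_affine O (m : nat) a b c (Xi : R -> 'M[R]_(m, N)) (al be : R) : 0 < al -> parallel O a b c Xi ->
  parallel O ((a - be) / al) ((b - be) / al) (fun t => c (be + al * t)) (fun t => Xi (be + al * t)).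
Proof.
move=> al0 H; have ab := parallel_lt H; move: H => [cc pc Oc [pX nX] [s dX]].
have oab t : t \in `[(a - be) / al, (b - be) / al] -> be + al * t \in `[a, b].
  by rewrite !in_itv/= ler_pdivrMr// ler_pdivlMr// => /andP[h1 h2]; apply/andP; split; lra.
split; [|exact: (pws_affine be al0 pc)|by move=> t /oab/Oc|split; [exact: pws_affine|by move=> t /oab/nX]|].
  by have := @within_lin_comp _ _ a b c al be (ltW ab) cc; exact: continuous_subspaceW.
exists (map (fun t => (t - be) / al) s) => t tab ts.
have tab' : be + al * t \in `]a, b[.
  by move: tab; rewrite !in_itv/= ltr_pdivrMr// ltr_pdivlMr// => /andP[h1 h2]; apply/andP; split; lra.
have [|d dXt d0] := dX (be + al * t) tab'.
  apply: contra ts => h; apply/mapP; exists (be + al * t) => //.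
  by rewrite [be + _]addrC addrK mulrAC divff ?mul1r ?gt_eqF.
exists (al *: d); last by rewrite -scalemxAl d0 scaler0.
exact: (is_derive_comp1 (is_derive_affine be al t) dXt).
Qed.

Lemma parallel_cat O (m : nat) a l b c1 c2 (X1 X2 : R -> 'M[R]_(m, N)) :
  parallel O a l c1 X1 -> parallel O l b c2 X2 -> c1 l = c2 l -> X1 l = X2 l ->
  parallel O a b (fun t => if t <= l then c1 t else c2 t) (fun t => if t <= l then X1 t else X2 t).
Proof.
move=> H1 H2 cl Xl; have al := parallel_lt H1; have lb := parallel_lt H2.
move: H1 H2 => [cc1 pc1 Oc1 [pX1 nX1] [s1 dX1]] [cc2 pc2 Oc2 [pX2 nX2] [s2 dX2]].
have E1 (T : Type) (g1 g2 : R -> T) : {in `[a, l], g1 =1 (fun t => if t <= l then g1 t else g2 t)}.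
  by move=> t; rewrite in_itv/= => /andP[_ ->].
have E2 (T : Type) (g1 g2 : R -> T) : g1 l = g2 l -> {in `[l, b], g2 =1 (fun t => if t <= l then g1 t else g2 t)}.
  move=> gl t; rewrite in_itv/= => /andP[lt _].
  by case: (ltgtP t l) lt => // -> _; rewrite gl.
have cases t : t \in `[a, b] -> t \in `[a, l] \/ t \in `[l, b].
  rewrite !in_itv/= => /andP[h1 h2]; have [h3|/ltW h3] := leP t l; [left|right].
    by rewrite h1.
  by rewrite h3.
split.
- apply: (within_cat (ltW al) (ltW lb)).
    by apply: within_eq cc1 => t; exact: (E1 M).
  by apply: within_eq cc2 => t; exact: (E2 M).
- apply: (@pws_cat _ _ a l b).
    by apply: pws_eq pc1 => t tal /=; rewrite -(E1 _ c1 c2).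
  by apply: pws_eq pc2 => t tal /=; rewrite -(E2 _ c1 c2).
- move=> t /cases[h|h]; first by rewrite -(E1 _ c1 c2)//; exact: Oc1.
  by rewrite -(E2 _ c1 c2)//; exact: Oc2.
- split; first apply: (@pws_cat _ _ a l b).
  + by apply: pws_eq pX1; exact: E1.
  + by apply: pws_eq pX2; exact: E2.
  + move=> t /cases[h|h]; first by rewrite -(E1 _ c1 c2)// -(E1 _ X1 X2)// nX1.
    by rewrite -(E2 _ c1 c2)// -(E2 _ X1 X2)// nX2.
exists (l :: s1 ++ s2) => t; rewrite in_itv/= => /andP[at_ tb].
rewrite inE mem_cat !negb_or => /and3P[tl t1 t2].
case: (ltgtP t l) tl => // [tl _|lt _].
  have tal : t \in `]a, l[ by rewrite in_itv/= at_.
  have [d dXt d0] := dX1 t tal t1; exists d => //.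
  apply: near_eq_is_derive dXt; have := near_itv tal; apply: filterS => u /itvP ual.
  by rewrite (ltW (_ : u < l)) ?ual.
have tlb : t \in `]l, b[ by rewrite in_itv/= lt.
have [d dXt d0] := dX2 t tlb t2; exists d => //.
apply: near_eq_is_derive dXt; have := near_itv tlb; apply: filterS => u /itvP ual.
by rewrite leNgt ual.
Qed.

Lemma parallel_in O O' (m : nat) a b c (Xi : R -> 'M[R]_(m, N)) : parallel O a b c Xi ->
  {in `[a, b], forall t, O' (c t)} -> parallel O' a b c Xi.
Proof. by move=> [cc pc Oc pX dX] Oc'; split. Qed.

(* A transport from the normal space at [p] to the one at [q] is extended by 0 on the tangent space. *)
Definition Tr O p q (g : 'M[R]_N) := exists a b c Xi,
  [/\ parallel O a b c Xi, c a = p, c b = q, Xi a = P p & Xi b = g].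

Lemma Tr_frame O p q g : Tr O p q g -> [/\ g *m g^T = P p, P p *m g = g, g^T *m g = P q & g *m P q = g].
Proof.
move=> [a [b [c [Xi [H ca cb Xa Xb]]]]]; have ab := ltW (parallel_lt H).
have bab : b \in `[a, b] by rewrite in_itv/= ab lexx.
have := parallel_frame H _ bab; rewrite ca Xb cb => /(_ Xa)[h1 h2 h3]; split=> //.
by have [_ _ _ [_ nX] _] := H; have := nX b bab; rewrite Xb cb.
Qed.

Lemma Tr_ends O p q g : Tr O p q g -> O p /\ O q.
Proof.
move=> [a [b [c [Xi [H <- <- Xa Xb]]]]]; have ab := ltW (parallel_lt H).
by have [_ _ Oc _ _] := H; split; apply: Oc; rewrite in_itv/= ab lexx.
Qed.

Lemma Tr_sub O O' p q g : O `<=` O' -> Tr O p q g -> Tr O' p q g.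
Proof.
move=> OO [a [b [c [Xi [H ca cb Xa Xb]]]]]; exists a, b, c, Xi; split=> //.
exact: parallel_sub OO H.
Qed.

Lemma Tr_refl O p : O p -> Tr O p p (P p).
Proof.
move=> Op; exists 0, 1, (fun=> p), (fun=> P p); split=> //; split=> //.
- exact/continuous_subspaceT/cst_continuous.
- by apply: pws_smooth => // k; exact: Ck_cst.
- split; first by apply: pws_smooth => // k; exact: Ck_cst.
  by move=> t _; have [] := normal_projP smf p.
exists [::] => t _ _; exists 0; last by rewrite mul0mx.
exact: is_derive_cst.
Qed.

Lemma Tr_sym O p q g : Tr O p q g -> Tr O q p g^T.
Proof.
move=> T; have [h1 h2 h3 h4] := Tr_frame T; move: T => [a [b [c [Xi [H ca cb Xa Xb]]]]].
exists (- b), (- a), (fun t => c (- t)), (fun t => g^T *m Xi (- t)); rewrite !opprK Xa Xb; split=> //.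
  exact/parallel_mulmx/parallel_reverse.
by have [PT _] := normal_projP smf p; rewrite -[in RHS]h2 trmx_mul PT.
Qed.

Lemma Tr_comp O p q r g h : Tr O p q g -> Tr O q r h -> Tr O p r (g *m h).
Proof.
move=> T T'; have [h1 h2 h3 h4] := Tr_frame T.
move: T T' => [a [b [c [Xi [H ca cb Xa Xb]]]]] [a' [b' [c' [Xi' [H' ca' cb' Xa' Xb']]]]].
have K := parallel_mulmx g (parallel_affine (a' - b) ltr01 H').
rewrite !divr1 subKr in K.
have ab := parallel_lt H; have := parallel_lt K; set e := (b' - _) => be.
have ee : a' - b + 1 * e = b' by rewrite /e mul1r; lra.
have eb : a' - b + 1 * b = a' by rewrite mul1r subrK.
have := parallel_cat H K _ _.
rewrite eb cb ca' Xb Xa' h4 => /(_ erefl erefl) L.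
eexists a, e, _, _; split; first exact: L.
- by rewrite /= ltW.
- by rewrite /= leNgt be/= ee.
- by rewrite /= ltW.
- by rewrite /= leNgt be/= ee Xb'.
Qed.

Lemma parallel_Tr O O' a b c (Xi : R -> 'M[R]_N) s t : parallel O a b c Xi -> Xi a = P (c a) ->
  a <= s -> s <= t -> t <= b -> {in `[s, t], forall u, O' (c u)} ->
  Tr O' (c s) (c t) ((Xi s)^T *m Xi t).
Proof.
move=> H Xa as_ st tb Oc.
have sab : s \in `[a, b] by rewrite in_itv/= as_ (le_trans st).
have [h1 h2 h3] := parallel_frame H Xa sab.
move: st; rewrite le_eqVlt => /predU1P[E|st].
  rewrite -E in Oc *; rewrite h3; apply: Tr_refl; apply: Oc; rewrite in_itv/=.
  by rewrite lexx.
exists s, t, c, (fun u => (Xi s)^T *m Xi u); split=> //.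
by apply/parallel_mulmx/(parallel_in (parallel_restrict H as_ st tb)).
Qed.

(* Loops in [O], not necessarily null-homotopic; elements extended by the identity as in [restricted_holonomy_of]. *)
Definition Hol O p : set 'M[R]_N := [set g | exists2 h, Tr O p p h & g = h + (1%:M - P p)].

Lemma Hol_mul p g h : P p *m h = h -> g *m P p = g ->
  (g + (1%:M - P p)) *m (h + (1%:M - P p)) = g *m h + (1%:M - P p).
Proof.
move=> Ph gP; have [_ PP] := normal_projP smf p.
by rewrite mulmxDl !mulmxDr !mulmxDl !mulmxN !mulNmx !mulmx1 !mul1mx Ph gP PP opprK !subrr addNr !addr0 add0r.
Qed.

Lemma Hol_group O p : O p -> orthogonal_group (Hol O p).
Proof.
move=> Op; split.
- by exists (P p); [exact: Tr_refl|rewrite addrC subrK].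
- move=> _ _ [g Tg ->] [h Th ->]; have [_ _ _ gP] := Tr_frame Tg; have [_ Ph _ _] := Tr_frame Th.
  by rewrite Hol_mul//; exists (g *m h); first exact: Tr_comp Tg Th.
- move=> _ [g Tg ->]; exists g^T; first exact: Tr_sym.
  by have [PT _] := normal_projP smf p; rewrite linearD linearB /= trmx1 PT.
move=> _ [g Tg ->]; have [PT _] := normal_projP smf p.
have [gg _ _ gP] := Tr_frame Tg; have [_ Ph _ _] := Tr_frame (Tr_sym Tg).
by rewrite linearD linearB /= trmx1 PT Hol_mul// gg addrC subrK.
Qed.

Lemma Hol_sub O O' p : O `<=` O' -> Hol O p `<=` Hol O' p.
Proof. by move=> OO _ [h Th ->]; exists h => //; exact: Tr_sub Th. Qed.

Lemma Hol_proj O p k : Hol O p k -> Tr O p p (P p *m k).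
Proof.
move=> [h Th ->]; have [_ PP] := normal_projP smf p; have [_ Ph _ _] := Tr_frame Th.
by rewrite mulmxDr mulmxBr mulmx1 PP subrr addr0 Ph.
Qed.

Lemma Hol_tangent O p k : Hol O p k -> k *m P p = P p *m k /\ (1%:M - P p) *m k = 1%:M - P p.
Proof.
move=> [h Th ->]; have [_ PP] := normal_projP smf p; have [_ Ph _ hP] := Tr_frame Th; split.
  by rewrite mulmxDl mulmxDr mulmxBl mulmxBr mul1mx mulmx1 PP subrr !addr0 Ph hP.
by rewrite mulmxDr !mulmxBl !mulmxBr !mul1mx !mulmx1 PP Ph !subrr !subr0 add0r.
Qed.

Lemma Hol_conj O p q g k : Tr O p q g -> Hol O p k -> Hol O q (g^T *m k *m g + (1%:M - P q)).
Proof.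
move=> Tg Hk; exists (g^T *m k *m g) => //.
have [_ Pg _ _] := Tr_frame Tg; have [PT _] := normal_projP smf p.
rewrite -{1}Pg trmx_mul PT -(mulmxA g^T).
exact: Tr_comp (Tr_comp (Tr_sym Tg) (Hol_proj Hk)) Tg.
Qed.

Lemma Hol_Tr O p q g g' : Tr O p q g -> Tr O p q g' -> Hol O p (g *m g'^T + (1%:M - P p)).
Proof. by move=> T T'; exists (g *m g'^T) => //; exact: Tr_comp T (Tr_sym T'). Qed.

End Transport.

(** * Restricted and local holonomy expressed by transports in charts *)

Section RestrictedHolonomy.
Context {R : realType} {M : topologicalType} {n N : nat}.
Variable f : M -> 'rV[R]_N.
Hypothesis smf : submanifold n f.
Implicit Types (O : set M) (p q : M) (c : R -> M) (a b : R).

Notation P := (@normal_proj R M n N f).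
Notation parallel := (@parallel R M n N f).
Notation Hol := (@Hol R M n N f).
Notation Tr := (@Tr R M n N f).

Lemma parallel_sum O (m : nat) a b c (I : Type) (r : seq I) (X : I -> R -> 'M[R]_(m, N)) : a < b ->
  {within `[a, b], continuous c} -> pws a b (f \o c) -> {in `[a, b], forall t, O (c t)} ->
  (forall i, parallel O a b c (X i)) -> parallel O a b c (fun t => \sum_(i <- r) X i t).
Proof.
move=> ab cc pc Oc H; elim: r => [|i r IH].
  rewrite (_ : (fun t => _) = fun=> 0); last by apply/funext => t; rewrite big_nil.
  split=> //; first by split; [apply: pws_smooth => // k; exact: Ck_cst|move=> t _; rewrite mul0mx].
  by exists [::] => t _ _; exists 0; [exact: is_derive_cst|rewrite mul0mx].
rewrite (_ : (fun t => _) = fun t => X i t + \sum_(j <- r) X j t); last by apply/funext => t; rewrite big_cons.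
have [_ _ _ [p1 n1] [s1 d1]] := H i; have [_ _ _ [p2 n2] [s2 d2]] := IH.
split=> //; first split.
- apply: pws_op p1 p2 => g1 g2 sg1 sg2 k; exact: CkD openT (sg1 k) (sg2 k).
- by move=> t tab; rewrite mulmxDl n1// n2.
exists (s1 ++ s2) => t tab; rewrite mem_cat negb_or => /andP[t1 t2].
have [d dX d0] := d1 t tab t1; have [d' dX' d0'] := d2 t tab t2.
exists (d + d'); first exact: is_deriveD.
by rewrite mulmxDl d0 d0' addr0.
Qed.

Lemma sum_delta_row (m k : nat) (A : 'M[R]_(m, k)) : \sum_i delta_mx i (0 : 'I_1) *m row i A = A.
Proof.
transitivity ((\sum_i delta_mx i (0 : 'I_1) *m delta_mx (0 : 'I_1) i) *m A).
  by rewrite mulmx_suml; apply: eq_bigr => i _; rewrite rowE mulmxA.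
rewrite -[RHS]mul1mx; congr (_ *m _); rewrite mx1_sum_delta.
by apply: eq_bigr => i _; rewrite mul_delta_mx.
Qed.

Lemma restricted_sub O O' p : O `<=` O' -> restricted_holonomy_of n f O p `<=` restricted_holonomy_of n f O' p.
Proof.
move=> OO g [c [[cc pc Oc c0 c1] [H [cH [OH HH]]] h1 h2]]; exists c; split=> //.
  by split=> // t /Oc/OO.
by exists H; split=> //; split=> // s t s1 t1; apply/OO/OH.
Qed.

(** The definition transports one normal vector at a time. A field is chosen for each row of the
    normal projection at [p], and the rows are assembled into one matrix-valued field. *)
Lemma restricted_parallel O p g : restricted_holonomy_of n f O p g -> exists c Xi,
  [/\ parallel O 0 1 c Xi, Xi 0 = P p, Xi 1 = P p *m g, piecewise_smooth_loop f O p c & null_homotopic O p c] /\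
  g = P p *m g + (1%:M - P p).
Proof.
move=> [c [loop nul tg ng]]; have [cc /piecewise_smoothE pc Oc c0 c1] := loop.
have [PT PP] := normal_projP smf p.
have /choice[xi Hxi] : forall i, exists x, parallel_normal_field n f c x /\
    x 0 = row i (P p) /\ x 1 = row i (P p) *m g.
  move=> i; have [|xi [h1 h2 h3]] := ng (row i (P p)); last by exists xi.
  by apply/(normal_spaceE smf); rewrite -row_mul PP.
exists c, (fun t => \sum_i delta_mx i (0 : 'I_1) *m xi i t); split; first split=> //.
- apply: parallel_sum => // i; apply: parallel_mulmx.
  have [[/piecewise_smoothE pxi nxi txi] _] := Hxi i.
  split=> //; first by split=> // t t01; apply/(normal_spaceE smf)/nxi.
  have [s ds] := pws_derivable pxi; exists s => t t01 ts.
  have dt := ds t t01 ts; exists (derive1 (xi i) t); first by rewrite derive1E; exact/derivableP.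
  by apply/(tangent_spaceE smf); exact: txi.
- rewrite -[RHS]sum_delta_row; apply: eq_bigr => i _; by rewrite (Hxi i).2.1.
- rewrite -[RHS]sum_delta_row; apply: eq_bigr => i _; by rewrite (Hxi i).2.2 row_mul.
rewrite -[LHS]mul1mx -[X in X *m _](subrK (P p)) mulmxDl addrC; congr (_ + _).
apply/row_matrixP => i; rewrite row_mul tg//; apply/(tangent_spaceE smf).
by rewrite -row_mul mulmxBl mul1mx PP subrr row0.
Qed.

Lemma restricted_Hol O p g : restricted_holonomy_of n f O p g -> Hol O p g.
Proof.
move=> /restricted_parallel[c [Xi [[pX X0 X1 [cc pc Oc c0 c1] _] gE]]].
by exists (P p *m g) => //; exists 0, 1, c, Xi; split.
Qed.

(** [parallel] asks for tangency only off a finite set, whereas [parallel_normal_field] asks for it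
    wherever the derivative exists. At such a point the derivative is that of the smooth piece [g]
    on the left; the normal part of [g'] is continuous and vanishes at points arbitrarily close on
    the left, so it vanishes at [t0]. *)
Lemma parallel_tangent O (m : nat) a b c (Xi : R -> 'M[R]_(m, N)) (t0 : R) d : parallel O a b c Xi ->
  t0 \in `]a, b[ -> is_derive t0 1 Xi d -> d *m P (c t0) = 0.
Proof.
move=> [cc pc Oc [pX nX] [s dX]] t0ab dXt0; have ab := pws_lt pc.
have /andP[at0 t0b] : a < t0 < b by move: t0ab; rewrite in_itv.
have [e [g [e0 ae sg cg]]] := pws_left_piece pX at0 (ltW t0b).
rewrite (left_derive_eq e0 cg dXt0 (smooth_is_derive t0 sg)).
apply/eqP/negPn/negP => k0.
pose k t := derive1 g t *m P (c t).
have dg : continuous (derive1 g).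
  have [_ /(_ 1) h] := sg 1%N.
  have -> : derive1 g = 'D_1 g by apply/funext => u; exact: derive1E.
  by move=> t; exact: h t I.
have ck : {within `[a, b], continuous k}.
  apply: within_mulmx; first exact: continuous_subspaceT.
  by apply: (@within_comp _ _ _ _ c P) => // t _; exact: normal_proj_continuous.
have ckc := within_clamp (ltW ab) ck.
have : \forall t \near t0, (k \o clamp a b) t != 0.
  apply: (cvgr_neq0 _ (ckc t0)).
  by rewrite /= clamp_id ?(ltW at0) ?(ltW t0b).
move=> /nbhs_ballP[r /= r0 Hr].
have [|t tI ts] := @avoid_finite R (t0 - Num.min r e) t0 s.
  by rewrite ltrBlDr ltrDl lt_min r0.
have mr : Num.min r e <= r by rewrite ge_min lexx.
have me : Num.min r e <= e by rewrite ge_min lexx orbT.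
have /andP[t1 t2] : t0 - Num.min r e < t < t0 by move: tI; rewrite in_itv.
have tab : t \in `]a, b[ by rewrite in_itv/=; apply/andP; split; lra.
have := Hr t; rewrite -ball_normE /= clamp_id; last by apply/andP; split; lra.
have -> : `|t0 - t| = t0 - t by rewrite gtr0_norm; lra.
move=> /(_ ltac:(lra)) /eqP; apply.
have [d' dXt' d0'] := dX t tab ts.
have := piece_derive sg cg (t := t); rewrite in_itv/= => /(_ ltac:(apply/andP; split; lra)) dXt.
by rewrite /k -(is_derive_unique dXt' dXt).
Qed.

(** The coordinates identify the range with R^n, so any loop there is contracted by straight
    segments to the base point; [Hol], which admits all loops, thus agrees with the restricted group
    on a chart. *)
Lemma chart_Hol phi q g : chart f phi -> range (phi : 'rV[R]_n -> M) q ->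
  Hol (range phi) q g -> restricted_holonomy_of n f (range phi) q g.
Proof.
move=> cp Wq Hg; have [gP gT] := Hol_tangent smf Hg; have TP := Hol_proj smf Hg.
move: TP => [a [b [c [Xi [H ca cb Xa Xb]]]]]; have ab := parallel_lt H.
have ba : 0 < b - a by rewrite subr_gt0.
have {H} := parallel_affine a ba H; rewrite subrr mul0r divff ?gt_eqF//.
set c' := (fun t : R => c _); set Xi' := (fun t : R => Xi _) => H.
have c0 : c' 0 = q by rewrite /c' mulr0 addr0.
have c1 : c' 1 = q by rewrite /c' mulr1 addrC subrK.
have X0 : Xi' 0 = P q by rewrite /Xi' mulr0 addr0.
have X1 : Xi' 1 = P q *m g by rewrite /Xi' mulr1 addrC subrK.
have [cc pc Oc [pX nX] [s dX]] := H.
exists c'; split.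
- by split=> //; exact/piecewise_smoothE.
- pose x t := chart_inv phi (c' (clamp 0 1 t)).
  have cx : continuous x.
    have cc' := within_clamp ler01 cc.
    move=> t; have [y _ yE] := Oc (clamp 0 1 t) (ltac:(rewrite in_itv/=; exact: clamp_in)).
    apply: (@continuous_comp _ _ _ (c' \o clamp 0 1) (chart_inv phi) t); first exact: cc'.
    by rewrite /= -yE; exact: (chart_inv_continuous (x := y) cp).
  have xE t : t \in `[0, 1] -> phi (x t) = c' t.
    move=> t01; rewrite /x clamp_id; last by move: t01; rewrite in_itv.
    by apply: chart_invK; exact: Oc.
  pose x0 := chart_inv phi q; have px0 : phi x0 = q by exact: chart_invK.
  exists (fun st => phi ((1 - st.1) *: x st.2 + st.1 *: x0)); split; [|split].
  + apply: continuous_subspaceT => st; apply: continuous_comp; last exact: chart_continuous cp _.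
    apply: cvgD; apply: cvgZ.
    * by apply: cvgB; [exact: cvg_cst|exact: cvg_fst].
    * by apply: continuous_comp; [exact: cvg_snd|exact: cx].
    * exact: cvg_fst.
    * exact: cvg_cst.
  + by move=> s0 t0 _ _; exists ((1 - s0) *: x t0 + s0 *: x0).
  move=> t t01 /=; have xx u : u \in `[0, 1] -> c' u = q -> x u = x0.
    by move=> u01 cu; apply: (chart_inj cp); rewrite xE// cu.
  have z01 : (0 : R) \in `[0, 1] by rewrite in_itv/= lexx ler01.
  have o01 : (1 : R) \in `[0, 1] by rewrite in_itv/= lexx ler01.
  split.
  + by rewrite subr0 scale1r scale0r addr0 xE.
  + by rewrite subrr scale0r add0r scale1r.
  + by rewrite (xx 0)// -scalerDl subrK scale1r.
  + by rewrite (xx 1)// -scalerDl subrK scale1r.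
- move=> v /(tangent_spaceE smf) vP.
  have vE : v = v *m (1%:M - P q) by rewrite mulmxBr mulmx1 vP subr0.
  by rewrite {1}vE -mulmxA gT -vE.
move=> u /(normal_spaceE smf) uP; exists (fun t => u *m Xi' t).
have HU := parallel_mulmx u H.
have [_ _ _ [pU nU] _] := HU.
split; [split|by rewrite X0|by rewrite X1 mulmxA uP].
- exact/piecewise_smoothE.
- by move=> t t01; apply/(normal_spaceE smf); exact: nU.
move=> t t01 /derivableP dU; apply/(tangent_spaceE smf).
by rewrite derive1E; exact: parallel_tangent HU t01 dU.
Qed.

(** Ranges of charts centred at [p] form a neighbourhood basis, and by [chart_Hol] null-homotopy may
    be dropped on each of them. *)
Lemma local_HolP p g : local_holonomy n f p g <->
  forall phi, chart f phi -> phi (0 : 'rV[R]_n) = p -> Hol (range phi) p g.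
Proof.
split=> [lg phi cp p0|H U [oU Up]].
  apply: restricted_Hol; apply: lg; split; first exact: (chart_range_open cp).
  by exists 0.
have [phi [cp p0 pU]] := chart_small smf oU Up.
by apply: (restricted_sub pU); apply: chart_Hol (H phi cp p0); last by exists 0.
Qed.

End RestrictedHolonomy.

(** * Connection forms and radial gauges *)

Section Chains.
Context {R : realType}.

Lemma smooth_derivable {V W : normedModType R} (G : V -> W) x v : smooth_on setT G -> is_derive x v G ('D_v G x).
Proof. by move=> sG; have [dG _] := sG 1%N; apply/derivableP; apply: diff_derivable; exact: dG. Qed.

Lemma smooth_derive {V W : normedModType R} (G : V -> W) v : smooth_on setT G -> smooth_on setT ('D_v G).
Proof. by move=> sG k; have [_] := sG k.+1; apply. Qed.

Lemma derive_smooth_lin {V W : normedModType R} (G : V -> W) x (a : R) u v : smooth_on setT G ->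
  'D_(a *: u + v) G x = a *: 'D_u G x + 'D_v G x.
Proof. by move=> sG; have [dG _] := sG 1%N; rewrite !deriveE ?linearP//; exact: dG. Qed.

Lemma derive_smooth_sum {n : nat} {W : normedModType R} (G : 'rV[R]_n -> W) x v : smooth_on setT G ->
  'D_v G x = \sum_i v 0 i *: 'D_(delta_mx 0 i) G x.
Proof.
move=> sG; have [dG _] := sG 1%N; rewrite deriveE ?linear_rV; last exact: dG.
by apply: eq_bigr => i _; rewrite deriveE//; exact: dG.
Qed.

Lemma is_derive_comp_smooth {V W : normedModType R} (G : V -> W) (x : R -> V) (t : R) d :
  smooth_on setT G -> is_derive t 1 x d -> is_derive t 1 (G \o x) ('D_d G (x t)).
Proof.
move=> sG dx; have [dG _] := sG 1%N.
have dxt : differentiable x t by apply/derivable1_diffP; exact: (@ex_derive _ _ _ _ _ _ _ dx).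
have dGx : differentiable (G \o x) t by apply: differentiable_comp => //; exact: dG.
have /derivableP : derivable (G \o x) t 1 by apply/derivable1_diffP.
rewrite [in X in is_derive _ _ _ X -> _]deriveE// diff_comp//; last exact: dG.
have -> // : ('d G (x t) \o 'd x t) 1 = 'D_d G (x t).
rewrite /= [RHS]deriveE; last exact: dG.
by congr ('d G (x t) _); rewrite -deriveE// (@derive_val _ _ _ _ _ _ _ dx).
Qed.

Lemma smooth_affine {W : normedModType R} (n : nat) (G : 'rV[R]_n -> W) (x v : 'rV[R]_n) : smooth_on setT G ->
  smooth_on setT (fun t : R => G (x + t *: v)).
Proof.
move=> sG k; elim: k G sG => [|k IH] G sG.
  move=> t _; apply: continuous_comp; last exact: (sG 0%N).
  by apply: cvgD; [exact: cvg_cst|apply: cvgZ; [exact: cvg_id|exact: cvg_cst]].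
have dg (t : R) : is_derive t 1 (fun t => G (x + t *: v)) ('D_v G (x + t *: v)).
  by apply: is_derive_line; exact: smooth_derivable.
have dG (t : R) : differentiable (fun t : R => G (x + t *: v)) t.
  by apply/derivable1_diffP; exact: (@ex_derive _ _ _ _ _ _ _ (dg t)).
split=> [t _|h]; first exact: dG.
have -> : 'D_h (fun t : R => G (x + t *: v)) = fun t => h *: 'D_v G (x + t *: v).
  by apply/funext => t; rewrite deriveE// (diff1E (dG t)) derive1E (@derive_val _ _ _ _ _ _ _ (dg t)).
by apply: (CkZ _ openT); exact: (IH _ (smooth_derive v sG)).
Qed.

Lemma ode_smooth (q : nat) (A Y : R -> 'M[R]_q) : smooth_on setT A -> ode_sol A Y -> smooth_on setT Y.
Proof.
move=> sA [Y0 dY]; elim=> [|k IH]; first by move=> t _; exact: is_derive_continuous (dY t).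
have dG (t : R) : differentiable Y t by apply/derivable1_diffP; exact: (@ex_derive _ _ _ _ _ _ _ (dY t)).
split=> [t _|h]; first exact: dG.
have -> : 'D_h Y = fun t => h *: (Y t *m A t).
  by apply/funext => t; rewrite deriveE// (diff1E (dG t)) derive1E (@derive_val _ _ _ _ _ _ _ (dY t)).
by apply: (CkZ _ openT); exact: Ck_mulmx openT IH (sA k).
Qed.

End Chains.

Section ProjectionAlgebra.
Context {R : realType} {N : nat}.
Implicit Types P D Q : 'M[R]_N.

(* [D] stands for a derivative of the projection [P]. *)
Lemma proj_sandwich P D : P *m P = P -> D *m P + P *m D = D -> P *m D *m P = 0.
Proof.
move=> PP DE; have : P *m (D *m P + P *m D) *m P = P *m D *m P by rewrite DE.
rewrite mulmxDr mulmxDl !mulmxA PP -(mulmxA _ P P) PP => /eqP.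
by rewrite addrC -subr_eq0 addrK => /eqP.
Qed.

Lemma proj_connection P D : P *m P = P -> D *m P + P *m D = D ->
  let K := P *m D - D *m P in (K *m P = - (D *m P)) /\ (P *m K = P *m D).
Proof.
move=> PP DE; have S := proj_sandwich PP DE.
by rewrite /= mulmxBl mulmxBr !mulmxA S PP -(mulmxA D) PP sub0r subr0.
Qed.

End ProjectionAlgebra.

(** * Transport along segments and the radial gauge of a chart *)

Section ChartTransport.
Context {R : realType} {M : topologicalType} {n N : nat}.
Variable f : M -> 'rV[R]_N.
Hypothesis smf : submanifold n f.
Variable phi : 'rV[R]_n -> M.
Hypothesis cp : chart f phi.

Notation Tr := (@Tr R M n N f).
Notation Hol := (@Hol R M n N f).
Notation V := 'rV[R]_n.
Local Notation W := (range phi).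

Lemma cproj_sig : {p : V -> 'M[R]_N | forall x, p x = nproj (f \o phi) x}.
Proof. by exists (nproj (f \o phi)). Qed.

(* The opaque witness keeps unification from unfolding the projection. *)
Definition cproj : V -> 'M[R]_N := sval cproj_sig.
Local Notation P := cproj.

Lemma cproj_nproj x : P x = nproj (f \o phi) x.
Proof. exact: (svalP cproj_sig). Qed.

Lemma cproj_smooth : smooth_on setT P.
Proof.
by rewrite (funext cproj_nproj) => k; apply: nproj_smooth; [exact: chart_smooth|exact: chart_imm].
Qed.

Lemma cproj_proj x : orth_proj (P x).
Proof. by rewrite cproj_nproj; apply: nproj_proj; [exact: chart_smooth|exact: chart_imm]. Qed.

Lemma cprojE x : @normal_proj R M n N f (phi x) = P x.
Proof. by rewrite cproj_nproj; exact: normal_proj_chart. Qed.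

Lemma cproj_derive x v : 'D_v P x *m P x + P x *m 'D_v P x = 'D_v P x.
Proof.
have dP (t : R) : is_derive t 1 (fun t => P (x + t *: v)) ('D_v P (x + t *: v)).
  by apply: is_derive_line; exact/smooth_derivable/cproj_smooth.
have := is_derive_mulmx (dP 0) (dP 0); rewrite scale0r addr0 => d2.
have d1 := dP 0; rewrite scale0r addr0 in d1; apply: is_derive_unique d2 _.
rewrite (_ : (fun t => _) = fun t => P (x + t *: v))//.
by apply/funext => t; have [] := cproj_proj (x + t *: v).
Qed.

Lemma cproj_derive_sym x v : ('D_v P x)^T = 'D_v P x.
Proof.
have dP (t : R) : is_derive t 1 (fun t => P (x + t *: v)) ('D_v P (x + t *: v)).
  by apply: is_derive_line; exact/smooth_derivable/cproj_smooth.
have := is_derive_trmx (dP 0); rewrite scale0r addr0 => d2.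
have d1 := dP 0; rewrite scale0r addr0 in d1; apply: is_derive_unique d2 _.
rewrite (_ : (fun t => _) = fun t => P (x + t *: v))//.
by apply/funext => t; have [] := cproj_proj (x + t *: v).
Qed.

(* The connection [P dP - dP P] on the trivial bundle has [P] as a parallel section
   and induces the normal connection on its image. *)
Definition conn (x v : V) : 'M[R]_N := P x *m 'D_v P x - 'D_v P x *m P x.

Lemma conn_skew x v : (conn x v)^T = - conn x v.
Proof.
have [PT _] := cproj_proj x.
by rewrite /conn linearB /= !trmx_mul cproj_derive_sym PT opprB.
Qed.

Lemma conn_proj x v : conn x v *m P x = - ('D_v P x *m P x) /\ P x *m conn x v = P x *m 'D_v P x.
Proof. by have [_ PP] := cproj_proj x; exact: (proj_connection PP (cproj_derive x v)). Qed.

Lemma conn_commute x v : conn x v *m P x + 'D_v P x = P x *m conn x v.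
Proof.
have [-> ->] := conn_proj x v.
by rewrite -{2}(cproj_derive x v) addKr.
Qed.

Lemma connZ x (s : R) v : conn x (s *: v) = s *: conn x v.
Proof.
rewrite /conn -[s *: v]addr0 derive_smooth_lin; last exact: cproj_smooth.
rewrite (_ : 'D_0 P x = 0) ?addr0 -?scalemxAr -?scalemxAl -?scalerBr//.
by rewrite deriveE ?linear0//; have [dP _] := cproj_smooth 1%N; exact: dP.
Qed.

Lemma conn_smooth v : smooth_on setT (fun x => conn x v).
Proof.
move=> k; have sP := cproj_smooth k; have sD := smooth_derive v cproj_smooth k.
by apply: (CkB openT); exact: Ck_mulmx openT _ _.
Qed.

Definition seg_ode x v Y := ode_sol (fun t => conn (x + t *: v) v) Y.

Lemma seg_smooth x v : smooth_on setT (fun t : R => conn (x + t *: v) v).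
Proof. exact: (smooth_affine x v (conn_smooth v)). Qed.

Lemma seg_continuous x v : continuous (fun t : R => conn (x + t *: v) v).
Proof. by move=> t; exact: (seg_smooth x v 0%N). Qed.

Lemma seg_ode_ex x v : exists Y, seg_ode x v Y.
Proof. exact: ode_sol_ex (@seg_continuous x v). Qed.

(** The difference of the two sides solves the same linear equation and vanishes at 0, since the
    projection is parallel for [conn]. *)
Lemma seg_ode_commute x v Y t : seg_ode x v Y -> P x *m Y t = Y t *m P (x + t *: v).
Proof.
move=> sY; have [Y0 dY] := sY.
pose y t := P x *m Y t - Y t *m P (x + t *: v).
have dP (u : R) : is_derive u 1 (fun t => P (x + t *: v)) ('D_v P (x + u *: v)).
  by apply: is_derive_line; exact/smooth_derivable/cproj_smooth.
have dy (u : R) : is_derive u 1 y (y u *m conn (x + u *: v) v).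
  apply: (is_derive_eq (is_deriveB (is_derive_mulmxl (P x) (dY u)) (is_derive_mulmx (dY u) (dP u)))).
  rewrite /y mulmxBl -!mulmxA -mulmxDr conn_commute //.
have := ode_unique (@seg_continuous x v) sY dy t.
rewrite /y Y0 scale0r addr0 mulmx1 mul1mx subrr mul0mx => /eqP.
by rewrite subr_eq0 => /eqP.
Qed.

Lemma seg_ode_orth x v Y t : seg_ode x v Y -> Y t *m (Y t)^T = 1%:M.
Proof.
move=> [Y0 dY].
have dYY (u : R) : is_derive u 1 (fun t => Y t *m (Y t)^T) 0.
  apply: (is_derive_eq (is_derive_mulmx (dY u) (is_derive_trmx (dY u)))).
  by rewrite trmx_mul conn_skew mulNmx mulmxN mulmxA subrr.
by rewrite (mx_derive0_const t 0 dYY) Y0 trmx1 mulmx1.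
Qed.

Lemma seg_ode_scale x v Y (s : R) : seg_ode x v Y -> seg_ode x (s *: v) (fun t => Y (s * t)).
Proof.
move=> [Y0 dY]; split; first by rewrite mulr0.
move=> t; have := is_derive_comp1 (is_derive_lin s t) (dY (s * t)).
by rewrite scalerA [t * s]mulrC connZ -scalemxAr.
Qed.

Lemma seg_Tr x v Y (s : R) : seg_ode x v Y -> Tr W (phi x) (phi (x + s *: v)) (P x *m Y s).
Proof.
move=> sY; have := seg_ode_scale s sY; set v' := s *: v; set Y' := (fun t => _) => sY'.
have -> : Y s = Y' 1 by rewrite /Y' mulr1.
have [Y0 dY] := sY'; have smY := ode_smooth (seg_smooth x v') sY'.
exists 0, 1, (fun t => phi (x + t *: v')), (fun t => P x *m Y' t); rewrite scale0r addr0 scale1r Y0 mulmx1 cprojE; split=> //.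
split.
- apply: continuous_subspaceT => t; apply: continuous_comp; last exact: chart_continuous cp _.
  by apply: cvgD; [exact: cvg_cst|apply: cvgZ; [exact: cvg_id|exact: cvg_cst]].
- by apply: pws_smooth => //; exact: (smooth_affine x v' (chart_smooth cp)).
- by move=> t _; exists (x + t *: v').
- split; first by apply: pws_smooth => // k; apply: (Ck_mulmx openT); [exact: Ck_cst|exact: smY].
  by move=> t _; rewrite cprojE (seg_ode_commute t sY') -mulmxA; have [_ ->] := cproj_proj (x + t *: v').
exists [::] => t _ _; exists (P x *m (Y' t *m conn (x + t *: v') v')); first exact: is_derive_mulmxl.
rewrite cprojE mulmxA (seg_ode_commute t sY') -!mulmxA (conn_proj _ _).1 mulmxN mulmxA.
by have [_ PP] := cproj_proj (x + t *: v'); rewrite (proj_sandwich PP (cproj_derive _ _)) oppr0 mulmx0.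
Qed.

Lemma Tr_chart x y : exists g, Tr W (phi x) (phi y) g.
Proof.
have [Y sY] := seg_ode_ex x (y - x); have := seg_Tr 1 sY.
by rewrite scale1r addrC subrK => T; exists (P x *m Y 1).
Qed.

Definition radial_gauge Q := smooth_on setT Q /\ forall x : V, seg_ode 0 x (fun t => Q (t *: x)).

(** [Q x] is the transport along the ray from 0 to [x], so its smoothness is smooth dependence on
    the parameter [x]. That [Q (t x)] is the transport along the ray of [x] up to time [t] follows
    from rescaling the time and uniqueness. *)
Lemma radial_gauge_ex : exists Q, radial_gauge Q.
Proof.
have [Y HY] := choice (seg_ode_ex 0).
exists (fun x => Y x 1); split.
  move=> k; pose A (p : V * R) := conn (p.2 *: p.1) p.1.
  have cfst : continuous (fst : V * R -> V) by move=> p; exact: cvg_fst.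
  have csnd : continuous (snd : V * R -> R) by move=> p; exact: cvg_snd.
  apply: (@ode_smooth_dependence _ _ k _ A Y) => [|x]; last first.
    have E : (fun t : R => conn (0 + t *: x) x) = fun t => A (x, t) by apply/funext => t; rewrite /A add0r.
    by rewrite -E; exact: HY.
  have sth : Ck k setT (fun p : V * R => p.2 *: p.1).
    apply: (Ck_mx openT) => i j.
    apply: (@Ck_eq _ _ _ _ _ (fun p : V * R => p.2 * p.1 i j) _ openT) => [p _|]; first by rewrite mxE.
    apply: (CkM openT); first exact: (Ck_linear k setT (L := snd) csnd).
    by apply: (Ck_coord _ _ openT); exact: (Ck_linear k setT (L := fst) cfst).
  have sD : Ck k setT (fun p : V * R => 'D_(p.1) P (p.2 *: p.1)).
    apply: (@Ck_eq _ _ _ _ _ (fun p : V * R => \sum_i p.1 0 i *: 'D_(delta_mx 0 i) P (p.2 *: p.1)) _ openT) => [p _|].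
      by rewrite -derive_smooth_sum//; exact: cproj_smooth.
    apply: Ck_sum => [|i _]; first exact: openT.
    apply: (Ck_mx openT) => a b.
    apply: (@Ck_eq _ _ _ _ _ (fun p : V * R => p.1 0 i * ('D_(delta_mx 0 i) P (p.2 *: p.1)) a b) _ openT) => [p _|]; first by rewrite mxE.
    apply: (CkM openT).
      by apply: (Ck_coord _ _ openT); exact: (Ck_linear k setT (L := fst) cfst).
    apply: (Ck_coord _ _ openT).
    exact: (Ck_comp_mx openT openT (fun _ _ => I) (smooth_derive (delta_mx 0 i) cproj_smooth k) sth).
  have sP : Ck k setT (fun p : V * R => P (p.2 *: p.1)).
    exact: (Ck_comp_mx openT openT (fun _ _ => I) (cproj_smooth k) sth).
  by apply: (CkB openT); exact: Ck_mulmx openT _ _.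
move=> x; have [Y0 dY] := HY x.
rewrite (_ : (fun t => _) = Y x)//; apply/funext => t.
have := ode_unique (@seg_continuous 0 (t *: x)) (HY (t *: x)) (seg_ode_scale t (HY x)).2 1.
by rewrite mulr1 mulr0 Y0 mul1mx => ->.
Qed.

End ChartTransport.

Section Gauge.
Context {R : realType} {M : topologicalType} {n N : nat}.
Variable f : M -> 'rV[R]_N.
Hypothesis smf : submanifold n f.
Variable phi : 'rV[R]_n -> M.
Hypothesis cp : chart f phi.

Notation Tr := (@Tr R M n N f).
Notation Hol := (@Hol R M n N f).
Notation V := 'rV[R]_n.
Local Notation W := (range phi).
Local Notation P := (cproj f phi).
Local Notation K := (conn f phi).

Variable Q : V -> 'M[R]_N.
Hypothesis rQ : radial_gauge f phi Q.

Lemma gauge_smooth : smooth_on setT Q. Proof. by case: rQ. Qed.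

Lemma gauge_seg x : seg_ode f phi 0 x (fun t => Q (t *: x)). Proof. by case: rQ. Qed.

Lemma gauge0 : Q 0 = 1%:M.
Proof. by have [] := gauge_seg 0; rewrite scale0r. Qed.

Lemma gauge_commute x : P 0 *m Q x = Q x *m P x.
Proof. by have := seg_ode_commute cp 1 (gauge_seg x); rewrite /= !scale1r add0r. Qed.

Lemma gauge_orth x : Q x *m (Q x)^T = 1%:M.
Proof. by have := seg_ode_orth cp 1 (gauge_seg x); rewrite /= !scale1r. Qed.

Lemma gauge_orthV x : (Q x)^T *m Q x = 1%:M.
Proof. exact: mulmx1C (gauge_orth x). Qed.

Lemma gauge_commuteT x : (Q x)^T *m P 0 = P x *m (Q x)^T.
Proof.
have [PT _] := cproj_proj cp 0; have [PT' _] := cproj_proj cp x.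
by rewrite -[LHS]trmxK trmx_mul trmxK PT gauge_commute trmx_mul PT'.
Qed.

Lemma gauge_Tr x : Tr W (phi 0) (phi x) (P 0 *m Q x).
Proof. by have := seg_Tr cp 1 (gauge_seg x); rewrite !scale1r add0r. Qed.

Lemma gauge_derive x v : is_derive x v Q ('D_v Q x).
Proof. exact/smooth_derivable/gauge_smooth. Qed.

Lemma gauge_derive_line x v : is_derive (0 : R) 1 (fun t : R => Q (x + t *: v)) ('D_v Q x).
Proof. by apply: is_derive_line; rewrite scale0r addr0; exact: gauge_derive. Qed.

Lemma cproj_derive_line x v : is_derive (0 : R) 1 (fun t : R => P (x + t *: v)) ('D_v P x).
Proof. by apply: is_derive_line; rewrite scale0r addr0; exact/smooth_derivable/cproj_smooth. Qed.

Lemma gauge_derive_orth x v : 'D_v Q x *m (Q x)^T = - (Q x *m ('D_v Q x)^T).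
Proof.
have d := gauge_derive_line x v; have := is_derive_mulmx d (is_derive_trmx d).
rewrite scale0r addr0 (_ : (fun t => _) = fun=> 1%:M); last by apply/funext => t; rewrite gauge_orth.
by move=> h; have /eqP := is_derive_unique h (is_derive_cst _ _ _); rewrite addr_eq0 => /eqP.
Qed.

Lemma gauge_derive_commute x v : P 0 *m 'D_v Q x = 'D_v Q x *m P x + Q x *m 'D_v P x.
Proof.
have d := gauge_derive_line x v; have := is_derive_mulmx d (cproj_derive_line x v).
rewrite scale0r addr0; apply: is_derive_unique.
have := is_derive_mulmxl (P 0) d; rewrite (_ : (fun t => _) = fun t => Q (x + t *: v) *m P (x + t *: v))//.
by apply/funext => t; rewrite gauge_commute.
Qed.

(* The connection form in the gauge [Q]. *)
Definition gform x v := (Q x *m K x v - 'D_v Q x) *m (Q x)^T.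
Definition nform x v := P 0 *m gform x v.

Lemma gform_commute x v : gform x v *m P 0 = P 0 *m gform x v.
Proof.
rewrite /gform -mulmxA gauge_commuteT mulmxA; rewrite [RHS]mulmxA; congr (_ *m _).
rewrite mulmxBl [RHS]mulmxBr gauge_derive_commute.
rewrite mulmxA gauge_commute -[Q x *m P x *m K x v]mulmxA -(conn_commute cp) mulmxDr mulmxA.
by rewrite opprD addrACA subrr addr0.
Qed.

(** Consider the loop that runs along the ray to [x], then along the segment to [x + s v], and back
    along the ray. Its holonomy [ga s] is smooth in [s], and its velocity at [s = 0] is the
    connection form in the gauge. *)
Lemma nform_velocity x v : velocity (Hol W (phi 0)) (nform x v).
Proof.
have [Z sZ] := seg_ode_ex cp x v; have [Z0 dZ] := sZ.
have smZ := ode_smooth (seg_smooth cp x v) sZ.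
have smQ : smooth_on setT (fun s : R => Q (x + s *: v)) by exact: smooth_affine gauge_smooth.
pose ga s := P 0 *m (Q x *m Z s *m (Q (x + s *: v))^T *m P 0) + (1%:M - P 0).
have gaE s : P 0 *m Q x *m (P x *m Z s) *m (P 0 *m Q (x + s *: v))^T = P 0 *m (Q x *m Z s *m (Q (x + s *: v))^T *m P 0).
  have [PT _] := cproj_proj cp 0.
  rewrite trmx_mul PT !mulmxA -[P 0 *m Q x *m P x]mulmxA -gauge_commute !mulmxA.
  by have [_ ->] := cproj_proj cp 0.
exists ga; split.
- move=> k; apply: (CkD openT); last exact: Ck_cst.
  apply: (Ck_mulmx openT); first exact: Ck_cst.
  apply: (Ck_mulmx openT); last exact: Ck_cst.
  apply: (Ck_mulmx openT); last exact: Ck_trmx openT (smQ k).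
  by apply: (Ck_mulmx openT); [exact: Ck_cst|exact: smZ].
- rewrite /ga -gaE Z0 scale0r addr0 mulmx1.
  have [PT PP] := cproj_proj cp 0.
  rewrite -[P 0 *m Q x *m P x]mulmxA -gauge_commute trmx_mul PT !mulmxA PP.
  by rewrite -(mulmxA (P 0) (Q x)) gauge_orth mulmx1 PP addrC subrK.
- move=> t; rewrite /ga -gaE; eexists; last by rewrite (cprojE cp).
  exact: (Tr_comp smf (Tr_comp smf (gauge_Tr x) (seg_Tr cp t sZ)) (Tr_sym smf (gauge_Tr _))).
have dga := is_derive_mulmxl (P 0) (is_derive_mulmxr (P 0) (is_derive_mulmx (is_derive_mulmxl (Q x) (dZ 0)) (is_derive_trmx (gauge_derive_line x v)))).
apply: (is_derive_eq (is_deriveD dga (is_derive_cst _ _ _))).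
rewrite scale0r !addr0 Z0 mul1mx mulmx1.
have -> : Q x *m K x v *m (Q x)^T + Q x *m ('D_v Q x)^T = gform x v.
  by rewrite /gform mulmxBl gauge_derive_orth opprK.
by rewrite gform_commute mulmxA; have [_ ->] := cproj_proj cp 0.
Qed.

Lemma gform_sum x v : gform x v = \sum_i v 0 i *: gform x (delta_mx 0 i).
Proof.
have DQ := derive_smooth_sum x v gauge_smooth.
have DP := derive_smooth_sum x v (cproj_smooth cp).
rewrite /gform /conn DQ DP !(mulmx_sumr, mulmx_suml) -sumrB mulmx_sumr -sumrB mulmx_suml.
by apply: eq_bigr => i _; rewrite -!(scalemxAl, scalemxAr) -scalerBr -scalemxAr -scalerBr scalemxAl.
Qed.

Lemma gform_smooth v : smooth_on setT (fun x => gform x v).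
Proof.
move=> k; have sQ := gauge_smooth k; have sDQ := smooth_derive v gauge_smooth k.
apply: (Ck_mulmx openT); last exact: (Ck_trmx openT sQ).
by apply: (CkB openT) => //; apply: (Ck_mulmx openT sQ); exact: (conn_smooth cp v).
Qed.

Section Generation.
Variable G : set 'M[R]_N.
Hypothesis GG : orthogonal_group G.
Hypothesis nG : forall x v, velocity G (nform x v).

(* In the gauge [Q], parallel transport along any curve solves [g' = g w] with [w] a
   value of the connection form. *)
Lemma Hol_generated : Hol W (phi 0) `<=` G.
Proof.
move=> _ [h [a [b [c [Xi [H ca cb Xa Xb]]]]] ->].
have [L LP] := lie_algebra_ex GG.
have ab := parallel_lt H; have [cc pc Oc [pX nX] [s dX]] := H.
pose x t := chart_inv phi (c (clamp a b t)).
have cx : continuous x.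
  have cc' := within_clamp (ltW ab) cc.
  move=> t; have [y _ yE] := Oc (clamp a b t) (ltac:(rewrite in_itv/=; exact: clamp_in (ltW ab))).
  apply: (@continuous_comp _ _ _ (c \o clamp a b) (chart_inv phi) t); first exact: cc'.
  by rewrite /= -yE; exact: (chart_inv_continuous (x := y) cp).
have xE t : t \in `[a, b] -> phi (x t) = c t.
  move=> tab; rewrite /x clamp_id; last by move: tab; rewrite in_itv.
  by apply: chart_invK; exact: Oc.
have aab : a \in `[a, b] by rewrite in_itv/= lexx ltW.
have bab : b \in `[a, b] by rewrite in_itv/= lexx ltW.
have xa : x a = 0 by apply: (chart_inj cp); rewrite xE.
have xb : x b = 0 by apply: (chart_inj cp); rewrite xE.
(* The transport read in the gauge; the identity on the tangent space is added so that it is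
   comparable with elements of [G]. *)
pose g t := Xi t *m (Q (x t))^T + (1%:M - P 0).
have cQ : continuous (fun t => (Q (x t))^T).
  move=> t; apply: (@continuous_comp _ _ _ x (fun y => (Q y)^T) t); first exact: cx.
  exact: (Ck_trmx openT (gauge_smooth 0%N)).
have cg : {within `[a, b], continuous g}.
  have cXQ : {within `[a, b], continuous (fun t => Xi t *m (Q (x t))^T)}.
    by apply: within_mulmx (pws_continuous pX) _; exact: continuous_subspaceT.
  by move=> t; exact: (@cvgD _ _ _ (nbhs (t : subspace `[a, b])) _ _ _ _ _ (cXQ t) (cvg_cst _)).
(* [arc_in_group] needs a continuous [w], but the velocity of the curve may jump at the break
   points; it is applied on each smooth piece and the group elements are multiplied. *)
have arc y a' b' : pws a' b' y -> a <= a' -> b' <= b -> {in `[a', b'], y =1 f \o c} -> exists2 k, G k & g b' = g a' *m k.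
  elim=> {y a' b'} [a' b' y ge ab' sge yg|a' m b' y p1 IH1 p2 IH2] aa bb yc; last first.
    have m1 := pws_lt p1; have m2 := pws_lt p2.
    have [|t tI|k1 G1 E1] := IH1 aa; first exact: le_trans (ltW m2) bb.
      by apply: yc; move: tI; rewrite !in_itv/= => /andP[-> /le_trans->]//; exact: ltW.
    have [||t tI|k2 G2 E2] := IH2; [exact: le_trans aa (ltW m1)|exact: bb| |].
      by apply: yc; move: tI; rewrite !in_itv/= => /andP[h1 ->]; rewrite (le_trans (ltW m1)).
    exists (k1 *m k2); last by rewrite mulmxA -E1 -E2.
    by case: GG => _ + _ _; apply.
  pose v t := derive1 ge t *m jinv (f \o phi) (x t).
  pose w t := nform (x t) (v t).
  have sab : `[a', b'] `<=` `[a, b].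
    by move=> t; rewrite /= !in_itv/= => /andP[h1 h2]; rewrite (le_trans aa)// (le_trans h2).
  apply: (arc_in_group GG LP (w := w) (s := s) (ltW ab')).
  - exact: continuous_subspaceW sab cg.
  - apply: continuous_subspaceT => t.
    have cv : {for t, continuous v}.
      have cge : continuous (derive1 ge).
        have [_ /(_ 1) hh] := sge 1%N.
        have -> : derive1 ge = 'D_1 ge by apply/funext => u; exact: derive1E.
        by move=> u; exact: hh u I.
      apply: (@cvg_mulmx R _ (nbhs t) (nbhs_filter t)); first exact: cge.
      apply: (@continuous_comp _ _ _ x (jinv (f \o phi)) t); first exact: cx.
      exact: (jinv_smooth (chart_smooth cp) (chart_imm cp) 0).
    rewrite /continuous_at /w /nform.
    rewrite (_ : (fun t => _) = fun t => P 0 *m \sum_i v t 0 i *: gform (x t) (delta_mx 0 i)); last first.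
      by apply/funext => u; rewrite gform_sum.
    rewrite (gform_sum (x t) (v t)).
    apply: (@cvg_mulmx R _ (nbhs t) (nbhs_filter t)); first exact: cvg_cst.
    apply/cvg_mxP => i j; rewrite summxE.
    rewrite (_ : (fun t => _) = fun t => \sum_k v t 0 k * gform (x t) (delta_mx 0 k) i j); last first.
      by apply/funext => u; rewrite summxE; apply: eq_bigr => k _; rewrite mxE.
    apply: (@cvg_sumr R _ (nbhs t) (nbhs_filter t)) => k; rewrite mxE.
    apply: (@cvgM _ _ (nbhs t) (nbhs_filter t)).
      exact: (continuous_mxP v t).1 cv 0 k.
    have cgf : {for t, continuous (fun t => gform (x t) (delta_mx 0 k))}.
      apply: (@continuous_comp _ _ _ x (fun y => gform y (delta_mx 0 k)) t); first exact: cx.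
      exact: (gform_smooth (delta_mx 0 k) 0%N).
    exact: (continuous_mxP _ t).1 cgf i j.
  - by move=> t _; apply/LP; exact: nG.
  move=> t tab' ts.
  have tab : t \in `]a, b[.
    by move: tab'; rewrite !in_itv/= => /andP[h1 h2]; rewrite (le_lt_trans aa)// (lt_le_trans h2).
  have [d dXt d0] := dX t tab ts.
  have dy := piece_derive sge yg tab'.
  have [dx _] : is_derive t 1 x (v t) /\ derive1 ge t *m nproj (f \o phi) (x t) = 0.
    apply: (lift_derive (chart_smooth cp) (chart_imm cp) (y := y)) => //; first exact: cx.
    have := near_itv tab'; apply: filterS => u uab'.
    rewrite /= xE; last by apply: sab; exact: subset_itv_oo_cc.
    by rewrite yc//; exact: subset_itv_oo_cc.
  have dQ := is_derive_trmx (is_derive_comp_smooth gauge_smooth dx).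
  have dP := is_derive_comp_smooth (cproj_smooth cp) dx.
  have XP : Xi t *m P (x t) = Xi t.
    by rewrite -(cprojE cp) xE ?nX//; exact: subset_itv_oo_cc.
  have dP0 : d *m P (x t) = 0 by rewrite -(cprojE cp) xE//; exact: subset_itv_oo_cc.
  have dE : d = Xi t *m 'D_(v t) P (x t).
    have := is_derive_mulmx dXt dP; rewrite /= dP0 add0r => h1; apply: is_derive_unique h1.
    apply: near_eq_is_derive dXt; have := near_itv tab; apply: filterS => u uab.
    by rewrite -(cprojE cp) xE ?nX//; exact: subset_itv_oo_cc.
  apply: (is_derive_eq (is_deriveD (is_derive_mulmx dXt dQ) (is_derive_cst _ _ _))).
  rewrite addr0 /w /nform /g mulmxDl [X in _ = _ + X](_ : _ = 0) ?addr0; last first.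
    by rewrite mulmxA mulmxBl mul1mx; have [_ ->] := cproj_proj cp 0; rewrite subrr mul0mx.
  rewrite mulmxA -(mulmxA (Xi t)) gauge_commuteT mulmxA XP /gform mulmxA.
  have -> : Xi t *m (Q (x t))^T *m (Q (x t) *m K (x t) (v t) - 'D_(v t) Q (x t)) =
     d - Xi t *m (Q (x t))^T *m 'D_(v t) Q (x t).
    rewrite mulmxBr; congr (_ - _); rewrite mulmxA -(mulmxA (Xi t)) gauge_orthV mulmx1.
    by rewrite -XP -mulmxA (conn_proj cp _ _).2 mulmxA XP.
  rewrite mulmxBl; congr (_ + _).
  by rewrite -(mulmxA (Xi t *m _)) gauge_derive_orth mulmxN opprK mulmxA -(mulmxA (Xi t)) gauge_orthV mulmx1.
have [k Gk E] := arc _ a b pc (lexx a) (lexx b) (fun t _ => erefl).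
have hk : h + (1%:M - @normal_proj R M n N f (phi 0)) = k.
  move: E; rewrite /g xa xb Xa Xb gauge0 trmx1 !mulmx1 (cprojE cp) => ->.
  by rewrite addrC subrK mul1mx.
by rewrite hk.
Qed.

End Generation.

End Gauge.

(** * Equality of local and restricted holonomy *)

Lemma connected_locally_constant {T : topologicalType} (A : set T) (a : T) : connected [set: T] ->
  A a -> (forall t, \forall u \near t, A t <-> A u) -> forall t, A t.
Proof.
move=> cT Aa H t; have -> // : A = setT.
apply: cT; first by exists a.
  exists A; last by rewrite setTI.
  by rewrite openE => u Au; have := H u; apply: filterS => w; rewrite -propeqE => <-.
exists A; last by rewrite setTI.
rewrite -openC openE => u Au; have := H u; apply: filterS => w; rewrite /setC /=.
by move=> h Aw; apply: Au; apply/h.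
Qed.

Lemma continuous_pair {T U V : topologicalType} (f : T -> U) (g : T -> V) u :
  {for u, continuous f} -> {for u, continuous g} -> {for u, continuous (fun t => (f t, g t))}.
Proof.
move=> cf cg.
exact: (@cvg_pair _ _ _ (nbhs u) (nbhs (f u)) (nbhs (g u)) (nbhs_filter u) (nbhs_filter _) (nbhs_filter _) _ _ cf cg).
Qed.

Lemma choice2 {I J K : Type} (X : I -> J -> K -> Prop) : (forall i j, exists k, X i j k) ->
  exists k, forall i j, X i j (k i j).
Proof.
by move=> H; have [k Hk] := choice (fun ij => H ij.1 ij.2); exists (fun i j => k (i, j)) => i j; exact: (Hk (i, j)).
Qed.

Section Shift.
Context {R : realType} {M : topologicalType} {n N : nat}.
Variable f : M -> 'rV[R]_N.

Lemma derive_shift {V W : normedModType R} (F : V -> W) x0 x v :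
  'D_v (fun y => F (x0 + y)) x = 'D_v F (x0 + x).
Proof.
rewrite /derive; set g1 := (fun h => _); set g2 := (fun h => _).
by have -> : g1 = g2 by apply/funext => h; rewrite /g1 /g2 /= addrCA.
Qed.

Lemma chart_shift phi x0 : chart f phi -> chart f (fun x : 'rV[R]_n => phi (x0 + x)).
Proof.
move=> cp; have sF := chart_smooth cp.
have cs : continuous (fun x : 'rV[R]_n => x0 + x).
  by move=> x; exact: (@cvgD _ _ _ (nbhs x) (nbhs_filter x) _ _ _ _ (cvg_cst _) cvg_id).
split.
- split; first exact: openT.
  by move=> x y _ _ /(chart_inj cp)/addrI.
- by move=> x _; apply: continuous_comp; [exact: cs|exact: chart_continuous cp _].
- move=> O oO _; rewrite (_ : _ @` O = phi @` [set y | O (y - x0)]).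
    apply: (chart_open cp).
    apply: ((continuousP (fun y : 'rV[R]_n => y - x0)).1 _ O oO) => y.
    exact: (@cvgB _ _ _ (nbhs y) (nbhs_filter y) _ _ _ _ cvg_id (cvg_cst _)).
  apply/seteqP; split=> q /=; first by move=> [x Ox <-]; exists (x0 + x) => //; rewrite addrC addKr.
  by move=> [y Oy <-]; exists (y - x0) => //; rewrite addrC subrK.
- move=> k; apply: (@Ck_comp_mx _ _ _ _ _ _ setT setT (f \o phi) (fun x => x0 + x)) => //; try exact: openT.
  by apply: (CkD openT); [exact: Ck_cst|exact: Ck_id].
move=> x w _; rewrite (derive_shift (f \o phi)); exact: (chart_imm cp).
Qed.

Lemma range_shift (phi : 'rV[R]_n -> M) x0 : range (fun x => phi (x0 + x)) = range phi.
Proof.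
apply/seteqP; split=> q /= [x _ <-]; first by exists (x0 + x).
by exists (x - x0) => //; rewrite addrC subrK.
Qed.

End Shift.

Section LocalHolonomy.
Context {R : realType} {M : topologicalType} {n N : nat}.
Variable f : M -> 'rV[R]_N.
Hypothesis smf : submanifold n f.
Implicit Types (O : set M) (p q : M) (phi : 'rV[R]_n -> M).

Notation P := (@normal_proj R M n N f).
Notation Hol := (@Hol R M n N f).
Notation Tr := (@Tr R M n N f).
Notation loc := (@local_holonomy R M N n f).

Lemma local_Hol phi p g : chart f phi -> range phi p -> loc p g -> Hol (range phi) p g.
Proof.
move=> cp [x _ <-] /(local_HolP smf)/(_ _ (chart_shift x cp)); rewrite addr0 range_shift; exact.
Qed.

Lemma local_group p : orthogonal_group (loc p).
Proof.
have gr phi : phi (0 : 'rV[R]_n) = p -> orthogonal_group (Hol (range phi) p).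
  by move=> p0; apply: Hol_group => //; exists 0.
split.
- by apply/(local_HolP smf) => phi cp p0; have [] := gr phi p0.
- move=> g h /(local_HolP smf) Hg /(local_HolP smf) Hh; apply/(local_HolP smf) => phi cp p0.
  by have [_ + _ _] := gr phi p0; apply; [exact: Hg|exact: Hh].
- move=> g /(local_HolP smf) Hg; apply/(local_HolP smf) => phi cp p0.
  by have [_ _ + _] := gr phi p0; apply; exact: Hg.
move=> g /(local_HolP smf) Hg; have [phi [cp p0]] := chart_at smf p.
by have [_ _ _] := gr phi p0; apply; exact: Hg.
Qed.

(** After moving the centre of the chart to [q], the connection form in a radial gauge takes its
    values among the velocities of the holonomy group, and [Hol_generated] applies. Inclusions of
    holonomy groups are thereby checked on Lie algebras. *)
Lemma Hol_velocity_sub phi q (G : set 'M[R]_N) : chart f phi -> range phi q -> orthogonal_group G ->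
  (forall X, velocity (Hol (range phi) q) X -> velocity G X) -> Hol (range phi) q `<=` G.
Proof.
move=> cp [x _ <-] GG vG; have cp' := chart_shift x cp.
have [Q rQ] := radial_gauge_ex cp'.
have := Hol_generated cp' rQ GG.
rewrite range_shift addr0; apply => y v; apply: vG.
by have := nform_velocity smf cp' rQ y v; rewrite range_shift addr0.
Qed.

Lemma velocity_sub (G G' : set 'M[R]_N) X : G `<=` G' -> velocity G X -> velocity G' X.
Proof. by move=> GG [g [h1 h2 h3 h4]]; exists g; split=> // t; exact/GG/h3. Qed.

Lemma velocity_Hol O p X : velocity (Hol O p) X -> P p *m X = X /\ X *m P p = X.
Proof.
move=> [g [sg g0 Gg dg]].
have X1 : (1%:M - P p) *m X = 0.
  apply: is_derive_unique (is_derive_mulmxl (1%:M - P p) dg) _.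
  rewrite (_ : (fun t => _) = fun=> 1%:M - P p); first exact: is_derive_cst.
  by apply/funext => t; exact: (Hol_tangent smf (Gg t)).2.
have XP : X *m P p = P p *m X.
  apply: is_derive_unique (is_derive_mulmxr (P p) dg) _.
  rewrite (_ : (fun t => _) = fun t => P p *m g t); first exact: is_derive_mulmxl.
  by apply/funext => t; exact: (Hol_tangent smf (Gg t)).1.
have PX : P p *m X = X.
  by move: X1; rewrite mulmxBl mul1mx => /eqP; rewrite subr_eq0 => /eqP.
by rewrite XP.
Qed.

Lemma velocity_Tr O p q g X : Tr O p q g -> velocity (Hol O p) X -> velocity (Hol O q) (g^T *m X *m g).
Proof.
move=> Tg [ga [sga g0 Gga dga]].
exists (fun t => g^T *m ga t *m g + (1%:M - P q)); split.
- move=> k; apply: (CkD openT); last exact: Ck_cst.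
  apply: (Ck_mulmx openT); last exact: Ck_cst.
  by apply: (Ck_mulmx openT); [exact: Ck_cst|exact: sga].
- by have [_ _ gg _] := Tr_frame smf Tg; rewrite g0 mulmx1 gg addrC subrK.
- by move=> t; exact: (Hol_conj smf Tg (Gga t)).
apply: (is_derive_eq (is_deriveD (is_derive_mulmxr g (is_derive_mulmxl g^T dga)) (is_derive_cst _ _ _))).
by rewrite addr0.
Qed.

Lemma lie_dimP (G : set 'M[R]_N) d : lie_group_dim G d <->
  exists2 L : {vspace 'M[R]_N}, \dim L = d & forall X, X \in L <-> velocity G X.
Proof.
split=> [[L dL LP]|[L <- LP]]; last exact: lie_group_dimE.
exists L => // X; rewrite LP; split=> -[g [sg g0 Gg dg]]; exists g; split=> //.
  by rewrite -dg; exact: smooth_is_derive.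
by rewrite derive1E (@derive_val _ _ _ _ _ _ _ dg).
Qed.

Lemma lie_dim_ex (G : set 'M[R]_N) : orthogonal_group G -> exists d, lie_group_dim G d.
Proof. by move=> /lie_algebra_ex[L LP]; exists (\dim L); apply/lie_dimP; exists L. Qed.

Lemma lie_dim_sub (G G' : set 'M[R]_N) d e : (forall X, velocity G X -> velocity G' X) -> lie_group_dim G d ->
  lie_group_dim G' e -> (d <= e)%N /\ ((e <= d)%N -> forall X, velocity G' X -> velocity G X).
Proof.
move=> GG /lie_dimP[L <- LP] /lie_dimP[L' <- LP'].
have LL : (L <= L')%VS by apply/subvP => X /LP/GG/LP'.
split; first exact: dimvS.
move=> dim X /LP'; have /eqP -> : L' == L by rewrite eq_sym eqEdim LL.
by move=> /LP.
Qed.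

(** Conjugation by a transport maps velocities to velocities. It is injective on them because
    velocities vanish on the tangent space, where [g] was extended by 0. *)
Lemma lie_dim_le_Tr O p q g d e : Tr O p q g -> lie_group_dim (Hol O p) d -> lie_group_dim (Hol O q) e -> (d <= e)%N.
Proof.
move=> Tg /lie_dimP[L dL LV] /lie_dimP[L' dL' LV'].
pose T : 'End('M[R]_N) := linfun (mulmxr g \o mulmx g^T).
have TE X : T X = g^T *m X *m g by rewrite lfunE.
rewrite -dL -dL' -(@limg_dim_eq _ _ _ T L); last first.
  apply/eqP; rewrite -subv0; apply/subvP => X /memv_capP[XL]; rewrite memv_ker TE memv0 => /eqP TX.
  have [PX XP] := velocity_Hol ((LV X).1 XL).
  have [gg _ _ _] := Tr_frame smf Tg.
  have : g *m (g^T *m X *m g) *m g^T = 0 by rewrite TX mulmx0 mul0mx.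
  by rewrite !mulmxA gg -mulmxA gg PX XP => ->.
apply: dimvS; apply/subvP => _ /memv_imgP[X XL ->]; rewrite TE; apply/LV'.
by apply: velocity_Tr Tg _; exact/LV.
Qed.

Lemma lie_dim_Tr O p q g d : Tr O p q g -> lie_group_dim (Hol O p) d -> lie_group_dim (Hol O q) d.
Proof.
move=> Tg Ld; have [Op Oq] := Tr_ends Tg.
have [e Le] := lie_dim_ex (Hol_group smf Oq).
have d1 := lie_dim_le_Tr Tg Ld Le; have d2 := lie_dim_le_Tr (Tr_sym smf Tg) Le Ld.
by have -> : d = e by apply/eqP; rewrite eqn_leq d1.
Qed.

(** The charts used as cells for the homotopy: on such a chart, two transports with the same end
    points differ by local holonomy. *)
Definition good phi := chart f phi /\ forall q, range phi q -> Hol (range phi) q `<=` loc q.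

Lemma good_loc phi q : good phi -> range phi q -> loc q = Hol (range phi) q.
Proof.
move=> [cp H] Wq; apply/seteqP; split; last exact: H.
by move=> g; exact: local_Hol.
Qed.

Lemma good_restricted phi : local_eq_restricted n f -> chart f phi -> good phi.
Proof.
move=> leq cp; split=> // q Wq g Hg; rewrite (leq q).
exact: (restricted_sub (@subsetT _ _)) (chart_Hol smf cp Wq Hg).
Qed.

Lemma good_dim phi p q d : good phi -> range phi p -> range phi q ->
  lie_group_dim (loc p) d -> lie_group_dim (loc q) d.
Proof.
move=> gp Wp Wq; rewrite (good_loc gp Wp) (good_loc gp Wq).
have [cp _] := gp; case: Wp Wq => x _ <- [y _ <-].
by have [g Tg] := Tr_chart cp x y; exact: lie_dim_Tr Tg.
Qed.

Lemma restricted_dim_constant : connected [set: M] -> local_eq_restricted n f -> local_holonomy_dim_constant n f.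
Proof.
move=> cM leq.
have [[p _]|noM] := pselect ([set: M] !=set0); last first.
  by exists 0%N => p; exfalso; apply: noM; exists p.
have [d Ld] := lie_dim_ex (local_group p).
exists d; apply: (connected_locally_constant (A := fun q => lie_group_dim (loc q) d) cM Ld) => q.
have [phi [cp q0]] := chart_at smf q; have gp := good_restricted leq cp.
have Wq : range phi q by exists 0.
have : nbhs q (range phi) by apply: open_nbhs_nbhs; split => //; exact: (chart_range_open cp).
by apply: filterS => u Wu; split; [exact: (good_dim gp Wq Wu)|exact: (good_dim gp Wu Wq)].
Qed.

(** Choose the chart centred at [p] inside [U] whose holonomy group has minimal dimension. A smaller
    chart inside any other chart [psi] has at least that dimension, hence the same Lie algebra and
    the same group, which is therefore contained in the group of [psi]. *)
Lemma min_chart p (U : set M) : open U -> U p -> exists phi,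
  [/\ chart f phi, phi (0 : 'rV[R]_n) = p, range phi `<=` U & Hol (range phi) p `<=` loc p].
Proof.
move=> oU Up.
pose ok k := `[< exists phi, [/\ chart f phi, phi (0 : 'rV[R]_n) = p, range phi `<=` U & lie_group_dim (Hol (range phi) p) k] >].
have ex : exists k, ok k.
  have [phi [cp p0 pU]] := chart_small smf oU Up.
  have [|d Ld] := @lie_dim_ex (Hol (range phi) p); first by apply: Hol_group => //; exists 0.
  by exists d; apply/asboolP; exists phi.
case: (ex_minnP ex) => k /asboolP[phi [cp p0 pU Lk]] kmin.
exists phi; split=> // g Hg; apply/(local_HolP smf) => psi cps ps0.
have [||chi [cc c0 cU]] := chart_small smf (U := range phi `&` range psi) (p := p).
- by apply: openI; [exact: (chart_range_open cp)|exact: (chart_range_open cps)].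
- by split; exists 0.
have cphi : range chi `<=` range phi by move=> q /cU[].
have cpsi : range chi `<=` range psi by move=> q /cU[].
have Gc : orthogonal_group (Hol (range chi) p) by apply: Hol_group => //; exists 0.
have [e Le] := lie_dim_ex Gc.
have ke : (k <= e)%N.
  by apply: kmin; apply/asboolP; exists chi; split=> // q /cphi/pU.
apply: (Hol_sub cpsi); apply: (Hol_velocity_sub (q := p) cp _ Gc) => //; first by exists 0.
by have [_] := lie_dim_sub (fun X => velocity_sub (Hol_sub cphi)) Le Lk; apply.
Qed.

(** On a minimal chart around [p] the holonomy group has dimension [d] at [p], hence by transport at
    every point [q] of the chart. The local group at [q] lies inside it and also has dimension [d],
    so the two have the same Lie algebra. *)
Lemma dim_constant_good p : local_holonomy_dim_constant n f -> exists phi, good phi /\ range phi p.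
Proof.
move=> [d Ld]; have [phi [cp p0 _ Hp]] := min_chart openT (I : setT p).
have Wp : range phi p by exists 0.
have lp : loc p = Hol (range phi) p by apply/seteqP; split=> // g; exact: local_Hol.
exists phi; split=> //; split=> // q Wq.
have [psi [cps ps0 psU Hq]] := min_chart (chart_range_open cp) Wq.
have Gq := local_group q.
suff H X : velocity (Hol (range phi) q) X -> velocity (loc q) X by exact: Hol_velocity_sub.
have Lq : lie_group_dim (Hol (range phi) q) d.
  move: (Ld p); rewrite lp; case: Wp Wq => x _ <- [y _ <-].
  by have [g Tg] := Tr_chart cp x y; exact: lie_dim_Tr Tg.
have [_] := lie_dim_sub (fun X => velocity_sub (fun g => @local_Hol phi q g cp Wq)) (Ld q) Lq.
by apply.
Qed.


End LocalHolonomy.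

(** * Subdivision of a null homotopy into good charts *)

Section HomotopyGrid.
Context {R : realType} {M : topologicalType} {n N : nat}.
Variable f : M -> 'rV[R]_N.
Hypothesis smf : submanifold n f.
Implicit Types (O : set M) (p q : M) (phi : 'rV[R]_n -> M).

Notation P := (@normal_proj R M n N f).
Notation Hol := (@Hol R M n N f).
Notation Tr := (@Tr R M n N f).
Notation loc := (@local_holonomy R M N n f).
Notation good := (@good R M n N f).

Hypothesis cover : forall p, exists phi, good phi /\ range phi p.

(** The path is only continuous, so nothing is transported along it: the parameters whose point is
    reached from [c a] by some transport in [O] form a set that is open and closed. *)
Lemma path_Tr O (c : R -> M) (a b : R) : open O -> continuous c -> a <= b ->
  (forall t, a <= t <= b -> O (c t)) -> exists g, Tr O (c a) (c b) g.
Proof.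
move=> oO cc ab Oc.
have cR : connected [set: R] by apply/connected_intervalP => x y z.
pose d := c \o clamp a b.
have cd : continuous d by move=> t; apply: continuous_comp; [exact: clamp_continuous|exact: cc].
have Od t : O (d t) by apply: Oc; exact: clamp_in.
have da : d a = c a by rewrite /d /= clamp_id// lexx ab.
have db : d b = c b by rewrite /d /= clamp_id// lexx ab.
rewrite -db.
apply: (connected_locally_constant (A := fun t => exists g, Tr O (c a) (d t) g) (a := a) cR).
  by rewrite da; exists (P (c a)); apply: Tr_refl => //; rewrite -da.
move=> t; have [phi [cp p0 pO]] := chart_small smf oO (Od t).
have : nbhs t (d @^-1` range phi).
  by apply: cd; apply: open_nbhs_nbhs; split; [exact: (chart_range_open cp)|exists 0].
apply: filterS => u [x _ xE].
have [k Tk] := Tr_chart cp 0 x; rewrite p0 xE in Tk.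
have {}Tk := Tr_sub pO Tk.
split=> -[g Tg]; first by exists (g *m k); exact: Tr_comp Tg Tk.
by exists (g *m k^T); apply: (Tr_comp smf Tg); exact: Tr_sym.
Qed.

(** Products of transports that each stay in one good chart; these carry local holonomy groups to
    local holonomy groups. *)
Inductive chain p : M -> 'M[R]_N -> Prop :=
| chain_nil : chain p p (P p)
| chain_step q r g k phi : chain p q g -> good phi -> Tr (range phi) q r k -> chain p r (g *m k).

Lemma chain_frame p q g : chain p q g -> [/\ g *m g^T = P p, P p *m g = g, g^T *m g = P q & g *m P q = g].
Proof.
elim=> [|{}q r {}g k phi _ [h1 h2 h3 h4] _ /(Tr_frame smf)[k1 k2 k3 k4]].
  by have [PT PP] := normal_projP smf p; rewrite PT.
split.
- by rewrite trmx_mul mulmxA -(mulmxA g) k1 h4.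
- by rewrite mulmxA h2.
- by rewrite trmx_mul mulmxA -(mulmxA k^T) h3 -mulmxA k2.
- by rewrite -mulmxA k4.
Qed.

Lemma loc_tangent p g : loc p g -> g *m P p = P p *m g /\ (1%:M - P p) *m g = 1%:M - P p.
Proof. by have [phi [[cp _] Wp]] := cover p; move=> /(local_Hol smf cp Wp)/(Hol_tangent smf). Qed.

(** Within one good chart the local groups are the full groups of that chart, and these are
    conjugate under transport; the chain is undone one step at a time. *)
Lemma chain_loc p q g k : chain p q g -> loc q k -> loc p (g *m k *m g^T + (1%:M - P p)).
Proof.
move=> H; elim: H k => {q g} [|q r g k phi Hg IH gp Tk] l ll.
  have [PT PP] := normal_projP smf p; have [lP lT] := loc_tangent ll.
  by rewrite PT -lP -mulmxA PP lP -[X in _ + X]lT -mulmxDl addrC subrK mul1mx.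
have [Wq Wr] := Tr_ends Tk.
have : loc q (k *m l *m k^T + (1%:M - P q)).
  rewrite (good_loc smf gp Wq).
  have := Hol_conj smf (Tr_sym smf Tk) (_ : Hol (range phi) r l); rewrite trmxK; apply.
  by rewrite -(good_loc smf gp Wr).
move=> /IH; have [_ _ _ gP] := chain_frame Hg.
rewrite mulmxDr mulmxBr mulmx1 gP subrr addr0 trmx_mul !mulmxA.
by rewrite -!mulmxA.
Qed.

(** Equality modulo the local holonomy group at [p]: the loop that goes out by [g] and returns by
    [h] has local holonomy. *)
Definition equivt p (g h : 'M[R]_N) := loc p (g *m h^T + (1%:M - P p)).

Lemma equivt_trans p q g h k : chain p q g -> chain p q h -> chain p q k ->
  equivt p g h -> equivt p h k -> equivt p g k.
Proof.
move=> /chain_frame[g1 g2 g3 g4] /chain_frame[h1 h2 h3 h4] /chain_frame[k1 k2 k3 k4] gh hk.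
have [_ + _ _] := local_group smf p; move=> /(_ _ _ gh hk).
have [PT PP] := normal_projP smf p.
rewrite (Hol_mul smf (p := p)); last 2 first.
- by rewrite mulmxA h2.
- by rewrite -mulmxA -[P p]PT -trmx_mul h2.
by rewrite mulmxA -(mulmxA g) h3 g4.
Qed.

Lemma equivt_mulr p q r g h k : chain p q g -> chain p q h -> (exists phi, good phi /\ Tr (range phi) q r k) ->
  equivt p g h -> equivt p (g *m k) (h *m k).
Proof.
move=> /chain_frame[g1 g2 g3 g4] Hh [phi [_ /(Tr_frame smf)[k1 _ _ _]]].
by rewrite /equivt trmx_mul mulmxA -(mulmxA g) k1 g4.
Qed.

Lemma equivt_cell p q r g k k' phi : chain p q g -> good phi -> Tr (range phi) q r k -> Tr (range phi) q r k' ->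
  equivt p (g *m k) (g *m k').
Proof.
move=> Hg gp Tk Tk'; have [Wq _] := Tr_ends Tk.
have : loc q (k *m k'^T + (1%:M - P q)) by rewrite (good_loc smf gp Wq); exact: (Hol_Tr smf Tk Tk').
move=> /(chain_loc Hg); have [_ _ _ gP] := chain_frame Hg.
by rewrite /equivt mulmxDr mulmxBr mulmx1 gP subrr addr0 trmx_mul !mulmxA.
Qed.

(** A Lebesgue number for the cover of the square by preimages of good charts, obtained by letting
    the radius [d] tend to 0 from the right in the near-covering form of compactness. *)
Lemma lebesgue_good (H : R * R -> M) : continuous H -> exists2 d : R, 0 < d &
  forall s t : R, s \in `[0, 1] -> t \in `[0, 1] -> exists phi, good phi /\
    forall s' t', `|s - s'| < d -> `|t - t'| < d -> range phi (H (s', t')).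
Proof.
move=> cH; pose K : set (R * R) := `[0, 1]%classic `*` `[0, 1]%classic.
have cK : compact K by apply: compact_setX; exact: segment_compact.
pose ok (d : R) (z : R * R) := exists phi, good phi /\
    forall s' t', `|z.1 - s'| < d -> `|z.2 - t'| < d -> range phi (H (s', t')).
have near_cov := (compact_near_coveringP K).1 cK R (0 : R)^'+ ok.
have Hd : \forall d \near (0 : R)^'+, K `<=` ok d.
  apply: near_cov => z _.
  have [phi [gp Wz]] := cover (H z); have [cp _] := gp.
  have : nbhs z (H @^-1` range phi) by apply: cH; apply: open_nbhs_nbhs; split; [exact: (chart_range_open cp)|].
  move=> /nbhs_ballP[r /= r0 Hr]; have r2 : 0 < r / 2 by rewrite divr_gt0.
  exists (ball z (r / 2), [set d | d < r / 2]).
    by split; [exact: nbhsx_ballx|exact: nbhs_right_lt].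
  move=> [z' d] [/= [z1 z2] dr]; exists phi; split=> // s' t' h1 h2; apply: Hr.
  have tri (x y w : R) : ball x (r / 2) y -> `|y - w| < d -> ball x r w.
    rewrite -!ball_normE /= => xy yw.
    have -> : x - w = (x - y) + (y - w) by rewrite addrA subrK.
    by rewrite (le_lt_trans (ler_normD _ _))//; lra.
  by split; [exact: tri z1 h1|exact: tri z2 h2].
near (0 : R)^'+ => d.
exists d; first by near: d; exact: nbhs_right_gt.
move=> s t s0 t0; have Kd : K `<=` ok d by near: d.
exact: (Kd (s, t)).
Unshelve. all: by end_near. Qed.

(** Row [i] of the grid gives a product [G i] of transports along its horizontal edges. Row 0 is the
    given loop and the last row stays at [p]. Two consecutive rows bound a strip of cells, each
    contained in a good chart, and crossing one cell changes the product only by local holonomy. *)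
Lemma restricted_sub_loc p g : restricted_holonomy n f p g -> loc p g.
Proof.
move=> /(restricted_parallel smf)[c [Xi [[pX X0 X1 [cc pc _ c0 c1] [H [cH [_ HH]]]] gE]]].
pose Hc (z : R * R) := H (clamp 0 1 z.1, clamp 0 1 z.2).
have cHc : continuous Hc.
  move=> z; have clz : continuous (fun z : R * R => (clamp 0 1 z.1, clamp 0 1 z.2)).
    move=> u; apply: (@continuous_pair _ _ _ (fun z : R * R => clamp 0 1 z.1) (fun z : R * R => clamp 0 1 z.2) u).
      by apply: (@continuous_comp _ _ _ fst (clamp 0 1) u); [exact: cvg_fst|exact: (clamp_continuous ler01)].
    by apply: (@continuous_comp _ _ _ snd (clamp 0 1) u); [exact: cvg_snd|exact: (clamp_continuous ler01)].
  have Kz u : (`[0, 1] `*` `[0, 1])%classic (clamp 0 1 u.1 : R, clamp 0 1 u.2 : R).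
    by split; rewrite /= in_itv/=; exact: clamp_in ler01.
  apply: (cvg_comp (fun z : R * R => (clamp 0 1 z.1, clamp 0 1 z.2)) H _ ((subspace_continuousP _ _).1 cH _ (Kz z))).
  move=> A hA; have := clz z _ hA; rewrite /nbhs /=; apply: filterS => u /=.
  by apply; exact: Kz.
have [d d0 Hd] := lebesgue_good cHc.
have [m md] : exists m : nat, m.+1%:R^-1 < d.
  by have [m] := ltr_add_invr d0; rewrite add0r; exists m.
pose s_ (i : nat) : R := i%:R / m.+1%:R.
have m0 : (0 : R) < m.+1%:R by rewrite ltr0n.
have sS i : s_ i <= s_ i.+1 by rewrite /s_ ler_pM2r ?invr_gt0// ler_nat.
have s_0 : s_ 0%N = 0 by rewrite /s_ mul0r.
have s_m : s_ m.+1 = 1 by rewrite /s_ divff// gt_eqF.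
have s01 i : (i <= m.+1)%N -> s_ i \in `[0, 1].
  by move=> im; rewrite in_itv/= /s_ divr_ge0//= ler_pdivrMr// mul1r ler_nat.
have cell i j : exists phi, good phi /\ ((i <= m.+1)%N -> (j <= m.+1)%N ->
    forall s t, s_ i <= s <= s_ i.+1 -> s_ j <= t <= s_ j.+1 -> range phi (Hc (s, t))).
  have [/andP[im jm]|] := boolP ((i <= m.+1)%N && (j <= m.+1)%N); last first.
    have [phi [gp _]] := cover p => h; exists phi; split=> // im jm.
    by rewrite im jm in h.
  have [phi [gp Hp]] := Hd _ _ (s01 i im) (s01 j jm); exists phi; split=> // _ _ s t si tj.
  have near k u : s_ k <= u <= s_ k.+1 -> `|s_ k - u| < d.
    move=> /andP[h1 h2]; rewrite distrC ger0_norm ?subr_ge0//.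
    rewrite ltrBlDl (le_lt_trans h2)// /s_ -addn1 natrD mulrDl mul1r.
    by rewrite ltrD2l.
  by apply: Hp; exact: near.
have [W HW] := choice2 cell.
pose v i j := Hc (s_ i, s_ j).
have gW i j : good (W i j) by have [] := HW i j.
have oW i j : open (range (W i j)) by have [cp _] := gW i j; exact: (chart_range_open cp).
have self i : s_ i <= s_ i <= s_ i.+1 by rewrite lexx sS.
have self' i : s_ i <= s_ i.+1 <= s_ i.+1 by rewrite lexx sS.
have imp (A : Prop) (B : 'M[R]_N -> Prop) : (A -> exists k, B k) -> exists k, A -> B k.
  by have [a|na] := pselect A; [move=> /(_ a)[k Bk]; exists k|exists 0].
(* An edge of row 0 carries the actual transport of the loop. An interior edge carries any transport
   inside both adjacent cells, since the homotopy need not be smooth there. *)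
have hor i j : exists k, (i <= m.+1)%N /\ (j <= m)%N ->
    [/\ Tr (range (W i j)) (v i j) (v i j.+1) k,
     forall i', i = i'.+1 -> Tr (range (W i' j)) (v i j) (v i j.+1) k &
     i = 0%N -> k = (Xi (s_ j))^T *m Xi (s_ j.+1)].
  apply: imp => -[im jm]; have jm1 := leqW jm.
  have in_row i' t : (i' <= m.+1)%N -> s_ i' <= s_ i <= s_ i'.+1 -> s_ j <= t <= s_ j.+1 -> range (W i' j) (Hc (s_ i, t)).
    by move=> im' si tj; have [_] := HW i' j; apply.
  case: i im in_row => [|i] im in_row.
    exists ((Xi (s_ j))^T *m Xi (s_ j.+1)); split=> //.
    have H0 t : t \in `[0, 1] -> Hc (0, t) = c t.
      move=> t01; rewrite /Hc /= clamp_id ?lexx ?ler01// clamp_id; last by move: t01; rewrite in_itv.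
      by have [] := HH t t01.
    have := s01 j jm1; have := s01 j.+1 jm; rewrite /v s_0 => j1 j2; rewrite !H0//.
    apply: (parallel_Tr smf pX) => //; first by rewrite X0 c0.
    - by move: j2; rewrite in_itv/= => /andP[].
    - by move: j1; rewrite in_itv/= => /andP[].
    move=> t; rewrite in_itv/= => tj; rewrite -H0; last first.
      move: tj j1 j2; rewrite !in_itv/= => /andP[h1 h2] /andP[h3 h4] /andP[h5 h6].
      by rewrite (le_trans h5)// (le_trans h2).
    by have := in_row 0%N t im (self 0%N) tj; rewrite s_0.
  have [|||k Tk] := @path_Tr (range (W i.+1 j) `&` range (W i j)) (fun t => Hc (s_ i.+1, t)) _ _ _ _ (sS j).
  - by apply: openI; exact: oW.
  - move=> t; apply: (@continuous_comp _ _ _ (fun t => (s_ i.+1, t)) Hc t); last exact: cHc.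
    by apply: (@continuous_pair _ _ _ (fun=> s_ i.+1) (fun t : R => t) t); [exact: cvg_cst|exact: cvg_id].
  - by move=> t tj; split; apply: in_row => //; exact: ltnW.
  by exists k; split=> // [|i' [<-]]; apply: Tr_sub Tk => q [].
have ver i j : exists k, (i <= m)%N /\ (j <= m.+1)%N ->
    Tr (range (W i j)) (v i j) (v i.+1 j) k /\
     forall j', j = j'.+1 -> Tr (range (W i j')) (v i j) (v i.+1 j) k.
  apply: imp => -[im jm]; have im1 := leqW im.
  have in_col j' t : (j' <= m.+1)%N -> s_ j' <= s_ j <= s_ j'.+1 -> s_ i <= t <= s_ i.+1 -> range (W i j') (Hc (t, s_ j)).
    by move=> jm' sj ti; have [_] := HW i j'; apply.
  (* For [j = 0] the predecessor is [j] itself, so the left border of the square involves only one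
     cell. *)
  pose O := range (W i j) `&` range (W i j.-1).
  have [||t ti|k Tk] := @path_Tr O (fun t => Hc (t, s_ j)) _ _ _ _ (sS i).
  - by apply: openI; exact: oW.
  - move=> t; apply: (@continuous_comp _ _ _ (fun t => (t, s_ j)) Hc t); last exact: cHc.
    by apply: (@continuous_pair _ _ _ (fun t : R => t) (fun=> s_ j) t); [exact: cvg_id|exact: cvg_cst].
  - split; first exact: in_col.
    by case: j jm in_col {O} => [|j] jm in_col /=; apply: in_col => //; exact: ltnW.
  exists k; split; first by apply: Tr_sub Tk => q [].
  by move=> j' jE; apply: Tr_sub Tk => q []; rewrite jE.
have [e He] := choice2 hor.
have [u Hu] := choice2 ver.
have v_ i j : (i <= m.+1)%N -> (j <= m.+1)%N -> v i j = H (s_ i, s_ j).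
  move=> im jm; have := s01 i im; have := s01 j jm; rewrite !in_itv/= => h1 h2.
  by rewrite /v /Hc /= !clamp_id.
have v0 i : (i <= m.+1)%N -> v i 0%N = p.
  by move=> im; rewrite v_// s_0; have [] := HH _ (s01 i im).
have vm i : (i <= m.+1)%N -> v i m.+1 = p.
  by move=> im; rewrite v_// s_m; have [] := HH _ (s01 i im).
have vtop j : (j <= m.+1)%N -> v m.+1 j = p.
  by move=> jm; rewrite v_// s_m; have [] := HH _ (s01 j jm).
pose G i := fix G j := if j is j'.+1 then G j' *m e i j' else P p.
have GS i j : G i j.+1 = G i j *m e i j by [].
have cG i j : (i <= m.+1)%N -> (j <= m.+1)%N -> chain p (v i j) (G i j).
  move=> im; elim: j => [|j IH] jm; first by rewrite v0//; exact: chain_nil.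
  have [T _ _] := He i j (conj im jm).
  exact: (chain_step (IH (ltnW jm)) (gW i j) T).
have up i j : (i <= m)%N -> (j <= m.+1)%N -> chain p (v i.+1 j) (G i j *m u i j).
  by move=> im jm; have [T _] := Hu i j (conj im jm); exact: (chain_step (cG i j (leqW im) jm) (gW i j) T).
have [PT PP] := normal_projP smf p.
have refl q a : chain p q a -> equivt p a a.
  by move=> /chain_frame[aa _ _ _]; rewrite /equivt aa addrC subrK; have [] := local_group smf p.
(* The induction on [j] sweeps the strip from left to right: each step replaces the lower and right
   edges of a cell by its left and upper edges. *)
have square i j : (i <= m)%N -> (j <= m.+1)%N -> equivt p (G i j *m u i j) (G i.+1 j).
  move=> im; have im1 := leqW im; elim: j => [|j IH] jm.
    have [T _] := Hu i 0%N (conj im jm); rewrite (v0 i im1) (v0 i.+1 im) in T.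
    have [Wp _] := Tr_ends T.
    have := equivt_cell (chain_nil p) (gW i 0%N) T (Tr_refl smf Wp).
    by rewrite PP.
  have jm1 := ltnW jm; have [T1 _ _] := He i j (conj im1 jm).
  have [T2 T2' _] := He i.+1 j (conj im jm).
  have [T3 _] := Hu i j (conj im jm1).
  have [_ /(_ j erefl) T4] := Hu i j.+1 (conj im jm).
  have cell1 := equivt_cell (cG i j im1 jm1) (gW i j) (Tr_comp smf T1 T4) (Tr_comp smf T3 (T2' i erefl)).
  have ed : exists phi, good phi /\ Tr (range phi) (v i.+1 j) (v i.+1 j.+1) (e i.+1 j) by exists (W i.+1 j).
  have step2 := equivt_mulr (up i j im jm1) (cG i.+1 j im jm1) ed (IH jm1).
  rewrite !GS -(mulmxA _ (e i j)); apply: (equivt_trans _ _ _ cell1).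
  - by rewrite mulmxA -GS; exact: (up i j.+1 im jm).
  - by rewrite mulmxA; exact: (chain_step (up i j im jm1) (gW i.+1 j) T2).
  - by rewrite -GS; exact: cG.
  by rewrite mulmxA.
have rows i : (i <= m)%N -> equivt p (G i m.+1) (G i.+1 m.+1).
  move=> im; have im1 := leqW im; have c1' := cG i m.+1 im1 (leqnn _); have c2' := cG i.+1 m.+1 im (leqnn _).
  have [T _] := Hu i m.+1 (conj im (leqnn _)); rewrite (vm i im1) (vm i.+1 im) in T c1' c2'.
  have [Wp _] := Tr_ends T.
  have := equivt_cell c1' (gW i m.+1) (Tr_refl smf Wp) T.
  have [_ _ _ ->] := chain_frame c1' => E.
  apply: (equivt_trans c1' _ c2' E); last exact: square.
  exact: (chain_step c1' (gW i m.+1) T).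
have tower i : (i <= m.+1)%N -> equivt p (G 0%N m.+1) (G i m.+1).
  elim: i => [|i IH] im; first exact: (refl _ _ (cG 0%N m.+1 isT (leqnn _))).
  have K i' : (i' <= m.+1)%N -> chain p p (G i' m.+1) by move=> im'; rewrite -{2}(vm i' im'); exact: cG.
  exact: (equivt_trans (K 0%N isT) (K i (ltnW im)) (K i.+1 im) (IH (ltnW im)) (rows i im)).
(* All vertices of the last row are [p], so each edge is a loop in a good chart and may be replaced
   by the identity transport. *)
have top j : (j <= m.+1)%N -> equivt p (G m.+1 j) (P p).
  elim: j => [|j IH] jm; first exact: (refl _ _ (chain_nil p)).
  have [T _ _] := He m.+1 j (conj (leqnn _) jm).
  have c1' := cG m.+1 j (leqnn _) (ltnW jm).
  rewrite (vtop j (ltnW jm)) (vtop j.+1 jm) in T c1'.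
  have [Wp _] := Tr_ends T.
  have := equivt_cell c1' (gW m.+1 j) T (Tr_refl smf Wp).
  have [_ _ _ h4] := chain_frame c1'; rewrite h4 => E.
  exact: (equivt_trans (chain_step c1' (gW m.+1 j) T) c1' (chain_nil p) E (IH (ltnW jm))).
have G0 j : (j <= m.+1)%N -> G 0%N j = Xi (s_ j).
  elim: j => [|j IH] jm; first by rewrite s_0 X0.
  rewrite GS; have [_ _ /(_ erefl) ->] := He 0%N j (conj isT jm).
  have X0' : Xi 0 = P (c 0) by rewrite X0 c0.
  have [h1 _ _] := parallel_frame smf pX X0' (s01 j (ltnW jm)).
  have [_ h2 _] := parallel_frame smf pX X0' (s01 j.+1 jm).
  by rewrite IH; [rewrite mulmxA h1 h2|exact: ltnW].
have c0p := cG 0%N m.+1 isT (leqnn _); have cmp := cG m.+1 m.+1 (leqnn _) (leqnn _).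
rewrite vm// in c0p; rewrite vm// in cmp.
have := equivt_trans c0p cmp (chain_nil p) (tower m.+1 (leqnn _)) (top m.+1 (leqnn _)).
rewrite (G0 m.+1 (leqnn _)) s_m X1 /equivt PT.
have gP : g *m P p = P p *m g.
  have [_ _ _ [_ nX] _] := pX; have := nX 1; rewrite in_itv/= ler01 lexx X1 c1 => /(_ isT) nX1.
  by rewrite {1}gE mulmxDl mulmxBl mul1mx PP subrr addr0.
by rewrite -mulmxA gP mulmxA PP -gE.
Qed.

End HomotopyGrid.

Theorem local_eq_restrictedP {R : realType} {M : topologicalType} {n N : nat} (f : M -> 'rV[R]_N) :
  submanifold n f -> connected [set: M] -> local_eq_restricted n f <-> local_holonomy_dim_constant n f.
Proof.
move=> smf cM; split=> [|dc p]; first exact: restricted_dim_constant.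
apply/seteqP; split=> g.
  by move=> /(_ setT); apply; split; [exact: openT|].
exact: (restricted_sub_loc smf (fun p => dim_constant_good smf p dc)).
Qed.

(** * Pairs of self-adjoint operators commuting across pairs *)

Section SelfAdjoint.
Context {R : realType} {n : nat}.
Implicit Types (u v : 'rV[R]_n) (A X Y : 'M[R]_n).

Definition bil A u v : R := (u *m A *m v^T) 0 0.

Lemma bilDl A u u' v : bil A (u + u') v = bil A u v + bil A u' v.
Proof. by rewrite /bil !mulmxDl mxE. Qed.

Lemma bilDr A u v v' : bil A u (v + v') = bil A u v + bil A u v'.
Proof. by rewrite /bil linearD /= mulmxDr mxE. Qed.

Lemma bilZl A a u v : bil A (a *: u) v = a * bil A u v.
Proof. by rewrite /bil -!scalemxAl mxE. Qed.

Lemma bilZr A a u v : bil A u (a *: v) = a * bil A u v.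
Proof. by rewrite /bil linearZ /= -scalemxAr mxE. Qed.

Lemma bil_sym A u v : A^T = A -> bil A u v = bil A v u.
Proof. by move=> AT; rewrite /bil -[in RHS](trmxK (v *m A *m u^T)) [RHS]mxE !trmx_mul trmxK AT mulmxA. Qed.

Lemma bil_continuous A : continuous (fun u => bil A u u).
Proof.
move=> u; have c1 : {for u, continuous (fun u : 'rV[R]_n => u *m A)}.
  by apply: (@cvg_mulmx R _ (nbhs u) (nbhs_filter u)); [exact: cvg_id|exact: cvg_cst].
have c2 : {for u, continuous (fun u : 'rV[R]_n => u^T)}.
  apply: (continuous_mxP (fun u : 'rV[R]_n => u^T) u).2 => i j.
  rewrite (_ : (fun _ => _) = fun y : 'rV[R]_n => y j i); last by apply/funext => y; rewrite mxE.
  exact: coord_continuous.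
have := @cvg_mulmx R _ (nbhs u) (nbhs_filter u) _ _ _ _ _ _ _ c1 c2.
by move=> c3; exact: (continuous_mxP (fun u : 'rV[R]_n => u *m A *m u^T) u).1 c3 0 0.
Qed.

Variable G : 'M[R]_n.
Hypothesis symG : G^T = G.
Hypothesis posG : forall u, u != 0 -> 0 < bil G u u.

Lemma bilG_eq0 u : bil G u u = 0 -> u = 0.
Proof. by move=> u0; apply/eqP/negPn/negP => /posG; rewrite u0 ltxx. Qed.

(* A maximum of the Rayleigh quotient of [X] on [F] is an eigenvector. *)
Lemma self_adjoint_eigenvector (F X : 'M[R]_n) : F != 0 -> (F *m X <= F)%MS -> (X *m G)^T = X *m G ->
  exists lam u, [/\ u != 0, (u <= F)%MS & u *m X = lam *: u].
Proof.
move=> F0 FX sX; pose S := X *m G.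
pose D := [set u : 'rV[R]_n | `|u| = 1 /\ (u <= F)%MS].
have cD : compact D.
  apply: (@subclosed_compact _ _ [set u : 'rV[R]_n | `|u| <= 1]); last 2 first.
  - exact: cube_compact.
  - by move=> u [u1 _] /=; rewrite u1.
  have -> : D = (Num.norm @^-1` [set t : R | t = 1]) `&` ((fun u => `|u *m cokermx F|) @^-1` [set t : R | t = 0]).
    apply/seteqP; split=> u /= [u1 uF]; split=> //.
      by move: uF; rewrite submxE => /eqP ->; rewrite normr0.
    by rewrite submxE; apply/eqP/normr0_eq0.
  apply: closedI; apply: closed_comp; try exact: closed_eq.
    by move=> x _; exact: norm_continuous.
  move=> x _; apply: (@cvg_norm _ _ _ (nbhs x)).
  by apply: (@cvg_mulmx R _ (nbhs x) (nbhs_filter x)); [exact: cvg_id|exact: cvg_cst].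
have nrmD u : u != 0 -> (u <= F)%MS -> D (`|u|^-1 *: u).
  move=> u0 uF; split; last exact: scalemx_sub.
  by rewrite normrZ gtr0_norm ?invr_gt0 ?normr_gt0// mulVf ?normr_eq0.
have nzD u : D u -> u != 0 by move=> [u1 _]; rewrite -normr_eq0 u1 oner_neq0.
have [v v0 vF] : exists2 v : 'rV[R]_n, v != 0 & (v <= F)%MS.
  have [i Fi] : exists i, row i F != 0.
    apply: contrapT => H; move/eqP: F0; apply; apply/row_matrixP => i; rewrite row0.
    by apply/eqP/negPn/negP => Fi; apply: H; exists i.
  by exists (row i F) => //; exact: row_sub.
pose r u := bil S u u / bil G u u.
have [|||u0 Du0 umax] := @EVT_max_rV R n r D.
- by exists (`|v|^-1 *: v); exact: nrmD.
- exact: cD.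
- apply: continuous_in_subspaceT => u; rewrite inE => Du.
  apply: (@cvgM _ _ (nbhs u) (nbhs_filter u) _ _ _ _ (@bil_continuous S u)).
  by apply: (@cvgV _ _ (nbhs u) (nbhs_filter u) _ _ _ (@bil_continuous G u)); rewrite gt_eqF// posG// nzD.
rewrite inE in Du0; set lam := r u0 in umax.
have le v' : (v' <= F)%MS -> bil S v' v' <= lam * bil G v' v'.
  have [->|v'0 v'F] := eqVneq v' 0; first by rewrite /bil !mul0mx mxE mulr0.
  have := umax (`|v'|^-1 *: v'); rewrite inE => /(_ (nrmD _ v'0 v'F)).
  have i0 : 0 < `|v'|^-1 by rewrite invr_gt0 normr_gt0.
  rewrite /r !bilZl !bilZr ler_pdivrMr; last by rewrite !mulr_gt0// posG.
  by rewrite 2!(mulrCA lam) !ler_pM2l.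
exists lam, u0; have [u1 uF] := Du0; split=> //; first exact: nzD.
set y := lam *: u0 - u0 *m X; suff : y = 0 by move/eqP; rewrite subr_eq0 => /eqP.
have yF : (y <= F)%MS.
  by rewrite addmx_sub ?scalemx_sub// eqmx_opp (submx_trans _ FX)// submxMr.
apply: bilG_eq0.
have h0 : lam * bil G u0 u0 = bil S u0 u0.
  by rewrite /lam /r mulfVK// gt_eqF// posG// nzD.
have hy w : bil G y w = lam * bil G u0 w - bil S u0 w.
  by rewrite /y /S bilDl bilZl -scaleN1r bilZl mulN1r /bil mulmxA.
clearbody y.
have gy : 0 <= bil G y y.
  by have [->|/posG/ltW//] := eqVneq y 0; rewrite /bil !mul0mx mxE.
have key t : 0 <= 2 * t * bil G y y + t ^+ 2 * (lam * bil G y y - bil S y y).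
  have := le (u0 + t *: y) (addmx_sub uF (scalemx_sub _ yF)).
  rewrite !(bilDl, bilDr, bilZl, bilZr) (bil_sym y u0 symG) (bil_sym y u0 sX) -subr_ge0.
  have := hy y; move: h0.
  move: (bil G u0 u0) (bil G u0 y) (bil G y y) (bil S u0 u0) (bil S u0 y) (bil S y y) => a b c d e k h0 ->.
  by rewrite -h0 => h; rewrite (le_trans h)// le_eqVlt; apply/orP; left; apply/eqP; ring.
have k0 : 0 <= lam * bil G y y - bil S y y by rewrite subr_ge0 le.
move: key gy k0; move: (bil G y y) (_ - _) => c d key c0 d0.
apply/eqP; rewrite eq_le c0 andbT leNgt; apply/negP => cp.
have d1 : 0 < d + 1 by lra.
(* First variation at the maximum: [c] is the squared length of [y]. For this small negative
   parameter the linear term outweighs the quadratic one, so a positive [c] would make [key]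
   fail. *)
have := key (- (c / (d + 1))); rewrite leNgt => /negP; apply.
set s := c / (d + 1); have s0 : 0 < s by rewrite divr_gt0.
have sd : s * d < c by rewrite /s mulrAC ltr_pdivrMr//; nra.
nra.
Qed.

Lemma gram_eq0 (m : nat) (U : 'M[R]_(m, n)) : U *m G *m U^T = 0 -> U = 0.
Proof.
move=> U0; apply/row_matrixP => i; rewrite row0; apply: bilG_eq0.
have := congr1 (fun A : 'M[R]_m => A i i) U0; rewrite [RHS]mxE => <-.
by rewrite /bil -row_mul tr_row !mxE; apply: eq_bigr => j _; rewrite !mxE.
Qed.

Definition orthc (K : 'M[R]_n) : 'M[R]_n := kermx (G *m K^T).

Lemma orthc_disjoint (K : 'M[R]_n) (m : nat) (U : 'M[R]_(m, n)) : (U <= K)%MS -> (U <= orthc K)%MS -> U = 0.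
Proof.
move=> /submxP[D UE] /sub_kermxP UG; apply: gram_eq0.
by rewrite {2}UE trmx_mul !mulmxA -(mulmxA U) UG mul0mx.
Qed.

Lemma orthc_dec (K W : 'M[R]_n) : (K <= W)%MS ->
  (W <= K + (W :&: orthc K))%MS /\ (\rank K + \rank (W :&: orthc K) = \rank W)%N.
Proof.
move=> KW; have dis : (K :&: (W :&: orthc K) = 0)%MS.
  apply: (@orthc_disjoint K); first exact: capmxSl.
  by rewrite (submx_trans (capmxSr _ _))// capmxSr.
have sub : (K + (W :&: orthc K) <= W)%MS by rewrite addsmx_sub KW capmxSl.
have rs := mxrank_disjoint_sum dis.
have := mxrank_mul_ker W (G *m K^T).
have rk : (\rank (W *m (G *m K^T)) <= \rank K)%N.
  by rewrite mulmxA -(mxrank_tr K) mxrankM_maxr.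
have rle := mxrankS sub; rewrite rs in rle.
move=> re; have E : (\rank K + \rank (W :&: orthc K) = \rank W)%N.
  by apply/eqP; rewrite eqn_leq rle -re leq_add2r.
by split=> //; rewrite -(geq_leqif (mxrank_leqif_sup sub)) rs E.
Qed.

Lemma orthc_stable (K X : 'M[R]_n) : (X *m G)^T = X *m G -> (K *m X <= K)%MS -> (orthc K *m X <= orthc K)%MS.
Proof.
move=> sX /submxP[D KX]; apply/sub_kermxP.
have -> : orthc K *m X *m (G *m K^T) = orthc K *m (G *m (K *m X)^T).
  have XG : X *m G = G *m X^T by rewrite -{1}sX trmx_mul symG.
  by rewrite -(mulmxA (orthc K)) (mulmxA X) XG trmx_mul !mulmxA.
by rewrite KX trmx_mul !mulmxA -(mulmxA _ G) mulmx_ker mul0mx.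
Qed.

Section CommutingPairs.
Variable I : finType.
Variables X Y : I -> 'M[R]_n.
Hypothesis sX : forall i, (X i *m G)^T = X i *m G.
Hypothesis sY : forall i, (Y i *m G)^T = Y i *m G.
Hypothesis cXX : forall i j, i != j -> X i *m X j = X j *m X i.
Hypothesis cXY : forall i j, i != j -> X i *m Y j = Y j *m X i.
Hypothesis cYY : forall i j, i != j -> Y i *m Y j = Y j *m Y i.

Definition cm i := X i *m Y i - Y i *m X i.
Definition stab (J : {set I}) (W : 'M[R]_n) := forall j, j \in J -> (W *m X j <= W)%MS /\ (W *m Y j <= W)%MS.

Lemma cm_skew i : cm i *m G = - (G *m (cm i)^T).
Proof.
have h A : (A *m G)^T = A *m G -> A *m G = G *m A^T by move=> sA; rewrite -{1}sA trmx_mul symG.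
rewrite /cm linearB /= !trmx_mul mulmxBl mulmxBr -!mulmxA (h _ (sX i)) (h _ (sY i)) !mulmxA.
by rewrite (h _ (sX i)) (h _ (sY i)) opprB.
Qed.

Lemma stab_cap (J : {set I}) (W U : 'M[R]_n) : stab J W -> stab J U -> stab J (W :&: U)%MS.
Proof.
move=> sW sU j jJ; have [w1 w2] := sW j jJ; have [u1 u2] := sU j jJ.
rewrite !sub_capmx; split; apply/andP; split.
- by rewrite (submx_trans _ w1)// submxMr// capmxSl.
- by rewrite (submx_trans _ u1)// submxMr// capmxSr.
- by rewrite (submx_trans _ w2)// submxMr// capmxSl.
- by rewrite (submx_trans _ u2)// submxMr// capmxSr.
Qed.

Lemma stab_orthc (J : {set I}) (W : 'M[R]_n) : stab J W -> stab J (orthc W).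
Proof. by move=> sW j jJ; have [h1 h2] := sW j jJ; split; exact: orthc_stable. Qed.

Lemma stab_ker (J : {set I}) (Z : 'M[R]_n) : (forall j, j \in J -> Z *m X j = X j *m Z /\ Z *m Y j = Y j *m Z) -> stab J (kermx Z).
Proof.
by move=> cZ j /cZ[h1 h2]; split; apply/sub_kermxP; rewrite -mulmxA -?h1 -?h2 mulmxA mulmx_ker mul0mx.
Qed.

Lemma stab_mul (J : {set I}) (W Z : 'M[R]_n) : stab J W ->
  (forall j, j \in J -> Z *m X j = X j *m Z /\ Z *m Y j = Y j *m Z) -> stab J (W *m Z).
Proof.
move=> sW cZ j jJ; have [h1 h2] := sW j jJ; have [z1 z2] := cZ j jJ.
by rewrite -!mulmxA z1 z2 !mulmxA; split; exact: submxMr.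
Qed.

(* Otherwise an eigenspace of [X i] inside the image of the commutator would be stable under [Y i]. *)
Lemma unstable_ex (J : {set I}) i (E : 'M[R]_n) : i \notin J -> stab (i |: J) E -> E *m cm i != 0 ->
  exists W Z, [/\ (W <= E)%MS, stab J W, Z = X i \/ Z = Y i & ~~ (W *m Z <= W)%MS].
Proof.
move=> iJ sE Ec0; apply: contrapT => H.
have st W : (W <= E)%MS -> stab J W -> (W *m X i <= W)%MS /\ (W *m Y i <= W)%MS.
  move=> WE sW; split; apply/negPn/negP => nst; apply: H.
    by exists W, (X i); split=> //; left.
  by exists W, (Y i); split=> //; right.
have ne j : j \in J -> i != j by move=> jJ; apply: contraNneq iJ => ->.
have comX j : j \in J -> X i *m X j = X j *m X i /\ X i *m Y j = Y j *m X i.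
  by move=> /ne ij; rewrite (cXX ij) (cXY ij).
have comY j : j \in J -> Y i *m X j = X j *m Y i /\ Y i *m Y j = Y j *m Y i.
  by move=> /ne ij; rewrite (cYY ij) cXY// eq_sym.
have comC j : j \in J -> cm i *m X j = X j *m cm i /\ cm i *m Y j = Y j *m cm i.
  move=> jJ; have [a1 a2] := comX j jJ; have [b1 b2] := comY j jJ.
  by rewrite /cm !mulmxBl !mulmxBr -!mulmxA a1 a2 b1 b2 !mulmxA a1 a2 b1 b2.
pose F := E *m cm i.
have sEJ : stab J E by move=> j jJ; apply: sE; rewrite finset.in_setU jJ orbT.
have FE : (F <= E)%MS.
  have [e1 e2] := sE i (finset.setU11 _ _).
  rewrite /F /cm mulmxBr !mulmxA addmx_sub// ?eqmx_opp.
    exact: submx_trans (submxMr _ e1) e2.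
  exact: submx_trans (submxMr _ e2) e1.
have sF : stab J F by exact: stab_mul.
have [lam [u [u0 uF uX]]] := self_adjoint_eigenvector Ec0 (st F FE sF).1 (sX i).
pose L := (F :&: kermx (X i - lam%:M))%MS.
have sL : stab J L.
  apply: stab_cap => //; apply: stab_ker => j /comX[h1 h2].
  by rewrite !mulmxBl !mulmxBr h1 h2 !mul_scalar_mx !mul_mx_scalar.
have uL : (u <= L)%MS.
  by rewrite sub_capmx uF; apply/sub_kermxP; rewrite mulmxBr uX mul_mx_scalar subrr.
have [_ LY] := st L (submx_trans (capmxSl _ _) FE) sL.
have eig (m : nat) (w : 'M[R]_(m, n)) : (w <= L)%MS -> w *m X i = lam *: w.
  rewrite sub_capmx => /andP[_ /sub_kermxP]; rewrite mulmxBr mul_mx_scalar => /eqP.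
  by rewrite subr_eq0 => /eqP.
have uc : u *m cm i = 0.
  rewrite /cm mulmxBr !mulmxA uX (eig _ (u *m Y i)) -?scalemxAl ?subrr//.
  exact: submx_trans (submxMr _ uL) LY.
move/submxP: uF => [a ua]; move/eqP: u0; apply; apply: gram_eq0.
rewrite {1}ua /F !mulmxA -(mulmxA _ (cm i)) cm_skew mulmxN mulNmx -!mulmxA -trmx_mul uc.
by rewrite trmx0 !mulmx0 oppr0.
Qed.

(** Set one index [i] aside and let [W] be of minimal rank among the subspaces of [E] stable under
    the other pairs but not under [Z], one of [X i] and [Y i]. Minimality forces [W] and its image
    under [Z] to meet trivially, so [T], their sum, has twice the rank of [W]. The remaining pairs
    are split by whether they fail to commute on [W], and induction is applied to [W] and to the
    orthogonal complement of [T] in [E]. *)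
Lemma commuting_pairs_rank (J : {set I}) (E : 'M[R]_n) : stab J E ->
  (forall i, i \in J -> E *m cm i != 0) -> (#|J|.*2 <= \rank E)%N.
Proof.
move: {2}#|J| (leqnn #|J|) => k; elim: k J E => [|k IH] J E.
  by rewrite leqn0 => /eqP ->.
move=> Jk sE Ec; have [->|[i iJ]] := finset.set_0Vmem J; first by rewrite cards0.
pose J' := J :\ i; have iJ' : i \notin J' by rewrite !inE eqxx.
have JE : i |: J' = J by exact: finset.setD1K.
have J'J j : j \in J' -> j \in J by rewrite -JE => jJ; rewrite finset.in_setU jJ orbT.
pose ok r := `[< exists W Z, [/\ (W <= E)%MS, stab J' W, Z = X i \/ Z = Y i, ~~ (W *m Z <= W)%MS & \rank W = r] >].
have okP : exists r, ok r.
  have [|W [Z [h1 h2 h3 h4]]] := unstable_ex iJ' _ (Ec i iJ); first by rewrite JE.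
  by exists (\rank W); apply/asboolP; exists W, Z.
case: (ex_minnP okP) => r /asboolP[W [Z [WE sW ZXY nst rW]]] rmin.
have ne j : j \in J' -> i != j by move=> jJ; apply: contraNneq iJ' => ->.
have cZ j : j \in J' -> Z *m X j = X j *m Z /\ Z *m Y j = Y j *m Z.
  move=> /ne ij; case: ZXY => ->; first by rewrite (cXX ij) (cXY ij).
  by rewrite (cYY ij) cXY// eq_sym.
have sZ : (Z *m G)^T = Z *m G by case: ZXY => ->.
(* The vectors of [W] that [Z] keeps in [W]. *)
pose K := (W :&: kermx (Z *m cokermx W))%MS.
have inK (m : nat) (w : 'M[R]_(m, n)) : (w <= W)%MS -> (w *m Z <= W)%MS -> (w <= K)%MS.
  by move=> wW wZ; rewrite sub_capmx wW; apply/sub_kermxP; rewrite mulmxA; apply/eqP; rewrite -submxE.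
have KW : (K <= W)%MS by exact: capmxSl.
have KZ : (K *m Z <= W)%MS.
  by rewrite submxE -mulmxA; apply/eqP/sub_kermxP; exact: capmxSr.
have sK : stab J' K.
  move=> j jJ; have [w1 w2] := sW j jJ; have [z1 z2] := cZ j jJ; split; apply: inK.
  - exact: submx_trans (submxMr _ KW) w1.
  - by rewrite -mulmxA -z1 mulmxA (submx_trans (submxMr _ KZ) w1).
  - exact: submx_trans (submxMr _ KW) w2.
  - by rewrite -mulmxA -z2 mulmxA (submx_trans (submxMr _ KZ) w2).
(* If [K] were nonzero, its complement [U] in [W] would have smaller rank, hence be stable under [Z]
   by minimality, hence lie in [K] and vanish; then [W = K] would be stable under [Z]. *)
have K0 : K = 0.
  apply/eqP/negPn/negP => K0; have [WK rWK] := orthc_dec KW.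
  set U := (W :&: orthc K)%MS in WK rWK.
  have UW : (U <= W)%MS by exact: capmxSl.
  have UZ : (U *m Z <= U)%MS.
    apply/negPn/negP => nU; have : (r <= \rank U)%N.
      apply: rmin; apply/asboolP; exists U, Z; split=> //; first exact: submx_trans WE.
      by apply: stab_cap => //; exact: stab_orthc.
    by rewrite -rW -rWK -{2}[\rank U]add0n leq_add2r leqn0 mxrank_eq0 (negPf K0).
  have U0 : U = 0.
    apply: (@orthc_disjoint K); last exact: capmxSr.
    by apply: inK => //; exact: submx_trans UZ UW.
  move/negP: nst; apply; rewrite U0 addsmx0 in WK.
  exact: submx_trans (submxMr _ WK) KZ.
pose T := (W + W *m Z)%MS.
have dis : (W :&: W *m Z = 0)%MS.
  have /submxP[D DE] := capmxSr W (W *m Z).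
  have : (D *m W <= K)%MS.
    by apply: inK; [exact: submxMl|rewrite -mulmxA -DE; exact: capmxSl].
  by rewrite K0 submx0 => /eqP DW; rewrite DE mulmxA DW mul0mx.
have rT : \rank T = (\rank W).*2.
  rewrite (mxrank_disjoint_sum dis) -addnn; congr (_ + _)%N.
  rewrite -(mxrank_mul_ker W Z); suff -> : (W :&: kermx Z = 0)%MS by rewrite mxrank0 addn0.
  apply/eqP; rewrite -submx0 -K0; apply: inK; first exact: capmxSl.
  by have /sub_kermxP -> := capmxSr W (kermx Z); exact: sub0mx.
have ZE : (W *m Z <= E)%MS.
  have [e1 e2] := sE i iJ; rewrite (submx_trans (submxMr _ WE))//.
  by case: ZXY => ->.
have TE : (T <= E)%MS by rewrite addsmx_sub WE.
have [ET rET] := orthc_dec TE; set U := (E :&: orthc T)%MS in ET rET.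
have sE' : stab J' E by move=> j /J'J; exact: sE.
have sT : stab J' T.
  move=> j jJ; have [w1 w2] := sW j jJ; have [m1 m2] := stab_mul sW cZ jJ.
  by split; rewrite addsmxMr addsmxS.
have sU : stab J' U by apply: stab_cap => //; exact: stab_orthc.
(* A pair in [A] commutes on [W], and also on the image of [W] under [Z], since [Z] commutes with
   it. So it still fails to commute on the complement of [T]. *)
pose B := [set j in J' | W *m cm j != 0]; pose A := J' :\: B.
have cJ : (#|J| = #|B| + #|A| + 1)%N.
  by rewrite (cardsD1 i) iJ -/J' -(cardsID B J') (finset.setIidPr _) 1?addnC//; apply/fintype.subsetP => j; rewrite inE => /andP[].
have Bk : (#|B| <= k)%N by rewrite cJ in Jk; lia.
have Ak : (#|A| <= k)%N by rewrite cJ in Jk; lia.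
have hB : (#|B|.*2 <= \rank W)%N.
  apply: (IH B W Bk) => [j|j]; first by rewrite inE => /andP[jJ _]; exact: sW.
  by rewrite inE => /andP[].
have hA : (#|A|.*2 <= \rank U)%N.
  apply: (IH A U Ak) => j; first by rewrite inE => /andP[_]; exact: sU.
  rewrite !inE => /andP[+ /andP[ji jJ]]; rewrite ji jJ /= => /negPn/eqP Wj.
  have jJ' : j \in J' by rewrite !inE ji.
  apply: contraNneq (Ec j jJ) => Uj.
  have [z1 z2] := cZ j jJ'.
  have Zc : Z *m cm j = cm j *m Z.
    by rewrite /cm mulmxBl mulmxBr !mulmxA z1 z2 -!mulmxA z1 z2.
  have /sub_kermxP -> // : (E <= kermx (cm j))%MS.
  rewrite (submx_trans ET)// !addsmx_sub; apply/andP; split; last by apply/sub_kermxP.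
  by apply/andP; split; apply/sub_kermxP; rewrite // -mulmxA Zc mulmxA Wj mul0mx.
have W0 : (0 < \rank W)%N.
  by rewrite lt0n mxrank_eq0; apply: contraNneq nst => ->; rewrite mul0mx sub0mx.
(* The rank of [E] is at least [2 rank W + 2 #|A|], with [rank W] at least both 1 and [2 #|B|];
   hence [2 rank W] is at least [2 #|B| + 2]. *)
by rewrite cJ -rET rT; lia.
Qed.

End CommutingPairs.

End SelfAdjoint.

(** * Normal curvature and the bound *)

Section Schwarz.
Context {R : realType} {n : nat}.
Local Notation V := 'rV[R]_n.

Lemma smooth_is_derive_line {W : normedModType R} (G : V -> W) x v (t : R) : smooth_on setT G ->
  is_derive t 1 (fun t : R => G (x + t *: v)) ('D_v G (x + t *: v)).
Proof. by move=> sG; apply: is_derive_line; exact: smooth_derivable. Qed.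

Lemma smooth_is_derive_line0 {W : normedModType R} (G : V -> W) x v : smooth_on setT G ->
  is_derive (0 : R) 1 (fun t : R => G (x + t *: v)) ('D_v G x).
Proof. by move=> sG; have := smooth_is_derive_line x v 0 sG; rewrite scale0r addr0. Qed.

Lemma second_difference (G : V -> R) x u v (s : R) : smooth_on setT G -> 0 < s ->
  exists a b, [/\ 0 <= a <= s, 0 <= b <= s &
    G (x + s *: u + s *: v) - G (x + s *: u) - G (x + s *: v) + G x = s * s * 'D_v ('D_u G) (x + a *: u + b *: v)].
Proof.
move=> sG s0.
have d1 (t : R) : is_derive t 1 (fun t : R => G (x + s *: v + t *: u) - G (x + t *: u))
    ('D_u G (x + s *: v + t *: u) - 'D_u G (x + t *: u)).
  exact: is_deriveB (smooth_is_derive_line _ _ _ sG) (smooth_is_derive_line _ _ _ sG).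
have [a aI E1] := mvt (ltW s0) (fun t _ => d1 t).
have sD := smooth_derive u sG.
have d2 (t : R) := smooth_is_derive_line (x + a *: u) v t sD.
have [b bI E2] := mvt (ltW s0) (fun t _ => d2 t).
exists a, b; split; [by move: aI; rewrite in_itv|by move: bI; rewrite in_itv|].
move: E1 E2; rewrite !scale0r !addr0 !subr0.
rewrite -[x + s *: v + s *: u]addrA [s *: v + _]addrC addrA.
rewrite -[x + s *: v + a *: u]addrA [s *: v + _]addrC addrA => E1 E2.
rewrite [RHS](_ : _ = ('D_v ('D_u G) (x + a *: u + b *: v) * s) * s); last by ring.
by rewrite -E2 -E1; ring.
Qed.

Lemma dist_half (a b c e : R) : `|a - c| < e / 2 -> `|b - c| < e / 2 -> `|a - b| <= e.
Proof.
move=> h1 h2; have -> : a - b = (a - c) - (b - c) by rewrite opprB addrA subrK.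
by rewrite (le_trans (ler_normB _ _))// [leRHS]splitr lerD// ltW.
Qed.

(** The second difference of [G] on a small parallelogram is symmetric in [u] and [v]. Two
    applications of the mean value theorem equate it with s^2 times either mixed derivative, each at
    a point near [x]. *)
Lemma schwarz_real (G : V -> R) x u v : smooth_on setT G -> 'D_v ('D_u G) x = 'D_u ('D_v G) x.
Proof.
move=> sG; apply/eqP; rewrite -subr_eq0 -normr_le0; apply/ler_addgt0Pl => e e0; rewrite addr0.
have e2 : 0 < e / 2 by rewrite divr_gt0.
have c1 : continuous ('D_v ('D_u G)) by move=> y; exact: (smooth_derive v (smooth_derive u sG) 0%N).
have c2 : continuous ('D_u ('D_v G)) by move=> y; exact: (smooth_derive u (smooth_derive v sG) 0%N).
have /nbhs_ballP[r1 /= r10 H1] := (@cvgrPdist_lt _ _ _ (nbhs x) (nbhs_filter x) _ _).1 (c1 x) _ e2.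
have /nbhs_ballP[r2 /= r20 H2] := (@cvgrPdist_lt _ _ _ (nbhs x) (nbhs_filter x) _ _).1 (c2 x) _ e2.
pose r := Num.min r1 r2; have r0 : 0 < r by rewrite lt_min r10.
pose k := `|u| + `|v| + 1; have k0 : 0 < k by rewrite ltr_wpDl// addr_ge0.
pose s := r / (k + k); have s0 : 0 < s by rewrite divr_gt0// addr_gt0.
have near (a b : R) : 0 <= a <= s -> 0 <= b <= s -> `|x - (x + a *: u + b *: v)| < r.
  move=> /andP[a0 as_] /andP[b0 bs].
  rewrite -addrA opprD addNKr normrN (le_lt_trans (ler_normD _ _))// !normrZ !ger0_norm//.
  rewrite (@le_lt_trans _ _ (s * `|u| + s * `|v|))//; first by rewrite lerD// ler_wpM2r.
  rewrite -mulrDr (@le_lt_trans _ _ (s * k))//; first by rewrite ler_pM2l// lerDl.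
  have sk : s * k + s * k = r by rewrite -mulrDr /s divfK// gt_eqF// addr_gt0.
  have sk0 : 0 < s * k by rewrite mulr_gt0.
  by lra.
have [a [b [a1 b1 E1]]] := second_difference x u v sG s0.
have [b' [a' [b1' a1' E2]]] := second_difference x v u sG s0.
have h1 := H1 (x + a *: u + b *: v); have h2 := H2 (x + b' *: v + a' *: u).
have {}h1 : `|'D_v ('D_u G) x - 'D_v ('D_u G) (x + a *: u + b *: v)| < e / 2.
  by apply: h1; rewrite -ball_normE /=; rewrite (lt_le_trans (near _ _ a1 b1))// ge_min lexx.
have {}h2 : `|'D_u ('D_v G) x - 'D_u ('D_v G) (x + b' *: v + a' *: u)| < e / 2.
  apply: h2; rewrite -ball_normE /= -addrA [b' *: v + _]addrC addrA.
  by rewrite (lt_le_trans (near _ _ a1' b1'))// ge_min lexx orbT.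
have E : 'D_v ('D_u G) (x + a *: u + b *: v) = 'D_u ('D_v G) (x + b' *: v + a' *: u).
  apply: (@mulfI _ (s * s)); first by rewrite mulf_neq0// gt_eqF.
  apply: etrans (esym E1) _; apply: etrans _ E2.
  by rewrite (addrAC x (s *: u) (s *: v)) [X in X + G x = _]addrAC.
rewrite E in h1.
exact: (dist_half h1 h2).
Qed.

Lemma smooth_coord (m p : nat) (G : V -> 'M[R]_(m, p)) i j : smooth_on setT G -> smooth_on setT (fun x => G x i j).
Proof. by move=> sG k; exact: Ck_coord openT (sG k). Qed.

Lemma derive_coord_smooth (m p : nat) (G : V -> 'M[R]_(m, p)) v i j : smooth_on setT G ->
  'D_v (fun x => G x i j) = fun x => ('D_v G x) i j.
Proof. by move=> sG; apply/funext => x; apply: derive_coord; exact: (@ex_derive _ _ _ _ _ _ _ (smooth_derivable x v sG)). Qed.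

Lemma schwarz (m p : nat) (G : V -> 'M[R]_(m, p)) x u v : smooth_on setT G -> 'D_v ('D_u G) x = 'D_u ('D_v G) x.
Proof.
move=> sG; apply/matrixP => i j.
have := schwarz_real x u v (smooth_coord i j sG).
rewrite (derive_coord_smooth u i j sG) (derive_coord_smooth v i j sG).
rewrite !derive_coord//.
  exact: (@ex_derive _ _ _ _ _ _ _ (smooth_derivable x u (smooth_derive v sG))).
exact: (@ex_derive _ _ _ _ _ _ _ (smooth_derivable x v (smooth_derive u sG))).
Qed.

End Schwarz.

Section ProjectionCurvature.
Context {R : realType} {N : nat}.
Implicit Types P D E : 'M[R]_N.

Lemma proj_conn_mul P D E : P *m P = P -> D *m P + P *m D = D -> E *m P + P *m E = E ->
  (P *m D - D *m P) *m (P *m E - E *m P) = - (D *m E).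
Proof.
move=> PP DE EE; have s1 := proj_sandwich PP DE; have s2 := proj_sandwich PP EE.
have -> : D *m E = D *m P *m E + P *m D *m E *m P.
  rewrite -{1}EE mulmxDr addrC !mulmxA; congr (_ + _).
  by rewrite -{1}DE !mulmxDl -[D *m P *m E *m P]mulmxA -[D *m P *m (E *m P)]mulmxA (mulmxA P) s2 mulmx0 add0r.
rewrite mulmxBl !mulmxBr !mulmxA s1 mul0mx sub0r.
rewrite -[D *m P *m P]mulmxA PP -[D *m P *m E *m P]mulmxA -[D *m P *m (E *m P)]mulmxA (mulmxA P E) s2 mulmx0 subr0.
by rewrite opprD addrC.
Qed.

Lemma proj_mul_commute P D E : P *m P = P -> D *m P + P *m D = D -> E *m P + P *m E = E ->
  P *m (D *m E) = D *m E *m P.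
Proof.
move=> PP DE EE; have s1 := proj_sandwich PP DE; have s2 := proj_sandwich PP EE.
have -> : P *m (D *m E) = P *m D *m E *m P.
  by rewrite -{1}EE mulmxDr mulmxDr !mulmxA s1 mul0mx addr0.
by rewrite -{2}DE !mulmxDl -[D *m P *m E *m P]mulmxA -[D *m P *m (E *m P)]mulmxA (mulmxA P) s2 mulmx0 add0r.
Qed.

End ProjectionCurvature.

(** The noncommutative computation behind [structure_equation]. The terms [z] and [q] stand for
    second derivatives of the projection and of the gauge; being the same in both hypotheses, they
    cancel on subtraction. *)
Lemma structure_algebra {R : realType} (N : nat) (Q Ga Gb Ka Kb s t z q d1 d2 : 'M[R]_N) :
  Kb *m Ka = - s -> Ka *m Kb = - t ->
  d1 *m Q + Ga *m (Q *m Kb - Gb *m Q) = (Q *m Kb - Gb *m Q) *m Ka + Q *m (s - t + z) - q ->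
  d2 *m Q + Gb *m (Q *m Ka - Ga *m Q) = (Q *m Ka - Ga *m Q) *m Kb + Q *m (t - s + z) - q ->
  (d1 - d2 - (Ga *m Gb - Gb *m Ga)) *m Q = Q *m (s - t).
Proof.
move=> kba kab.
rewrite !mulmxBl !mulmxBr !mulmxDr !mulmxN !mulmxA -(mulmxA Q Kb) -(mulmxA Q Ka) kba kab !mulmxN.
move: (d1 *m Q) (d2 *m Q) (Q *m s) (Q *m t) (Q *m z) (Ga *m Q *m Kb) (Gb *m Q *m Ka) => e1 e2 qs qt qz g1 g2.
move: (Ga *m Gb *m Q) (Gb *m Ga *m Q) => g3 g4 h1 h2.
apply/matrixP => i j.
have := congr1 (fun A : 'M[R]_N => A i j) h1; have := congr1 (fun A : 'M[R]_N => A i j) h2.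
by rewrite !mxE => l2 l1; lra.
Qed.

Section Brackets.
Context {R : realType} {N : nat}.
Implicit Types P Z A B D E : 'M[R]_N.

Lemma bracket_proj P A B D E : P *m P = P -> A *m P = P *m A -> B *m P = P *m B ->
  P *m (D - E - (A *m B - B *m A)) = P *m D - P *m E - (P *m A *m (P *m B) - P *m B *m (P *m A)).
Proof.
move=> PP AP BP; rewrite !mulmxBr; congr (_ - _ - (_ - _)).
  by rewrite !mulmxA -(mulmxA P A) AP mulmxA PP.
by rewrite !mulmxA -(mulmxA P B) BP mulmxA PP.
Qed.

Lemma bracket_commute Z A B D E : Z *m A = A *m Z -> Z *m B = B *m Z -> Z *m D = D *m Z -> Z *m E = E *m Z ->
  Z *m (D - E - (A *m B - B *m A)) = (D - E - (A *m B - B *m A)) *m Z.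
Proof.
move=> ZA ZB ZD ZE; rewrite !mulmxBr !mulmxBl ZD ZE; congr (_ - (_ - _)).
  by rewrite mulmxA ZA -mulmxA ZB mulmxA.
by rewrite mulmxA ZB -mulmxA ZA mulmxA.
Qed.

Lemma bracket0 Z A D E : Z *m (D - E - (A *m 0 - 0 *m A)) = 0 -> Z *m D = Z *m E.
Proof. by rewrite mulmx0 mul0mx subrr subr0 mulmxBr => /eqP; rewrite subr_eq0 => /eqP. Qed.

Lemma scale_block_sum (t : R) Z P A D : Z *m (P *m A) + t *: (Z *m (P *m D)) = Z *m (P *m (t *: D + A)).
Proof. by rewrite !mulmxDr -!scalemxAr addrC. Qed.

Lemma skew_gram (A S : 'M[R]_N) : S^T = - S -> A *m S *m A^T + A *m (A *m S)^T = 0.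
Proof. by move=> sk; rewrite trmx_mul sk mulNmx mulmxN mulmxA subrr. Qed.

End Brackets.

(** * Curvature in a radial gauge and flat blocks *)

Section GaugeCurvature.
Context {R : realType} {M : topologicalType} {n N : nat}.
Variable f : M -> 'rV[R]_N.
Hypothesis smf : submanifold n f.
Variable phi : 'rV[R]_n -> M.
Hypothesis cp : chart f phi.

Notation Hol := (@Hol R M n N f).
Notation V := 'rV[R]_n.
Local Notation P := (cproj f phi).
Local Notation K := (conn f phi).

Variable Q : V -> 'M[R]_N.
Hypothesis rQ : radial_gauge f phi Q.
Local Notation gform := (gform f phi Q).
Local Notation nform := (nform f phi Q).

(** Up to sign, the curvature of the connection [conn] on the trivial bundle. It commutes with the
    normal projection, and its normal part is the normal curvature. *)
Definition curv x a b := 'D_b P x *m 'D_a P x - 'D_a P x *m 'D_b P x.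

Lemma gform_mulQ x a : gform x a *m Q x = Q x *m K x a - 'D_a Q x.
Proof. by rewrite /gform -mulmxA (gauge_orthV cp rQ) mulmx1. Qed.

Lemma gauge_derive_form x b : 'D_b Q x = Q x *m K x b - gform x b *m Q x.
Proof. by rewrite gform_mulQ opprB addrC subrK. Qed.

Lemma structure_half x a b :
  'D_b (gform^~ a) x *m Q x + gform x a *m 'D_b Q x = 'D_b Q x *m K x a +
  Q x *m (curv x a b + (P x *m 'D_b ('D_a P) x - 'D_b ('D_a P) x *m P x)) - 'D_b ('D_a Q) x.
Proof.
have sQ := gauge_smooth rQ; have sP := cproj_smooth cp.
have dQ := smooth_is_derive_line0 x b sQ; have dP := smooth_is_derive_line0 x b sP.
have dQa := smooth_is_derive_line0 x b (smooth_derive a sQ); have dPa := smooth_is_derive_line0 x b (smooth_derive a sP).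
have dg := smooth_is_derive_line0 x b (gform_smooth cp rQ a).
have d1 := is_derive_mulmx dg dQ; rewrite !scale0r !addr0 in d1.
have dK0 := is_deriveB (is_derive_mulmx dP dPa) (is_derive_mulmx dPa dP).
rewrite !scale0r !addr0 in dK0.
have dK : is_derive (0 : R) 1 (fun t : R => K (x + t *: b) a) _ := dK0.
have d2 := is_deriveB (is_derive_mulmx dQ dK) dQa; rewrite !scale0r !addr0 in d2.
rewrite (_ : (fun t => gform (x + t *: b) a *m Q (x + t *: b)) = fun t => Q (x + t *: b) *m K (x + t *: b) a - 'D_a Q (x + t *: b)) in d1; last first.
  by apply/funext => t; exact: gform_mulQ.
rewrite (is_derive_unique d1 d2) /curv; congr (_ + _ *m _ - _).
by rewrite opprD (addrC (- ('D_b ('D_a P) x *m P x))) addrACA.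
Qed.

(** Cartan's structure equation in the gauge [Q]. It is the antisymmetrisation of the derivative of
    [gform Q = Q K - dQ], where the second derivatives disappear by Schwarz's theorem. *)
Lemma structure_equation x a b :
  'D_b (gform^~ a) x - 'D_a (gform^~ b) x - (gform x a *m gform x b - gform x b *m gform x a) =
  Q x *m curv x a b *m (Q x)^T.
Proof.
have h1 := structure_half x a b; have h2 := structure_half x b a.
have sQ := gauge_smooth rQ; have sP := cproj_smooth cp.
rewrite (schwarz x b a sQ) (schwarz x b a sP) in h2.
have [_ PP] := cproj_proj cp x.
have ka : K x b *m K x a = - ('D_b P x *m 'D_a P x) by exact: proj_conn_mul PP (cproj_derive cp x b) (cproj_derive cp x a).
have kb : K x a *m K x b = - ('D_a P x *m 'D_b P x) by exact: proj_conn_mul PP (cproj_derive cp x a) (cproj_derive cp x b).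
set A := _ - _ - _; rewrite -[A]mulmx1 -(gauge_orth cp rQ x) mulmxA; congr (_ *m _).
rewrite (gauge_derive_form x b) in h1; rewrite (gauge_derive_form x a) in h2.
exact: (structure_algebra ka kb h1 h2).
Qed.

Lemma gform_radial x (t : R) : gform (t *: x) x = 0.
Proof.
have [_ dQ] := gauge_seg rQ x; have := dQ t; rewrite add0r => h.
have := smooth_is_derive_line 0 x t (gauge_smooth rQ); rewrite add0r.
rewrite (_ : (fun t : R => Q (0 + t *: x)) = fun t => Q (t *: x)); last by apply/funext => u; rewrite add0r.
by move=> /(is_derive_unique h) E; rewrite /gform E subrr mul0mx.
Qed.

Lemma gform_lin y (t s : R) u v : gform y (t *: u + s *: v) = t *: gform y u + s *: gform y v.
Proof.
rewrite !(gform_sum cp rQ y) !scaler_sumr -big_split /=.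
by apply: eq_bigr => i _; rewrite !mxE scalerDl !scalerA.
Qed.

(** Differentiating at [s = 0] the vanishing of the form at [t x + s v] on the radial vector
    [t x + s v] itself. *)
Lemma gform_euler x v (t : R) : t *: 'D_v (gform^~ x) (t *: x) + gform (t *: x) v = 0.
Proof.
have dx := smooth_is_derive_line0 (t *: x) v (gform_smooth cp rQ x).
have dv := smooth_is_derive_line0 (t *: x) v (gform_smooth cp rQ v).
have d1 : is_derive (0 : R) 1 (fun s : R => t *: gform (t *: x + s *: v) x + s *: gform (t *: x + s *: v) v) 0.
  rewrite (_ : (fun s => _) = fun=> 0); first exact: is_derive_cst.
  apply/funext => s; have := gform_radial (t *: x + s *: v) 1; rewrite scale1r.
  by rewrite gform_lin.
have d2 : is_derive (0 : R) 1 (fun s : R => s *: gform (t *: x + s *: v) v) (gform (t *: x) v).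
  have dI : is_derive (0 : R) 1 (fun s : R => s *: (1%:M : 'M[R]_N)) 1%:M.
    have := @is_derive_line R _ _ (fun A : 'M[R]_N => A) 0 1%:M 0 1%:M (is_derive_id _ _).
    by rewrite (_ : (fun s => _) = fun s : R => s *: (1%:M : 'M[R]_N))//; apply/funext => s; rewrite add0r.
  have := is_derive_mulmx dI dv; rewrite !scale0r mul0mx !addr0 mul1mx.
  rewrite (_ : (fun s => _) = fun s : R => s *: gform (t *: x + s *: v) v)//.
  by apply/funext => s; rewrite -scalemxAl mul1mx.
have d3 := is_deriveD (is_deriveZ t dx) d2.
exact: is_derive_unique d3 d1.
Qed.

(* [Z] is the projection onto a holonomy invariant subspace of the normal space at the centre. *)
Section Block.
Variable Z : 'M[R]_N.
Hypothesis Zcomm : forall x v, Z *m nform x v = nform x v *m Z.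

Definition ncurv x a b := P 0 *m (Q x *m curv x a b *m (Q x)^T).

Lemma nform_smooth v : smooth_on setT (fun x => nform x v).
Proof. by move=> k; apply: (Ck_mulmx openT); [exact: Ck_cst|exact: (gform_smooth cp rQ v)]. Qed.

Lemma nform_derive x a b : 'D_b (nform^~ a) x = P 0 *m 'D_b (gform^~ a) x.
Proof.
have d1 := is_derive_mulmxl (P 0) (smooth_is_derive_line0 x b (gform_smooth cp rQ a)).
exact: is_derive_unique (smooth_is_derive_line0 x b (nform_smooth a)) d1.
Qed.

Lemma ncurvE x a b : ncurv x a b = 'D_b (nform^~ a) x - 'D_a (nform^~ b) x - (nform x a *m nform x b - nform x b *m nform x a).
Proof.
have [_ PP] := cproj_proj cp 0.
apply: etrans (congr1 (mulmx (P 0)) (esym (structure_equation x a b))) _.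
apply: etrans (bracket_proj _ _ PP (gform_commute cp rQ x a) (gform_commute cp rQ x b)) _.
by congr (_ - _ - _); exact: (esym (nform_derive _ _ _)).
Qed.

Lemma block_derive_commute x a b : Z *m 'D_b (nform^~ a) x = 'D_b (nform^~ a) x *m Z.
Proof.
have d := smooth_is_derive_line0 x b (nform_smooth a).
apply: is_derive_unique (is_derive_mulmxl Z d) _.
rewrite (_ : (fun t => _) = fun t : R => nform (x + t *: b) a *m Z); first exact: is_derive_mulmxr.
by apply/funext => t; rewrite Zcomm.
Qed.

Lemma block_curv_commute x a b : Z *m ncurv x a b = ncurv x a b *m Z.
Proof.
rewrite ncurvE; exact: (bracket_commute (Zcomm x a) (Zcomm x b) (block_derive_commute x a b) (block_derive_commute x b a)).
Qed.

(** In a radial gauge the curvature recovers the connection form: the structure equation with one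
    radial argument, combined with [gform_euler], shows that [t] times the form at [t x] has a
    derivative given by the curvature. Here its [Z] part has derivative 0 and vanishes at
    [t = 0]. *)
Lemma flat_block_nform x v : (forall y a b, Z *m ncurv y a b = 0) -> Z *m nform x v = 0.
Proof.
move=> flat.
pose mu (t : R) := t *: (Z *m nform (t *: x) v).
have dmu (t : R) : is_derive t 1 mu 0.
  have dn : is_derive t 1 (fun t : R => Z *m nform (t *: x) v) (Z *m 'D_x (nform^~ v) (t *: x)).
    have := is_derive_mulmxl Z (smooth_is_derive_line 0 x t (nform_smooth v)).
    rewrite add0r (_ : (fun t => _) = fun t : R => Z *m nform (t *: x) v)//.
    by apply/funext => u; rewrite add0r.
  have dI : is_derive t 1 (fun s : R => s *: (1%:M : 'M[R]_N)) 1%:M.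
    have := @is_derive_line R _ _ (fun A : 'M[R]_N => A) 0 1%:M t 1%:M (is_derive_id _ _).
    by rewrite (_ : (fun s => _) = fun s : R => s *: (1%:M : 'M[R]_N))//; apply/funext => s; rewrite add0r.
  have := is_derive_mulmx dI dn; rewrite mul1mx -scalemxAl mul1mx.
  rewrite (_ : (fun s => _) = mu); last by apply/funext => s; rewrite -scalemxAl mul1mx.
  have := flat (t *: x) v x; rewrite ncurvE [nform (t *: x) x](_ : _ = 0); last by rewrite /nform gform_radial mulmx0.
  move=> /bracket0 ->.
  rewrite (nform_derive (t *: x) x v) /nform scale_block_sum gform_euler !mulmx0.
  exact.
have := mx_derive0_const (m := N) (n := N) (f := mu) 1 0 dmu.
by rewrite /mu scale0r !scale1r.
Qed.

(** [Hol_generated] with [G] the group of orthogonal matrices that fix the rows of [Z]: the values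
    of the form are skew and killed by [Z], so their exponentials lie in [G]. *)
Lemma flat_block_trivial g : (forall y a b, Z *m ncurv y a b = 0) -> Hol (range phi) (phi 0) g -> Z *m g = Z.
Proof.
move=> flat Hg; pose G := [set g : 'M[R]_N | g *m g^T = 1%:M /\ Z *m g = Z].
have GG : orthogonal_group G.
  split.
  - by split; rewrite ?trmx1 ?mulmx1.
  - move=> g1 h1 [p1 z1] [p2 z2]; split; last by rewrite mulmxA z1.
    by rewrite trmx_mul mulmxA -(mulmxA g1) p2 mulmx1.
  - move=> g1 [p1 z1]; split; first by rewrite trmxK; exact: mulmx1C.
    by rewrite -{1}z1 -mulmxA p1 mulmx1.
  - by move=> g1 [].
have [//|_ ->//] := Hol_generated cp rQ GG _ Hg.
move=> x v; have Zn := flat_block_nform x v flat.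
have sk : (nform x v)^T = - nform x v.
  apply: velocity_skew (nform_velocity smf cp rQ x v).
  by apply: (Hol_group smf); exists 0.
have cA : smooth_on setT (fun _ : R => nform x v) by move=> k; exact: Ck_cst.
have [Y sY] := ode_sol_ex (fun t => cA 0%N t I); have [Y0 dY] := sY.
exists Y; split=> //; first exact: ode_smooth cA sY; last first.
  by have := dY 0; rewrite Y0 mul1mx.
move=> t; split.
  have dYY (u : R) : is_derive u 1 (fun t => Y t *m (Y t)^T) 0.
    apply: (is_derive_eq (is_derive_mulmx (dY u) (is_derive_trmx (dY u)))).
    exact: skew_gram.
  by rewrite (mx_derive0_const t 0 dYY) Y0 trmx1 mulmx1.
pose z t := Z *m Y t - Z.
have dz (u : R) : is_derive u 1 z (z u *m nform x v).
  apply: (is_derive_eq (is_deriveB (is_derive_mulmxl Z (dY u)) (is_derive_cst Z u 1))).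
  by rewrite subr0 /z mulmxBl Zn subr0 mulmxA.
have := ode_unique (fun t => cA 0%N t I) sY dz t.
by rewrite {2}/z Y0 mulmx1 subrr mul0mx => /eqP; rewrite subr_eq0 => /eqP.
Qed.

End Block.

End GaugeCurvature.

Section Projections.
Context {R : realType} {N : nat}.
Implicit Types (G : set 'M[R]_N) (V : {vspace 'rV[R]_N}) (Z : 'M[R]_N).

Definition proj_onto V Z := orth_proj Z /\ forall u : 'rV_N, u *m Z = u <-> u \in V.

Lemma proj_onto_ex V : exists Z, proj_onto V Z.
Proof.
pose B := \matrix_(i < \dim V) (vbasis V)`_i.
have BE (c : 'rV_(\dim V)) : c *m B = \sum_i c 0 i *: (vbasis V)`_i.
  by rewrite mulmx_sum_row; apply: eq_bigr => i _; rewrite rowK.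
have inV (c : 'rV_(\dim V)) : c *m B \in V.
  by rewrite BE; apply: memv_suml => i _; apply/memvZ/vbasis_mem/mem_nth; rewrite size_tuple.
have Bc u : u \in V -> exists c : 'rV_(\dim V), u = c *m B.
  move=> uV; exists (\row_i coord (vbasis V) i u).
  by rewrite BE {1}(coord_vbasis uV); apply: eq_bigr => i _; rewrite mxE.
have Bu : B *m B^T \in unitmx.
  apply: gram_unit => c; rewrite BE => c0; apply/rowP => i; rewrite mxE.
  by have /freeP := basis_free (vbasisP V); apply.
exists (B^T *m invmx (B *m B^T) *m B); split; first split.
- by rewrite !trmx_mul trmxK trmx_inv trmx_mul trmxK mulmxA.
- by rewrite !mulmxA -(mulmxA _ B B^T) -(mulmxA B^T _ (B *m B^T)) mulVmx// mulmx1.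
move=> u; split=> [<-|/Bc[c ->]]; first by rewrite mulmxA; exact: inV.
by rewrite !mulmxA -(mulmxA c B) -(mulmxA c) mulmxV// mulmx1.
Qed.

Lemma proj_onto_mul V Z (m : nat) (A : 'M[R]_(m, N)) : proj_onto V Z -> (forall i, row i A \in V) -> A *m Z = A.
Proof. by move=> [_ ZV] AV; apply/row_matrixP => i; rewrite row_mul; apply/ZV. Qed.

Lemma proj_onto_row V Z i : proj_onto V Z -> row i Z \in V.
Proof. by move=> [[_ ZZ] ZV]; apply/ZV; rewrite -row_mul ZZ. Qed.

Lemma proj_onto_commute V Z G g : orthogonal_group G -> invariant G V -> proj_onto V Z -> G g -> Z *m g = g *m Z.
Proof.
move=> GG iV pZ Gg; have [[ZT ZZ] _] := pZ.
have h k : G k -> Z *m k *m Z = Z *m k.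
  by move=> Gk; apply: (proj_onto_mul pZ) => i; rewrite row_mul; apply: iV Gk _ _; exact: (proj_onto_row i pZ).
have [_ _ GT _] := GG.
have := congr1 trmx (h g^T (GT g Gg)); rewrite !trmx_mul trmxK ZT mulmxA => <-.
by rewrite h.
Qed.

Lemma proj_onto_orth V V' Z Z' : proj_onto V Z -> proj_onto V' Z' -> orthogonal_spaces V V' -> Z *m Z' = 0.
Proof.
move=> pZ pZ' o; have [[ZT' _] _] := pZ'; apply/matrixP => i j; rewrite mxE [RHS]mxE.
have h := o _ _ (proj_onto_row i pZ) (proj_onto_row j pZ').
have {}h : (row i Z *m (row j Z')^T) 0 0 = 0 by rewrite h mxE.
rewrite mxE in h; apply: etrans h; apply: eq_bigr => k _; rewrite !mxE.
by congr (_ * _); rewrite -{1}ZT' mxE.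
Qed.

End Projections.

(** * Second fundamental form and the Ricci equation *)

Section SecondFundamentalForm.
Context {R : realType} {n N : nat}.
Variable F : 'rV[R]_n -> 'rV[R]_N.
Hypothesis sF : smooth_on setT F.
Hypothesis immF : forall x w, 'D_w F x = 0 -> w = 0.
Local Notation J := (jac F).
Local Notation P := (nproj F).

(** The matrix, in coordinates, of the bilinear form given by the [xi] component of the second
    derivative of [F]. The shape operator is [sff] times the inverse of [gram], self-adjoint for the
    induced metric. *)
Definition sff x (xi : 'rV[R]_N) : 'M[R]_n := \matrix_i (xi *m ('D_(delta_mx 0 i) J x)^T).
Definition gram x := J x *m (J x)^T.

Lemma jac_smooth_on : smooth_on setT J.
Proof. by move=> k; exact: jac_smooth. Qed.

Lemma sff_row x xi (a : 'rV[R]_n) : a *m sff x xi = xi *m ('D_a J x)^T.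
Proof.
rewrite (derive_smooth_sum x a jac_smooth_on) linear_sum /= mulmx_sumr mulmx_sum_row.
by apply: eq_bigr => i _; rewrite rowK linearZ /= scalemxAr.
Qed.

Lemma sff_sym x xi : (sff x xi)^T = sff x xi.
Proof.
have sffE i j : sff x xi i j = \sum_k xi 0 k * ('D_(delta_mx 0 i) J x) j k.
  by rewrite /sff mxE mxE; apply: eq_bigr => k _; rewrite [X in _ * X]mxE.
apply/matrixP => i j; rewrite mxE !sffE; apply: eq_bigr => k _; congr (_ * _).
have E (a b : 'I_n) : ('D_(delta_mx 0 a) J x) b k = ('D_(delta_mx 0 a) ('D_(delta_mx 0 b) F) x) 0 k.
  rewrite -derive_coord; last exact: (@ex_derive _ _ _ _ _ _ _ (smooth_derivable x _ jac_smooth_on)).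
  rewrite -derive_coord; last exact: (@ex_derive _ _ _ _ _ _ _ (smooth_derivable x _ (smooth_derive _ sF))).
  by rewrite (_ : (fun y => J y b k) = fun y => 'D_(delta_mx 0 b) F y 0 k)//; apply/funext => y; rewrite mxE.
have S := congr1 (fun A : 'rV[R]_N => A 0 k) (schwarz x (delta_mx 0 i) (delta_mx 0 j) sF).
exact: etrans (E j i) (etrans S (esym (E i j))).
Qed.

Lemma nproj_smooth_on : smooth_on setT P.
Proof. by move=> k; exact: nproj_smooth. Qed.

Lemma jac_nproj_derive x a : J x *m 'D_a P x = - ('D_a J x *m P x).
Proof.
have dJ := smooth_is_derive_line0 x a jac_smooth_on.
have dP := smooth_is_derive_line0 x a nproj_smooth_on.
have := is_derive_mulmx dJ dP; rewrite !scale0r !addr0.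
rewrite (_ : (fun t => _) = fun=> 0); last by apply/funext => t; rewrite (jac_nproj sF immF).
move=> h; have /eqP := is_derive_unique h (is_derive_cst _ _ _).
by rewrite addr_eq0 => /eqP ->; rewrite opprK.
Qed.

Lemma sff_curvature x (xi eta : 'rV[R]_N) a b : xi *m P x = xi -> eta *m P x = eta ->
  ('D_a P x)^T = 'D_a P x -> 'D_a P x *m P x + P x *m 'D_a P x = 'D_a P x ->
  xi *m ('D_a P x *m 'D_b P x) *m eta^T =
  a *m (sff x xi *m invmx (gram x) *m sff x eta) *m b^T.
Proof.
move=> xP eP sPa Pa; have [PT PP] := nproj_proj sF immF x.
have e1 : xi *m 'D_a P x = xi *m 'D_a P x *m jinv F x *m J x.
  rewrite -[RHS]mulmxA (_ : jinv F x *m J x = 1%:M - P x); last by rewrite /nproj opprB addrC subrK.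
  have z : xi *m 'D_a P x *m P x = 0.
    by rewrite -{1}xP -(mulmxA xi) -(mulmxA xi) (proj_sandwich PP Pa) mulmx0.
  by rewrite mulmxBr mulmx1 z subr0.
have e2 : xi *m 'D_a P x *m (J x)^T = - (xi *m ('D_a J x)^T).
  have := congr1 trmx (jac_nproj_derive x a); rewrite trmx_mul sPa linearN /= trmx_mul PT => h.
  by rewrite -mulmxA h mulmxN mulmxA xP.
have e3 : J x *m 'D_b P x *m eta^T = - ('D_b J x *m eta^T).
  by rewrite jac_nproj_derive mulNmx -mulmxA -[P x]PT -trmx_mul eP.
rewrite mulmxA e1 /jinv mulmxA e2 -(mulmxA _ (J x)) -(mulmxA _ (J x *m _)) e3.
rewrite !mulNmx mulmxN opprK -!sff_row -!mulmxA; congr (_ *m (_ *m (_ *m _))).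
rewrite -[LHS]trmxK trmx_mul trmxK -sff_row trmx_mul sff_sym //.
Qed.

Lemma gram_pos x u : u != 0 -> 0 < bil (gram x) u u.
Proof.
move=> u0; have uJ : u *m J x != 0 by apply: contraNneq u0 => /(jac_inj sF immF) ->.
rewrite /bil /gram mulmxA -mulmxA -trmx_mul lt_neqAle mxE; apply/andP; split; last first.
  by apply: sumr_ge0 => i _; rewrite [X in _ * X]mxE -expr2 sqr_ge0.
apply: contraNneq uJ => h; apply/eqP/mulmx_trmx_eq0/matrixP => i j.
by rewrite !ord1 mxE -h mxE.
Qed.

End SecondFundamentalForm.

Section BlockAlgebra.
Context {R : realType} {N : nat}.

Lemma block_algebra (Q Qt c P P0 Z : 'M[R]_N) : Qt *m Q = 1%:M -> P0 *m Q = Q *m P -> P *m c = c *m P ->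
  P *m Qt = Qt *m P0 -> P0 *m Z = Z -> c *m (Qt *m Z *m Q) = Qt *m (P0 *m (Q *m c *m Qt) *m Z) *m Q.
Proof.
move=> QQ PQ Pc PQt PZ.
rewrite (mulmxA P0) (mulmxA P0) PQ -(mulmxA Q P) Pc -(mulmxA Q) -(mulmxA c P) PQt !mulmxA QQ mul1mx.
by rewrite -(mulmxA _ P0) PZ.
Qed.

Lemma block_cross (xi eta : 'rV[R]_N) (B B' c : 'M[R]_N) : xi *m B = xi -> eta *m B' = eta -> B'^T = B' ->
  c *m B' = B' *m c -> B *m B' = 0 -> xi *m c *m eta^T = 0.
Proof.
move=> xB eB BT cB BB; rewrite -xB -eB trmx_mul BT mulmxA -(mulmxA _ c) cB mulmxA -(mulmxA xi) BB.
by rewrite mulmx0 !mul0mx.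
Qed.

Lemma block_fixed (g gt k Z P0 P : 'M[R]_N) : g *m gt = P0 -> g *m P = g -> Z *m P0 = Z -> P0 *m Z = Z ->
  k *m P0 = P0 *m k -> gt *m Z *m g *m (gt *m k *m g + (1%:M - P)) = gt *m Z *m g -> Z *m k = Z.
Proof.
move=> gg gP ZP PZ kP E.
have E' : g *m (gt *m Z *m g *m (gt *m k *m g)) *m gt = g *m (gt *m Z *m g) *m gt.
  by rewrite -[in RHS]E mulmxDr mulmxBr mulmx1 -(mulmxA _ g P) gP subrr addr0.
move: E'; rewrite !mulmxA gg PZ -(mulmxA Z g gt) gg ZP -(mulmxA (Z *m k)) gg.
by rewrite -mulmxA kP mulmxA ZP.
Qed.

End BlockAlgebra.

(** * Curved blocks and the bound *)

Section Bound.
Context {R : realType} {M : topologicalType} {n N : nat}.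
Variable f : M -> 'rV[R]_N.
Hypothesis smf : submanifold n f.

Notation P := (@normal_proj R M n N f).
Notation Hol := (@Hol R M n N f).
Notation Tr := (@Tr R M n N f).
Notation loc := (@local_holonomy R M N n f).
Notation V := 'rV[R]_n.

Lemma cproj_derive_comp (phi psi : V -> M) y a : chart f phi -> chart f psi -> range psi `<=` range phi ->
  exists b, 'D_a (cproj f psi) y = 'D_b (cproj f phi) (chart_inv phi (psi y)).
Proof.
move=> cp cs sub.
pose x (t : R) := chart_inv phi (psi (y + t *: a)).
have cline : continuous (fun t : R => y + t *: a).
  by move=> t; apply: cvgD; [exact: cvg_cst|apply: cvgZ; [exact: cvg_id|exact: cvg_cst]].
have xE t : phi (x t) = psi (y + t *: a) by apply: chart_invK; apply: sub; exists (y + t *: a).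
have cx : {for (0 : R), continuous x}.
  apply: (@continuous_comp _ _ _ (fun t : R => psi (y + t *: a)) (chart_inv phi) 0).
    apply: (@continuous_comp _ _ _ (fun t : R => y + t *: a) psi 0); first exact: cline.
    exact: chart_continuous cs _.
  by rewrite -xE; exact: chart_inv_continuous cp.
have dy := smooth_is_derive_line0 y a (chart_smooth cs).
have nE : \forall t \near (0 : R), (f \o phi) (x t) = (f \o psi) (y + t *: a).
  by apply: filterE => t /=; rewrite xE.
have [dx _] := lift_derive (chart_smooth cp) (chart_imm cp) cx nE dy.
set d := _ *m _ in dx; exists d.
have dP := is_derive_comp_smooth (cproj_smooth cp) dx.
have x0 : x 0 = chart_inv phi (psi y) by rewrite /x scale0r addr0.
rewrite x0 in dP; apply: is_derive_unique (smooth_is_derive_line0 y a (cproj_smooth cs)) _.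
rewrite (_ : (fun t => _) = cproj f phi \o x)//; apply/funext => t /=.
by rewrite -(cprojE cs) -(cprojE cp) xE.
Qed.

Lemma nform_commute_block (phi : V -> M) (Q : V -> 'M[R]_N) Z x v : chart f phi -> radial_gauge f phi Q ->
  (forall g, Hol (range phi) (phi 0) g -> Z *m g = g *m Z) -> Z *m nform f phi Q x v = nform f phi Q x v *m Z.
Proof.
move=> cp rQ Zc; have [g [sg g0 Gg dg]] := nform_velocity smf cp rQ x v.
apply: is_derive_unique (is_derive_mulmxl Z dg) _.
rewrite (_ : (fun t => _) = fun t => g t *m Z); first exact: is_derive_mulmxr.
by apply/funext => t; rewrite Zc.
Qed.

Hypothesis leq : local_eq_restricted n f.
Variable phi : V -> M.
Hypothesis cp : chart f phi.
Variable Q : V -> 'M[R]_N.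
Hypothesis rQ : radial_gauge f phi Q.
Local Notation P0 := (cproj f phi 0).
Local Notation p := (phi 0).

Definition holonomy_block (Z : 'M[R]_N) :=
  [/\ Z^T = Z, Z *m P0 = Z & forall g, Hol (range phi) p g -> Z *m g = g *m Z].

Definition curved (Z : 'M[R]_N) x := exists a b, Z *m ncurv f phi Q x a b != 0.

Lemma ncurv_smooth a b : smooth_on setT (fun x => ncurv f phi Q x a b).
Proof.
move=> k; have sQ := gauge_smooth rQ k.
have sa := smooth_derive a (cproj_smooth cp) k; have sb := smooth_derive b (cproj_smooth cp) k.
apply: (Ck_mulmx openT); first exact: Ck_cst.
apply: (Ck_mulmx openT); last exact: (Ck_trmx openT sQ).
apply: (Ck_mulmx openT) => //.
by apply: (CkB openT); [exact: (Ck_mulmx openT sb sa)|exact: (Ck_mulmx openT sa sb)].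
Qed.

Lemma curved_open Z x : curved Z x -> exists O, [/\ open O, O x & forall y, O y -> curved Z y].
Proof.
move=> [a [b ne]].
exists [set y | Z *m ncurv f phi Q y a b != 0]; split=> //; last by move=> y yO; exists a, b.
have cn : continuous (fun y => Z *m ncurv f phi Q y a b).
  by move=> y; exact: (Ck_mulmx openT (Ck_cst 0 setT Z) (ncurv_smooth a b 0%N)).
rewrite (_ : [set y | _] = (fun y => `|Z *m ncurv f phi Q y a b|) @^-1` [set r : R | 0 < r]); last first.
  by apply/seteqP; split=> y /=; rewrite normr_gt0.
apply: ((continuousP _).1 _ _ (@open_gt R 0)) => y.
by apply: (@cvg_norm _ _ _ (nbhs y)); exact: cn.
Qed.

(** If the block were flat on [O], its transport [Z'] to a small chart [psi] inside [O] would be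
    fixed by the holonomy of [psi]. Since local and restricted holonomy coincide, that group is the
    full holonomy group of [phi] at the same point, and transporting back shows that every [g] fixes
    [Z]. *)
Lemma curved_dense Z (O : set V) : holonomy_block Z -> open O -> O !=set0 ->
  (exists2 g, Hol (range phi) p g & Z *m g != Z) -> exists2 x, O x & curved Z x.
Proof.
move=> [ZT ZP Zc] oO [x0 Ox0] [g Hg gZ]; apply: contrapT => H.
have flat x a b : O x -> Z *m ncurv f phi Q x a b = 0.
  by move=> Ox; apply/eqP/negPn/negP => ne; apply: H; exists x => //; exists a, b.
have [||psi [cs ps0 psub]] := chart_small smf (U := phi @` O) (p := phi x0).
- exact: chart_open cp oO.
- by exists x0.
have sub : range psi `<=` range phi by move=> q /psub[x _ <-]; exists x.
have gp := good_restricted smf leq cp; have gs := good_restricted smf leq cs.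
have [Q' rQ'] := radial_gauge_ex cs.
pose g0 := P0 *m Q x0; have T0 : Tr (range phi) p (phi x0) g0 by exact: (gauge_Tr cp rQ).
have [g00 Pg0 g00' g0P] := Tr_frame smf T0.
pose Z' := g0^T *m Z *m g0.
have PZ : P0 *m Z = Z.
  by have [PT _] := cproj_proj cp 0; have := congr1 trmx ZP; rewrite trmx_mul PT ZT.
have Wx0 : range phi (phi x0) by exists x0.
have Hl k : Hol (range phi) (phi x0) k -> Hol (range psi) (phi x0) k.
  rewrite -(good_loc smf gp Wx0) (good_loc smf gs)//; by exists 0.
have Z0 : Z *m (1%:M - P0) = 0 by rewrite mulmxBr mulmx1 ZP subrr.
(* Transport by the gauge of [psi] and by that of [phi] differ by an element of the holonomy group,
   which commutes with [Z]; flatness thus passes from one gauge to the other. *)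
have Tpsi y : exists A x', [/\ O x', A = g0 *m (cproj f psi 0 *m Q' y), psi y = phi x' & Z *m A = A *m (P0 *m Q x')^T *m Z *m (P0 *m Q x')].
  have [x' Ox' xE] : (phi @` O) (psi y) by apply: psub; exists y.
  exists (g0 *m (cproj f psi 0 *m Q' y)), x'; split=> //.
  set A := g0 *m _; set B := P0 *m Q x'.
  have TA : Tr (range phi) p (psi y) A.
    by apply: Tr_comp T0 _ => //; have := Tr_sub sub (gauge_Tr cs rQ' y); rewrite ps0.
  have TB : Tr (range phi) p (psi y) B by rewrite -xE; exact: (gauge_Tr cp rQ).
  have [_ _ _ AP] := Tr_frame smf TA; have [_ PB BB _] := Tr_frame smf TB.
  have Hk := Hol_Tr smf TA TB.
  have := Zc _ Hk; rewrite (cprojE cp) mulmxDr mulmxDl Z0 mulmxBl mul1mx PZ subrr !addr0 => ZAB.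
  have -> : Z *m A = Z *m (A *m B^T) *m B by rewrite -(mulmxA Z) -(mulmxA A) BB AP.
  by rewrite ZAB.
have flat' y a b : Z' *m ncurv f psi Q' y a b = 0.
  have [A [x' [Ox' AE yE ZA]]] := Tpsi y.
  have [a' Ea] := cproj_derive_comp y a cp cs sub; have [b' Eb] := cproj_derive_comp y b cp cs sub.
  rewrite yE (chartK _ cp) in Ea Eb.
  have cE : curv f psi y a b = curv f phi x' a' b'.
    exact: (congr2 (fun U W : 'M[R]_N => U *m W - W *m U) Eb Ea).
  have Zc0 : Z *m (P0 *m Q x') *m curv f phi x' a' b' = 0.
    have := flat x' a' b' Ox'; rewrite /ncurv => /(congr1 (mulmx^~ (Q x'))).
    rewrite mul0mx -!mulmxA (gauge_orthV cp rQ) mulmx1 !mulmxA //.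
  rewrite /ncurv cE /Z' -(mulmxA g0^T) -(mulmxA g0^T).
  have -> : Z *m g0 *m (cproj f psi 0 *m (Q' y *m curv f phi x' a' b' *m (Q' y)^T)) =
      Z *m A *m curv f phi x' a' b' *m (Q' y)^T by rewrite AE !mulmxA.
  by rewrite ZA -(mulmxA _ Z) -(mulmxA _ (Z *m _)) Zc0 mulmx0 mul0mx mulmx0.
have triv k : Hol (range phi) (phi x0) k -> Z' *m k = Z'.
  move=> /Hl; rewrite -ps0 => Hk.
  exact: (flat_block_trivial smf cs rQ' flat' Hk).
move/eqP: gZ; apply.
have [gP _] := Hol_tangent smf Hg; rewrite (cprojE cp) in gP g00.
exact: (block_fixed g00 g0P ZP PZ gP (triv _ (Hol_conj smf T0 Hg))).
Qed.

(** Each block is curved on an open dense set of points; finitely many such sets have a common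
    point. *)
Lemma curved_common (I : eqType) (r : seq I) (Z : I -> 'M[R]_N) (O : set V) : open O -> O !=set0 ->
  (forall i, i \in r -> holonomy_block (Z i) /\ exists2 g, Hol (range phi) p g & Z i *m g != Z i) ->
  exists2 x, O x & forall i, i \in r -> curved (Z i) x.
Proof.
elim: r O => [|i r IH] O oO [x0 Ox0] H; first by exists x0.
have [|hZ gZ] := H i; first exact: mem_head.
have [x Ox cx] := curved_dense hZ oO (ex_intro _ _ Ox0) gZ.
have [U [oU Ux cU]] := curved_open cx.
have [||j jr|y [Oy Uy] cy] := IH (O `&` U).
- exact: openI.
- by exists x.
- by apply: H; rewrite inE jr orbT.
exists y => // j; rewrite inE => /predU1P[->|]; [exact: cU|exact: cy].
Qed.

Local Notation S := (sff (f \o phi)).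
Local Notation Gi x := (invmx (gram (f \o phi) x)).

Lemma sff_curv x xi eta a b : xi *m cproj f phi x = xi -> eta *m cproj f phi x = eta ->
  xi *m curv f phi x a b *m eta^T = b *m (S x xi *m Gi x *m S x eta) *m a^T - a *m (S x xi *m Gi x *m S x eta) *m b^T.
Proof.
move=> xP eP; rewrite /curv mulmxBr mulmxBl.
have sF := chart_smooth cp; have imF := chart_imm cp.
have da := cproj_derive cp x a; have db := cproj_derive cp x b.
have sa := cproj_derive_sym cp x a; have sb := cproj_derive_sym cp x b.
have E : cproj f phi = nproj (f \o phi) by exact: funext (cproj_nproj f phi).
rewrite E in xP eP da db sa sb *.
exact: (congr2 (fun u v => u - v) (sff_curvature sF imF a xP eP sb db) (sff_curvature sF imF b xP eP sa da)).
Qed.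

Lemma sff_bracket_tr x xi eta : (S x xi *m Gi x *m S x eta)^T = S x eta *m Gi x *m S x xi.
Proof.
have sF := chart_smooth cp.
by rewrite !trmx_mul trmx_inv !sff_sym// /gram trmx_mul trmxK mulmxA.
Qed.

Lemma scalar_tr (a b : V) (B : 'M[R]_n) : a *m B *m b^T = b *m B^T *m a^T.
Proof.
have -> : b *m B^T *m a^T = (a *m B *m b^T)^T by rewrite !trmx_mul trmxK mulmxA.
by apply/matrixP => i j; rewrite [RHS]mxE !ord1.
Qed.

Definition local_block Z x := (Q x)^T *m Z *m Q x.

Lemma local_block_normal Z x : holonomy_block Z -> local_block Z x *m cproj f phi x = local_block Z x.
Proof. by move=> [_ ZP _]; rewrite /local_block -mulmxA -(gauge_commute cp rQ) !mulmxA -(mulmxA _ Z) ZP. Qed.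

Lemma local_block_curv Z x a b : holonomy_block Z ->
  local_block Z x *m curv f phi x a b = (Q x)^T *m (Z *m ncurv f phi Q x a b) *m Q x /\
  curv f phi x a b *m local_block Z x = local_block Z x *m curv f phi x a b.
Proof.
move=> [ZT ZP Zc]; have [PT0 _] := cproj_proj cp 0.
have PZ : cproj f phi 0 *m Z = Z by have := congr1 trmx ZP; rewrite trmx_mul PT0 ZT.
have ZT' := @block_curv_commute _ _ _ _ f phi cp Q rQ Z (fun y v => nform_commute_block y v cp rQ Zc) x a b.
have [_ PP] := cproj_proj cp x.
have cP : cproj f phi x *m curv f phi x a b = curv f phi x a b *m cproj f phi x.
  have da := cproj_derive cp x a; have db := cproj_derive cp x b.
  rewrite /curv mulmxBr mulmxBl; congr (_ - _); exact: proj_mul_commute.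
have h1 : local_block Z x *m curv f phi x a b = (Q x)^T *m (Z *m ncurv f phi Q x a b) *m Q x.
  rewrite /ncurv /local_block (mulmxA Z) ZP -!mulmxA (gauge_orthV cp rQ) mulmx1 //.
split=> //; rewrite h1 ZT' /local_block /ncurv.
exact: block_algebra (gauge_orthV cp rQ x) (gauge_commute cp rQ x) cP (esym (gauge_commuteT cp rQ x)) PZ.
Qed.

(** The curvature preserves a block, so if it is nonzero there some matrix entry between two vectors
    of the block is nonzero; by the Ricci equation these two vectors have non-commuting shape
    operators. *)
Lemma curved_sff Z x : holonomy_block Z -> Z *m Z = Z -> curved Z x ->
  exists xi eta, [/\ xi *m local_block Z x = xi, eta *m local_block Z x = eta &
    S x xi *m Gi x *m S x eta <> S x eta *m Gi x *m S x xi].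
Proof.
move=> hZ ZZ [a [b ne]]; have [h1 h2] := local_block_curv x a b hZ.
have hP := local_block_normal x hZ; have [ZT _ _] := hZ.
set B := local_block Z x in h1 h2 hP *; set c := curv f phi x a b in h1 h2 *.
have BB : B *m B = B.
  by rewrite /B /local_block !mulmxA -(mulmxA _ (Q x) (Q x)^T) (gauge_orth cp rQ) mulmx1 -(mulmxA _ Z Z) ZZ.
have BT : B^T = B by rewrite /B /local_block !trmx_mul trmxK ZT mulmxA.
have : B *m c *m B != 0.
  apply: contraNneq ne => B0; rewrite -mulmxA h2 mulmxA BB h1 in B0.
  move/(congr1 (fun A => Q x *m A *m (Q x)^T)): B0.
  by rewrite mulmx0 mul0mx !mulmxA (gauge_orth cp rQ) mul1mx -(mulmxA _ (Q x)) (gauge_orth cp rQ) mulmx1 => ->.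
move=> ne'; have [k [l kl]] : exists k l, (B *m c *m B) k l != 0.
  apply: contrapT => H; move/eqP: ne'; apply; apply/matrixP => k l; rewrite [RHS]mxE.
  by apply/eqP/negPn/negP => h; apply: H; exists k, l.
exists (row k B), (row l B); split; try by rewrite -row_mul BB.
move=> E; move/eqP: kl; apply.
have -> : (B *m c *m B) k l = (row k B *m c *m (row l B)^T) 0 0.
  rewrite tr_row BT -row_mul -[in RHS](mulmx1 (row k _)).
  by rewrite mulmx1 !mxE; apply: eq_bigr => i _; rewrite !mxE.
rewrite sff_curv -?row_mul ?hP// (scalar_tr a b) sff_bracket_tr -E subrr mxE //.
Qed.

(** The curvature preserves each block, so its matrix entries between orthogonal blocks vanish in
    all tangent directions; this is the commutation by the Ricci equation. *)
Lemma block_sff_commute Z Z' x xi eta : holonomy_block Z -> holonomy_block Z' -> Z *m Z' = 0 ->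
  xi *m local_block Z x = xi -> eta *m local_block Z' x = eta ->
  S x xi *m Gi x *m S x eta = S x eta *m Gi x *m S x xi.
Proof.
move=> hZ hZ' ZZ' xZ eZ; rewrite -[RHS]sff_bracket_tr.
have xP : xi *m cproj f phi x = xi by rewrite -xZ -mulmxA local_block_normal.
have eP : eta *m cproj f phi x = eta by rewrite -eZ -mulmxA local_block_normal.
have [ZT' _ _] := hZ'.
have BT : (local_block Z' x)^T = local_block Z' x by rewrite /local_block !trmx_mul trmxK ZT' mulmxA.
have BB : local_block Z x *m local_block Z' x = 0.
  by rewrite /local_block !mulmxA -(mulmxA _ (Q x) (Q x)^T) (gauge_orth cp rQ) mulmx1 -(mulmxA _ Z Z') ZZ' mulmx0 mul0mx.
have c0 a b : xi *m curv f phi x a b *m eta^T = 0.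
  exact: block_cross xZ eZ BT (local_block_curv x a b hZ').2 BB.
set B := _ *m _; apply/matrixP => i j; rewrite [RHS]mxE.
have := c0 (delta_mx 0 j) (delta_mx 0 i); rewrite sff_curv// -/B => /eqP.
rewrite subr_eq0 => /eqP /matrixP/(_ 0 0).
by clearbody B; rewrite -!rowE !trmx_delta -!colE !mxE.
Qed.

(** At a common curved point each block of [r] supplies two non-commuting shape operators, and
    operators from different blocks commute. [commuting_pairs_rank] on the whole tangent space, of
    dimension [n], gives the count. *)
Lemma blocks_bound (I : finType) (r : {set I}) (Z : I -> 'M[R]_N) :
  (forall i, holonomy_block (Z i)) -> (forall i, Z i *m Z i = Z i) -> (forall i j, i != j -> Z i *m Z j = 0) ->
  (forall i, i \in r -> exists2 g, Hol (range phi) p g & Z i *m g != Z i) -> (#|r| <= n./2)%N.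
Proof.
move=> hZ ZZ ZZ' gr.
have [|x _ cx] := @curved_common I (enum r) Z setT openT (ex_intro _ 0 Logic.I).
  by move=> i; rewrite mem_enum => ir; split; [exact: hZ|exact: gr].
have pick i : exists xe : 'rV[R]_N * 'rV[R]_N, [/\ xe.1 *m local_block (Z i) x = xe.1, xe.2 *m local_block (Z i) x = xe.2 &
    i \in r -> S x xe.1 *m Gi x *m S x xe.2 <> S x xe.2 *m Gi x *m S x xe.1].
  have [ir|ir] := boolP (i \in r); last by exists (0, 0); rewrite !mul0mx; split.
  have [|xi [eta [h1 h2 h3]]] := @curved_sff (Z i) x (hZ i) (ZZ i); last by exists (xi, eta).
  by apply: cx; rewrite mem_enum.
have [xe Hxe] := choice pick.
pose G := gram (f \o phi) x.
have Gu : G \in unitmx by exact: (jac_gram (chart_smooth cp) (chart_imm cp)).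
have GT : G^T = G by rewrite /G /gram trmx_mul trmxK.
pose X i := S x (xe i).1 *m invmx G; pose Y i := S x (xe i).2 *m invmx G.
have sX xi : (S x xi *m invmx G *m G)^T = S x xi *m invmx G *m G.
  by rewrite -mulmxA mulVmx// mulmx1; apply: sff_sym; exact: chart_smooth cp.
have comm i j xi eta : i != j -> xi *m local_block (Z i) x = xi -> eta *m local_block (Z j) x = eta ->
  S x xi *m invmx G *m (S x eta *m invmx G) = S x eta *m invmx G *m (S x xi *m invmx G).
  by move=> ij h1 h2; rewrite !mulmxA (block_sff_commute (hZ i) (hZ j) (ZZ' i j ij) h1 h2).
have sG := gram_pos (chart_smooth cp) (chart_imm cp) x.
have cXX i j : i != j -> X i *m X j = X j *m X i.
  by move=> ij; have [a1 _ _] := Hxe i; have [b1 _ _] := Hxe j; exact: comm ij a1 b1.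
have cXY i j : i != j -> X i *m Y j = Y j *m X i.
  by move=> ij; have [a1 _ _] := Hxe i; have [_ b1 _] := Hxe j; exact: comm ij a1 b1.
have cYY i j : i != j -> Y i *m Y j = Y j *m Y i.
  by move=> ij; have [_ a1 _] := Hxe i; have [_ b1 _] := Hxe j; exact: comm ij a1 b1.
have := @commuting_pairs_rank R n G GT (sG) I X Y (fun i => sX _) (fun i => sX _) cXX cXY cYY r 1%:M _ _.
rewrite mxrank1 => H; rewrite -(doubleK #|r|); apply: half_leq; apply: H.
  by move=> i _; split; exact: submx1.
move=> i ir; rewrite mul1mx; have [_ _ /(_ ir) ne] := Hxe i.
apply/eqP => c0; apply: ne; apply: (can_inj (mulmxK (_ : invmx G \in unitmx))); first by rewrite unitmx_inv.
by move/eqP: c0; rewrite /cm subr_eq0 => /eqP; rewrite /X /Y !mulmxA.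
Qed.

End Bound.

Theorem num_nonabelian_bound {R : realType} {M : topologicalType} {n N : nat} (f : M -> 'rV[R]_N) p r :
  submanifold n f -> local_eq_restricted n f -> num_nonabelian_irreducible n f p r -> (r <= n./2)%N.
Proof.
move=> smf leq [k [V0 [V [nV [qV oV] tV0 iV ->]]]].
have [phi [cp p0]] := chart_at smf p; rewrite -p0 in nV tV0 iV *.
have [Q rQ] := radial_gauge_ex cp.
have W0 : range phi (phi 0) by exists 0.
have gp := good_restricted smf leq cp.
have HE : restricted_holonomy n f (phi 0) = @Hol R M n N f (range phi) (phi 0) by apply: etrans (esym (leq _)) _; exact: good_loc.
have GG : orthogonal_group (@Hol R M n N f (range phi) (phi 0)) by exact: Hol_group.
have /choice[Z pZ] : forall i, exists Z, proj_onto (V i) Z by move=> i; exact: proj_onto_ex.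
pose J : {set 'I_k} := [set i | `[< acts_nonabelian (restricted_holonomy n f (phi 0)) (V i) >]]%SET.
rewrite (_ : #|_| = #|J|); last by apply: eq_card => i; rewrite !inE.
have Vn i u : u \in V i -> u *m cproj f phi 0 = u.
  move=> uV; rewrite -(cprojE cp); apply/(normal_spaceE smf)/nV.
  apply: (subvP (addvSr V0 _)); exact: (subvP (sumv_sup i isT (subvv _)) _ uV).
apply: (@blocks_bound _ _ _ _ f smf leq phi cp Q rQ 'I_k J Z).
- move=> i; have [[ZT ZZ] ZV] := pZ i; split=> //.
    by apply/row_matrixP => j; rewrite row_mul; apply: Vn; exact: proj_onto_row (pZ i).
  move=> g Hg; apply: proj_onto_commute GG _ (pZ i) Hg.
  by have [_ inv _] := iV i; rewrite -HE.
- by move=> i; have [[_ ZZ] _] := pZ i.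
- by move=> i j ij; exact: proj_onto_orth (pZ i) (pZ j) (oV i j ij).
move=> i; rewrite inE => /asboolP[g [h [u [Hg Hh uV ne]]]]; rewrite HE in Hg Hh.
apply: contrapT => H; apply: ne.
(* A block fixed by the whole group is acted on trivially, hence abelian; so a non-abelian block is
   moved by some holonomy. *)
have triv k' : @Hol R M n N f (range phi) (phi 0) k' -> forall w, w \in V i -> w *m k' = w.
  move=> Hk w wV; have [_ ZV] := pZ i; have /ZV wZ := wV; rewrite -{1}wZ -mulmxA.
  have -> : Z i *m k' = Z i by apply/eqP/negPn/negP => h'; apply: H; exists k'.
  by [].
by rewrite !triv.
Qed.

(** * Normal frames with constant connection form *)

(** Reparametrising by a map of the line into (- e / 2, e / 2) with velocity e / 4 at 0 keeps the
    curve in the group for all times; the factor e / 4 is then removed by linearity. *)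
Lemma velocity_local {R : realType} {N : nat} (G : set 'M[R]_N) (ga : R -> 'M[R]_N) (e : R) X : orthogonal_group G ->
  0 < e -> smooth_on setT ga -> ga 0 = 1%:M -> (forall t, `|t| < e -> G (ga t)) -> is_derive (0 : R) 1 ga X ->
  velocity G X.
Proof.
move=> GG e0 sg g0 Gg dg.
pose th (t : R) := cube_coord (e / 2) t 0.
have th0 : th 0 = 0 by rewrite /th /cube_coord /logistic oppr0 expR0; field.
have the t : `|th t| < e.
  have := logistic_gt0 t; have := logistic_lt1 t; rewrite /th /cube_coord => l1 l0.
  by rewrite ltr_norml; apply/andP; split; nra.
have dth : is_derive (0 : R) 1 th (e / 4).
  apply: (is_derive_eq (cube_coord_derive (e / 2) 0 0)).
  by rewrite /logistic oppr0 expR0; field.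
have sth k : Ck k setT th.
  apply: (CkD openT (@Ck_cst _ _ _ _ _ 0)); apply: (CkM openT (@Ck_cst _ _ _ _ _ _)).
  apply: (CkB openT _ (@Ck_cst _ _ _ _ _ _)); apply: (CkM openT (@Ck_cst _ _ _ _ _ _)).
  exact: Ck_logistic.
have V : velocity G ((e / 4) *: X).
  exists (ga \o th); split.
  - move=> k; apply: (Ck_mx openT) => i j.
    by apply: (@Ck_comp_real _ _ k (fun t => ga t i j) th); [apply: (Ck_coord _ _ openT); exact: sg|exact: sth].
  - by rewrite /= th0.
  - by move=> t; exact: Gg.
  by apply: is_derive_comp1 dth _; rewrite th0.
have [G1 _ _ _] := GG; have := velocity_lin (4 / e) GG V (velocity0 G1).
rewrite addr0 scalerA; suff -> : 4 / e * (e / 4) = 1 by rewrite scale1r.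
by field; rewrite gt_eqF.
Qed.

Section Wedge.
Context {R : realType} {k : nat}.
Implicit Types (x y u v : 'rV[R]_k).

Definition dot x y : R := (x *m y^T) 0 0.
Definition wedge x y : 'M[R]_k := x^T *m y - y^T *m x.

Lemma dotC x y : dot x y = dot y x.
Proof. by rewrite /dot -[in RHS](trmxK (y *m x^T)) trmx_mul trmxK [RHS]mxE. Qed.

Lemma mul_dot x y : x *m y^T = (dot x y)%:M.
Proof. exact: mx11_scalar. Qed.

Lemma row_wedge u x y : u *m wedge x y = dot u x *: y - dot u y *: x.
Proof. by rewrite /wedge mulmxBr !mulmxA !mul_dot !mul_scalar_mx. Qed.

Lemma wedgeNC x y : wedge y x = - wedge x y.
Proof. by rewrite /wedge opprB. Qed.

Lemma wedge_linl a x y u : wedge (a *: x + y) u = a *: wedge x u + wedge y u.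
Proof.
by rewrite /wedge linearD linearZ /= mulmxDl mulmxDr -scalemxAl -scalemxAr scalerBr opprD addrACA.
Qed.

Lemma wedge_bracket x y u v : wedge x y *m wedge u v - wedge u v *m wedge x y =
  dot y u *: wedge x v + dot x v *: wedge y u - dot y v *: wedge x u - dot x u *: wedge y v.
Proof.
have E (a b c d : 'rV[R]_k) : a^T *m b *m (c^T *m d) = dot b c *: (a^T *m d).
  by rewrite mulmxA -(mulmxA a^T) mul_dot mul_mx_scalar scalemxAl.
rewrite /wedge !mulmxBl !mulmxBr !E (dotC u x) (dotC u y) (dotC v x) (dotC v y).
move: (dot y u) (dot x v) (dot y v) (dot x u) => a b c d.
by apply/matrixP => i j; rewrite !mxE; ring.
Qed.

(** The rows of [p] and [Z] expand [Z = p^T Z] as a sum of products; skewness makes its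
    antisymmetrisation equal to [2 Z], hence the factor one half. *)
Lemma skew_wedge (p Z : 'M[R]_k) : orth_proj p -> Z^T = - Z -> p *m Z = Z ->
  Z = 2^-1 *: \sum_j wedge (row j p) (row j Z).
Proof.
move=> [pT pp] ZT pZ.
have E : \sum_j (row j p)^T *m row j Z = Z.
  rewrite -[RHS]pZ; apply/matrixP => a b; rewrite summxE !mxE; apply: eq_bigr => j _.
  by rewrite !mxE big_ord1 !mxE -[in RHS]pT mxE.
rewrite /wedge sumrB E.
have -> : \sum_j (row j Z)^T *m row j p = - Z.
  by rewrite -ZT -{2}E linear_sum /=; apply: eq_bigr => j _; rewrite trmx_mul trmxK.
by rewrite opprK; apply/matrixP => a b; rewrite !mxE; field.
Qed.

End Wedge.

(** * Holonomy from a normal frame with constant connection form *)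

Section ConstantFrame.
Context {R : realType} {n N k : nat}.
Local Notation V := 'rV[R]_n.
Variable F : V -> 'rV[R]_N.
Hypothesis smf : submanifold n F.
Hypothesis cF : chart F (@id V).
Variable E : V -> 'M[R]_(k, N).
Hypothesis sE : smooth_on setT E.
Hypothesis EE : forall x, E x *m (E x)^T = 1%:M.
Hypothesis EF : forall x w, E x *m ('D_w F x)^T = 0.
Hypothesis kN : (N - n <= k)%N.
Variable A : V -> 'M[R]_k.
Hypothesis EA : forall x v, E x *m ('D_v E x)^T = A v.
Notation P := (@normal_proj R V n N F).
Notation Hol := (@Hol R V n N F).
Notation Tr := (@Tr R V n N F).

Let sF : smooth_on setT F := chart_smooth cF.
Let immF : forall x w, 'D_w F x = 0 -> w = 0 := chart_imm cF.

Lemma frame_proj x : P x = (E x)^T *m E x.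
Proof.
rewrite (normal_proj_chart x cF); apply/esym/orth_proj_rank_eq.
- split; first by rewrite trmx_mul trmxK.
  by rewrite mulmxA -(mulmxA _ (E x)) EE mulmx1.
- exact: nproj_proj.
- rewrite -mulmxA; congr (_ *m _); apply/row_matrixP => i; rewrite row_mul.
  apply/(nproj_fix sF immF); apply/rowP => j; rewrite !mxE.
  have := congr1 (fun B : 'M[R]_(k, 1) => B i 0) (EF x (delta_mx 0 j)); rewrite !mxE => e0; apply: etrans e0.
  by apply: eq_bigr => l _; rewrite !mxE.
have -> : \rank (nproj F x) = (N - n)%N by rewrite -(normal_proj_chart x cF); exact: normal_proj_rank.
apply: leq_trans kN _; rewrite -[X in (X <= _)%N](mxrank1 R k) -(EE x).
apply: leq_trans (mxrankM_maxl _ _) _.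
have {1}-> : E x = E x *m ((E x)^T *m E x) by rewrite mulmxA EE mul1mx.
exact: mxrankM_maxr.
Qed.


Lemma conn_form_skew v : (A v)^T = - A v.
Proof.
have d := smooth_is_derive_line0 0 v sE.
have := is_derive_mulmx d (is_derive_trmx d); rewrite /= scale0r addr0 EA => dd.
have d0 : is_derive (0 : R) 1 (fun t : R => E (0 + t *: v) *m (E (0 + t *: v))^T) 0.
  by rewrite (_ : (fun t => _) = fun=> 1%:M); [exact: is_derive_cst|apply/funext => t].
have := is_derive_unique dd d0; rewrite -(EA 0 v) trmx_mul trmxK => /eqP.
by rewrite addr_eq0 => /eqP.
Qed.

Lemma conn_formZ (s : R) v : A (s *: v) = s *: A v.
Proof.
rewrite -(EA 0) -[s *: v]addr0 (derive_smooth_lin _ _ _ _ sE) -(EA 0 v).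
have -> : 'D_0 E 0 = 0.
  have := derive_smooth_lin 0 1 0 0 sE; rewrite !scale1r addr0 => /eqP.
  by rewrite -subr_eq0 opprD addrA subrr sub0r oppr_eq0 => /eqP.
by rewrite addr0 linearZ /= -scalemxAr.
Qed.

Lemma flow_sig v : {Y : R -> 'M[R]_k | ode_sol (fun=> A v) Y}.
Proof. by apply/boolp.cid/ode_sol_ex => t; exact: cvg_cst. Qed.

(** The matrix exponential of [t A v]. As [A] does not depend on the point, it is the transport
    along any segment of velocity [v], read in the frame. *)
Definition flow v : R -> 'M[R]_k := sval (flow_sig v).

Lemma flow0 v : flow v 0 = 1%:M.
Proof. by rewrite /flow; case: (flow_sig v) => Y []. Qed.

Lemma flow_derive v (t : R) : is_derive t 1 (flow v) (flow v t *m A v).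
Proof. by rewrite /flow; case: (flow_sig v) => Y []. Qed.

Lemma flow_ode v : ode_sol (fun=> A v) (flow v).
Proof. by split; [exact: flow0|exact: flow_derive]. Qed.

Lemma flow_smooth v : smooth_on setT (flow v).
Proof. by apply: (ode_smooth (A := fun=> A v)) (flow_ode v) => k'; exact: Ck_cst. Qed.

Lemma flow_unique v (Y : R -> 'M[R]_k) t : Y 0 = 1%:M -> (forall u : R, is_derive u 1 Y (Y u *m A v)) -> Y t = flow v t.
Proof.
move=> Y0 dY; rewrite -[RHS]mul1mx -Y0; apply: (ode_unique (A := fun=> A v)) dY t => [u|]; first exact: cvg_cst.
exact: flow_ode.
Qed.

Lemma flow_orth v t : flow v t *m (flow v t)^T = 1%:M.
Proof.
have d (u : R) : is_derive u 1 (fun t => flow v t *m (flow v t)^T) 0.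
  apply: (is_derive_eq (is_derive_mulmx (flow_derive v u) (is_derive_trmx (flow_derive v u)))).
  by rewrite trmx_mul conn_form_skew mulNmx mulmxN mulmxA subrr.
by rewrite (mx_derive0_const t 0 d) flow0 trmx1 mulmx1.
Qed.

Lemma flowZ v s t : flow (s *: v) t = flow v (s * t).
Proof.
apply/esym; apply: (flow_unique (Y := fun t => flow v (s * t))) => [|u]; first by rewrite mulr0 flow0.
have := is_derive_comp1 (is_derive_lin s u) (flow_derive v (s * u)).
by rewrite conn_formZ -scalemxAr.
Qed.

Lemma flow_Tr (O : set V) q v : (forall t, 0 <= t <= 1 -> O (q + t *: v)) ->
  Tr O q (q + v) ((E q)^T *m flow v 1 *m E (q + v)).
Proof.
move=> Ot; have dE t := smooth_is_derive_line q v t sE.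
exists 0, 1, (fun t => q + t *: v), (fun t => (E q)^T *m flow v t *m E (q + t *: v)).
rewrite scale0r addr0 scale1r flow0 mulmx1 frame_proj; split=> //.
split.
- apply: continuous_subspaceT => t.
  by apply: cvgD; [exact: cvg_cst|apply: cvgZ; [exact: cvg_id|exact: cvg_cst]].
- by apply: pws_smooth => //; exact: (smooth_affine q v sF).
- by move=> t; rewrite in_itv /= => tI; exact: Ot.
- split.
    apply: pws_smooth => // k'; apply: (Ck_mulmx openT); last exact: (smooth_affine q v sE).
    by apply: (Ck_mulmx openT); [exact: Ck_cst|exact: flow_smooth].
  by move=> t _; rewrite frame_proj mulmxA -(mulmxA _ (E _)) EE mulmx1.
exists [::] => t _ _.
have d := is_derive_mulmx (is_derive_mulmxl (E q)^T (flow_derive v t)) (dE t).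
exists ((E q)^T *m (flow v t *m A v) *m E (q + t *: v) + (E q)^T *m flow v t *m 'D_v E (q + t *: v)).
  exact: d.
have DE : 'D_v E (q + t *: v) *m (E (q + t *: v))^T = - A v.
  by rewrite -conn_form_skew -(EA (q + t *: v)) trmx_mul trmxK.
rewrite frame_proj; move: (E (q + t *: v)) ('D_v E (q + t *: v)) (EE (q + t *: v)) DE => B D BB DB.
by rewrite (mulmxA _ B^T) mulmxDl -(mulmxA _ B) BB mulmx1 -(mulmxA _ D) DB mulmxN !mulmxA subrr mul0mx.
Qed.

(** The condition is imposed at every point of [O], so that it can be transported along small
    segments within [O]. *)
Definition frame_velocity (O : set V) (Y : 'M[R]_k) := forall q, O q -> velocity (Hol O q) ((E q)^T *m Y *m E q).

Lemma frame_velocity_lin (O : set V) a Y Z : frame_velocity O Y -> frame_velocity O Z -> frame_velocity O (a *: Y + Z).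
Proof.
move=> hY hZ q Oq; rewrite mulmxDr mulmxDl -scalemxAr -scalemxAl.
by apply: velocity_lin; [exact: Hol_group|exact: hY|exact: hZ].
Qed.

Lemma frame_velocity0 (O : set V) : frame_velocity O 0.
Proof. by move=> q Oq; rewrite mulmx0 mul0mx; apply: velocity0; have [] := Hol_group smf Oq. Qed.

Lemma small_plane (O : set V) q v w : open O -> O q ->
  exists2 e : R, 0 < e & forall s t, `|s| <= e -> `|t| <= e -> O (q + s *: v + t *: w).
Proof.
move=> oO Oq; have := open_nbhs_nbhs (conj oO Oq); rewrite -nbhs_ballE => -[r /= r0 rO].
have c0 : 0 < `|v| + `|w| + 1 by rewrite ltr_wpDl// addr_ge0.
exists (r / 2 / (`|v| + `|w| + 1)); first by rewrite !divr_gt0.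
move=> s t hs ht; apply: rO; rewrite -ball_normE /=.
rewrite -addrA opprD addrA subrr sub0r normrN.
apply: le_lt_trans (ler_normD _ _) _; rewrite !normrZ.
set e := r / 2 / _ in hs ht.
have h1 : `|s| * `|v| <= e * `|v| by apply: ler_wpM2r.
have h2 : `|t| * `|w| <= e * `|w| by apply: ler_wpM2r.
have h3 : e * (`|v| + `|w| + 1) = r / 2 by rewrite /e mulfVK// gt_eqF.
have e0 : 0 < e by rewrite !divr_gt0.
nra.
Qed.


Lemma small_Tr (O : set V) q v w : open O -> O q -> exists2 e : R, 0 < e & forall s t, `|s| < e -> `|t| < e ->
  Tr O (q + s *: v) (q + s *: v + t *: w) ((E (q + s *: v))^T *m flow w t *m E (q + s *: v + t *: w)).
Proof.
move=> oO Oq; have [e e0 eO] := small_plane v w oO Oq; exists e => // s t hs ht.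
have := @flow_Tr O (q + s *: v) (t *: w); rewrite flowZ mulr1; apply=> u /andP[u0 u1].
rewrite scalerA; apply: eO; first exact: ltW.
by rewrite normrM (ger0_norm u0); apply: le_trans (ltW ht); rewrite ler_piMl.
Qed.

Lemma frame_velocity_closed (O : set V) q (Y : R -> 'M[R]_k) Y' e : O q -> 0 < e ->
  (forall t, `|t| < e -> velocity (Hol O q) ((E q)^T *m Y t *m E q)) -> is_derive (0 : R) 1 Y Y' ->
  velocity (Hol O q) ((E q)^T *m Y' *m E q).
Proof.
move=> Oq e0 hY dY; have [L LP] := lie_algebra_ex (Hol_group smf Oq).
apply/LP/(derive_in_vspace (f := fun t => (E q)^T *m Y t *m E q) (x := 0) e0) => [t|].
  by rewrite subr0 => te; apply/LP; exact: hY.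
by apply/is_derive_mulmxr/is_derive_mulmxl.
Qed.

Lemma flow_conj_derive v (Y : 'M[R]_k) : is_derive (0 : R) 1 (fun t => flow v t *m Y *m (flow v t)^T) (A v *m Y - Y *m A v).
Proof.
have d := flow_derive v 0.
apply: (is_derive_eq (is_derive_mulmx (is_derive_mulmxr Y d) (is_derive_trmx d))).
by rewrite flow0 !mul1mx trmx1 mulmx1 conn_form_skew mulmxN.
Qed.

(** Transport from the point [t v] away conjugates [Y] by the flow. The velocities at [q] form a
    subspace, so they contain the derivative at [t = 0] of this family, which is the bracket. *)
Lemma frame_velocity_bracket (O : set V) Y v : open O -> frame_velocity O Y ->
  frame_velocity O (A v *m Y - Y *m A v).
Proof.
move=> oO hY q Oq; have [e e0 eT] := small_Tr 0 v oO Oq.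
apply: (frame_velocity_closed Oq e0) (flow_conj_derive v Y) => t te.
have := eT 0 t; rewrite normr0 scale0r addr0 => /(_ e0 te) T.
have [_ Ot] := Tr_ends T.
have := velocity_Tr smf (Tr_sym smf T) (hY _ Ot); congr (velocity _ _).
rewrite trmxK -(mulmxA _ _ (_ *m _)) !trmx_mul trmxK.
by rewrite !mulmxA -(mulmxA _ _ (E _)^T) EE mulmx1 -(mulmxA _ _ (E _)^T) EE mulmx1.
Qed.

(* The small quadrilaterals [q, q + s v, q + s v + t w, q + t w] are loops whose holonomy is, in the frame,
   the group commutator of the flows. *)
Lemma frame_velocity_curvature (O : set V) v w : open O -> frame_velocity O (A v *m A w - A w *m A v).
Proof.
move=> oO q Oq; have [e1 e10 T1] := small_Tr v w oO Oq; have [e2 e20 T2] := small_Tr w v oO Oq.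
have [e [e0 ee1 ee2]] : exists e : R, [/\ 0 < e, e <= e1 & e <= e2].
  by exists (Num.min e1 e2); rewrite lt_min e10 e20 ge_min lexx ge_min lexx orbT.
have dY : is_derive (0 : R) 1 (fun s => flow v s *m A w *m (flow v s)^T - A w) (A v *m A w - A w *m A v).
  by apply: (is_derive_eq (is_deriveB (flow_conj_derive v (A w)) (is_derive_cst _ _ _))); rewrite subr0.
apply: (frame_velocity_closed Oq e0) dY => s se.
pose c t := flow v s *m flow w t *m (flow v s)^T *m (flow w t)^T.
have dc : is_derive (0 : R) 1 c (flow v s *m A w *m (flow v s)^T - A w).
  have d := flow_derive w 0.
  apply: (is_derive_eq (is_derive_mulmx (is_derive_mulmxr (flow v s)^T (is_derive_mulmxl (flow v s) d)) (is_derive_trmx d))).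
  by rewrite flow0 !mul1mx trmx1 !mulmx1 flow_orth mul1mx conn_form_skew.
apply: (velocity_local (ga := fun t => (E q)^T *m c t *m E q + (1%:M - P q)) (Hol_group smf Oq) e0).
- move=> k'; apply: (CkD openT); last exact: Ck_cst.
  apply: (Ck_mulmx openT); last exact: Ck_cst.
  apply: (Ck_mulmx openT); first exact: Ck_cst.
  apply: (Ck_mulmx openT); last by apply: (Ck_trmx openT); exact: flow_smooth.
  apply: (Ck_mulmx openT); last exact: Ck_cst.
  by apply: (Ck_mulmx openT); [exact: Ck_cst|exact: flow_smooth].
- by rewrite /c flow0 mulmx1 flow_orth trmx1 !mulmx1 frame_proj addrC subrK.
- move=> t te; exists ((E q)^T *m c t *m E q) => //.
  have a0 : `|0 : R| < e1 by rewrite normr0.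
  have b0 : `|0 : R| < e2 by rewrite normr0.
  have s1 := lt_le_trans se ee1; have s2 := lt_le_trans se ee2.
  have t1 := lt_le_trans te ee1; have t2 := lt_le_trans te ee2.
  have h1 := T2 0 s b0 s2; have h2 := T1 s t s1 t1.
  have h3 := T1 0 t a0 t1; have h4 := T2 t s t2 s2.
  rewrite !scale0r !addr0 in h1 h3.
  rewrite -[q + t *: w + s *: v]addrA [t *: w + _]addrC addrA in h4.
  have := Tr_comp smf (Tr_comp smf h1 h2) (Tr_comp smf (Tr_sym smf h4) (Tr_sym smf h3)); congr (Tr _ _ _ _).
  rewrite /c; move: (E (q + s *: v)) (EE (q + s *: v)) (E (q + s *: v + t *: w)) (EE (q + s *: v + t *: w))
    (E (q + t *: w)) (EE (q + t *: w)) (E q) (flow v s) (flow w t) => B1 H1 B2 H2 B3 H3 B0 X Y.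
  rewrite !trmx_mul !trmxK !mulmxA.
  by rewrite -(mulmxA _ B1) H1 mulmx1 -(mulmxA _ B2) H2 mulmx1 -(mulmxA _ B3) H3 mulmx1.
apply: (is_derive_eq (is_deriveD (is_derive_mulmxr (E q) (is_derive_mulmxl (E q)^T dc)) (is_derive_cst _ _ _))).
by rewrite addr0.
Qed.

Lemma parallel_frame_derive (m : nat) (O : set V) (a b : R) (c : R -> V) (Xi : R -> 'M[R]_(m, N)) :
  parallel (n := n) F O a b c Xi ->
  {within `[a, b], continuous (fun t => Xi t *m (E (c t))^T)} /\
  exists s : seq R, forall t : R, t \in `]a, b[ -> t \notin s -> exists v,
    is_derive t 1 (fun t => Xi t *m (E (c t))^T) (Xi t *m (E (c t))^T *m A v).
Proof.
move=> [cc pc _ [pXi XiP] [s sP]]; split.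
  apply: within_mulmx; first exact: pws_continuous pXi.
  apply: within_trmx; apply: (within_comp (g := E)) => // t _.
  by case: (sE 1) => dE _; apply: differentiable_continuous; exact: dE.
have [s' s'P] := pws_derivable pc; exists (s ++ s') => t tI; rewrite mem_cat negb_or => /andP[ts ts'].
have [d dd dP] := sP t tI ts; have ab := pws_lt pc.
pose x t := c (clamp a b t).
have cx : continuous x := within_clamp (ltW ab) cc.
have xE u : u \in `[a, b] -> x u = c u by move=> ui; rewrite /x clamp_id//; move: ui; rewrite in_itv.
have xt := xE _ (subset_itv_oo_cc tI).
have [dx _] : is_derive t 1 x (derive1 (F \o c) t *m jinv F (x t)) /\ derive1 (F \o c) t *m nproj F (x t) = 0.
  apply: (lift_derive sF immF (y := F \o c)); first exact: cx.
    by have := near_itv tI; apply: filterS => u ui; rewrite /= xE//; exact: subset_itv_oo_cc.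
  by apply: DeriveDef; [exact: s'P|rewrite derive1E].
set v := _ *m jinv F _ in dx; exists v.
have dE := is_derive_comp_smooth sE dx.
have d1 : is_derive t 1 (fun t => Xi t *m (E (c t))^T) (d *m (E (c t))^T + Xi t *m ('D_v E (c t))^T).
  have := is_derive_mulmx dd (is_derive_trmx dE); rewrite /= xt; apply: near_eq_is_derive.
  by have := near_itv tI; apply: filterS => u ui; rewrite /= xE//; exact: subset_itv_oo_cc.
apply: (is_derive_eq d1).
have -> : d *m (E (c t))^T = 0.
  by move: dP; rewrite frame_proj => /(congr1 (mulmx^~ (E (c t))^T)); rewrite mul0mx -!mulmxA EE mulmx1.
rewrite add0r -{1}(XiP t (subset_itv_oo_cc tI)) frame_proj mulmxA -mulmxA.
by rewrite EA.
Qed.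

Lemma frame_const (m j : nat) (O : set V) (a b : R) (c : R -> V) (Xi : R -> 'M[R]_(m, N)) (B : 'M[R]_(k, j)) :
  parallel (n := n) F O a b c Xi -> (forall v, A v *m B = 0) ->
  Xi a *m (E (c a))^T *m B = Xi b *m (E (c b))^T *m B.
Proof.
move=> H AB; have [cY [s sP]] := parallel_frame_derive H.
apply: (const_off_finite (f := fun t => Xi t *m (E (c t))^T *m B) (s := s) (ltW (parallel_lt H))) => [|t tI ts].
  by apply: within_mulmx cY _; apply: continuous_subspaceT => t; exact: cvg_cst.
have [v dv] := sP t tI ts; apply: (is_derive_eq (is_derive_mulmxr B dv)).
by rewrite -[LHS]mulmxA AB mulmx0.
Qed.

(** Read in the frame, a parallel field solves y' = y A(v) with [A v] skew; so conjugating by it a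
    matrix that commutes with all [A v] has derivative zero. *)
Lemma frame_gram_const (m : nat) (O : set V) (a b : R) (c : R -> V) (Xi : R -> 'M[R]_(m, N)) (B : 'M[R]_k) :
  parallel (n := n) F O a b c Xi -> (forall v, A v *m B = B *m A v) ->
  Xi a *m (E (c a))^T *m B *m (Xi a *m (E (c a))^T)^T = Xi b *m (E (c b))^T *m B *m (Xi b *m (E (c b))^T)^T.
Proof.
move=> H AB; have [cY [s sP]] := parallel_frame_derive H.
apply: (const_off_finite (f := fun t => Xi t *m (E (c t))^T *m B *m (Xi t *m (E (c t))^T)^T) (s := s) (ltW (parallel_lt H))) => [|t tI ts].
  apply: within_mulmx; last exact: within_trmx.
  by apply: within_mulmx cY _; apply: continuous_subspaceT => t; exact: cvg_cst.
have [v dv] := sP t tI ts; apply: (is_derive_eq (is_derive_mulmx (is_derive_mulmxr B dv) (is_derive_trmx dv))).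
move: (Xi t *m _) => Y; rewrite [(Y *m A v)^T]trmx_mul conn_form_skew.
by rewrite mulNmx mulmxN -(mulmxA Y) AB !mulmxA subrr.
Qed.

Lemma frame_projK (x : V) : P x *m (E x)^T = (E x)^T.
Proof. by rewrite frame_proj -mulmxA EE mulmx1. Qed.

Lemma frame_projC x : (1%:M - P x) *m (E x)^T = 0.
Proof. by rewrite mulmxBl mul1mx frame_projK subrr. Qed.

Lemma Hol_fix_frame (j : nat) (O : set V) p g (B : 'M[R]_(k, j)) : Hol O p g -> (forall v, A v *m B = 0) ->
  g *m ((E p)^T *m B) = (E p)^T *m B.
Proof.
move=> [h [a [b [c [Xi [H ca cb Xa Xb]]]]] ->] AB.
have := frame_const H AB; rewrite ca cb Xa Xb frame_projK => e0.
by rewrite mulmxDl !mulmxA frame_projC mul0mx addr0 -e0.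
Qed.

Lemma Hol_commute_frame (O : set V) p g (B : 'M[R]_k) : Hol O p g -> (forall v, A v *m B = B *m A v) ->
  g *m ((E p)^T *m B *m E p) = (E p)^T *m B *m E p *m g.
Proof.
move=> Hg AB; have Op : O p by case: Hg => h T _; have [] := Tr_ends T.
have [_ _ _ /(_ g Hg) gg] := Hol_group smf Op.
suff h : g *m ((E p)^T *m B *m E p) *m g^T = (E p)^T *m B *m E p by rewrite -[in RHS]h -(mulmxA _ _ g) (mulmx1C gg) mulmx1.
move: Hg {gg} => [h [a [b [c [Xi [H ca cb Xa Xb]]]]] ->].
have := frame_gram_const H AB; rewrite ca cb Xa Xb frame_projK trmxK => e0.
have -> : (h + (1%:M - P p)) *m ((E p)^T *m B *m E p) = h *m (E p)^T *m B *m E p.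
  by rewrite mulmxDl !mulmxA frame_projC !mul0mx addr0.
have EP : E p *m (1%:M - P p)^T = 0 by rewrite -[X in X *m _]trmxK -trmx_mul frame_projC trmx0.
by rewrite [(h + _)^T]linearD /= mulmxDr -(mulmxA _ (E p) (_ - _)^T) EP mulmx0 addr0 e0 trmx_mul trmxK !mulmxA.
Qed.

Lemma velocity_fix_frame (j : nat) (O : set V) p X (B : 'M[R]_(k, j)) : velocity (Hol O p) X -> (forall v, A v *m B = 0) ->
  X *m ((E p)^T *m B) = 0.
Proof.
move=> [ga [_ _ Hga dga]] AB; apply: is_derive_unique (is_derive_mulmxr ((E p)^T *m B) dga) _.
rewrite (_ : (fun t => _) = fun=> (E p)^T *m B); first exact: is_derive_cst.
by apply/funext => t; apply: Hol_fix_frame.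
Qed.

Lemma velocity_commute_frame (O : set V) p X (B : 'M[R]_k) : velocity (Hol O p) X -> (forall v, A v *m B = B *m A v) ->
  X *m ((E p)^T *m B *m E p) = (E p)^T *m B *m E p *m X.
Proof.
move=> [ga [_ _ Hga dga]] AB; apply: is_derive_unique (is_derive_mulmxr ((E p)^T *m B *m E p) dga) _.
rewrite (_ : (fun t => _) = fun t => (E p)^T *m B *m E p *m ga t); first exact: is_derive_mulmxl.
by apply/funext => t; apply: Hol_commute_frame.
Qed.

Variables (m : nat) (pi : 'I_m -> 'M[R]_k) (kap : 'M[R]_k).
Hypothesis pi_proj : forall i, orth_proj (pi i).
Hypothesis pi_orth : forall i j, i != j -> pi i *m pi j = 0.
Hypothesis kap_proj : orth_proj kap.
Hypothesis kap_pi : kap + \sum_i pi i = 1%:M.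
Hypothesis A_kap : forall v, A v *m kap = 0.
Hypothesis A_pi : forall v i, A v *m pi i = pi i *m A v.
(** Every linear space that contains the curvatures and is closed under brackets with the connection
    form contains so of each block. The predicate form lets it be applied directly to
    [frame_velocity]. *)
Hypothesis generated : forall K : 'M[R]_k -> Prop, K 0 -> (forall a Y Z, K Y -> K Z -> K (a *: Y + Z)) ->
  (forall v w, K (A v *m A w - A w *m A v)) -> (forall v Y, K Y -> K (A v *m Y - Y *m A v)) ->
  forall i x y, x *m pi i = x -> y *m pi i = y -> K (wedge x y).

Lemma frame_velocity_wedge (O : set V) i x y : open O -> x *m pi i = x -> y *m pi i = y -> frame_velocity O (wedge x y).
Proof.
move=> oO; apply: generated.
- exact: frame_velocity0.
- by move=> a Y Z; exact: frame_velocity_lin.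
- by move=> v w; exact: frame_velocity_curvature.
- by move=> v Y; exact: frame_velocity_bracket.
Qed.

(** In the frame, a velocity [Z] of the whole group commutes with all [pi i] and kills [kap], so it
    is a sum of skew parts, one in each block; these are sums of wedges, which are already
    velocities for [O]. *)
Lemma velocity_frame (O : set V) p X : open O -> O p -> velocity (Hol setT p) X -> velocity (Hol O p) X.
Proof.
move=> oO Op VX; have XT := velocity_skew (Hol_group smf (I : setT p)) VX.
have [PX XP] := velocity_Hol smf VX.
pose Z := E p *m X *m (E p)^T.
have XZ : X = (E p)^T *m Z *m E p by rewrite /Z !mulmxA -frame_proj PX -mulmxA -frame_proj XP.
have ZT : Z^T = - Z by rewrite /Z !trmx_mul trmxK XT mulNmx mulmxN !mulmxA.
have Zpi i : Z *m pi i = pi i *m Z.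
  have h := velocity_commute_frame VX (A_pi^~ i).
  transitivity (E p *m (X *m ((E p)^T *m pi i *m E p)) *m (E p)^T).
    by rewrite /Z !mulmxA -(mulmxA _ (E p)) EE mulmx1.
  by rewrite h /Z !mulmxA EE mul1mx.
have Zk : Z *m kap = 0 by rewrite /Z -!mulmxA (velocity_fix_frame VX A_kap) mulmx0.
have ZE : Z = \sum_i Z *m pi i by rewrite -mulmx_sumr -[LHS]mulmx1 -kap_pi mulmxDr Zk add0r.
suff : frame_velocity O Z by move=> /(_ p Op); rewrite -XZ.
have KD Y Y' : frame_velocity O Y -> frame_velocity O Y' -> frame_velocity O (Y + Y').
  by move=> hY hY'; rewrite -[Y]scale1r; exact: frame_velocity_lin.
have KZ a Y : frame_velocity O Y -> frame_velocity O (a *: Y).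
  by move=> hY; rewrite -[_ *: _]addr0; apply: frame_velocity_lin hY (@frame_velocity0 O).
rewrite ZE; apply: big_ind => [| |i _]; [exact: frame_velocity0|exact: KD|].
have [piT pipi] := pi_proj i.
have sk : (Z *m pi i)^T = - (Z *m pi i) by rewrite trmx_mul piT ZT mulmxN Zpi.
have pZ : pi i *m (Z *m pi i) = Z *m pi i by rewrite mulmxA -Zpi -mulmxA pipi.
rewrite (skew_wedge (pi_proj i) sk pZ); apply: KZ.
apply: big_ind => [| |j _]; [exact: frame_velocity0|exact: KD|].
by apply: (frame_velocity_wedge (i := i)) => //; rewrite -row_mul ?pipi// -mulmxA pipi.
Qed.

Lemma Hol_local (O : set V) p : open O -> O p -> Hol setT p = Hol O p.
Proof.
move=> oO Op; apply/seteqP; split; last exact: Hol_sub.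
have rT : range (@id V) = setT by rewrite image_id.
have := @Hol_velocity_sub _ _ _ _ _ smf id p (Hol O p) cF; rewrite rT; apply=> //; first exact: Hol_group.
by move=> X; exact: velocity_frame.
Qed.

Lemma restricted_HolE p : restricted_holonomy n F p = Hol setT p.
Proof.
apply/seteqP; split=> g; first exact: restricted_Hol.
have := @chart_Hol _ _ _ _ _ smf id p g cF; rewrite image_id; exact.
Qed.

Lemma frame_local_eq_restricted : local_eq_restricted n F.
Proof.
move=> p; rewrite restricted_HolE; apply/seteqP; split=> g.
  move=> /(local_HolP smf) /(_ (fun x => p + x) (chart_shift p cF) (addr0 p)); exact: Hol_sub.
move=> Hg; apply/(local_HolP smf) => phi cp phi0.
rewrite -Hol_local//; first exact: chart_range_open cp.
by exists 0.
Qed.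


Hypothesis triple : forall i, exists x y z : 'rV[R]_k, [/\ x *m pi i = x, y *m pi i = y, z *m pi i = z,
  [/\ dot x x = 1, dot y y = 1 & dot z z = 1] & [/\ dot x y = 0, dot x z = 0 & dot y z = 0]].

Lemma orth_proj_vspace (Z : 'M[R]_N) : orth_proj Z -> exists V : {vspace 'rV[R]_N}, proj_onto V Z.
Proof.
move=> oZ; have [L LP] := @vspace_of_pred R 'rV[R]_N (fun u => u *m Z = u) (mul0mx _ _)
  (fun a u v (hu : u *m Z = u) (hv : v *m Z = v) => etrans (mulmxDl _ _ _) (congr2 +%R (etrans (esym (scalemxAl _ _ _)) (congr1 _ hu)) hv)).
by exists L; split=> // u; rewrite LP.
Qed.

Lemma frame_block_mul p (Y Z : 'M[R]_k) : ((E p)^T *m Y *m E p) *m ((E p)^T *m Z *m E p) = (E p)^T *m (Y *m Z) *m E p.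
Proof. by rewrite !mulmxA -(mulmxA _ (E p)) EE mulmx1. Qed.

Lemma frame_block_proj p (Y : 'M[R]_k) : orth_proj Y -> orth_proj ((E p)^T *m Y *m E p).
Proof. by move=> [YT YY]; split; [rewrite !trmx_mul trmxK YT mulmxA|rewrite frame_block_mul YY]. Qed.

Lemma dot_frame p x y : dot (x *m E p) (y *m E p) = dot x y.
Proof. by rewrite /dot trmx_mul mulmxA -(mulmxA x) EE mulmx1. Qed.

Lemma wedge_frame p x y : wedge (x *m E p) (y *m E p) = (E p)^T *m wedge x y *m E p.
Proof. by rewrite /wedge !trmx_mul mulmxBr mulmxBl !mulmxA. Qed.

Lemma velocity_wedge p i x y : x *m pi i = x -> y *m pi i = y -> velocity (Hol setT p) (wedge (x *m E p) (y *m E p)).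
Proof. by move=> hx hy; rewrite wedge_frame; apply: (frame_velocity_wedge openT hx hy). Qed.

Lemma invariant_velocity (G : set 'M[R]_N) (W : {vspace 'rV[R]_N}) X u : invariant G W -> velocity G X -> u \in W -> u *m X \in W.
Proof.
move=> inv [ga [_ _ Gga dga]] uW.
by apply: (derive_in_vspace (f := fun t => u *m ga t) (x := 0) ltr01) (is_derive_mulmxl u dga) => t _; apply: inv.
Qed.

(** The velocities include so of each block. Irreducibility: a nonzero [v] in an invariant [W] is
    sent by [wedge v u] to a combination of [u] and [v] with nonzero coefficient at [u]. Non-abelian
    action: commuting group elements would have commuting velocities, which [wedge x y] and
    [wedge y z] contradict on [x]. *)
Lemma frame_num_nonabelian p : num_nonabelian_irreducible n F p m.
Proof.
pose Pi i := (E p)^T *m pi i *m E p; pose Pk := (E p)^T *m kap *m E p.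
have [V0 [V0p V0P]] := orth_proj_vspace (frame_block_proj p kap_proj).
have [U /all_and2[Up UP]] := choice (fun i => orth_proj_vspace (frame_block_proj p (pi_proj i))).
have PE : P p = Pk + \sum_i Pi i.
  rewrite frame_proj -[X in X *m _]mulmx1 -kap_pi mulmxDr mulmxDl; congr (_ + _).
  by rewrite mulmx_sumr mulmx_suml.
have kap_pi0 i : kap *m pi i = 0.
  have := congr1 (mulmx^~ (pi i)) kap_pi; rewrite mul1mx mulmxDl mulmx_suml (bigD1 i)//= big1 => [|j ji]; last exact: pi_orth.
  by rewrite addr0 (pi_proj i).2 => /eqP; rewrite -subr_eq0 addrK => /eqP.
have kP : Pk *m P p = Pk.
  by rewrite PE mulmxDr frame_block_mul kap_proj.2 mulmx_sumr big1 ?addr0// => i _; rewrite frame_block_mul kap_pi0 mulmx0 mul0mx.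
have iP i : Pi i *m P p = Pi i.
  rewrite PE mulmxDr frame_block_mul.
  have -> : pi i *m kap = 0 by rewrite -[LHS]trmxK trmx_mul (pi_proj i).1 kap_proj.1 kap_pi0 trmx0.
  rewrite mulmx0 mul0mx add0r mulmx_sumr (bigD1 i)//= frame_block_mul (pi_proj i).2 big1 ?addr0// => j ji.
  by rewrite frame_block_mul pi_orth 1?eq_sym// mulmx0 mul0mx.
have orthP (V V' : {vspace 'rV[R]_N}) Z Z' : Z^T = Z -> Z'^T = Z' -> (forall u : 'rV_N, u *m Z = u <-> u \in V) ->
    (forall u : 'rV_N, u *m Z' = u <-> u \in V') -> Z *m Z' = 0 -> orthogonal_spaces V V'.
  move=> ZT ZT' VP VP' ZZ u v /VP <- /VP' <-.
  by rewrite trmx_mul ZT' mulmxA -(mulmxA u) ZZ mulmx0 mul0mx.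
have HP := restricted_HolE p.
have UinE i u : u \in U i -> exists2 x, x *m pi i = x & u = x *m E p.
  move=> /UP hu; exists (u *m (E p)^T *m pi i); first by rewrite -(mulmxA _ (pi i)) (pi_proj i).2.
  by rewrite -{1}hu /Pi !mulmxA.
have Ein i x : x *m pi i = x -> x *m E p \in U i.
  by move=> hx; apply/UP; rewrite /Pi !mulmxA -(mulmxA x) EE mulmx1 hx.
exists m, V0, U; split.
- move=> u; rewrite (normal_spaceE smf); split.
    move=> <-; rewrite PE mulmxDr mulmx_sumr; apply: memv_add.
      by apply/V0P; rewrite -mulmxA V0p.2.
    by apply: memv_sumr => i _; apply/UP; rewrite -mulmxA (Up i).2.
  move=> /memv_addP[a aV [b /memv_sumP[bs bsU ->] ->]].
  rewrite mulmxDl mulmx_suml; congr (_ + _).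
    by move: aV => /V0P <-; rewrite -mulmxA kP.
  by apply: eq_bigr => i _; have /UP <- := bsU i isT; rewrite -mulmxA iP.
- split=> [i|i j ij].
    apply: (orthP _ _ Pk (Pi i) V0p.1 (Up i).1 V0P (UP i)).
    by rewrite frame_block_mul kap_pi0 mulmx0 mul0mx.
  apply: (orthP _ _ (Pi i) (Pi j) (Up i).1 (Up j).1 (UP i) (UP j)).
  by rewrite frame_block_mul pi_orth// mulmx0 mul0mx.
- move=> g; rewrite HP => Hg u /V0P <-.
  have [_ _ /(_ g Hg) HgT _] := Hol_group smf (I : setT p).
  have := congr1 trmx (Hol_fix_frame HgT A_kap).
  rewrite !trmx_mul !trmxK kap_proj.1 => h.
  by rewrite /Pk -!mulmxA [kap *m (E p *m g)]mulmxA h.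
- move=> i; have [x [y [z [hx hy hz [xx yy zz] [xy xz yz]]]]] := triple i; split.
  + apply/eqP => U0; have := Ein i x hx; rewrite U0 memv0 => /eqP x0.
    by have := dot_frame p x x; rewrite xx x0 /dot mul0mx mxE => /eqP; rewrite eq_sym oner_eq0.
  + move=> g; rewrite HP => Hg u /UP <-; apply/UP; have := Hol_commute_frame Hg (A_pi^~ i).
    move: (_ *m E p) (Up i).2 => Z ZZ h.
    by rewrite -(mulmxA _ g) h mulmxA -(mulmxA u) ZZ.
  move=> W WU inv; have [W0|W0] := eqVneq W 0%VS; [by left|right].
  apply/eqP; rewrite eqEsubv WU /=; apply/subvP => u uU.
  have vW := memv_pick W; set v := vpick W in vW; have v0 : v != 0 by rewrite vpick0.
  have [a ha va] := UinE i v (subvP WU _ vW); have [b hb ub] := UinE i u uU.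
  have := invariant_velocity inv (X := wedge v u).
  rewrite HP {1}va {1}ub => /(_ _ (velocity_wedge p ha hb) vW); rewrite row_wedge => h.
  have vv : dot v v != 0.
    by apply: contra v0 => /eqP vv; apply/eqP/mulmx_trmx_eq0; rewrite mul_dot vv raddf0.
  have : dot v v *: u \in W by rewrite -[_ *: u](subrK (dot v u *: v)); apply: memvD => //; exact: memvZ.
  by move=> /(memvZ (dot v v)^-1); rewrite scalerA mulVf// scale1r.
apply/esym/eqP; rewrite -[X in _ == X]card_ord; apply/eqP/eq_card => i; rewrite !inE; apply/asboolP.
have [x [y [z [hx hy hz [xx yy zz] [xy xz yz]]]]] := triple i.
apply: contrapT => nab.
have comm g h u : Hol setT p g -> Hol setT p h -> u \in U i -> u *m g *m h = u *m h *m g.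
  move=> Hg Hh uU; apply: contrapT => ne; apply: nab; rewrite /= HP.
  by exists g, h, u.
have comm1 X h u : velocity (Hol setT p) X -> Hol setT p h -> u \in U i -> u *m X *m h = u *m h *m X.
  move=> [ga [_ _ Hga dga]] Hh uU.
  apply: is_derive_unique (is_derive_mulmxr h (is_derive_mulmxl u dga)) _.
  rewrite (_ : (fun t => _) = fun t => u *m h *m ga t); first exact: is_derive_mulmxl.
  by apply/funext => t; apply: comm.
have comm2 X Y u : velocity (Hol setT p) X -> velocity (Hol setT p) Y -> u \in U i -> u *m X *m Y = u *m Y *m X.
  move=> VX [ga [_ _ Hga dga]] uU.
  apply: is_derive_unique (is_derive_mulmxl (u *m X) dga) _.
  rewrite (_ : (fun t => _) = fun t => u *m ga t *m X); first by apply/is_derive_mulmxr/is_derive_mulmxl.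
  by apply/funext => t; apply: comm1.
have := comm2 _ _ _ (velocity_wedge p hx hy) (velocity_wedge p hy hz) (Ein i x hx).
rewrite (_ : x *m E p *m wedge (x *m E p) _ = y *m E p); last first.
  by rewrite row_wedge !dot_frame xx xy scale1r scale0r subr0.
rewrite row_wedge [x *m E p *m _]row_wedge !dot_frame yy yz xy xz !scale0r !subr0 scale1r mul0mx.
by move=> z0; have := dot_frame p z z; rewrite zz z0 /dot mul0mx mxE => /eqP; rewrite eq_sym oner_eq0.
Qed.

End ConstantFrame.

Section RowSpaceTopology.
Context {R : realType} {n : nat}.
Local Notation V := 'rV[R]_n.

Lemma row_second_countable : @second_countable V.
Proof.
pose B (c : 'rV[rat]_n * nat) : set V := ball (map_mx ratr c.1 : V) (c.2.+1%:R^-1 : R).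
exists (range B); first exact: sub_countable (card_image_le _ _) (countableP _).
split=> [_ [c _ <-]|x U].
  exact: ball_open.
rewrite -nbhs_ballE => -[e /= e0 eU].
have [j je] : exists j : nat, (j.+1%:R^-1 : R) < e / 2.
  exists (Num.bound (e / 2)^-1); rewrite -[ltRHS]invrK ltf_pV2 ?posrE ?invr_gt0 ?divr_gt0//.
  by apply: lt_trans (archi_boundP _) _; rewrite ?invr_ge0 ?divr_ge0 ?(ltW e0)// ltr_nat.
have j0 : 0 < (j.+1%:R^-1 : R) by rewrite invr_gt0.
have r0 : 0 < (j.+1%:R^-1 / 2 : R) by rewrite divr_gt0.
have q i : exists q : rat, `|x 0 i - ratr q| < j.+1%:R^-1 / 2.
  have O0 : ball (x 0 i) (j.+1%:R^-1 / 2 : R) !=set0 by exists (x 0 i); exact: ballxx.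
  have [r [h [q _ qr]]] := dense_rat O0 (ball_open _ _); rewrite -{r}qr in h.
  by exists q; move: h; rewrite -ball_normE.
have [c cP] := choice q.
have xc : `|x - map_mx ratr (\row_i c i)| <= j.+1%:R^-1 / 2.
  by apply: mx_norm_le => [|i0 i]; [exact: ltW|rewrite ord1 !mxE ltW].
exists (B (\row_i c i, j)); first split; first by exists (\row_i c i, j).
  rewrite /B -ball_normE /= distrC; apply: le_lt_trans xc _.
  by move: j0; move: (j.+1%:R^-1 : R) => d; lra.
move=> y; rewrite /B -ball_normE /= => yc; apply: eU; rewrite -ball_normE /=.
rewrite -(subrKA (map_mx ratr (\row_i c i))); apply: le_lt_trans (ler_normD _ _) _.
by move: je xc yc; move: (j.+1%:R^-1 : R) => d; lra.
Qed.

Lemma row_connected : connected [set: V].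
Proof.
have -> : [set: V] = \bigcup_(v in setT) [set t *: v | t in (setT : set R)].
  by apply/seteqP; split=> // v _; exists v => //; exists 1 => //; rewrite scale1r.
apply: bigcup_connected; first by exists 0 => v _; exists 0 => //; rewrite scale0r.
move=> v _; apply: connected_continuous_connected.
  by apply/connected_intervalP => x y _ _ z _.
by apply: continuous_subspaceT => t; apply: cvgZ; [exact: cvg_id|exact: cvg_cst].
Qed.

End RowSpaceTopology.

(** The vectors [T1] and [T2] have product -14: because it is nonzero, the bracket of the two
    generators is a nonzero multiple of [wedge e1 e2], and further brackets reach all six wedges.
    They are linearly independent, with determinant 48, which brings back [t1] and [t2]. *)
Lemma span4_generated {R : realType} {k : nat} (K : 'M[R]_k -> Prop) (c : R) (e1 e2 t1 t2 : 'rV[R]_k) :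
  c != 0 -> K 0 -> (forall a Y Z, K Y -> K Z -> K (a *: Y + Z)) ->
  [/\ dot e1 e1 = 1, dot e2 e2 = 1, dot t1 t1 = 1 & dot t2 t2 = 1] ->
  [/\ dot e1 e2 = 0, dot t1 t2 = 0, dot e1 t1 = 0, dot e1 t2 = 0 & dot e2 t1 = 0 /\ dot e2 t2 = 0] ->
  let A1 := c *: wedge (7 *: t1 - t2) e1 in let A2 := c *: wedge (7 *: t2 - t1) e2 in
  K (A1 *m A2 - A2 *m A1) -> (forall Y, K Y -> K (A1 *m Y - Y *m A1)) -> (forall Y, K Y -> K (A2 *m Y - Y *m A2)) ->
  forall a1 a2 a3 a4 b1 b2 b3 b4, K (wedge (a1 *: e1 + a2 *: e2 + a3 *: t1 + a4 *: t2) (b1 *: e1 + b2 *: e2 + b3 *: t1 + b4 *: t2)).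
Proof.
move=> c0 K0 Klin [e11 e22 t11 t22] [e12 t12 e1t1 e1t2 [e2t1 e2t2]] A1 A2 K12 KA1 KA2.
have KD Y Z : K Y -> K Z -> K (Y + Z) by move=> hY hZ; rewrite -[Y]scale1r; exact: Klin.
have KZ a Y : K Y -> K (a *: Y) by move=> hY; rewrite -[_ *: _]addr0; exact: Klin.
have KN Y : K Y -> K (- Y) by move=> hY; rewrite -scaleN1r; exact: KZ.
have Kdiv a Y : a != 0 -> K (a *: Y) -> K Y by move=> a0 h; rewrite -[Y]scale1r -(mulVf a0) -scalerA; exact: KZ.
have dl a x y u : dot (a *: x - y) u = a * dot x u - dot y u :> R by rewrite /dot mulmxBl -scalemxAl !mxE.
have dr a x y u : dot u (a *: x - y) = a * dot u x - dot u y :> R by rewrite dotC dl !(dotC _ u).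
pose T1 := 7 *: t1 - t2; pose T2 := 7 *: t2 - t1.
have br x y u v : A1 = c *: wedge x y -> K (A1 *m wedge u v - wedge u v *m A1) ->
    K (dot y u *: wedge x v + dot x v *: wedge y u - dot y v *: wedge x u - dot x u *: wedge y v).
  move=> ->; rewrite -scalemxAl -scalemxAr -scalerBr => /(Kdiv _ _ c0).
  by rewrite wedge_bracket.
have br2 x y u v : A2 = c *: wedge x y -> K (A2 *m wedge u v - wedge u v *m A2) ->
    K (dot y u *: wedge x v + dot x v *: wedge y u - dot y v *: wedge x u - dot x u *: wedge y v).
  move=> ->; rewrite -scalemxAl -scalemxAr -scalerBr => /(Kdiv _ _ c0).
  by rewrite wedge_bracket.
have e21 : dot e2 e1 = 0 by rewrite dotC.
have t21 : dot t2 t1 = 0 by rewrite dotC.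
have D1 : [/\ dot e1 T1 = 0, dot e1 T2 = 0, dot e2 T1 = 0, dot e2 T2 = 0 & [/\ dot T1 e1 = 0, dot T1 e2 = 0, dot T2 e1 = 0 & dot T2 e2 = 0]].
  by rewrite /T1 /T2; split; last split; rewrite ?(dotC _ e1) ?(dotC _ e2) ?dl dr ?e1t1 ?e1t2 ?e2t1 ?e2t2; lra.
have D2 : [/\ dot T1 T1 = 50, dot T2 T2 = 50, dot T1 T2 = - 14 & dot T2 T1 = - 14].
  by rewrite /T1 /T2; split; rewrite dl !dr t11 t22 t12 t21; lra.
have [a1 a2 a3 a4 [a5 a6 a7 a8]] := D1; have [b1 b2 b3 b4] := D2.
have E1 : A1 = c *: wedge T1 e1 by []; have E2 : A2 = c *: wedge T2 e2 by [].
have k12 : K (wedge e1 e2).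
  have := K12; rewrite {1 2}E2 -!scalemxAr -!scalemxAl -scalerBr => /(Kdiv _ _ c0).
  rewrite -scalerBr -/T1 => /(Kdiv _ _ c0).
  rewrite wedge_bracket a2 a6 e12 b3 !scale0r !subr0 addr0 sub0r -scaleNr opprK.
  by apply: Kdiv; lra.
have kT12 : K (wedge T1 e2).
  have := br _ _ _ _ E1 (KA1 _ k12); rewrite e11 a5 a6 e12 !scale0r !subr0 addr0 scale1r; exact.
have kT21 : K (wedge T2 e1).
  have := br2 _ _ _ _ E2 (KA2 _ k12); rewrite e21 e22 a7 a8 !scale0r !subr0 add0r scale1r sub0r => /KN.
  by rewrite opprK.
have kTT : K (wedge T2 T1).
  have := br2 _ _ _ _ E2 (KA2 _ kT12); rewrite a3 e22 a8 b4 !scale0r scale1r !add0r scaleNr opprK.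
  have -> : wedge e2 e2 = 0 by rewrite /wedge subrr.
  by rewrite scaler0 addr0 => /KN; rewrite opprK.
have kT11 : K (wedge T1 e1).
  have := br _ _ _ _ E1 (KA1 _ kTT); rewrite a2 a1 b1 b3 !scale0r add0r subr0 scaleNr opprK.
  rewrite (wedgeNC T2) (wedgeNC T1) => h.
  have {h} : K (14 *: - wedge T1 e1) by rewrite -[X in K X](addrK (50 *: - wedge T2 e1)) [_ + 50 *: _]addrC; apply: KD h _; apply/KN/KZ/KN.
  by move=> /(Kdiv _ _ _) h; rewrite -[wedge _ _]opprK; apply/KN/h; lra.
have kT22 : K (wedge T2 e2).
  have := br2 _ _ _ _ E2 (KA2 _ kTT); rewrite a4 a3 b4 b2 !scale0r add0r subr0 scaleNr.
  rewrite (wedgeNC T2) (wedgeNC T1) => h.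
  have {h} : K (14 *: wedge T2 e2).
    rewrite -[14 *: _](addrK (50 *: wedge T1 e2)).
    by apply: KD; [move: h; rewrite !scalerN !opprK|exact/KN/KZ].
  by move=> /(Kdiv _ _ _); apply; lra.
have KC x y : K (wedge x y) -> K (wedge y x) by move=> h; rewrite wedgeNC; exact: KN.
have Kxx x : K (wedge x x) by rewrite /wedge subrr.
have Kl a b x y u : K (wedge x u) -> K (wedge y u) -> K (wedge (a *: x + b *: y) u).
  move=> hx hy; rewrite wedge_linl -[b *: y]addr0 wedge_linl; apply: (Klin) => //; apply: (Klin) => //.
  by rewrite /wedge trmx0 mul0mx mulmx0 subrr.
have E3 : t1 = (7 / 48) *: T1 + 48^-1 *: T2 by rewrite /T1 /T2; apply/rowP => j; rewrite !mxE; field.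
have E4 : t2 = 48^-1 *: T1 + (7 / 48) *: T2 by rewrite /T1 /T2; apply/rowP => j; rewrite !mxE; field.
have Kt x : K (wedge T1 x) -> K (wedge T2 x) -> K (wedge t1 x) /\ K (wedge t2 x).
  by move=> h1 h2; rewrite E3 E4; split; exact: Kl.
have [k31 k41] := Kt _ kT11 kT21; have [k32 k42] := Kt _ kT12 kT22.
have [h1 _] := Kt _ (Kxx T1) kTT; have [h2 _] := Kt _ (KC _ _ kTT) (Kxx T2).
have [_ k43] := Kt _ (KC _ _ h1) (KC _ _ h2).
have Kspan u a b d e : K (wedge e1 u) -> K (wedge e2 u) -> K (wedge t1 u) -> K (wedge t2 u) ->
    K (wedge (a *: e1 + b *: e2 + d *: t1 + e *: t2) u).
  move=> u1 u2 u3 u4; rewrite -[_ + d *: t1]scale1r; apply: (Kl) => //.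
  by rewrite -[_ + b *: e2]scale1r; do 2?apply: (Kl).
by move=> *; apply: (Kspan); apply: (KC); apply: (Kspan) => //; apply: (KC).
Qed.

(** * Inversion *)

Section InversionCurve.
Context {R : realType} {N : nat}.

Definition inversion (y : 'rV[R]_N) : 'rV[R]_N := (dot y y)^-1 *: y.
(** The reflection in the hyperplane orthogonal to [y]. Divided by the squared length of [y] it is
    the differential of the inversion, so it carries orthonormal normal frames to orthonormal normal
    frames. *)
Definition reflection (y : 'rV[R]_N) : 'M[R]_N := 1%:M - (2 / dot y y) *: (y^T *m y).

Lemma dot_eq0 (y : 'rV[R]_N) : (dot y y == 0) = (y == 0).
Proof.
apply/eqP/eqP => [h|->]; last by rewrite /dot mul0mx mxE.
by apply: mulmx_trmx_eq0; rewrite mul_dot h raddf0.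
Qed.

Lemma inversionK y : inversion (inversion y) = y.
Proof.
have [->|y0] := eqVneq y 0; first by rewrite /inversion !scaler0.
have yy : dot y y != 0 by rewrite dot_eq0.
have h : dot (inversion y) (inversion y) = (dot y y)^-1.
  by rewrite {1}/dot /inversion linearZ /= -scalemxAl -scalemxAr scalerA mxE -/(dot y y); field.
by rewrite [LHS]/inversion h /inversion scalerA invrK divff// scale1r.
Qed.

Lemma inversion_eq0 y : (inversion y == 0) = (y == 0).
Proof.
apply/eqP/eqP => [h|->]; last by rewrite /inversion scaler0.
by rewrite -(inversionK y) h /inversion scaler0.
Qed.

Lemma reflection_sym y : (reflection y)^T = reflection y.
Proof. by rewrite /reflection linearB linearZ /= trmx1 trmx_mul trmxK. Qed.

Lemma reflectionK y : y != 0 -> reflection y *m reflection y = 1%:M.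
Proof.
rewrite -dot_eq0 => yy; rewrite /reflection mulmxBl !mulmxBr !mul1mx mulmx1 -scalemxAl -scalemxAr.
have -> : y^T *m y *m (y^T *m y) = dot y y *: (y^T *m y) by rewrite mulmxA -(mulmxA y^T) mul_dot mul_mx_scalar scalemxAl.
rewrite !scalerA; have -> : 2 / dot y y * (2 / dot y y) * dot y y = 2 / dot y y + 2 / dot y y by field.
by move: (2 / dot y y) (y^T *m y) => a B; apply/matrixP => i j; rewrite !mxE; ring.
Qed.

Lemma is_derive_scalemx (m l : nat) (c : R -> R) (M : R -> 'M[R]_(m, l)) (t : R) dc dM : is_derive t 1 c dc -> is_derive t 1 M dM ->
  is_derive t 1 (fun t => c t *: M t) (dc *: M t + c t *: dM).
Proof.
move=> hc hM; apply/is_derive_mxP => i j.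
rewrite (_ : (fun y => _) = fun y => c y * M y i j); last by apply/funext => y; rewrite mxE.
apply: (is_derive_eq (is_deriveM hc ((is_derive_mxP _ _ _ _).1 hM i j))).
by rewrite addrC !mxE /GRing.scale /= [M t i j * dc]mulrC.
Qed.

Lemma is_derive_dot (ga : R -> 'rV[R]_N) (t : R) d : is_derive t 1 ga d ->
  is_derive t 1 (fun t => dot (ga t) (ga t)) (2 * dot (ga t) d).
Proof.
move=> dg; have := (is_derive_mxP _ _ _ _).1 (is_derive_mulmx dg (is_derive_trmx dg)) 0 0.
by move=> h; apply: (is_derive_eq h); rewrite mxE -/(dot _ _) -/(dot _ _) (dotC d); ring.
Qed.

Lemma is_derive_dotV (ga : R -> 'rV[R]_N) (t : R) d : ga t != 0 -> is_derive t 1 ga d ->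
  is_derive t 1 (fun t => (dot (ga t) (ga t))^-1) (- (2 * dot (ga t) d / dot (ga t) (ga t) ^+ 2)).
Proof.
move=> g0 dg; have g0' : dot (ga t) (ga t) != 0 by rewrite dot_eq0.
have h := is_deriveV g0' (is_derive_dot dg).
apply: (is_derive_eq h); rewrite /GRing.scale /=; field; exact: g0'.
Qed.

Lemma is_derive_inversion (ga : R -> 'rV[R]_N) (t : R) d : ga t != 0 -> is_derive t 1 ga d ->
  is_derive t 1 (fun t => inversion (ga t)) ((dot (ga t) (ga t))^-1 *: (d *m reflection (ga t))).
Proof.
move=> g0 dg; apply: (is_derive_eq (is_derive_scalemx (is_derive_dotV g0 dg) dg)).
have g0' : dot (ga t) (ga t) != 0 by rewrite dot_eq0.
rewrite /reflection mulmxBr mulmx1 -scalemxAr mulmxA mul_dot mul_scalar_mx (dotC d).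
move: g0'; move: (ga t) (dot (ga t) (ga t)) (dot (ga t) d) => y r s r0.
by apply/rowP => j; rewrite !mxE; field.
Qed.

(** The invariance of the normal connection under inversion: differentiating the reflection produces
    terms along [y] and [d], and they cancel because the frame is orthogonal to the tangent vector
    [d]. *)
Lemma is_derive_reflection_frame (k : nat) (ga : R -> 'rV[R]_N) (B : R -> 'M[R]_(k, N)) (t : R) d dB : ga t != 0 ->
  is_derive t 1 ga d -> is_derive t 1 B dB -> B t *m d^T = 0 ->
  exists2 D, is_derive t 1 (fun t => B t *m reflection (ga t)) D & B t *m reflection (ga t) *m D^T = B t *m dB^T.
Proof.
move=> g0 dg dBt Bd.
pose r := (dot (ga t) (ga t))^-1; pose y := ga t.
pose r' := - (2 * dot (ga t) d / dot (ga t) (ga t) ^+ 2).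
have dr := is_derive_dotV g0 dg.
pose H' : 'M[R]_N := - (2 *: (r' *: (y^T *m y) + r *: (d^T *m y + y^T *m d))).
have dH : is_derive t 1 (fun t => reflection (ga t)) H'.
  have h := is_derive_scalemx dr (is_derive_mulmx (is_derive_trmx dg) dg).
  have h2 := is_derive_scalemx (is_derive_cst (2 : R) t 1) h.
  have h3 := is_deriveB (is_derive_cst (1%:M : 'M[R]_N) t 1) h2.
  rewrite /reflection (_ : (fun t => _) = fun t => 1%:M - 2 *: ((dot (ga t) (ga t))^-1 *: ((ga t)^T *m ga t))).
    by apply: (is_derive_eq h3); rewrite sub0r scale0r add0r.
  by apply/funext => u; rewrite scalerA.
exists (dB *m reflection y + B t *m H'); first exact: is_derive_mulmx.
have yy : dot y y != 0 by rewrite dot_eq0.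
have dBT : d *m (B t)^T = 0 by rewrite -[LHS]trmxK trmx_mul trmxK Bd trmx0.
rewrite [(_ + _)^T]linearD /= !trmx_mul reflection_sym mulmxDr mulmxA -(mulmxA (B t)) reflectionK// mulmx1.
rewrite -[RHS]addr0; congr (_ + _).
pose s := B t *m y^T.
have sT : y *m (B t)^T = s^T by rewrite /s trmx_mul trmxK.
have HB : H'^T *m (B t)^T = - (2 *: (r' *: (y^T *m s^T) + r *: (d^T *m s^T))).
  have -> : H'^T = H' by apply/matrixP => i j; rewrite !mxE !big_ord1 !mxE; ring.
  by rewrite /H' mulNmx -scalemxAl mulmxDl -!scalemxAl mulmxDl -!mulmxA sT dBT mulmx0 addr0.
have h1 : B t *m reflection y *m y^T = - s.
  rewrite /reflection mulmxBr mulmx1 mulmxBl -/s -scalemxAr -scalemxAl !mulmxA -/s -(mulmxA s) mul_dot mul_mx_scalar scalerA.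
  by rewrite -mulrA mulVf// mulr1 scaler_nat mulr2n opprD addrA subrr sub0r.
have h2 : B t *m reflection y *m d^T = - (2 * r * dot y d) *: s.
  rewrite /reflection mulmxBr mulmx1 mulmxBl Bd sub0r -scalemxAr -scalemxAl !mulmxA -/s -(mulmxA s) mul_dot mul_mx_scalar scalerA.
  by rewrite scaleNr.
rewrite HB mulmxN -!scalemxAr mulmxDr -!scalemxAr !mulmxA h1 h2 mulNmx -scalemxAl.
rewrite /r' -/y; move: (s *m s^T) => Z.
apply/matrixP => i j; rewrite !mxE /r -/y; field; exact: yy.
Qed.

End InversionCurve.

Section InversionFrame.
Context {R : realType} {n N k : nat}.
Local Notation V := 'rV[R]_n.
Variables (g : V -> 'rV[R]_N) (E : V -> 'M[R]_(k, N)) (A : V -> 'M[R]_k).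
Hypothesis sg : smooth_on setT g.
Hypothesis g0 : forall x, g x != 0.
Hypothesis immg : forall x w, 'D_w g x = 0 -> w = 0.
Hypothesis sE : smooth_on setT E.
Hypothesis EE : forall x, E x *m (E x)^T = 1%:M.
Hypothesis Eg : forall x w, E x *m ('D_w g x)^T = 0.
Hypothesis EA : forall x v, E x *m ('D_v E x)^T = A v.

Definition inv_imm x := inversion (g x).
Definition inv_frame x := E x *m reflection (g x).

Lemma dotV_smooth l : Ck l setT (fun x => (dot (g x) (g x))^-1).
Proof.
apply: (CkV openT) => [x _|]; first by rewrite dot_eq0.
by apply: (Ck_coord _ _ openT); apply: (Ck_mulmx openT); [exact: sg|apply: (Ck_trmx openT); exact: sg].
Qed.

Lemma Ck_scalemx (l m j : nat) (c : V -> R) (M : V -> 'M[R]_(m, j)) : Ck l setT c -> Ck l setT M -> Ck l setT (fun x => c x *: M x).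
Proof.
move=> hc hM; apply: (Ck_mx openT) => a b.
apply: (@Ck_eq _ _ _ _ _ (fun x => c x * M x a b) _ openT) => [x _|]; first by rewrite mxE.
by apply: (CkM openT) => //; exact: (Ck_coord a b openT hM).
Qed.

Lemma inv_imm_smooth : smooth_on setT inv_imm.
Proof. by move=> l; apply: Ck_scalemx; [exact: dotV_smooth|exact: sg]. Qed.

Lemma inv_frame_smooth : smooth_on setT inv_frame.
Proof.
move=> l; apply: (Ck_mulmx openT); first exact: sE.
apply: (CkB openT); first exact: Ck_cst.
apply: Ck_scalemx; first by apply: (CkM openT); [exact: Ck_cst|exact: dotV_smooth].
by apply: (Ck_mulmx openT); [apply: (Ck_trmx openT)|]; exact: sg.
Qed.

Lemma inv_imm_derive x w : 'D_w inv_imm x = (dot (g x) (g x))^-1 *: ('D_w g x *m reflection (g x)).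
Proof.
have d := smooth_is_derive_line0 x w sg.
have gx : g (x + 0 *: w) != 0 by [].
have := is_derive_inversion gx d; rewrite scale0r addr0.
exact: is_derive_unique (smooth_is_derive_line0 x w inv_imm_smooth).
Qed.

Lemma inv_imm_immersion x w : 'D_w inv_imm x = 0 -> w = 0.
Proof.
rewrite inv_imm_derive => /eqP; rewrite scaler_eq0 invr_eq0 dot_eq0 (negPf (g0 x)) /= => /eqP h.
apply: (immg (x := x)).
by rewrite -[LHS]mulmx1 -(reflectionK (g0 x)) mulmxA h mul0mx.
Qed.

Lemma inv_frame_orth x : inv_frame x *m (inv_frame x)^T = 1%:M.
Proof. by rewrite /inv_frame trmx_mul reflection_sym mulmxA -(mulmxA (E x)) reflectionK// mulmx1. Qed.

Lemma inv_frame_normal x w : inv_frame x *m ('D_w inv_imm x)^T = 0.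
Proof.
by rewrite inv_imm_derive linearZ /= -scalemxAr trmx_mul reflection_sym mulmxA -(mulmxA (E x)) reflectionK// mulmx1 Eg scaler0.
Qed.

Lemma inv_frame_conn x v : inv_frame x *m ('D_v inv_frame x)^T = A v.
Proof.
have dg := smooth_is_derive_line0 x v sg; have dE := smooth_is_derive_line0 x v sE.
have gx : g (x + 0 *: v) != 0 by [].
have Ed : E (x + 0 *: v) *m ('D_v g x)^T = 0 by rewrite scale0r addr0 Eg.
have [D dD] := is_derive_reflection_frame gx dg dE Ed.
rewrite scale0r addr0 EA => <-; congr (_ *m _^T).
exact: is_derive_unique (smooth_is_derive_line0 x v inv_frame_smooth) dD.
Qed.

End InversionFrame.

(** * A product of surfaces and a flat factor *)

Section BlockCalculus.
Context {R : realType}.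

Lemma is_derive_row_mx (p q r : nat) (f : R -> 'M[R]_(p, q)) (g : R -> 'M[R]_(p, r)) (t : R) df dg :
  is_derive t 1 f df -> is_derive t 1 g dg -> is_derive t 1 (fun t => row_mx (f t) (g t)) (row_mx df dg).
Proof.
move=> hf hg; apply/is_derive_mxP => i j; case: (splitP j) => l E.
  rewrite (_ : j = lshift r l); last exact: val_inj.
  rewrite row_mxEl (_ : (fun y => _) = fun y => f y i l); first exact: (is_derive_mxP _ _ _ _).1 hf i l.
  by apply/funext => y; rewrite row_mxEl.
rewrite (_ : j = rshift q l); last exact: val_inj.
rewrite row_mxEr (_ : (fun y => _) = fun y => g y i l); first exact: (is_derive_mxP _ _ _ _).1 hg i l.
by apply/funext => y; rewrite row_mxEr.
Qed.

Lemma is_derive_col_mx (p q r : nat) (f : R -> 'M[R]_(q, p)) (g : R -> 'M[R]_(r, p)) (t : R) df dg :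
  is_derive t 1 f df -> is_derive t 1 g dg -> is_derive t 1 (fun t => col_mx (f t) (g t)) (col_mx df dg).
Proof.
move=> hf hg; have := is_derive_trmx (is_derive_row_mx (is_derive_trmx hf) (is_derive_trmx hg)).
rewrite tr_row_mx !trmxK (_ : (fun y => _) = fun y => col_mx (f y) (g y)) => //.
by apply/funext => y; rewrite tr_row_mx !trmxK.
Qed.

Lemma Ck_row_mx {U : normedModType R} l (p q r : nat) (f : U -> 'M[R]_(p, q)) (g : U -> 'M[R]_(p, r)) :
  Ck l setT f -> Ck l setT g -> Ck l setT (fun t => row_mx (f t) (g t)).
Proof.
move=> hf hg; apply: (Ck_mx openT) => i j; case: (splitP j) => a E.
  rewrite (_ : j = lshift r a); last exact: val_inj.
  by apply: (@Ck_eq _ _ _ _ _ (fun y => f y i a) _ openT) => [y _|]; [rewrite row_mxEl|exact: (Ck_coord _ _ openT)].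
rewrite (_ : j = rshift q a); last exact: val_inj.
by apply: (@Ck_eq _ _ _ _ _ (fun y => g y i a) _ openT) => [y _|]; [rewrite row_mxEr|exact: (Ck_coord _ _ openT)].
Qed.

Lemma Ck_col_mx {U : normedModType R} l (p q r : nat) (f : U -> 'M[R]_(q, p)) (g : U -> 'M[R]_(r, p)) :
  Ck l setT f -> Ck l setT g -> Ck l setT (fun t => col_mx (f t) (g t)).
Proof.
move=> hf hg; apply: (@Ck_eq _ _ _ _ _ (fun y => (row_mx (f y)^T (g y)^T)^T) _ openT) => [y _|].
  by rewrite tr_row_mx !trmxK.
by apply: (Ck_trmx openT); apply: Ck_row_mx; exact: (Ck_trmx openT).
Qed.

Lemma Ck_cos_sin l : Ck l setT (@cos R) /\ Ck l setT (@sin R).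
Proof.
have dc x : differentiable (@cos R) x by apply/derivable1_diffP; exact: derivable_cos.
have ds x : differentiable (@sin R) x by apply/derivable1_diffP; exact: ex_derive.
have Dv (f : R -> R) v : (forall x, differentiable f x) -> 'D_v f = fun x => v * 'D_1 f x.
  move=> df; apply/funext => x; rewrite !deriveE// -{1}[v]mulr1 -[v * 1]/(v *: (1 : R^o)).
  by rewrite linearZ.
have Dc v : 'D_v (@cos R) = fun x => v * - sin x.
  by rewrite Dv//; apply/funext => x; congr (_ * _); exact: derive_val.
have Ds v : 'D_v (@sin R) = fun x => v * cos x.
  by rewrite Dv//; apply/funext => x; congr (_ * _); exact: derive_val.
elim: l => [|l [hc hs]].
  by split=> x _; apply: differentiable_continuous.
split; (split=> [x _|v]; first by []); rewrite ?Dc ?Ds.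
  by apply: (CkM openT); [exact: Ck_cst|exact: (CkN openT)].
by apply: (CkM openT); [exact: Ck_cst|].
Qed.

Definition cosr (p : nat) (z : 'rV[R]_p) : 'rV[R]_p := \row_j cos (z 0 j).
Definition sinr (p : nat) (z : 'rV[R]_p) : 'rV[R]_p := \row_j sin (z 0 j).

Lemma is_derive_cosr (p : nat) (z a : 'rV[R]_p) : is_derive (0 : R) 1 (fun t : R => cosr (z + t *: a)) (- (a *m diag_mx (sinr z))) /\
  is_derive (0 : R) 1 (fun t : R => sinr (z + t *: a)) (a *m diag_mx (cosr z)).
Proof.
have da j : is_derive (0 : R) 1 (fun t => z 0 j + a 0 j * t) (a 0 j) by exact: is_derive_affine.
split; apply/is_derive_mxP => i j; rewrite ord1 {i}.
  rewrite (_ : (fun y => _) = cos \o (fun t => z 0 j + a 0 j * t)); last by apply/funext => t; rewrite !mxE /= mulrC.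
  apply: (is_derive_eq (is_derive_comp1 (da j) (is_derive_cos _))).
  by rewrite mulr0 addr0 mxE mul_mx_diag !mxE /GRing.scale /= mulrN.
rewrite (_ : (fun y => _) = sin \o (fun t => z 0 j + a 0 j * t)); last by apply/funext => t; rewrite !mxE /= mulrC.
apply: (is_derive_eq (is_derive_comp1 (da j) (is_derive_sin _))).
by rewrite mulr0 addr0 mul_mx_diag !mxE /GRing.scale /=.
Qed.

Lemma Ck_cosr {U : normedModType R} l (p : nat) (z : U -> 'rV[R]_p) : Ck l setT z ->
  Ck l setT (fun u => cosr (z u)) /\ Ck l setT (fun u => sinr (z u)).
Proof.
move=> hz; have [hc hs] := Ck_cos_sin l; have hz' j := Ck_coord 0 j openT hz.
split; apply: (Ck_mx openT) => i j; rewrite ord1.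
  apply: (@Ck_eq _ _ _ _ _ (cos \o (fun u => z u 0 j)) _ openT) => [u _|]; first by rewrite mxE.
  exact: Ck_comp_real.
apply: (@Ck_eq _ _ _ _ _ (sin \o (fun u => z u 0 j)) _ openT) => [u _|]; first by rewrite mxE.
exact: Ck_comp_real.
Qed.

Lemma cosr_sinr (p : nat) (z : 'rV[R]_p) :
  diag_mx (cosr z) *m diag_mx (cosr z) + diag_mx (sinr z) *m diag_mx (sinr z) = 1%:M.
Proof.
apply/matrixP => i j; rewrite !mul_diag_mx !mxE; have [->|_] := eqVneq i j.
  by rewrite !mulr1n -!expr2 cos2Dsin2.
by rewrite !mulr0n !mulr0 addr0.
Qed.

Lemma delta_diag (p : nat) (i : 'I_p) : delta_mx i i = diag_mx (delta_mx 0 i) :> 'M[R]_p.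
Proof.
apply/matrixP => a b; rewrite !mxE eqxx /=; have [->|ab] := eqVneq a b; first by rewrite andbb mulr1n.
by rewrite mulr0n; case: eqP => // <-; rewrite eq_sym (negPf ab).
Qed.

End BlockCalculus.

(** * Matrix identities for the torus frame: [C], [S] and [D] commute with each other, but not with
    [B] *)

Section FrameAlgebra.
Context {R : realType} {q : nat} (C S D B W : 'M[R]_q).
Hypotheses (CT : C^T = C) (ST : S^T = S) (DT : D^T = D) (BT : B^T = B) (WT : W^T = W).
Hypotheses (CS : C *m S = S *m C) (CD : C *m D = D *m C) (SD : S *m D = D *m S).
Hypotheses (CCSS : C *m C + S *m S = 1%:M) (WB : W *m W + B *m B = 1%:M).

Lemma trmxN (X : 'M[R]_q) : (- X)^T = - X^T.
Proof. exact: linearN. Qed.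

Lemma frame_algebra_et : C *m (- (B *m S))^T + S *m (B *m C)^T = 0.
Proof. by rewrite linearN /= !trmx_mul CT ST BT mulmxN !mulmxA CS addrC subrr. Qed.

Lemma frame_algebra_tt : W *m W^T + (- (B *m S) *m (- (B *m S))^T + (B *m C) *m (B *m C)^T) = 1%:M.
Proof.
rewrite linearN /= !trmx_mul CT ST BT WT mulNmx mulmxN opprK.
rewrite !mulmxA -(mulmxA B S) -(mulmxA B C) -mulmxDl -mulmxDr [S *m S + _]addrC CCSS mulmx1; exact: WB.
Qed.

Lemma conn_algebra_ee : C *m (- (S *m D))^T + S *m (C *m D)^T = 0.
Proof.
rewrite linearN /= !trmx_mul CT ST DT mulmxN !mulmxA CD SD -(mulmxA D C) CS -(mulmxA D S) addrC.
by rewrite !mulmxA subrr.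
Qed.

Lemma conn_algebra_et : C *m (- (B *m (C *m D)))^T + S *m (B *m (- (S *m D)))^T = - (D *m B).
Proof.
rewrite [B *m - _]mulmxN !trmxN !trmx_mul CT ST DT BT !mulmxN -opprD !mulmxA CD SD -mulmxDl; congr (- (_ *m _)).
by rewrite -!mulmxA -mulmxDr CCSS mulmx1.
Qed.

Lemma conn_algebra_te : - (B *m S) *m (- (S *m D))^T + B *m C *m (C *m D)^T = B *m D.
Proof.
rewrite linearN /= !trmx_mul CT ST DT mulNmx mulmxN opprK -!mulmxA -mulmxDr; congr (_ *m _).
by rewrite !mulmxA CD SD -!mulmxA -mulmxDr addrC CCSS mulmx1.
Qed.

Lemma conn_algebra_tt : - (B *m S) *m (- (B *m (C *m D)))^T + B *m C *m (B *m (- (S *m D)))^T = 0.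
Proof.
rewrite [B *m - _]mulmxN !trmxN !trmx_mul CT ST DT BT !mulNmx !mulmxN opprK !mulmxA.
by rewrite -(mulmxA B S) SD -(mulmxA B C) CD !mulmxA -(mulmxA (B *m D) C) CS mulmxA subrr.
Qed.

End FrameAlgebra.

Section DotBlocks.
Context {R : realType}.

Lemma dot_row_mx (p q : nat) (a c : 'rV[R]_p) (b d : 'rV[R]_q) : dot (row_mx a b) (row_mx c d) = dot a c + dot b d.
Proof. by rewrite /dot tr_row_mx mul_row_col mxE. Qed.

Lemma dot0l (p : nat) (a : 'rV[R]_p) : dot 0 a = 0.
Proof. by rewrite /dot mul0mx mxE. Qed.

Lemma dot0r (p : nat) (a : 'rV[R]_p) : dot a 0 = 0.
Proof. by rewrite dotC dot0l. Qed.

Lemma dot_delta (p : nat) (i j : 'I_p) : dot (delta_mx 0 i) (delta_mx 0 j) = (i == j)%:R :> R.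
Proof. by rewrite /dot trmx_delta mul_delta_mx_cond; case: (i == j); rewrite ?mulr1n ?mulr0n !mxE ?eqxx. Qed.

Lemma row_mul_delta (p : nat) (a : 'rV[R]_p) (i : 'I_p) : a *m delta_mx i i = a 0 i *: delta_mx 0 i.
Proof.
apply/rowP => j; rewrite !mxE eqxx /= (bigD1 i)//= big1 => [|l li]; first by rewrite !mxE eqxx addr0.
by rewrite !mxE (negPf li) mulr0.
Qed.

End DotBlocks.

Section ExampleData.
Context {R : realType} (e m : nat).
Local Notation q := (m + m)%N.
Local Notation n := (e + q)%N.
Local Notation N := (1 + (e + (q + (q + q))))%N.
Local Notation k := (1 + (q + q))%N.
Local Notation V := 'rV[R]_n.

Definition swap : 'M[R]_q := block_mx 0 1%:M 1%:M 0.
Definition spol (a b : R) : 'M[R]_q := a%:M + b *: swap.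

Lemma swapK : swap *m swap = 1%:M.
Proof. by rewrite /swap mulmx_block !(mul0mx, mulmx0, mul1mx, addr0, add0r) -scalar_mx_block. Qed.

Lemma spol_mul a b c d : spol a b *m spol c d = spol (a * c + b * d) (a * d + b * c).
Proof.
rewrite /spol mulmxDl !mulmxDr -!scalemxAl -!scalemxAr swapK !mul_scalar_mx !mul_mx_scalar.
by apply/matrixP => i j; rewrite !mxE; case: (i == j); rewrite ?mulr1n ?mulr0n; ring.
Qed.

Lemma spol_sym a b : (spol a b)^T = spol a b.
Proof. by rewrite /spol linearD linearZ /= tr_scalar_mx /swap tr_block_mx !trmx0 !trmx1. Qed.

Lemma spol1 : spol 1 0 = 1%:M.
Proof. by rewrite /spol scale0r addr0. Qed.

(** On the eigenspaces of [swap] for 1 and -1, [B] is 3/5 and 4/5, [W] is 4/5 and 3/5, [L] is -3/4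
    and -4/3, and [L'] is the inverse of [L]. The off-diagonal part of [B] couples the two circles
    of a pair; without it the surfaces would be products of helices. *)
Local Notation B := (spol (7 / 10) (- (1 / 10))).
Local Notation W := (spol (7 / 10) (1 / 10)).
Local Notation L := (spol (- (25 / 24)) (7 / 24)).
Local Notation L' := (spol (- (25 / 24)) (- (7 / 24))).

Lemma spol_LK : L *m L' = 1%:M.
Proof. by rewrite spol_mul -spol1; congr spol; field. Qed.

Lemma spol_WB : W *m W + B *m B = 1%:M.
Proof.
rewrite !spol_mul -spol1 /spol addrACA -scalerDl -raddfD /=.
by congr (_%:M + _ *: _); field.
Qed.

Lemma spol_WL : W *m L = - B.
Proof.
rewrite spol_mul /spol; apply/matrixP => i j; rewrite !mxE.
by case: (i == j); rewrite ?mulr1n ?mulr0n; field.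
Qed.

(* [L], [W] and [B] commute, [W^2 + B^2 = 1] and [W L = - B]: this makes [torus_frame] below an orthonormal normal
   frame whose connection form [torus_conn] does not depend on the point. *)
Definition torus_imm (x : V) : 'rV[R]_N :=
  row_mx 1%:M (row_mx (lsubmx x) (row_mx (rsubmx x *m L) (row_mx (cosr (rsubmx x)) (sinr (rsubmx x))))).

(** A linear left inverse of the immersion; it gives injectivity, a continuous inverse and
    closedness of the image at once. *)
Definition torus_coord : 'M[R]_(N, n) :=
  col_mx 0 (col_mx (row_mx 1%:M 0) (col_mx (row_mx 0 L') 0)).

Lemma torus_immK x : torus_imm x *m torus_coord = x.
Proof.
rewrite /torus_imm /torus_coord !mul_row_col !mulmx0 add0r addr0 !mul_mx_row !mulmx0 mulmx1 -mulmxA spol_LK mulmx1.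
by rewrite add_row_mx addr0 add0r hsubmxK.
Qed.

Lemma torus_imm_neq0 x : torus_imm x != 0.
Proof.
apply/eqP => /(congr1 lsubmx); rewrite row_mxKl linear0 => /matrixP /(_ 0 0) /eqP.
by rewrite !mxE eqxx oner_eq0.
Qed.

Local Notation C x := (diag_mx (cosr (rsubmx x))).
Local Notation S x := (diag_mx (sinr (rsubmx x))).

Definition torus_frame (x : V) : 'M[R]_(k, N) :=
  col_mx (row_mx 1%:M 0) (col_mx
    (row_mx 0 (row_mx 0 (row_mx 0 (row_mx (C x) (S x)))))
    (row_mx 0 (row_mx 0 (row_mx W (row_mx (- (B *m S x)) (B *m C x)))))).

Definition torus_conn (v : V) : 'M[R]_k :=
  block_mx 0 0 0 (block_mx 0 (- (diag_mx (rsubmx v) *m B)) (B *m diag_mx (rsubmx v)) 0).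

Lemma sub_linear (x : V) : continuous (rsubmx : V -> 'rV[R]_q) /\ continuous (lsubmx : V -> 'rV[R]_e).
Proof.
split=> y; apply/continuous_mxP => i j.
  rewrite (_ : (fun y => _) = fun y : V => y i (rshift e j)); last by apply/funext => u; rewrite mxE.
  exact: (continuous_mxP _ _).1 (@cvg_id _ _) i _.
rewrite (_ : (fun y => _) = fun y : V => y i (lshift q j)); last by apply/funext => u; rewrite mxE.
exact: (continuous_mxP _ _).1 (@cvg_id _ _) i _.
Qed.

Lemma torus_imm_smooth : smooth_on setT torus_imm.
Proof.
move=> l; apply: Ck_row_mx; first exact: Ck_cst.
have hr : Ck l setT (rsubmx : V -> 'rV[R]_q) by apply: Ck_linear; case: (sub_linear 0).
have hl : Ck l setT (lsubmx : V -> 'rV[R]_e) by apply: Ck_linear; case: (sub_linear 0).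
have [hc hs] := Ck_cosr hr.
apply: Ck_row_mx; first exact: hl.
apply: Ck_row_mx; first by apply: (Ck_mulmx openT); [exact: hr|exact: Ck_cst].
by apply: Ck_row_mx.
Qed.

Lemma torus_frame_smooth : smooth_on setT torus_frame.
Proof.
move=> l.
have hr : Ck l setT (rsubmx : V -> 'rV[R]_q) by apply: Ck_linear; case: (sub_linear 0).
have [hc hs] := Ck_cosr hr.
have hC : Ck l setT (fun x : V => C x) by apply: Ck_linear_comp => //; exact: openT.
have hS : Ck l setT (fun x : V => S x) by apply: Ck_linear_comp => //; exact: openT.
have c0 (p r : nat) (A : 'M[R]_(p, r)) : Ck l setT (fun _ : V => A) by exact: Ck_cst.
apply: Ck_col_mx; first exact: Ck_cst.
apply: Ck_col_mx; apply: Ck_row_mx (c0 _ _ _) _; apply: Ck_row_mx (c0 _ _ _) _; apply: Ck_row_mx (c0 _ _ _) _; apply: Ck_row_mx => //.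
  by apply: (CkN openT); apply: (Ck_mulmx openT).
by apply: (Ck_mulmx openT).
Qed.

Lemma torus_imm_derive x w : 'D_w torus_imm x =
  row_mx 0 (row_mx (lsubmx w) (row_mx (rsubmx w *m L) (row_mx (- (rsubmx w *m S x)) (rsubmx w *m C x)))).
Proof.
apply: is_derive_unique (smooth_is_derive_line0 x w torus_imm_smooth) _.
have [dc ds] := is_derive_cosr (rsubmx x) (rsubmx w).
have dl (p r : nat) (a b : 'M[R]_(p, r)) : is_derive (0 : R) 1 (fun t : R => a + t *: b) b.
  have dI : is_derive (0 : R) 1 (fun t : R => t *: b) b.
    have := is_derive_scalemx (is_derive_id (0 : R) 1) (is_derive_cst b (0 : R) 1).
    by rewrite scaler0 addr0 scale1r.
  by have := is_deriveD (is_derive_cst a (0 : R) 1) dI; rewrite add0r.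
rewrite /torus_imm (_ : (fun t => _) = fun t : R => row_mx 1%:M (row_mx (lsubmx x + t *: lsubmx w)
  (row_mx ((rsubmx x + t *: rsubmx w) *m L) (row_mx (cosr (rsubmx x + t *: rsubmx w)) (sinr (rsubmx x + t *: rsubmx w)))))); last first.
  by apply/funext => t; rewrite !linearD !linearZ.
exact: (is_derive_row_mx (is_derive_cst _ _ _) (is_derive_row_mx (dl _ _ _ _) (is_derive_row_mx (is_derive_mulmxr L (dl _ _ _ _)) (is_derive_row_mx dc ds)))).
Qed.

Lemma torus_imm_immersion x w : 'D_w torus_imm x = 0 -> w = 0.
Proof.
rewrite torus_imm_derive => h; have := congr1 (mulmx^~ torus_coord) h; rewrite mul0mx => <-.
rewrite /torus_coord !mul_row_col !mulmx0 add0r addr0 !mul_mx_row !mulmx0 mulmx1 -mulmxA spol_LK mulmx1.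
by rewrite add_row_mx addr0 add0r hsubmxK.
Qed.

Lemma torus_frame_orth x : torus_frame x *m (torus_frame x)^T = 1%:M.
Proof.
have CS := diag_mxC (cosr (rsubmx x)) (sinr (rsubmx x)).
have [CT ST] := (tr_diag_mx (cosr (rsubmx x)), tr_diag_mx (sinr (rsubmx x))).
have tt := frame_algebra_tt CT ST (spol_sym _ _) (spol_sym _ _) (cosr_sinr (rsubmx x)) spol_WB.
have et := frame_algebra_et CT ST (spol_sym (7 / 10) (- (1 / 10))) CS.
have te : - (B *m S x) *m C x + B *m C x *m S x = 0.
  by have := congr1 trmx et; rewrite trmx0 linearD /= !trmx_mul !trmxK CT ST.
rewrite /torus_frame !tr_col_mx !tr_row_mx !mul_col_row !mul_row_col !trmx0 !(mul0mx, mulmx0, add0r, addr0).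
rewrite mul_mx_row !mul_row_col mul_col_mx !mul_row_col !(mul0mx, mulmx0, add0r, addr0) row_mx0 col_mx0.
by rewrite trmx1 mulmx1 CT ST cosr_sinr et te tt -!scalar_mx_block.
Qed.

Lemma torus_frame_normal x w : torus_frame x *m ('D_w torus_imm x)^T = 0.
Proof.
rewrite torus_imm_derive /torus_frame !tr_row_mx !mul_col_mx !mul_row_col !trmx0 !(mul0mx, mulmx0, add0r, addr0).
have CS := diag_mxC (cosr (rsubmx x)) (sinr (rsubmx x)).
have [CT ST] := (tr_diag_mx (cosr (rsubmx x)), tr_diag_mx (sinr (rsubmx x))).
rewrite linearN /= !trmx_mul CT ST spol_sym.
have -> : C x *m - (S x *m (rsubmx w)^T) + S x *m (C x *m (rsubmx w)^T) = 0.
  by rewrite mulmxN !mulmxA CS addrC subrr.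
have -> : W *m (L *m (rsubmx w)^T) + (- (B *m S x) *m - (S x *m (rsubmx w)^T) + B *m C x *m (C x *m (rsubmx w)^T)) = 0.
  rewrite mulmxN mulNmx opprK !mulmxA spol_WL -mulmxDl -!mulmxDl -!mulmxA -!mulmxDr.
  by rewrite [S x *m _ + _]addrC cosr_sinr mulmx1 addNr mul0mx.
by rewrite !col_mx0.
Qed.

Lemma torus_frame_derive x w : 'D_w torus_frame x =
  col_mx (row_mx 0 0) (col_mx
    (row_mx 0 (row_mx 0 (row_mx 0 (row_mx (- (S x *m diag_mx (rsubmx w))) (C x *m diag_mx (rsubmx w))))))
    (row_mx 0 (row_mx 0 (row_mx 0 (row_mx (- (B *m (C x *m diag_mx (rsubmx w)))) (B *m - (S x *m diag_mx (rsubmx w)))))))).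
Proof.
apply: is_derive_unique (smooth_is_derive_line0 x w torus_frame_smooth) _.
have [dc ds] := is_derive_cosr (rsubmx x) (rsubmx w).
have dD (u v : 'rV[R]_q) : diag_mx (v *m diag_mx u) = diag_mx u *m diag_mx v.
  by rewrite diag_mxC mulmx_diag mul_mx_diag; congr diag_mx; apply/rowP => j; rewrite !mxE.
have dC : is_derive (0 : R) 1 (fun t : R => diag_mx (cosr (rsubmx x + t *: rsubmx w))) (- (S x *m diag_mx (rsubmx w))).
  by apply: (is_derive_eq (is_derive_linear (@diag_mx R q) dc)); rewrite linearN /= dD.
have dS : is_derive (0 : R) 1 (fun t : R => diag_mx (sinr (rsubmx x + t *: rsubmx w))) (C x *m diag_mx (rsubmx w)).
  by apply: (is_derive_eq (is_derive_linear (@diag_mx R q) ds)); rewrite /= dD.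
rewrite /torus_frame (_ : (fun t => _) = fun t : R => col_mx (row_mx 1%:M 0) (col_mx
    (row_mx 0 (row_mx 0 (row_mx 0 (row_mx (diag_mx (cosr (rsubmx x + t *: rsubmx w))) (diag_mx (sinr (rsubmx x + t *: rsubmx w)))))))
    (row_mx 0 (row_mx 0 (row_mx W (row_mx (- (B *m diag_mx (sinr (rsubmx x + t *: rsubmx w)))) (B *m diag_mx (cosr (rsubmx x + t *: rsubmx w))))))))); last first.
  by apply/funext => t; rewrite !linearD !linearZ.
have cst (p r : nat) (A : 'M[R]_(p, r)) := is_derive_cst A (0 : R) 1.
apply: (is_derive_col_mx (is_derive_row_mx (cst _ _ _) (cst _ _ _))); apply: is_derive_col_mx.
  do 3 (apply: (is_derive_row_mx (cst _ _ _))); exact: is_derive_row_mx.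
do 3 (apply: (is_derive_row_mx (cst _ _ _))); apply: is_derive_row_mx; last exact: is_derive_mulmxl.
exact/is_deriveN/is_derive_mulmxl.
Qed.

Lemma torus_frame_conn x v : torus_frame x *m ('D_v torus_frame x)^T = torus_conn v.
Proof.
rewrite torus_frame_derive /torus_frame /torus_conn.
set D := diag_mx (rsubmx v).
have CS := diag_mxC (cosr (rsubmx x)) (sinr (rsubmx x)).
have CD : C x *m D = D *m C x := diag_mxC _ _.
have SD : S x *m D = D *m S x := diag_mxC _ _.
have [CT ST] := (tr_diag_mx (cosr (rsubmx x)), tr_diag_mx (sinr (rsubmx x))).
have DT : D^T = D := tr_diag_mx _.
have BT := spol_sym (7 / 10) (- (1 / 10)).
have h1 := conn_algebra_ee CT ST DT CS CD SD.
have h2 := conn_algebra_et CT ST DT BT CD SD (cosr_sinr _).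
have h3 := conn_algebra_te _ CT ST DT CD SD (cosr_sinr _).
have h4 := conn_algebra_tt CT ST DT BT CS CD SD.
rewrite !tr_col_mx !tr_row_mx !mul_col_row !mul_row_col !trmx0 !(mul0mx, mulmx0, add0r, addr0).
rewrite mul_mx_row mul_col_mx !mul_row_col !(mul0mx, mulmx0, add0r, addr0) !col_mx0 h1 h2 h3 h4.
by rewrite row_mx0.
Qed.

End ExampleData.

Lemma sum_block_diag {R : realType} (p r : nat) (I : finType) (F : I -> 'M[R]_p) (G : I -> 'M[R]_r) :
  \sum_i block_mx (F i) 0 0 (G i) = block_mx (\sum_i F i) 0 0 (\sum_i G i).
Proof.
elim: (index_enum I) => [|x s IH]; first by rewrite !big_nil block_mx_const.
by rewrite !big_cons IH add_block_mx !addr0.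
Qed.

(** * Holonomy blocks of the example *)

Section ExampleBlocks.
Context {R : realType} (e m : nat).
Local Notation q := (m + m)%N.
Local Notation n := (e + q)%N.
Local Notation N := (1 + (e + (q + (q + q))))%N.
Local Notation k := (1 + (q + q))%N.
Local Notation V := 'rV[R]_n.
Local Notation A := (@torus_conn R e m).
Local Notation B := (@spol R m (7 / 10) (- (1 / 10))).

(** Selects the coordinates [i] and [m + i], which [swap] exchanges. Taken for both halves of the
    frame, it gives the four-dimensional block of one surface. *)
Definition pair_proj (i : 'I_m) : 'M[R]_q := block_mx (delta_mx i i) 0 0 (delta_mx i i).
Definition block_proj (i : 'I_m) : 'M[R]_k := block_mx 0 0 0 (block_mx (pair_proj i) 0 0 (pair_proj i)).
Definition trivial_proj : 'M[R]_k := block_mx 1%:M 0 0 0.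

Lemma pair_proj_sym i : (pair_proj i)^T = pair_proj i.
Proof. by rewrite /pair_proj tr_block_mx !trmx0 trmx_delta. Qed.

Lemma pair_proj_mul i j : pair_proj i *m pair_proj j = if i == j then pair_proj i else 0.
Proof.
rewrite /pair_proj mulmx_block !(mul0mx, mulmx0, add0r, addr0) mul_delta_mx_cond.
by case: eqP => [->|_]; rewrite ?mulr1n ?mulr0n ?block_mx_const.
Qed.

Lemma sum_pair_proj : \sum_i pair_proj i = 1%:M.
Proof.
have h : \sum_i delta_mx i i = 1%:M :> 'M[R]_m.
  apply/matrixP => a b; rewrite summxE !mxE (bigD1 a)//= big1 => [|j ja]; last by rewrite !mxE eq_sym (negPf ja).
  by rewrite !mxE eqxx addr0 eq_sym.
by rewrite /pair_proj sum_block_diag h -scalar_mx_block.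
Qed.

Lemma block_proj_orth i : orth_proj (block_proj i).
Proof.
split; first by rewrite /block_proj tr_block_mx [(block_mx (pair_proj i) _ _ _)^T]tr_block_mx !trmx0 pair_proj_sym.
by rewrite /block_proj 2!mulmx_block !(mul0mx, mulmx0, add0r, addr0) pair_proj_mul eqxx.
Qed.

Lemma block_proj_disjoint i j : i != j -> block_proj i *m block_proj j = 0.
Proof.
move=> /negPf ij; rewrite /block_proj 2!mulmx_block !(mul0mx, mulmx0, add0r, addr0) pair_proj_mul ij.
by rewrite !block_mx_const.
Qed.

Lemma trivial_proj_orth : orth_proj trivial_proj.
Proof.
split; first by rewrite /trivial_proj tr_block_mx !trmx0 trmx1.
by rewrite /trivial_proj mulmx_block !(mul0mx, mulmx0, add0r, addr0, mulmx1).
Qed.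

Lemma sum_block_proj : trivial_proj + \sum_i block_proj i = 1%:M.
Proof.
by rewrite /block_proj 2!sum_block_diag big1// sum_pair_proj /trivial_proj add_block_mx !(addr0, add0r) -!scalar_mx_block.
Qed.

Lemma pair_proj_diag i (a : 'rV[R]_q) : pair_proj i *m diag_mx a = diag_mx a *m pair_proj i.
Proof.
rewrite /pair_proj delta_diag -[a]hsubmxK diag_mx_row !mulmx_block !(mul0mx, mulmx0, add0r, addr0).
by rewrite diag_mxC [X in block_mx _ _ _ X]diag_mxC.
Qed.

Lemma pair_proj_swap i a b : pair_proj i *m spol m a b = spol m a b *m pair_proj i.
Proof.
rewrite /spol mulmxDr mulmxDl scalar_mxC -scalemxAl -scalemxAr; congr (_ + _ *: _).
by rewrite /pair_proj /swap !mulmx_block !(mul0mx, mulmx0, add0r, addr0, mul1mx, mulmx1).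
Qed.

Lemma conn_trivial v : A v *m trivial_proj = 0.
Proof. by rewrite /torus_conn /trivial_proj mulmx_block !(mul0mx, mulmx0, add0r, addr0) block_mx_const. Qed.

Lemma conn_block v i : A v *m block_proj i = block_proj i *m A v.
Proof.
rewrite /torus_conn /block_proj.
have hs := pair_proj_swap i (7 / 10) (- (1 / 10)); have hd := pair_proj_diag i (rsubmx v).
move: (pair_proj i) hs hd => p hs hd; rewrite !mulmx_block !(mul0mx, mulmx0, add0r, addr0).
by rewrite mulNmx mulmxN -!mulmxA -hs -hd !mulmxA hd hs.
Qed.

Definition evec (j : 'I_q) : 'rV[R]_k := row_mx 0 (row_mx (delta_mx 0 j) 0).
Definition tvec (j : 'I_q) : 'rV[R]_k := row_mx 0 (row_mx 0 (delta_mx 0 j)).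

Lemma dot_ee i j : dot (evec i) (evec j) = (i == j)%:R.
Proof. by rewrite !dot_row_mx !dot0l dot_delta add0r addr0. Qed.

Lemma dot_tt i j : dot (tvec i) (tvec j) = (i == j)%:R.
Proof. by rewrite !dot_row_mx !dot0l dot_delta !add0r. Qed.

Lemma dot_et i j : dot (evec i) (tvec j) = 0.
Proof. by rewrite !dot_row_mx !dot0l dot0r !addr0. Qed.

Lemma row_block_proj i (x : 'rV[R]_k) : x *m block_proj i = x -> exists a1 a2 a3 a4,
  x = a1 *: evec (lshift m i) + a2 *: evec (rshift m i) + a3 *: tvec (lshift m i) + a4 *: tvec (rshift m i).
Proof.
pose u : 'rV[R]_q := lsubmx (rsubmx x); pose w : 'rV[R]_q := rsubmx (rsubmx x).
exists (lsubmx u 0 i), (rsubmx u 0 i), (lsubmx w 0 i), (rsubmx w 0 i).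
have E : x = row_mx (lsubmx x) (row_mx u w) by rewrite !hsubmxK.
have P (v : 'rV[R]_q) : v *m pair_proj i = lsubmx v 0 i *: delta_mx 0 (lshift m i) + rsubmx v 0 i *: delta_mx 0 (rshift m i).
  rewrite -{1}[v]hsubmxK /pair_proj mul_row_block !mulmx0 addr0 add0r !row_mul_delta.
  have -> : delta_mx 0 (lshift m i) = row_mx (delta_mx 0 i) 0 :> 'rV[R]_q by rewrite delta_mx_lshift.
  have -> : delta_mx 0 (rshift m i) = row_mx 0 (delta_mx 0 i) :> 'rV[R]_q by rewrite delta_mx_rshift.
  by rewrite !scale_row_mx !scaler0 add_row_mx addr0 add0r.
rewrite -{1}H {1}E /block_proj !mul_row_block !(mulmx0, addr0, add0r) !P.
by rewrite /evec /tvec !scale_row_mx !add_row_mx !(scaler0, addr0, add0r).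
Qed.

Lemma evec_block i : evec (lshift m i) *m block_proj i = evec (lshift m i) /\ evec (rshift m i) *m block_proj i = evec (rshift m i).
Proof.
rewrite /evec /block_proj /pair_proj delta_mx_lshift delta_mx_rshift.
rewrite !mul_row_block !(mulmx0, mul0mx, addr0, add0r) !row_mul_delta.
by rewrite !mxE !eqxx !scale1r.
Qed.

Lemma tvec_block i : tvec (lshift m i) *m block_proj i = tvec (lshift m i) /\ tvec (rshift m i) *m block_proj i = tvec (rshift m i).
Proof.
rewrite /tvec /block_proj /pair_proj delta_mx_lshift delta_mx_rshift.
rewrite !mul_row_block !(mulmx0, mul0mx, addr0, add0r) !row_mul_delta.
by rewrite !mxE !eqxx !scale1r.
Qed.

Lemma conn_direction j : A (row_mx 0 (delta_mx 0 j)) = wedge (row_mx 0 (row_mx 0 (delta_mx 0 j *m B))) (evec j).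
Proof.
rewrite /torus_conn row_mxKr /wedge /evec !tr_row_mx !mul_col_row !trmx0 !(mul0mx, mulmx0).
rewrite opp_block_mx add_block_mx !(oppr0, addr0, add0r) trmx_mul spol_sym -delta_diag trmx_delta.
rewrite mulmxA mul_delta_mx -mulmxA mul_delta_mx.
by rewrite [X in _ = block_mx _ _ _ (_ + X)]opp_block_mx add_block_mx !(oppr0, addr0, add0r).
Qed.

Lemma delta_swap (i : 'I_m) : delta_mx 0 (lshift m i) *m B = (7 / 10) *: delta_mx 0 (lshift m i) - (1 / 10) *: delta_mx 0 (rshift m i) :> 'rV[R]_q /\
  delta_mx 0 (rshift m i) *m B = (7 / 10) *: delta_mx 0 (rshift m i) - (1 / 10) *: delta_mx 0 (lshift m i) :> 'rV[R]_q.
Proof.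
have [h1 h2] : delta_mx 0 (lshift m i) *m @swap R m = delta_mx 0 (rshift m i) :> 'rV[R]_q /\ delta_mx 0 (rshift m i) *m @swap R m = delta_mx 0 (lshift m i) :> 'rV[R]_q.
  by rewrite delta_mx_lshift delta_mx_rshift /swap !mul_row_block !(mul0mx, mulmx0, mulmx1, add0r, addr0).
by rewrite /spol !mulmxDr !mul_mx_scalar -!scalemxAr h1 h2 !scaleNr.
Qed.

(** The coefficients 7 and -1, with the common factor 1/10, are the entries of [B]; this is the form
    that [span4_generated] expects. *)
Lemma conn_pair (i : 'I_m) :
  A (row_mx 0 (delta_mx 0 (lshift m i))) = 10^-1 *: wedge (7 *: tvec (lshift m i) - tvec (rshift m i)) (evec (lshift m i)) /\
  A (row_mx 0 (delta_mx 0 (rshift m i))) = 10^-1 *: wedge (7 *: tvec (rshift m i) - tvec (lshift m i)) (evec (rshift m i)).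
Proof.
have Z (a : R) (x y : 'rV[R]_k) : a *: wedge x y = wedge (a *: x) y.
  by rewrite /wedge linearZ /= -scalemxAl -scalemxAr scalerBr.
have [h1 h2] := delta_swap i; rewrite !conn_direction h1 h2 !Z.
have T (u v : 'rV[R]_q) : row_mx (0 : 'rV[R]_1) (row_mx (0 : 'rV[R]_q) ((7 / 10) *: u - (1 / 10) *: v)) =
    10^-1 *: (7 *: row_mx 0 (row_mx 0 u) - row_mx 0 (row_mx 0 v)).
  rewrite !scale_row_mx !opp_row_mx !add_row_mx !scale_row_mx !(scaler0, oppr0, addr0, scaler0).
  by rewrite scalerBr scalerA mul1r mulrC.
by rewrite !T.
Qed.

Lemma block_generated (K : 'M[R]_k -> Prop) : K 0 -> (forall a Y Z, K Y -> K Z -> K (a *: Y + Z)) ->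
  (forall v w, K (A v *m A w - A w *m A v)) -> (forall v Y, K Y -> K (A v *m Y - Y *m A v)) ->
  forall i x y, x *m block_proj i = x -> y *m block_proj i = y -> K (wedge x y).
Proof.
move=> K0 Klin KA KY i x y /row_block_proj[a1 [a2 [a3 [a4 ->]]]] /row_block_proj[b1 [b2 [b3 [b4 ->]]]].
have [c1 c2] := conn_pair i.
have lr : lshift m i == rshift m i = false by exact: eq_lrshift.
apply: (@span4_generated R k K 10^-1) => //.
- by rewrite !dot_ee !dot_tt !eqxx.
- by rewrite !dot_ee !dot_tt !dot_et lr.
- by rewrite /= -c1 -c2; exact: KA.
- by move=> Y hY; rewrite -c1; exact: KY.
- by move=> Y hY; rewrite -c2; exact: KY.
Qed.

Lemma block_triple i : exists x y z : 'rV[R]_k, [/\ x *m block_proj i = x, y *m block_proj i = y, z *m block_proj i = z,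
  [/\ dot x x = 1, dot y y = 1 & dot z z = 1] & [/\ dot x y = 0, dot x z = 0 & dot y z = 0]].
Proof.
have [h1 h2] := evec_block i; have [h3 _] := tvec_block i.
exists (evec (lshift m i)), (evec (rshift m i)), (tvec (lshift m i)).
by rewrite !dot_ee !dot_tt !dot_et !eqxx eq_lrshift.
Qed.

End ExampleBlocks.

(** * Irreducibility of the inverted product *)

Lemma closure_image {T U : topologicalType} (phi : T -> U) (F : set T) (Z : set U) a :
  {for a, continuous phi} -> phi @` F `<=` Z -> closure F a -> closure Z (phi a).
Proof.
move=> c sub cl B nB; have [x [Fx Bx]] := cl _ (c _ nB).
by exists (phi x); split=> //; apply: sub; exists x.
Qed.

Section ProductClosure.
Context {R : realType} {N N1 N2 : nat} {M1 M2 : Type}.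
Variables (Z : set 'rV[R]_N) (f1 : M1 -> 'rV[R]_N1) (f2 : M2 -> 'rV[R]_N2).
Variables (A : 'M[R]_(N1, N)) (B : 'M[R]_(N2, N)) (b : 'rV[R]_N).
Hypothesis Zcl : forall y, closure Z y -> y != 0 -> Z y.
Hypothesis ZE : forall z, Z z <-> exists x y, z = b + f1 x *m A + f2 y *m B.
Hypotheses (AA : A *m A^T = 1%:M) (BB : B *m B^T = 1%:M) (AB : A *m B^T = 0).

Lemma affine_continuous (p : nat) (c : 'rV[R]_N) (D : 'M[R]_(p, N)) : continuous (fun u : 'rV[R]_p => c + u *m D).
Proof.
move=> u; apply: (@cvgD _ _ _ (nbhs u) (nbhs_filter u)); first exact: cvg_cst.
by apply: (@cvg_mulmx R _ (nbhs u) (nbhs_filter u)); [exact: cvg_id|exact: cvg_cst].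
Qed.

(** If [a] were a limit point of the first factor that is not attained, then for every [v] the point
    built from [a] and [f2 v] would be a limit of [Z] outside [Z], hence 0. Two different values of
    [f2] cannot both give 0. *)
Lemma product_factor_closed a y y' : f2 y <> f2 y' -> closure (range f1) a -> range f1 a.
Proof.
move=> yy cla; apply: contrapT => na.
have BA : B *m A^T = 0 by rewrite -[LHS]trmxK trmx_mul trmxK AB trmx0.
have H v : b + a *m A + f2 v *m B = 0.
  apply/eqP/negPn/negP => ne; apply: na.
  have : closure Z (b + f2 v *m B + a *m A).
    apply: (@closure_image 'rV[R]_N1 'rV[R]_N (fun u => b + f2 v *m B + u *m A) (range f1) Z a) => //.
      exact: affine_continuous.
    by move=> _ [_ [x _ <-] <-]; apply/ZE; exists x, v; rewrite addrAC.
  rewrite addrAC => /Zcl /(_ ne) /ZE[x [w /(congr1 (mulmx^~ A^T))]].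
  rewrite !mulmxDl -!mulmxA AA BA !mulmx0 !mulmx1 !addr0 => /addrI ax.
  by exists x.
apply: yy; have := H y; rewrite -(H y') => /addrI /(congr1 (mulmx^~ B^T)).
by rewrite -!mulmxA BB !mulmx1.
Qed.

End ProductClosure.

Section Irreducible.
Context {R : realType}.

Lemma submanifold_two_points (M : topologicalType) (n N : nat) (f : M -> 'rV[R]_N) (p : M) : (0 < n)%N ->
  submanifold n f -> exists y y' : M, y <> y'.
Proof.
case: n => // n _ [_ _ /(_ p)[V [phi [[[oV iV] _ _ _ _] [x Vx _]]]]].
have := open_nbhs_nbhs (conj oV Vx); rewrite -nbhs_ballE => -[r /= r0 rV].
pose x' : 'rV[R]_n.+1 := x + const_mx (r / 2).
have Vx' : V x'.
  apply: rV; rewrite -ball_normE /= /x' opprD addrA subrr sub0r normrN.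
  have h : `|(const_mx (r / 2) : 'rV[R]_n.+1)| <= r / 2.
    by apply: mx_norm_le => [|i j]; rewrite ?mxE ?ger0_norm// divr_ge0// ltW.
  by apply: le_lt_trans h _; lra.
exists (phi x), (phi x') => /iV; rewrite !inE => /(_ Vx Vx') /(congr1 (fun A : 'rV[R]_n.+1 => A 0 0)).
by rewrite /x' !mxE => h; lra.
Qed.

Lemma orthonormal_blocks (N1 N2 : nat) (A : 'M[R]_(N1, N1 + N2)) (B : 'M[R]_(N2, N1 + N2)) :
  A *m A^T = 1%:M -> B *m B^T = 1%:M -> A *m B^T = 0 -> A^T *m A + B^T *m B = 1%:M.
Proof.
move=> AA BB AB; have BA : B *m A^T = 0 by rewrite -[LHS]trmxK trmx_mul trmxK AB trmx0.
have : col_mx A B *m (col_mx A B)^T = 1%:M by rewrite tr_col_mx mul_col_row AA BB AB BA -scalar_mx_block.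
by move=> /mulmx1C; rewrite tr_col_mx mul_row_col.
Qed.

(** In a product decomposition the origin, a limit of the image, projects to a limit point of each
    factor. Both factors are closed, each having two points, so both projections are attained and
    the origin would be in the image. *)
Lemma irreducible_punctured (M : topologicalType) (n N : nat) (f : M -> 'rV[R]_N) : injective f ->
  (forall y, closure (range f) y -> y != 0 -> range f y) -> ~ range f 0 -> ((0 < n)%N -> closure (range f) 0) ->
  irreducible_submanifold n f.
Proof.
move=> fi cl n0 c0 [n1 [n2 [N1 [N2 [M1 [M2 [f1 [f2 [h [h' [A [B [b]]]]]]]]]]]]].
move=> [[n1_gt0 n2_gt0 nE NE] [sm1 sm2] [hK h'K _ _] [AA BB AB] fE].
case: _ / NE in f fi cl n0 c0 A B b AA BB AB fE * => {N}.
have c00 : closure (range f) 0 by apply: c0; rewrite -nE ltn_addr.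
have [_ [[p _ _] _]] := c00 setT filterT.
have fi1 x x' : f1 x = f1 x' -> x = x'.
  move=> e; have : f (h (x, (h' p).2)) = f (h (x', (h' p).2)) by rewrite !fE e.
  by move=> /fi /(can_inj hK) [].
have fi2 y y' : f2 y = f2 y' -> y = y'.
  move=> e; have : f (h ((h' p).1, y)) = f (h ((h' p).1, y')) by rewrite !fE e.
  by move=> /fi /(can_inj hK) [].
have [x [x' xx]] := submanifold_two_points (h' p).1 n1_gt0 sm1.
have [y [y' yy]] := submanifold_two_points (h' p).2 n2_gt0 sm2.
have ZE z : range f z <-> exists x y, z = b + f1 x *m A + f2 y *m B.
  split=> [[q _ <-]|[u [v ->]]]; last by exists (h (u, v)).
  by exists (h' q).1, (h' q).2; rewrite -fE -surjective_pairing h'K.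
have ZE' z : range f z <-> exists y x, z = b + f2 y *m B + f1 x *m A.
  rewrite ZE; split=> -[u [v ->]]; by exists v, u; rewrite addrAC.
have BA : B *m A^T = 0 by rewrite -[LHS]trmxK trmx_mul trmxK AB trmx0.
have lin (p' : nat) (C : 'M[R]_(_, p')) : continuous (fun z : 'rV[R]_(N1 + N2) => (z - b) *m C).
  move=> z; apply: (@cvg_mulmx R _ (nbhs z) (nbhs_filter z)); last exact: cvg_cst.
  by apply: (@cvgB _ _ _ (nbhs z) (nbhs_filter z)); [exact: cvg_id|exact: cvg_cst].
have cl1 : closure (range f1) ((0 - b) *m A^T).
  apply: (@closure_image 'rV[R]_(N1 + N2) 'rV[R]_N1 (fun z => (z - b) *m A^T) (range f)) c00; first exact: lin.
  move=> _ [_ /ZE[u [v ->]] <-]; exists u => //.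
  by rewrite [b + _ + _ - b]addrC -[b + _ + _]addrA addKr mulmxDl -!mulmxA AA BA mulmx0 mulmx1 addr0.
have cl2 : closure (range f2) ((0 - b) *m B^T).
  apply: (@closure_image 'rV[R]_(N1 + N2) 'rV[R]_N2 (fun z => (z - b) *m B^T) (range f)) c00; first exact: lin.
  move=> _ [_ /ZE[u [v ->]] <-]; exists v => //.
  by rewrite [b + _ + _ - b]addrC -[b + _ + _]addrA addKr mulmxDl -!mulmxA AB BB mulmx0 mulmx1 add0r.
have [u _ ue] : range f1 ((0 - b) *m A^T) by apply: (product_factor_closed cl ZE AA BB AB) cl1 => /fi2; exact: yy.
have [v _ ve] : range f2 ((0 - b) *m B^T) by apply: (product_factor_closed cl ZE' BB AA BA) cl2 => /fi1; exact: xx.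
apply: n0; apply/ZE; exists u, v; rewrite ue ve -addrA -!mulmxA -mulmxDr orthonormal_blocks// mulmx1.
by rewrite sub0r subrr.
Qed.

Lemma dot_sum (N : nat) (y : 'rV[R]_N) : dot y y = \sum_j y 0 j ^+ 2.
Proof. by rewrite /dot !mxE; apply: eq_bigr => j _; rewrite !mxE expr2. Qed.

Lemma dot_ge0 (N : nat) (y : 'rV[R]_N) : 0 <= dot y y.
Proof. by rewrite dot_sum sumr_ge0// => j _; exact: sqr_ge0. Qed.

Lemma norm_sq_dot (N : nat) (y : 'rV[R]_N) : `|y| ^+ 2 <= dot y y.
Proof.
have h : `|y| <= Num.sqrt (dot y y).
  apply: mx_norm_le; first exact: sqrtr_ge0.
  move=> i j; rewrite ord1 -sqrtr_sqr ler_sqrt ?dot_ge0// dot_sum (bigD1 j)//= lerDl.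
  by apply: sumr_ge0 => l _; exact: sqr_ge0.
by rewrite -[leRHS]sqr_sqrtr ?dot_ge0// lerXn2r// nnegrE// sqrtr_ge0.
Qed.

Lemma inversion_norm (N : nat) (y : 'rV[R]_N) : y != 0 -> `|inversion y| <= `|y|^-1.
Proof.
move=> y0; have n0 : 0 < `|y| by rewrite normr_gt0.
have d0 : 0 < dot y y by rewrite lt_def dot_eq0 y0 dot_ge0.
rewrite normrZ normrV ?unitfE ?gt_eqF// (gtr0_norm d0) mulrC ler_pdivrMr// mulrC ler_pdivlMr// -expr2.
exact: norm_sq_dot.
Qed.

Lemma inversion_continuous (N : nat) (y : 'rV[R]_N) : y != 0 -> {for y, continuous (@inversion R N)}.
Proof.
move=> y0; apply/continuous_mxP => i j.
rewrite (_ : (fun z => _) = fun z : 'rV[R]_N => (dot z z)^-1 * z i j); last by apply/funext => z; rewrite mxE.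
have cz i' j' : {for y, continuous (fun z : 'rV[R]_N => z i' j')} by apply: (continuous_mxP _ _).1; exact: cvg_id.
apply: (@cvgM _ _ (nbhs y) (nbhs_filter y)); last exact: cz.
apply: (@cvgV _ _ (nbhs y) (nbhs_filter y)); first by rewrite dot_eq0.
rewrite (_ : (fun z => _) = fun z : 'rV[R]_N => \sum_j z 0 j ^+ 2); last by apply/funext => z; exact: dot_sum.
rewrite dot_sum; apply: (@cvg_sumr R _ (nbhs y) (nbhs_filter y)) => l.
by apply: (@cvgM _ _ (nbhs y) (nbhs_filter y)); exact: cz.
Qed.

End Irreducible.

(** * Inversion of an immersion with a linear left inverse *)

Section InvertedGraph.
Context {R : realType} {n N : nat}.
Local Notation V := 'rV[R]_n.
Variables (g : V -> 'rV[R]_N) (G : 'M[R]_(N, n)).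
Hypothesis cg : continuous g.
Hypothesis gK : forall x, g x *m G = x.
Hypothesis g0 : forall x, g x != 0.
Local Notation f := (inv_imm g).

Lemma inv_immK x : inversion (f x) *m G = x.
Proof. by rewrite /inv_imm inversionK gK. Qed.

Lemma inv_imm_inj : injective f.
Proof. by move=> x y e; rewrite -(inv_immK x) e inv_immK. Qed.

Lemma coord_continuous (y : 'rV[R]_N) : y != 0 -> {for y, continuous (fun y => inversion y *m G)}.
Proof.
move=> y0; apply: (@cvg_mulmx R _ (nbhs y) (nbhs_filter y)); last exact: cvg_cst.
exact: inversion_continuous.
Qed.

Lemma inv_imm_embedded : embedded f.
Proof.
split=> [|U oU]; first exact: inv_imm_inj.
exists [set y | y != 0 /\ U (inversion y *m G)]; last first.
  apply/seteqP; split=> x /=; rewrite inv_immK inversion_eq0; last by case.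
  by split.
rewrite openE => y [y0 Uy]; rewrite /interior.
have h1 : \forall z \near y, z != 0 by exact: (cvgr_neq0 _ (@cvg_id _ (nbhs y)) y0).
have h2 : \forall z \near y, U (inversion z *m G) by apply: (coord_continuous y0); apply: open_nbhs_nbhs.
by near=> z; split; near: z.
Unshelve. all: by end_near. Qed.

(** Away from the origin the image is the zero set of the continuous map [Phi], which compares the
    inverted point with the point of the graph over its coordinates. *)
Lemma inv_imm_closure y : closure (range f) y -> y != 0 -> range f y.
Proof.
move=> cl y0; pose Phi (z : 'rV[R]_N) := inversion z - g (inversion z *m G).
have cPhi : {for y, continuous Phi}.
  apply: (@cvgB _ _ _ (nbhs y) (nbhs_filter y)); first exact: inversion_continuous.
  by apply: (@continuous_comp _ _ _ (fun z => inversion z *m G) g y); [exact: coord_continuous|exact: cg].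
have : Phi y = 0.
  apply/eqP/negPn/negP => ne.
  have [_ [[x _ <-]]] := cl _ (cvgr_neq0 _ cPhi ne).
  by rewrite /= /Phi inv_immK /inv_imm inversionK subrr eqxx.
move=> /eqP; rewrite subr_eq0 => /eqP e; exists (inversion y *m G) => //.
by rewrite /inv_imm -e inversionK.
Qed.

Lemma inv_imm_neq0 : ~ range f 0.
Proof. by move=> [x _ /eqP]; rewrite inversion_eq0; apply/negP. Qed.

(** If the image avoided a ball around 0, then [g] would be bounded, and so would the coordinates
    recovered from it by [G]; but these fill R^n, which is unbounded for positive [n]. *)
Lemma inv_imm_closure0 : (0 < n)%N -> closure (range f) 0.
Proof.
move=> n_gt0 U; rewrite -nbhs_ballE => -[r /= r0 rU]; apply: contrapT => ne.
have big x : r <= `|f x|.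
  rewrite leNgt; apply/negP => fx; apply: ne; exists (f x); split; first by exists x.
  by apply: rU; rewrite -ball_normE /= sub0r normrN.
pose c := N%:R * (r^-1 * `|G|).
have bnd (x : V) : `|x| <= c.
  rewrite -[x in leLHS]gK; apply: le_trans (mx_norm_mulmx _ _) _; rewrite /c ler_wpM2l// ler_wpM2r//.
  have f0 : f x != 0 by rewrite inversion_eq0.
  rewrite -[g x]inversionK; apply: le_trans (inversion_norm f0) _.
  by rewrite lef_pV2 ?posrE// (lt_le_trans r0).
have := bnd (const_mx (c + 1)); have := mx_norm_ge (const_mx (c + 1) : V) 0 (Ordinal n_gt0).
rewrite mxE => h1 h2; have := ler_norm (c + 1); lra.
Qed.

Lemma inv_imm_irreducible : irreducible_submanifold n f.
Proof.
exact: irreducible_punctured inv_imm_inj inv_imm_closure inv_imm_neq0 inv_imm_closure0.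
Qed.

End InvertedGraph.

Lemma linear_immersion_submanifold {R : realType} {n N : nat} (f : 'rV[R]_n -> 'rV[R]_N) : smooth_on setT f ->
  (forall x w, 'D_w f x = 0 -> w = 0) -> chart f (@id 'rV[R]_n) /\ submanifold n f.
Proof.
move=> sf immf; have c : chart f (@id 'rV[R]_n).
  split=> //; first by split=> //; exact: openT.
    by move=> x _; exact: cvg_id.
    by move=> W oW _; rewrite image_id.
  by move=> x w _; exact: immf.
split=> //; split; [exact: norm_hausdorff|exact: row_second_countable|].
by move=> p; exists setT, id; split=> //; exists p.
Qed.

Lemma sharp_example {R : realType} (n e m : nat) : n = (e + (m + m))%N ->
  exists (N : nat) (M : topologicalType) (f : M -> 'rV[R]_N) (p : M),
  [/\ submanifold n f /\ irreducible_submanifold n f, embedded f, connected [set: M],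
      local_eq_restricted n f & num_nonabelian_irreducible n f p m].
Proof.
move=> {n}->.
have sg := @torus_imm_smooth R e m; have g0 := @torus_imm_neq0 R e m; have gi := @torus_imm_immersion R e m.
have cg : continuous (@torus_imm R e m) by move=> x; exact: (sg 0%N).
have sf := inv_imm_smooth sg g0; have fi := inv_imm_immersion sg g0 gi.
have [cf smf] := linear_immersion_submanifold sf fi.
have sE := @torus_frame_smooth R e m; have EE := @torus_frame_orth R e m.
have fE := inv_frame_smooth sg g0 sE; have fEE := inv_frame_orth g0 EE.
have fN := inv_frame_normal sg g0 (@torus_frame_normal R e m).
have fA := inv_frame_conn sg g0 sE (@torus_frame_normal R e m) (@torus_frame_conn R e m).
(* Codimension and size of the frame agree, so the frame spans the normal spaces. *)
have kN : (1 + (e + (m + m + (m + m + (m + m)))) - (e + (m + m)) <= 1 + (m + m + (m + m)))%N by lia.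
exists _, _, (inv_imm (@torus_imm R e m)), 0; split.
- split=> //; exact: inv_imm_irreducible cg (@torus_immK R e m) g0.
- exact: inv_imm_embedded (@torus_immK R e m) g0.
- exact: row_connected.
- exact (frame_local_eq_restricted smf cf fE fEE fN kN fA (@block_proj_orth R m)
    (@sum_block_proj R m) (@conn_trivial R e m) (@conn_block R e m) (@block_generated R e m)).
- exact (frame_num_nonabelian smf cf fE fEE fN kN fA (@block_proj_orth R m) (@block_proj_disjoint R m) (@trivial_proj_orth R m)
    (@sum_block_proj R m) (@conn_trivial R e m) (@conn_block R e m) (@block_generated R e m) (@block_triple R m) 0).
Qed.

Theorem proposition6p1 (R : realType) :
  (* the bound, together with the equivalence of the two hypotheses *)
  (forall (n N : nat) (M : topologicalType) (f : M -> 'rV[R]_N),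
     submanifold n f ->
     (connected [set: M] ->
        (local_eq_restricted n f <-> local_holonomy_dim_constant n f)) /\
     (local_eq_restricted n f ->
        forall (p : M) (r : nat),
          num_nonabelian_irreducible n f p r -> (r <= n./2)%N)) /\
  (* sharpness *)
  (forall n : nat,
     exists (N : nat) (M : topologicalType) (f : M -> 'rV[R]_N) (p : M),
       [/\ submanifold n f, embedded f, connected [set: M],
           local_eq_restricted n f &
           num_nonabelian_irreducible n f p n./2]) /\
  (* sharpness in the class of irreducible submanifolds *)
  (forall n : nat,
     exists (N : nat) (M : topologicalType) (f : M -> 'rV[R]_N) (p : M),
       [/\ submanifold n f /\ irreducible_submanifold n f,
           embedded f, connected [set: M],
           local_eq_restricted n f &
           num_nonabelian_irreducible n f p n./2]).
Proof.
(* The parity of [n] is the dimension of the flat factor. *)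
have half (n : nat) : n = (odd n + (n./2 + n./2))%N by rewrite addnn odd_double_half.
split; last first.
  split=> n; have [N [M [f [p ex]]]] := @sharp_example R _ _ _ (half n); exists N, M, f, p => //.
  by case: ex => -[].
move=> n N M f sf; split=> [cM|le p r]; first exact: local_eq_restrictedP.
exact: num_nonabelian_bound.
Qed.
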